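(* Let $[\cdot]_\beta$ be the superexpectation of the super-Minkowski model on $\Lambda$, and let $\pi=(\pi(i,\boldsymbol{r}))$ be a smooth compactly supported probability measure on $\Lambda\times(0,\infty)^\Lambda$. For all smooth $f\colon\Lambda\times\mathbb{R}^\Lambda\to\mathbb{R}$ with rapid decay, $$\int_0^\infty\mathbb{E}_{\boldsymbol{\pi}}f(X_t,\boldsymbol{L}_t)\,dt=\sum_{i,j\in\Lambda}\Big[\frac{\pi(i,\boldsymbol{r})}{r_i}\,x_ix_j\,f(j,\boldsymbol{z})\Big]_\beta,$$ where $\mathbb{E}_{\boldsymbol{\pi}}$ denotes the expectation of a vertex-reinforced jump process (VRJP) with initial condition $(X_0,\boldsymbol{L}_0)$ distributed according to $\pi$.
   Context: $\Lambda$ is a finite set and $\beta=(\beta_{ij})_{i,j\in\Lambda}$ are edge weights with $\beta_{ij}=\beta_{ji}\ge0$ such that the graph with vertex set $\Lambda$ and edge set $\{\{i,j\}\mid\beta_{ij}>0\}$ is connected. Bold symbols denote objects indexed by $\Lambda$. That $\pi$ is a smooth compactly supported probability measure means that $\pi(i,\cdot)\ge0$ is, for each $i$, a smooth compactly supported density on $(0,\infty)^\Lambda$ and $\sum_i\int\pi(i,\boldsymbol{r})\,d\boldsymbol{r}=1$. A smooth $f$ has rapid decay if for each $i$ there is a coordinate $\ell_k$ such that $f(i,\boldsymbol{\ell})$ and all its partial derivatives in $\boldsymbol{\ell}$ are $O((1+|\ell_k|)^{-p})$ for every $p$, uniformly in the other coordinates. Forms: $\Omega^{2\Lambda}(\mathbb{R}^{3\Lambda})$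 is the algebra over $C^\infty(\mathbb{R}^{3\Lambda})$ (coordinates $(z_i,x_i,y_i)_{i\in\Lambda}$) generated by pairwise anticommuting (Grassmann) generators $(\xi_i,\eta_i)_{i\in\Lambda}$ (each squaring to $0$); its elements are called forms. $F_0$ denotes the degree-$0$ part of a form $F$; a form is even if all its terms have even degree in the generators. For even forms $F^1,\dots,F^k$ and a smooth $g$, $g(F^1,\dots,F^k)=\sum_\alpha\frac1{\alpha!}g^{(\alpha)}(F^1_0,\dots,F^k_0)\prod_j(F^j-F^j_0)^{\alpha_j}$ (a finite sum). $\partial_{\xi_i},\partial_{\eta_i}$ are the left derivatives (antiderivations over $C^\infty$ with $\partial_{\xi_i}\xi_j=\delta_{ij}=\partial_{\eta_i}\eta_j$, $\partial_{\xi_i}\eta_j=0=\partial_{\eta_i}\xi_j$). The Berezin integral is $\int_{(\mathbb{R}^{3|2})^\Lambda}F=(2\pi)^{-|\Lambda|}\int_{\mathbb{R}^{3\Lambda}}\prod_idx_i\,dy_i\,dz_i\ \big(\prod_i\partial_{\eta_i}\partial_{\xi_i}\big)F$. Super-Minkowski model: $u_i=(z_i,x_i,y_i,\xi_i,\eta_i)$, $u_i\cdot u_j=-z_iz_j+x_ix_j+y_iy_j-\xi_i\eta_j+\eta_i\xi_j$. Write $\boldsymbol{u}\cdot\boldsymbol{u}<0$ if the degree-$0$ part of $u_i\cdot u_i$ is negative for all $i$; on this set $r_i=\sqrt{-u_i\cdot u_i}$ (an even form). Let $H_\beta(\boldsymbol{u})=\frac14\sum_{i,j\in\Lambda}\beta_{ij}(u_i-u_j)\cdot(u_i-u_j)+\frac14\sum_{i,j\in\Lambda}\beta_{ij}(r_i-r_j)^2$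 and $[F]_\beta=\int_{(\mathbb{R}^{3|2})^\Lambda}F(\boldsymbol{u})e^{-H_\beta(\boldsymbol{u})}1_{\boldsymbol{u}\cdot\boldsymbol{u}<0}1_{\boldsymbol{z}>0}$, for smooth forms $F$ supported away from the boundary of $\{\boldsymbol{u}\cdot\boldsymbol{u}<0,\boldsymbol{z}>0\}$ for which the integral converges. VRJP: for initial vertex $v$ and initial local times $\boldsymbol{L}_0\in(0,\infty)^\Lambda$, $X_0=v$ and $\mathbb{P}_{v,\boldsymbol{L}_0}[X_{t+dt}=j\mid(X_s)_{s\le t},X_t=i]=\beta_{ij}L_t^j\,dt$, where $L_t^i=L_0^i+\int_0^t1_{X_s=i}\,ds$. *)

(* Defs.v *)
From HB Require Import structures.
From mathcomp Require Import all_boot all_order all_algebra.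
Set Implicit Arguments.
Unset Strict Implicit.
Unset Printing Implicit Defensive.
Import Order.TTheory GRing.Theory Num.Theory.
Local Open Scope ring_scope.

(* The Grassmann algebra over R on generators indexed by I: a form is the family
   of its coefficients F A on the monomials e_A, A a set of generators, where
   e_A is the product of the generators in A in increasing enum_rank order.
   The alias hides the pointwise ring structure of {ffun _ -> _}. *)
Definition grassmann (R : comNzRingType) (I : finType) : Type :=
  {ffun {set I} -> R}.

Section Grassmann.
Variables (R : comNzRingType) (I : finType).
Implicit Types (A B C : {set I}) (F G : grassmann R I).

HB.instance Definition _ :=
  GRing.Lmodule.copy (grassmann R I) {ffun {set I} -> R^o}.

Definition inversions A B : nat :=
  \sum_(a in A) \sum_(b in B) (enum_rank b < enum_rank a)%N.

Definition monom A : grassmann R I := [ffun B => (B == A)%:R].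

(* e_A * e_B = (-1) ^ (inversions A B) e_(A :|: B) if A and B are disjoint, and 0
   otherwise. *)
Definition gmul F G : grassmann R I :=
  [ffun C : {set I} => \sum_(A in powerset C)
     (-1) ^+ inversions A (C :\: A) * F A * G (C :\: A)].

Lemma inversionsUl A B C : [disjoint A & B] ->
  inversions (A :|: B) C = (inversions A C + inversions B C)%N.
Proof. by move=> AB; rewrite /inversions (eq_bigl [predU A & B]) ?bigU // => a; rewrite !inE. Qed.

Lemma inversionsUr A B C : [disjoint B & C] ->
  inversions A (B :|: C) = (inversions A B + inversions A C)%N.
Proof.
move=> BC; rewrite /inversions -big_split; apply: eq_bigr => a _.
by rewrite (eq_bigl [predU B & C]) ?bigU // => b; rewrite !inE.
Qed.

Lemma gmulA : associative gmul.
Proof.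
move=> F G H; apply/ffunP => D; rewrite !ffunE.
under eq_bigr => A AD do rewrite ffunE mulr_sumr.
under [RHS]eq_bigr => C CD do rewrite ffunE mulr_sumr mulr_suml.
rewrite [RHS](exchange_big_dep (fun A : {set I} => A \in powerset D)) /=; last first.
  by move=> C A; rewrite !powersetE => CD sAC; apply: subset_trans sAC CD.
apply: eq_bigr => A; rewrite powersetE => AD.
rewrite [RHS](reindex_onto (fun B : {set I} => A :|: B) (fun C => C :\: A)) /=; last first.
  by move=> C; rewrite !powersetE => /andP[_ sAC]; rewrite setUC setDE setUIl
    (setUC (~: A)) setUCr setIT; apply/setUidPl.
apply: eq_big => [B|B]; rewrite ?powersetE.
  rewrite subsetD subUset AD subsetUl andbT /=; congr (_ && _).
  rewrite setDUl setDv set0U; apply/idP/eqP => [|<-]; first exact: setDidPl.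
  by rewrite disjoints_subset setDE subsetIr.
rewrite subsetD => /andP[BD BA].
have ABE : (A :|: B) :\: A = B by rewrite setDUl setDv set0U; apply/setDidPl.
rewrite ABE setDDl !mulrA; set E := D :\: (A :|: B).
have AE : [disjoint A & E] by rewrite disjoint_sym disjoints_subset /E setDE setCU setIA (subset_trans (subsetIl _ _)) // subsetIr.
have BE : [disjoint B & E] by rewrite disjoint_sym disjoints_subset /E setDE setCU setIA subsetIr.
have -> : D :\: A = B :|: E.
  apply/setP => x; rewrite !inE; have := subsetP BD x; move: BA.
  rewrite disjoint_subset => /subsetP/(_ x); rewrite !inE.
  by case: (x \in B); case: (x \in A); case: (x \in D) => // H1 H2;
    rewrite ?H1 ?H2 //; have := H1 isT; have := H2 isT.
rewrite inversionsUr // inversionsUl; last by rewrite disjoint_sym.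
rewrite !exprD; move: (_ ^+ _) (_ ^+ _) (_ ^+ _) => x y z.
rewrite -!mulrA; rewrite ![F A * _]mulrCA !mulrA.
by congr (_ * _ * _ * _); rewrite -mulrA mulrC -mulrA.
Qed.

Lemma inversions0s B : inversions set0 B = 0%N.
Proof. by rewrite /inversions big_set0. Qed.
Lemma inversionss0 B : inversions B set0 = 0%N.
Proof. by rewrite /inversions big1 // => a _; rewrite big_set0. Qed.

Lemma gmul1l : left_id (monom set0) gmul.
Proof.
move=> F; apply/ffunP => C; rewrite !ffunE (bigD1 set0) ?powersetE ?sub0set //=.
rewrite big1 ?addr0 => [|A /andP[_ /negPf A0]]; last by rewrite ffunE A0 mulr0 mul0r.
by rewrite inversions0s ffunE eqxx !mul1r setD0.
Qed.

Lemma gmul1r : right_id (monom set0) gmul.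
Proof.
move=> F; apply/ffunP => C; rewrite !ffunE (bigD1 C) ?powersetE //=.
rewrite big1 ?addr0 => [|A /andP[]].
  by rewrite setDv inversionss0 ffunE eqxx mulr1 !mul1r.
rewrite powersetE => sAC /negPf nAC; rewrite ffunE setD_eq0.
by case: (boolP (C \subset A)) => [CA|_]; rewrite ?mulr0 //;
  rewrite eqEsubset sAC CA in nAC.
Qed.

Lemma gmulDl : left_distributive gmul +%R.
Proof.
move=> F G H; apply/ffunP => C; rewrite !ffunE -big_split; apply: eq_bigr => A _.
by rewrite ffunE mulrDr mulrDl.
Qed.

Lemma gmulDr : right_distributive gmul +%R.
Proof.
move=> F G H; apply/ffunP => C; rewrite !ffunE -big_split; apply: eq_bigr => A _.
by rewrite ffunE mulrDr.
Qed.

Lemma gone_neq0 : monom set0 != 0.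
Proof.
by apply/eqP => /ffunP/(_ set0); rewrite !ffunE eqxx; apply/eqP/oner_neq0.
Qed.

HB.instance Definition _ := GRing.Zmodule_isNzRing.Build (grassmann R I)
  gmulA gmul1l gmul1r gmulDl gmulDr gone_neq0.

Lemma gscaleAl (k : R) F G : k *: (F * G) = (k *: F) * G.
Proof.
apply/ffunP => C; rewrite !ffunE scaler_sumr; apply: eq_bigr => A _.
by rewrite ffunE /GRing.scale /= mulrA mulrCA mulrA.
Qed.

Lemma gscaleAr (k : R) F G : k *: (F * G) = F * (k *: G).
Proof.
apply/ffunP => C; rewrite !ffunE scaler_sumr; apply: eq_bigr => A _.
by rewrite ffunE /GRing.scale /= mulrCA.
Qed.

HB.instance Definition _ := GRing.Lmodule_isLalgebra.Build R (grassmann R I) gscaleAl.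
HB.instance Definition _ := GRing.Lalgebra_isAlgebra.Build R (grassmann R I) gscaleAr.

Definition generator (a : I) : grassmann R I := monom [set a].
Definition body F : R := F set0.
(* The left derivative with respect to the generator a: for a outside B,
   e_(a |: B) = (-1) ^ (inversions [set a] B) e_a * e_B is sent to
   (-1) ^ (inversions [set a] B) e_B. *)
Definition gderiv (a : I) F : grassmann R I :=
  [ffun B : {set I} => if a \in B then 0 else
     (-1) ^+ inversions [set a] B * F (a |: B)].
End Grassmann.

From mathcomp Require Import all_classical all_reals all_analysis.
Import numFieldNormedType.Exports.
Local Open Scope classical_set_scope.

Section LebesgueTuple.
Variable R : realType.

Definition tuple_cons n (p : measurableTypeR R * n.-tuple (measurableTypeR R)) :
  n.+1.-tuple (measurableTypeR R) := [tuple of p.1 :: p.2].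

Lemma measurable_tuple_cons n : measurable_fun setT (@tuple_cons n).
Proof. by apply: measurable_cons. Qed.

Section succ.
Variable n : nat.
Variable mu : {sigma_finite_measure set (n.-tuple (measurableTypeR R)) -> \bar R}.

Definition lebesgue_tuple_succ : set (n.+1.-tuple (measurableTypeR R)) -> \bar R :=
  pushforward (lebesgue_measure \x mu)%E (@tuple_cons n).

Let m1 : {measure set _ -> \bar R} := (lebesgue_measure \x mu)%E.

Let succ0 : lebesgue_tuple_succ set0 = 0%E.
Proof. by rewrite /lebesgue_tuple_succ /pushforward preimage_set0 measure0. Qed.

Let succ_ge0 A : (0 <= lebesgue_tuple_succ A)%E.
Proof. exact: (@measure_ge0 _ _ _ m1). Qed.

Let measurable_preim A : measurable A -> measurable (@tuple_cons n @^-1` A).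
Proof. by move=> mA; rewrite -[X in measurable X]setTI; exact: measurable_tuple_cons. Qed.

Let succ_sigma_additive : semi_sigma_additive lebesgue_tuple_succ.
Proof.
move=> F mF tF mUF; rewrite /lebesgue_tuple_succ /pushforward preimage_bigcup.
apply: (@measure_semi_sigma_additive _ _ _ m1).
- by move=> k; exact: measurable_preim.
- apply/trivIsetP => /= i j _ _ ij; rewrite -preimage_setI.
  by move/trivIsetP : tF => /(_ _ _ _ _ ij) ->//; rewrite preimage_set0.
- by rewrite -preimage_bigcup; exact: measurable_preim.
Qed.

HB.instance Definition _ := isMeasure.Build _ _ _ lebesgue_tuple_succ
  succ0 succ_ge0 succ_sigma_additive.

Let succ_sigma_finite : sigma_finite setT lebesgue_tuple_succ.
Proof.
have /sigma_finiteP[F [TF ndF Foo]] :=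
  sigma_finiteT (@lebesgue_measure R : {sigma_finite_measure set (measurableTypeR R) -> \bar R}).
have /sigma_finiteP[G [TG ndG Goo]] := sigma_finiteT mu.
pose uncons (t : n.+1.-tuple (measurableTypeR R)) := (thead t, [tuple of behead t]).
have consK : cancel uncons (@tuple_cons n) by move=> t; rewrite /tuple_cons /uncons/= -tuple_eta.
have unconsK : cancel (@tuple_cons n) uncons.
  by move=> [x t]; congr pair; apply/val_inj.
have muncons : measurable_fun setT uncons.
  by apply: measurable_fun_pair; [exact: measurable_tnth|exact: measurable_behead].
exists (fun k => uncons @^-1` (F k `*` G k)).
  apply/esym; rewrite -subTset => t _; have : setT (uncons t) by [].
  rewrite -setXTT TF TG => -[/= [j _ Fj] [k _ Gk]]; exists (maxn j k) => //; split.
  - by move: Fj; exact/subsetPset/ndF/leq_maxl.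
  - by move: Gk; exact/subsetPset/ndG/leq_maxr.
move=> k; have [mF Fk] := Foo k; have [mG Gk] := Goo k; split.
  by rewrite -[X in measurable X]setTI; apply: muncons => //; exact: measurableX.
rewrite /lebesgue_tuple_succ /pushforward -comp_preimage.
rewrite (_ : _ \o _ = id); last by apply/funext => x /=; rewrite unconsK.
by rewrite preimage_id product_measure1E// lte_mul_pinfty// ge0_fin_numE.
Qed.

HB.instance Definition _ := Measure_isSigmaFinite.Build _ _ _ lebesgue_tuple_succ
  succ_sigma_finite.
End succ.

(* Lebesgue measure on R^n. *)
Fixpoint lebesgue_tuple n :
    {sigma_finite_measure set (n.-tuple (measurableTypeR R)) -> \bar R} :=
  if n is n'.+1 then lebesgue_tuple_succ (lebesgue_tuple n')
  else \d_([tuple] : 0.-tuple (measurableTypeR R)).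
End LebesgueTuple.

Section RealVectors.
Variables (R : realType) (I : finType).
Implicit Types (i : I) (x : I -> R) (g : (I -> R) -> R).

(* R^I as functions on I and as the measurable type of #|I|-tuples. *)
Definition vec (t : #|I|.-tuple (measurableTypeR R)) : I -> R :=
  fun i => tnth t (enum_rank i).

Definition unvec x : #|I|.-tuple (measurableTypeR R) :=
  [tuple x (enum_val k) | k < #|I|].

Definition pderiv i g : (I -> R) -> R :=
  fun x => derive1 (fun t : R => g [eta x with i |-> t]) (x i).

Definition pderivs (s : seq I) g : (I -> R) -> R := foldr pderiv g s.

Definition smooth g : Prop := forall s : seq I,
  continuous (pderivs s g : {ptws I -> R} -> R) /\
  forall i x, derivable (fun t : R => pderivs s g [eta x with i |-> t]) (x i) 1.

End RealVectors.

Section FunctionalCalculus.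
Variables (R : realType) (I : finType).
Implicit Types (F : grassmann R I).

(* Taylor expansion of g(F^1, ..., F^k), for even F^j and g smooth near the
   degree-0 parts. Multi-indices with some al j > #|I| contribute 0, since
   F j - body (F j) is then nilpotent of order at most #|I| + 1; sequences of
   coordinates represent multi-indices in pderivs. *)
Definition gapp (J : finType) (g : (J -> R) -> R) (F : J -> grassmann R I) :
    grassmann R I :=
  \sum_(al : {ffun J -> 'I_#|I|.+1})
    (pderivs (flatten [seq nseq (al j) j | j <- enum J]) g
       (fun j => body (F j)) / (\prod_j (al j)`!)%:R) *:
    \prod_j (F j - (body (F j))%:A) ^+ al j.

Definition gapp1 (h : R -> R) F : grassmann R I :=
  gapp (fun v : unit -> R => h (v tt)) (fun _ => F).

End FunctionalCalculus.

Section SuperMinkowski.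
Variables (R : realType) (Lambda : finType).

(* The generators are xi_i = inl i and eta_i = inr i. All operations on forms
   are pointwise on R^(3 Lambda), so a form is a function of the coordinates
   z, x, y with values in the Grassmann algebra over R. Smoothness of the
   coefficients is not built in, so that forms can be cut off by indicators. *)
Definition galg := grassmann R (Lambda + Lambda)%type.

Definition superform := (Lambda -> R) -> (Lambda -> R) -> (Lambda -> R) -> galg.

Record supervector := SuperVector {
  sz : galg; sx : galg; sy : galg; sxi : galg; seta : galg }.

Definition supersub (u v : supervector) : supervector :=
  SuperVector (sz u - sz v) (sx u - sx v) (sy u - sy v)
    (sxi u - sxi v) (seta u - seta v).

Definition superdot (u v : supervector) : galg :=
  - (sz u * sz v) + sx u * sx v + sy u * sy v
  - sxi u * seta v + seta u * sxi v.

Definition supercoord (z x y : Lambda -> R) (i : Lambda) : supervector :=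
  SuperVector (z i)%:A (x i)%:A (y i)%:A
    (generator R (inl i)) (generator R (inr i)).

Definition superradius (u : supervector) : galg := gapp1 Num.sqrt (- superdot u u).

Definition hamiltonian (beta : Lambda -> Lambda -> R)
    (u : Lambda -> supervector) : galg :=
  4^-1 *: (\sum_i \sum_j beta i j *:
    superdot (supersub (u i) (u j)) (supersub (u i) (u j))) +
  4^-1 *: (\sum_i \sum_j beta i j *: (superradius (u i) - superradius (u j)) ^+ 2).

Definition timelike_future (z x y : Lambda -> R) : bool :=
  [forall i, (body (superdot (supercoord z x y i) (supercoord z x y i)) < 0)
             && (0 < z i)].

Definition lebesgue3 :=
  ((lebesgue_tuple R #|Lambda| \x lebesgue_tuple R #|Lambda|)
     \x lebesgue_tuple R #|Lambda|)%E.

Definition berezin_density (F : superform)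
    (p : #|Lambda|.-tuple (measurableTypeR R) *
         #|Lambda|.-tuple (measurableTypeR R) *
         #|Lambda|.-tuple (measurableTypeR R)) : R :=
  body (foldr (fun i G => gderiv (inr i) (gderiv (inl i) G))
    (F (vec p.1.1) (vec p.1.2) (vec p.2)) (enum Lambda)).

Definition berezin (F : superform) : \bar R :=
  (((2 * pi) ^- #|Lambda|)%:E *
   \int[lebesgue3]_p (berezin_density F p)%:E)%E.

Definition boltzmann (beta : Lambda -> Lambda -> R) (F : superform) : superform :=
  fun z x y => (timelike_future z x y)%:R *:
    (F z x y * gapp1 expR (- hamiltonian beta (supercoord z x y))).

Definition superexpectation (beta : Lambda -> Lambda -> R) (F : superform) : \bar R :=
  berezin (boltzmann beta F).

Definition superexpectation_cvg (beta : Lambda -> Lambda -> R) (F : superform) : Prop :=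
  lebesgue3.-integrable setT (fun p => (berezin_density (boltzmann beta F) p)%:E).

End SuperMinkowski.

Section Hypotheses.
Variables (R : realType) (Lambda : finType).

Definition smooth_compact_probability (nu : Lambda -> (Lambda -> R) -> R) : Prop :=
  [/\ forall i r, 0 <= nu i r,
      forall i, smooth (nu i),
      forall i, exists K : set {ptws Lambda -> R},
        [/\ compact K, K `<=` [set r | forall k, 0 < r k]
          & forall r, ~ K r -> nu i r = 0] &
      (\sum_i \int[lebesgue_tuple R #|Lambda|]_t (nu i (vec t))%:E = 1)%E].

Definition rapid_decay (f : Lambda -> (Lambda -> R) -> R) : Prop :=
  forall i, exists k, forall (s : seq Lambda) (p : nat), exists C : R,
    forall l : Lambda -> R, `|pderivs s (f i) l| <= C * (1 + `|l k|) ^- p.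

End Hypotheses.

Section VRJP.
Context (R : realType) (Lambda : finType) d (T : measurableType d).
Variables (P : probability T R) (beta : Lambda -> Lambda -> R).
Variables (X : R -> T -> Lambda) (L0 : T -> Lambda -> R).

Definition local_time (t : R) (w : T) (i : Lambda) : R :=
  L0 w i + \int[lebesgue_measure]_(s in `[0, t]) (X s w == i)%:R.

(* The sigma-algebra generated by L0 and (X s) for 0 <= s <= t. *)
Definition history (t : R) : set (set T) :=
  <<s [set A | (exists s i, [/\ 0 <= s, s <= t & A = [set w | X s w = i]]) \/
      (exists i (B : set (measurableTypeR R)),
         measurable B /\ A = [set w | B (L0 w i)])] >>.

(* A jump process with
     P[X_{t+h} = j | history t, X_t = i] = beta_ij L_t^j h + o(h),  j <> i,
   the conditional probabilities being tested against the events A of the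
   history at time t. The right limits h -> 0+ alone would not exclude jumps
   of positive probability at a deterministic time, hence the assumption that
   the process has no fixed time of discontinuity. *)
Record vrjp : Prop := Vrjp {
  vrjp_measurable : forall t i, 0 <= t -> measurable [set w | X t w = i];
  vrjp_measurable0 : forall i, measurable_fun setT (fun w => L0 w i);
  vrjp_gt0 : forall w i, 0 < L0 w i;
  vrjp_right_continuous : forall w t, 0 <= t ->
    \forall s \near t^'+, X s w = X t w;
  vrjp_left_limit : forall w t, 0 < t ->
    exists i, \forall s \near t^'-, X s w = i;
  vrjp_no_fixed_jump : forall t, 0 < t ->
    P [set w | X (t - h) w <> X t w] @[h --> 0^'+] --> 0%E;
  vrjp_rate : forall t i j (A : set T), 0 <= t -> i != j -> history t A ->
    ((h^-1)%:E * P (A `&` [set w | X t w = i /\ X (t + h) w = j]))%E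
      @[h --> 0^'+] -->
    (\int[P]_(w in A `&` [set w | X t w = i])
       (beta i j * local_time t w j)%:E)%E }.

Definition initial_law (nu : Lambda -> (Lambda -> R) -> R) : Prop :=
  forall i (B : set (#|Lambda|.-tuple (measurableTypeR R))), measurable B ->
    P [set w | X 0 w = i /\ B (unvec (L0 w))] =
    (\int[lebesgue_tuple R #|Lambda|]_(t in B) (nu i (vec t))%:E)%E.

End VRJP.

(* Main.v *)
(* Write q_k = z_k^2 - x_k^2 - y_k^2 and let n be the number of vertices. The
   integrand of the superexpectation is x_i x_j f_j(z) times the exponential of the
   quadratic energy times the top coefficient of G_i(q) exp(- sigma), where
   sigma = sum_kl beta_kl xi_k eta_l and the even form G_i satisfies
   d_(eta_k) G_i = - 2 xi_k d_(q_k) G_i. Let K(h) be the sum over i and j of these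
   integrals with h_j in place of f_j, and U(h) = int_0^oo E h(X_t, L_t) dt.

   The vector field z_j d_(x_j) + x_j d_(z_j) annihilates q. Integrating by parts
   along it gives K(A g) = - sum_i int z_i g_i(z) (...) for the generator
   (A g)_j = d_j g_j + sum_k beta_jk z_k (g_k - g_j). The right-hand side is
   evaluated by localization: for fixed z the integral over x, y, xi, eta does not
   depend on the interaction, which may be replaced by - s times the identity, and
   s -> oo leaves (2 pi)^n times the value at x = y = 0. Hence
   K(A g) = - (2 pi)^n sum_i int g_i nu_i, while Dynkin's formula is
   U(A g) = - sum_i int g_i nu_i.

   For h vanishing where sum z >= T, solve d_j g_j = - h_j along coordinate rays:
   D = (2 pi)^n U - K then satisfies D(h) = D(B h), where
   (B h)_j = sum_k beta_jk z_k (g_k - g_j) is a contraction for a norm with a large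
   exponential weight, so D = 0. Rapidly decaying functions are reached by cutting
   off. Since the reversed Cauchy-Schwarz inequality makes every term of the energy
   nonpositive, at most - c z_l / z_k along an edge kl, and the graph is connected,
   the decay of f_j in one single coordinate makes its density integrable; applied
   to |f|, this also gives the integrability of E f(X_t, L_t) in t. *)
Require Import Defs.
From mathcomp Require Import all_boot all_order all_algebra.
From mathcomp Require Import zify ring lra.
Set Implicit Arguments.
Unset Strict Implicit.
Unset Printing Implicit Defensive.
Import Order.TTheory GRing.Theory Num.Theory.
Local Open Scope ring_scope.

(** * Grassmann algebra *)

(** Boundary terms have to vanish in every integration by parts, and the support of [nu] sees to it.
    It keeps each q_k above a positive constant, so the integrand is 0 near the light cone and near
    z_k = 0, where the indicators jump. On this support |x_k| and |y_k| are at most z_k, hence a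
    cutoff in sum z alone gives compact support.

    The functions h_j met in the iteration are only Lipschitz, so the solution of d_j g_j = - h_j is
    differentiated in the direction j alone. This is enough: the vector field pairs g_j with d_(x_j)
    and d_(z_j) only.

    Localization needs no supersymmetry operator. After Berezin integration, the derivative of the
    integral in the strength of the interaction is an ordinary divergence in x plus one in y.

    The value at x = y = 0, where r = z, explains the form of the statement: the terms (r_k - r_l)^2
    of H make the exponentials cancel there, and 1 / r_i cancels the factor z_i which the vector
    field produces from x_i. *)

Section GrassmannAlgebra.
Variables (R : comNzRingType) (I : finType).
Implicit Types (a b c : I) (A B C : {set I}) (F G H N : grassmann R I) (k : R).

Local Notation gen := (@generator R I).

Lemma grassmannM F G C : (F * G) C = \sum_(A in powerset C)
  (-1) ^+ inversions A (C :\: A) * F A * G (C :\: A).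
Proof. by rewrite /GRing.mul /= ffunE. Qed.

Lemma grassmannZ k F C : (k *: F) C = k * F C.
Proof. by rewrite ffunE. Qed.

Lemma grassmann1 C : (1 : grassmann R I) C = (C == set0)%:R.
Proof. by rewrite /GRing.one /= ffunE. Qed.

Lemma generatorMl b F C : (gen b * F) C =
  if b \in C then (-1) ^+ inversions [set b] (C :\ b) * F (C :\ b) else 0.
Proof.
rewrite grassmannM; case: ifPn => bC.
  rewrite (bigD1 [set b]) ?powersetE ?sub1set //= big1 ?addr0 => [|A /andP[_ /negPf Ab]].
    by rewrite ffunE eqxx mulr1.
  by rewrite ffunE Ab mulr0 mul0r.
rewrite big1 // => A; rewrite powersetE => /subsetP AC; rewrite ffunE.
case: eqP => [E|_]; last by rewrite mulr0 mul0r.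
by case/negP: bC; apply: AC; rewrite E inE.
Qed.

Lemma generatorMr b F C : (F * gen b) C =
  if b \in C then (-1) ^+ inversions (C :\ b) [set b] * F (C :\ b) else 0.
Proof.
rewrite grassmannM; case: ifPn => bC.
  rewrite (bigD1 (C :\ b)) ?powersetE ?subsetDl //= big1 ?addr0.
    have -> : C :\: (C :\ b) = [set b].
      by apply/setP => x; rewrite !inE; case: eqP => [->|]; rewrite ?bC // andNb.
    by rewrite ffunE eqxx mulr1.
  move=> A; rewrite powersetE => /andP[AC nA]; rewrite ffunE.
  case: eqP => [E|_]; last by rewrite mulr0.
  by case/eqP: nA; rewrite -E setDDr setDv set0U; apply/esym/setIidPr.
rewrite big1 // => A; rewrite powersetE => /subsetP AC; rewrite ffunE.
case: eqP => [E|_]; last by rewrite mulr0.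
case/negP: bC; have : b \in [set b] by rewrite inE.
by rewrite -E inE => /andP[].
Qed.

(** Every element of [B] precedes or follows [b], so exactly one of the two counts sees it. This is
    the source of all anticommutation signs. *)
Lemma inversions1C b B : b \notin B ->
  (inversions [set b] B + inversions B [set b])%N = #|B|.
Proof.
move=> bB; rewrite /inversions big_set1 [X in (_ + X)%N](_ : _ =
  \sum_(c in B) (enum_rank b < enum_rank c))%N; last first.
  by apply: eq_bigr => c _; rewrite big_set1.
rewrite -big_split -[RHS]sum1_card /=; apply: eq_bigr => c cB.
have : enum_rank b != enum_rank c :> nat.
  by rewrite (inj_eq val_inj) (inj_eq enum_rank_inj); apply: contraNneq bB => ->.
by case: ltngtP.
Qed.

Lemma inversions1D b B c : c \in B ->
  inversions [set b] B = (inversions [set b] [set c] + inversions [set b] (B :\ c))%N.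
Proof.
move=> cB; rewrite -{1}(setD1K cB) inversionsUr //.
by rewrite disjoints1 !inE eqxx.
Qed.

Lemma gderivE a F B : gderiv a F B =
  if a \in B then 0 else (-1) ^+ inversions [set a] B * F (a |: B).
Proof. by rewrite ffunE. Qed.

Lemma gderivD a F G : gderiv a (F + G) = gderiv a F + gderiv a G.
Proof. by apply/ffunP => B; rewrite !ffunE; case: ifP; rewrite ?addr0 // mulrDr. Qed.

Lemma gderivZ a k F : gderiv a (k *: F) = k *: gderiv a F.
Proof.
apply/ffunP => B; rewrite !(gderivE, grassmannZ); case: ifP; rewrite ?mulr0 //.
by rewrite mulrCA.
Qed.

Lemma gderiv0 a : gderiv a (0 : grassmann R I) = 0.
Proof. by rewrite -(scale0r 0) gderivZ !scale0r. Qed.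

Lemma gderivN a F : gderiv a (- F) = - gderiv a F.
Proof. by rewrite -scaleN1r gderivZ scaleN1r. Qed.

Lemma gderiv_sum a (J : Type) (r : seq J) (P : pred J) (F : J -> grassmann R I) :
  gderiv a (\sum_(j <- r | P j) F j) = \sum_(j <- r | P j) gderiv a (F j).
Proof. by apply: big_morph; [exact: gderivD|exact: gderiv0]. Qed.

Lemma gderiv1 a : gderiv a (1 : grassmann R I) = 0.
Proof.
apply/ffunP => B; rewrite gderivE grassmann1 [RHS]ffunE; case: ifP => // _.
by case: eqP => [/setP/(_ a)|]; rewrite ?mulr0 // !inE eqxx.
Qed.

Lemma gderivA a k : gderiv a (k%:A : grassmann R I) = 0.
Proof. by rewrite gderivZ gderiv1 scaler0. Qed.

(** The graded Leibniz rule for one generator on the left. Together with the ungraded rule for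
    [geven] elements it covers all later products. *)
Lemma gderiv_generatorM a b F :
  gderiv a (gen b * F) = (a == b)%:R *: F - gen b * gderiv a F.
Proof.
apply/ffunP => B; rewrite ffunE [RHS]ffunE grassmannZ [X in _ = _ + X]ffunE !generatorMl.
case: (boolP (a == b)) => [/eqP<-|ab].
  rewrite mul1r; case: ifPn => aB.
    rewrite gderivE !inE eqxx /= setD1K // mulrA -exprD addnn -mul2n exprM sqrrN.
    by rewrite !expr1n mul1r subrr.
  by rewrite subr0 !inE eqxx /= setU1K // mulrA -exprD addnn -mul2n exprM sqrrN !expr1n mul1r.
have /negPf ba : b != a by rewrite eq_sym.
rewrite mul0r add0r !inE ba /=; case: ifPn => aB; case: ifPn => bB; rewrite ?oppr0 ?mulr0 //.
  by rewrite gderivE !inE ab aB /= mulr0 oppr0.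
rewrite gderivE !inE ab /= (negPf aB) /=.
have -> : (a |: B) :\ b = a |: (B :\ b).
  by apply/setP => x; rewrite !inE; case: (eqVneq x a) => // ->; rewrite ab.
rewrite !mulrA -!exprD (@inversions1D a B b) //.
rewrite (@inversions1D b (a |: (B :\ b)) a) ?inE ?eqxx //.
rewrite setU1K ?inE ?(negPf aB) ?andbF //.
have : (inversions [set a] [set b] + inversions [set b] [set a])%N = 1%N.
  by rewrite inversions1C ?cards1 // inE.
rewrite -mulNr => uw; congr (_ * _).
by rewrite addnACA uw exprS mulN1r addnC.
Qed.

Lemma gderiv_generator a b : gderiv a (gen b) = ((a == b)%:R)%:A.
Proof. by rewrite -[gen b]mulr1 gderiv_generatorM gderiv1 mulr0 subr0. Qed.

Lemma generator_anticomm a b : gen a * gen b = - (gen b * gen a).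
Proof.
apply/ffunP => C; rewrite generatorMl [RHS]ffunE generatorMl.
rewrite /generator !ffunE.
case: (boolP (a == b)) => [/eqP<-|ab].
  have -> : (C :\ a == [set a]) = false.
    by apply/eqP => /setP/(_ a); rewrite !inE eqxx.
  by rewrite mulr0; case: ifP; rewrite ?oppr0.
case: (boolP (C == [set a; b])) => [/eqP->|nC].
  have E1 : [set a; b] :\ a = [set b] by rewrite setU1K // inE.
  have E2 : [set a; b] :\ b = [set a] by rewrite setUC setU1K // inE eq_sym.
  rewrite !inE !eqxx orbT /= E1 E2 !eqxx !mulr1.
  have : (inversions [set a] [set b] + inversions [set b] [set a])%N = 1%N.
    by rewrite inversions1C ?cards1 // inE.
  case: (inversions _ _) => [|[|u]]; case: (inversions _ _) => [|[|w]] //.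
  by rewrite expr0 expr1 opprK.
have E x y : x \in C -> C :\ x == [set y] -> C = [set x; y].
  by move=> xC /eqP xy; rewrite -(setD1K xC) xy.
case: ifPn => aC; [case: eqP => [/eqP/(E _ _ aC) H|_]|]; rewrite ?mulr0 //.
- by rewrite H eqxx in nC.
- case: ifPn => bC; [case: eqP => [/eqP/(E _ _ bC) H|_]|]; rewrite ?mulr0 ?oppr0 //.
  by rewrite H setUC eqxx in nC.
case: ifPn => bC; [case: eqP => [/eqP/(E _ _ bC) H|_]|]; rewrite ?mulr0 ?oppr0 //.
by rewrite H setUC eqxx in nC.
Qed.

Lemma generator_sq a : gen a * gen a = 0.
Proof.
apply/ffunP => C; rewrite generatorMl /generator !ffunE.
have -> : (C :\ a == [set a]) = false.
  by apply/eqP => /setP/(_ a); rewrite !inE eqxx.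
by rewrite mulr0; case: ifP.
Qed.

(** The parity automorphism, which records the sign for moving a generator past an element. *)
Definition grading F : grassmann R I := [ffun C : {set I} => (-1) ^+ #|C| * F C].

Lemma generator_grading a F : gen a * F = grading F * gen a.
Proof.
apply/ffunP => C; rewrite generatorMl generatorMr; case: ifP => // aC.
rewrite ffunE mulrA -exprD; congr (_ * _).
rewrite -(@inversions1C a (C :\ a)) ?inE ?eqxx //.
rewrite addnC -addnA addnn -mul2n exprD exprM sqrrN !expr1n mulr1 //.
Qed.

Lemma gradingK : involutive grading.
Proof.
move=> F; apply/ffunP => C; rewrite !ffunE mulrA -exprD addnn -mul2n exprM.
by rewrite sqrrN !expr1n mul1r.
Qed.

(* Centrality together with the ungraded Leibniz rule are the two properties of
   even elements that are used, and they are stable under all ring operations. *)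
Definition geven N := (forall F, N * F = F * N) /\
  (forall a F, gderiv a (N * F) = gderiv a N * F + N * gderiv a F).

Lemma gevenZA k : geven k%:A.
Proof.
split=> [F|a F]; first by rewrite -scalerAl -scalerAr mul1r mulr1.
by rewrite gderivA mul0r add0r -!scalerAl !mul1r gderivZ.
Qed.

Lemma geven1 : geven 1.
Proof. by have := gevenZA 1; rewrite scale1r. Qed.

Lemma gevenD M N : geven M -> geven N -> geven (M + N).
Proof.
move=> [cM dM] [cN dN]; split=> [F|a F]; first by rewrite mulrDl mulrDr cM cN.
by rewrite !mulrDl !gderivD dM dN mulrDl addrACA.
Qed.

Lemma gevenM M N : geven M -> geven N -> geven (M * N).
Proof.
move=> [cM dM] [cN dN]; split=> [F|a F]; first by rewrite -mulrA cN mulrA cM mulrA.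
by rewrite -mulrA !dM !dN mulrDr mulrDl !mulrA addrA.
Qed.

Lemma gevenZ k N : geven N -> geven (k *: N).
Proof. by move=> eN; rewrite -[N]mul1r scalerAl; apply: gevenM => //; exact: gevenZA. Qed.

Lemma gevenN N : geven N -> geven (- N).
Proof. by move=> eN; rewrite -scaleN1r; exact: gevenZ. Qed.

Lemma geven0 : geven 0.
Proof. by rewrite -(scale0r 1); exact: gevenZA. Qed.

Lemma gevenB M N : geven M -> geven N -> geven (M - N).
Proof. by move=> eM eN; apply: gevenD => //; exact: gevenN. Qed.

Lemma geven_sum (J : Type) (r : seq J) (P : pred J) (F : J -> grassmann R I) :
  (forall j, P j -> geven (F j)) -> geven (\sum_(j <- r | P j) F j).
Proof. by move=> eF; apply: big_ind => //; [exact: geven0|exact: gevenD]. Qed.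

Lemma geven_prod (J : Type) (r : seq J) (P : pred J) (F : J -> grassmann R I) :
  (forall j, P j -> geven (F j)) -> geven (\prod_(j <- r | P j) F j).
Proof. by move=> eF; apply: big_ind => //; [exact: geven1|exact: gevenM]. Qed.

Lemma gevenX N m : geven N -> geven (N ^+ m).
Proof. by move=> eN; elim: m => [|m IH]; rewrite ?exprS; [exact: geven1|exact: gevenM]. Qed.

(** Passing two generators applies the parity automorphism twice, and the two signs of the Leibniz
    rule cancel. *)
Lemma geven_generators a b : geven (gen a * gen b).
Proof.
split=> [F|c F].
  by rewrite -mulrA (generator_grading b) mulrA (generator_grading a) gradingK -mulrA.
rewrite -mulrA !gderiv_generatorM gderiv_generator mulrBr mulrBl.
by rewrite -!scalerAl -!scalerAr -?scalerAl mulr1 opprB addrA addrAC mulrA.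
Qed.

Lemma gderivX a N m : geven N -> gderiv a (N ^+ m) = m%:R *: (gderiv a N * N ^+ m.-1).
Proof.
move=> eN; elim: m => [|m IH]; first by rewrite expr0 gderiv1 scale0r.
rewrite exprS (proj2 eN) IH /=; case: m IH => [|m] IH.
  by rewrite scale0r mulr0 addr0 scale1r.
rewrite -scalerAr (proj1 eN) -mulrA -exprSr /= [in RHS]mulrS scalerDl scale1r //.
Qed.

End GrassmannAlgebra.

(** * Nilpotency and the exponential of nilpotent elements *)

Section GrassmannExponential.
Variables (R : numFieldType) (I : finType).
Implicit Types (a b : I) (A B C : {set I}) (F G M N : grassmann R I) (k : R).

(** Membership in the p-th power of the ideal spanned by the generators. Nilpotency reduces to
    counting orders, since only 0 has order above [#|I|]. *)
Definition gorder (p : nat) F := forall A : {set I}, (#|A| < p)%N -> F A = 0.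

Lemma gorderM p q F G : gorder p F -> gorder q G -> gorder (p + q) (F * G).
Proof.
move=> oF oG C Cpq; rewrite grassmannM big1 // => A; rewrite powersetE => AC.
have [Ap|pA] := ltnP #|A| p; first by rewrite oF // mulr0 mul0r.
have ? := subset_leq_card AC; rewrite oG ?mulr0 // cardsDS //; lia.
Qed.

Lemma gorder_eq0 p F : (#|I| < p)%N -> gorder p F -> F = 0.
Proof.
move=> Ip oF; apply/ffunP => A; rewrite oF ?ffunE //.
by apply: leq_ltn_trans Ip; exact: max_card.
Qed.

Lemma gorder1 N : body N = 0 -> gorder 1 N.
Proof. by move=> N0 A; rewrite ltnS leqn0 cards_eq0 => /eqP->. Qed.

Lemma gorderX p m N : gorder p N -> gorder (p * m) (N ^+ m).
Proof.
move=> oN; elim: m => [|m IH]; first by rewrite muln0 => A.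
by rewrite mulnS exprS; exact: gorderM.
Qed.

Lemma nilpotent_exp m N : body N = 0 -> (#|I| < m)%N -> N ^+ m = 0.
Proof. by move=> /gorder1/(gorderX (m := m)); rewrite mul1n => oN /gorder_eq0; exact. Qed.

Lemma bodyD F G : body (F + G) = body F + body G.
Proof. by rewrite /body ffunE. Qed.

Lemma bodyZ k F : body (k *: F) = k * body F.
Proof. by rewrite /body grassmannZ. Qed.

Lemma bodyN F : body (- F) = - body F.
Proof. by rewrite /body ffunE. Qed.

Lemma body1 : body (1 : grassmann R I) = 1.
Proof. by rewrite /body grassmann1 eqxx. Qed.

Lemma bodyA k : body (k%:A : grassmann R I) = k.
Proof. by rewrite bodyZ body1 mulr1. Qed.

Lemma bodyM F G : body (F * G) = body F * body G.
Proof.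
rewrite /body grassmannM (bigD1 set0) ?powersetE ?sub0set //= big1 ?addr0.
  by rewrite set0D inversions0s mul1r.
by move=> A; rewrite powersetE subset0 => /andP[->].
Qed.

Lemma body_sum (J : Type) (r : seq J) (P : pred J) (F : J -> grassmann R I) :
  body (\sum_(j <- r | P j) F j) = \sum_(j <- r | P j) body (F j).
Proof. by apply: big_morph; [exact: bodyD|rewrite /body ffunE]. Qed.

Lemma body_generatorM a b : body (generator R a * generator R b) = 0.
Proof. by rewrite bodyM /body !ffunE eq_sym -cards_eq0 cards1 mul0r. Qed.

(** Stopping at [#|I|] loses nothing for an [N] with zero body, whose higher powers vanish; for
    other [N] this is not the exponential. *)
Definition gexp N : grassmann R I :=
  \sum_(m < #|I|.+1) (m`!%:R)^-1 *: N ^+ m.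

Lemma gexp0 : gexp 0 = 1.
Proof.
rewrite /gexp big_ord_recl big1 ?addr0 => [|i _]; last by rewrite expr0n scaler0.
by rewrite expr0 fact0 invr1 scale1r.
Qed.

Lemma geven_gexp N : geven N -> geven (gexp N).
Proof. by move=> eN; apply: geven_sum => m _; apply/gevenZ/gevenX. Qed.

(** Products of terms with p + q above [#|I|] vanish by their order; what remains of the square of
    indices is the triangle of the binomial expansion. *)
Lemma gexpD M N : body M = 0 -> body N = 0 -> GRing.comm M N ->
  gexp (M + N) = gexp M * gexp N.
Proof.
move=> M0 N0 cMN; set K := #|I|.+1.
pose u m := (m`!%:R)^-1 *: M ^+ m; pose v m := (m`!%:R)^-1 *: N ^+ m.
have uv0 p q : (K <= p + q)%N -> u p * v q = 0.
  move=> Kpq; rewrite /u /v -scalerAl -scalerAr.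
  rewrite [_ * _](@gorder_eq0 (p + q)) ?scaler0 //.
  by apply: gorderM; rewrite -[X in gorder X]mul1n; apply/gorderX/gorder1.
transitivity (\sum_(0 <= m < K) \sum_(0 <= i < K | (i <= m)%N) u (m - i)%N * v i).
  rewrite /gexp big_mkord; apply: eq_bigr => m _.
  rewrite exprDn_comm // scaler_sumr -(big_mkord xpredT (fun i =>
    (m`!%:R)^-1 *: (M ^+ (m - i) * N ^+ i *+ 'C(m, i)))).
  rewrite (big_nat_widen _ _ K) /=; last by rewrite ltnS -ltnS.
  apply: eq_bigr => i im; rewrite ltnS in im; rewrite /u /v -scalerAl -scalerAr !scalerA.
  rewrite -[M ^+ _ * _ *+ _]scaler_nat scalerA; congr (_ *: _).
  have fn0 p : p`!%:R != 0 :> R by rewrite pnatr_eq0 -lt0n fact_gt0.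
  rewrite -(bin_fact im) !natrM; have b0 : 'C(m, i)%:R != 0 :> R.
    by rewrite pnatr_eq0 -lt0n bin_gt0.
  by field; rewrite !fn0 b0.
rewrite (exchange_big_dep_nat xpredT) //= /gexp.
rewrite -[X in _ * X](big_mkord xpredT v) mulr_sumr.
apply: eq_big_nat => i /andP[_ iK]; rewrite -[X in _ = X * _](big_mkord xpredT u) mulr_suml.
rewrite [RHS](big_cat_nat (n := (K - i)%N)) ?leq_subr //= [X in _ + X]big_nat_cond.
rewrite [X in _ + X]big1 ?addr0; last first.
  by move=> p /andP[/andP[Kp _] _]; apply: uv0; lia.
transitivity (\sum_(i <= p < K) u (p - i)%N * v i); last first.
  by rewrite -{1}[i]add0n big_addn; apply: eq_bigr => p _; rewrite addnK.
by rewrite [RHS](big_nat_widenl _ 0).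
Qed.

Lemma gderiv_gexp a N : geven N -> body N = 0 ->
  gderiv a (gexp N) = gderiv a N * gexp N.
Proof.
move=> eN N0; rewrite /gexp gderiv_sum big_ord_recl expr0 gderivZ gderiv1 scaler0 add0r.
(* Obtained by differentiating [N ^+ #|I|.+1 = 0]. It removes the one term of the product with
   [gexp N] that the differentiated sum does not produce. *)
have dNK : gderiv a N * N ^+ #|I| = 0.
  have := gderivX a #|I|.+1 eN; rewrite nilpotent_exp // gderiv0 /= => /esym/eqP.
  by rewrite scaler_eq0 pnatr_eq0 /= => /eqP.
rewrite big_ord_recr /= mulrDr -scalerAr dNK scaler0 addr0 mulr_sumr.
apply: eq_bigr => i _; rewrite gderivZ gderivX //= -scalerAr scalerA; congr (_ *: _).
rewrite /bump /= add1n factS natrM invfM mulrAC mulVf ?mul1r //.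
by rewrite pnatr_eq0.
Qed.

End GrassmannExponential.

(** * The fermionic part of the Berezin integral *)

Section BerezinIntegral.
Variables (R : numFieldType) (Lambda : finType).
Local Notation I := (Lambda + Lambda)%type.
Implicit Types (F G : grassmann R I) (i j k : Lambda).

Definition gxi i : grassmann R I := generator R (inl i).
Definition geta i : grassmann R I := generator R (inr i).
Definition xieta i : grassmann R I := gxi i * geta i.

(** The fermionic part of [berezin_density]: the integral over all generators, before the
    integration over the coordinates. *)
Definition gtop F : R :=
  body (foldr (fun i G => gderiv (inr i) (gderiv (inl i) G)) F (enum Lambda)).

Lemma gderivC (a b : I) F : gderiv a (gderiv b F) = - gderiv b (gderiv a F).
Proof.
apply/ffunP => B; rewrite ffunE [RHS]ffunE !gderivE !inE.
case: (eqVneq a b) => [->|ab]; first by rewrite /= mulr0; case: ifP; rewrite ?oppr0.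
rewrite /=.
case: ifPn => aB; case: ifPn => bB; rewrite ?mulr0 ?oppr0 //.
rewrite setUCA !mulrA -!exprD -mulNr; congr (_ * _).
rewrite (@inversions1D _ b (a |: B) a) ?inE ?eqxx // setU1K //.
rewrite (@inversions1D _ a (b |: B) b) ?inE ?eqxx // setU1K //.
have : (inversions [set a] [set b] + inversions [set b] [set a])%N = 1%N.
  by rewrite inversions1C ?cards1 // inE.
case: (inversions [set a] [set b]) => [|[|u]]; case: (inversions [set b] [set a]) => [|[|w]] // _.
  by rewrite add0n addnCA exprS mulN1r addnC.
by rewrite add0n [in RHS]addnCA exprS mulN1r opprK addnC.
Qed.

Lemma gderiv_sq (a : I) F : gderiv a (gderiv a F) = 0.
Proof. by apply/ffunP => B; rewrite !ffunE !inE eqxx mulr0; case: ifP. Qed.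

Lemma gtop_linear c F G : gtop (c *: F + G) = c * gtop F + gtop G.
Proof.
rewrite /gtop /=.
set f := foldr _; suff -> s : f (c *: F + G) s = c *: f F s + f G s by rewrite bodyD bodyZ.
by elim: s => //= i s ->; rewrite !(gderivD, gderivZ).
Qed.

Lemma gtopD F G : gtop (F + G) = gtop F + gtop G.
Proof. by have := gtop_linear 1 F G; rewrite !scale1r mul1r. Qed.

Lemma gtop0 : gtop 0 = 0.
Proof. by apply: (addrI (gtop 0)); rewrite -gtopD !addr0. Qed.

Lemma gtopZ c F : gtop (c *: F) = c * gtop F.
Proof. by have := gtop_linear c F 0; rewrite gtop0 !addr0. Qed.

Lemma gtopN F : gtop (- F) = - gtop F.
Proof. by rewrite -scaleN1r gtopZ mulN1r. Qed.

Lemma gtop_sum (J : Type) (r : seq J) (P : pred J) (F : J -> grassmann R I) :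
  gtop (\sum_(j <- r | P j) F j) = \sum_(j <- r | P j) gtop (F j).
Proof. by apply: big_morph; [exact: gtopD|exact: gtop0]. Qed.

(** A derivative moves through the pairs of derivatives in [gtop] without sign until it meets its
    own copy, and its square is 0. This is fermionic integration by parts. *)
Lemma gtop_gderiv (a : I) F : gtop (gderiv a F) = 0.
Proof.
rewrite /gtop; set f := foldr _.
have fC s : f (gderiv a F) s = gderiv a (f F s).
  elim: s => //= i s ->.
  by rewrite (gderivC (inl i)) gderivN (gderivC (inr i)) opprK.
suff -> : f (gderiv a F) (enum Lambda) = 0 by rewrite /body ffunE.
have H i s : i \in s -> a = inl i \/ a = inr i -> f (gderiv a F) s = 0.
  elim: s => //= j s IH; rewrite inE => /orP[/eqP<-|/IH is0 /is0->]; rewrite ?gderiv0 //.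
  rewrite fC => -[->|->]; first by rewrite gderiv_sq gderiv0.
  by rewrite (gderivC (inl i)) gderivN gderiv_sq oppr0.
by case: a @f fC H => i f fC H; apply: (H i); rewrite ?mem_enum; auto.
Qed.

Lemma xietaE i F : xieta i * F = gxi i * (geta i * F).
Proof. by rewrite mulrA. Qed.

Lemma geven_xieta i : geven (xieta i).
Proof. exact: geven_generators. Qed.

Lemma body_xieta i : body (xieta i) = 0.
Proof. exact: body_generatorM. Qed.

Lemma xi_xieta i : gxi i * xieta i = 0.
Proof. by rewrite mulrA generator_sq mul0r. Qed.

Lemma xieta_sq i : xieta i * xieta i = 0.
Proof. by rewrite xietaE -(proj1 (geven_xieta i)) mulrA xi_xieta mul0r. Qed.

Lemma gderiv_eta_xieta k i : gderiv (inr k) (xieta i) = - (k == i)%:R *: gxi i.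
Proof. 
rewrite gderiv_generatorM gderiv_generator scale0r sub0r -scalerAr mulr1.
by rewrite scaleNr.
Qed.

Lemma gderiv_xi_xieta k i : gderiv (inl k) (xieta i) = (k == i)%:R *: geta i.
Proof.
by rewrite gderiv_generatorM gderiv_generator /= scale0r mulr0 subr0.
Qed.

Lemma gtop_xieta : gtop (\prod_(i <- enum Lambda) xieta i) = 1.
Proof.
rewrite /gtop; set f := foldr _.
suff H : forall s, uniq s -> f (\prod_(i <- s) xieta i) s = 1 by rewrite H ?body1 ?enum_uniq.
have fM i s F : i \notin s -> f (xieta i * F) s = xieta i * f F s.
  elim: s => //= j s IH; rewrite inE negb_or => /andP[ij /IH->].
  rewrite (proj2 (geven_xieta i)) gderiv_xi_xieta eq_sym (negPf ij) scale0r mul0r add0r.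
  by rewrite (proj2 (geven_xieta i)) gderiv_eta_xieta eq_sym (negPf ij) oppr0 scale0r mul0r add0r.
elim=> [|i s IH] /=; first by rewrite big_nil.
move=> /andP[/fM E /IH fs]; rewrite big_cons E fs mulr1 gderiv_xi_xieta eqxx scale1r.
by rewrite gderiv_generator eqxx scale1r.
Qed.

(** The rest of [G] has order at least 1 and the product has order twice [#|Lambda|], together more
    than the number of generators. *)
Lemma gtop_xieta_body G : gtop (G * \prod_(i <- enum Lambda) xieta i) = body G.
Proof.
set p := \prod_(i <- _) _.
rewrite -[G in LHS](subrK (body G)%:A) mulrDl gtopD -scalerAl mul1r gtopZ gtop_xieta mulr1.
rewrite [_ * p](@gorder_eq0 _ _ (1 + 2 * #|Lambda|)) ?gtop0 ?add0r //.
  by rewrite card_sum; lia.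
apply: gorderM; first by apply: gorder1; rewrite bodyD bodyN bodyA subrr.
rewrite cardE /p; elim: (enum Lambda) => [|i s IH]; first by rewrite big_nil muln0 => A.
rewrite big_cons mulnS; apply: gorderM => // A A2.
rewrite generatorMl; case: ifP => // iA; rewrite /geta /generator ffunE.
case: eqP => [E|_]; rewrite ?mulr0 //; move: A2.
by rewrite (cardsD1 (inl i)) iA E cards1.
Qed.

End BerezinIntegral.

From HB Require Import structures.
From mathcomp Require Import all_classical all_reals all_analysis.
From mathcomp Require Import measurable_realfun.
Import numFieldNormedType.Exports.
Local Open Scope classical_set_scope.
Local Open Scope ring_scope.

(** * Real analysis *)

Section DerivativeRules.
Variable R : realType.
Implicit Types (f g : R -> R) (x df dg : R).

Lemma der_cst (c : R) x : is_derive x 1 (fun=> c) 0.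
Proof. exact: is_derive_cst. Qed.

Lemma der_id x : is_derive x 1 (fun s : R => s) 1.
Proof. exact: is_derive_id. Qed.

Lemma derD f g x df dg : is_derive x 1 f df -> is_derive x 1 g dg ->
  is_derive x 1 (fun s => f s + g s) (df + dg).
Proof. by move=> Df Dg; exact: (is_deriveD Df Dg). Qed.

Lemma der_addl (c : R) x : is_derive x 1 (fun s => c + s) 1.
Proof. by have := derD (der_cst c x) (der_id x); rewrite add0r. Qed.

Lemma der_addr (c : R) x : is_derive x 1 (fun s => s + c) 1.
Proof. by have := derD (der_id x) (der_cst c x); rewrite addr0. Qed.

Lemma derN f x df : is_derive x 1 f df -> is_derive x 1 (fun s => - f s) (- df).
Proof. by move=> Df; exact: (is_deriveN Df). Qed.

Lemma derB f g x df dg : is_derive x 1 f df -> is_derive x 1 g dg ->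
  is_derive x 1 (fun s => f s - g s) (df - dg).
Proof. by move=> Df Dg; exact: (is_deriveB Df Dg). Qed.

Lemma derM f g x df dg : is_derive x 1 f df -> is_derive x 1 g dg ->
  is_derive x 1 (fun s => f s * g s) (df * g x + f x * dg).
Proof.
by move=> Df Dg; have := is_deriveM Df Dg; rewrite addrC [g x *: df]mulrC; exact.
Qed.

Lemma derZ (c : R) f x df : is_derive x 1 f df -> is_derive x 1 (fun s => c * f s) (c * df).
Proof. by move=> Df; have := derM (der_cst c x) Df; rewrite mul0r add0r. Qed.

Lemma der_sum (J : Type) (r : seq J) (f : J -> R -> R) x (df : J -> R) :
  (forall j, is_derive x 1 (f j) (df j)) ->
  is_derive x 1 (fun s => \sum_(j <- r) f j s) (\sum_(j <- r) df j).
Proof.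
move=> Df; elim: r => [|j r IH].
  by under eq_fun do rewrite big_nil; rewrite big_nil; exact: der_cst.
by under eq_fun do rewrite big_cons; rewrite big_cons; exact: derD.
Qed.

Lemma der_comp f g x df dg : is_derive (g x) 1 f df -> is_derive x 1 g dg ->
  is_derive x 1 (fun s => f (g s)) (df * dg).
Proof. by move=> Df Dg; exact: is_derive1_comp. Qed.

Lemma der_expR f x df : is_derive x 1 f df ->
  is_derive x 1 (fun s => expR (f s)) (df * expR (f x)).
Proof. by move=> Df; rewrite mulrC; apply: der_comp => //; exact: is_derive_expR. Qed.

Lemma der_eq f x df dg : is_derive x 1 f df -> df = dg -> is_derive x 1 f dg.
Proof. by move=> ? <-. Qed.

Lemma der_near f g x df : (\near x, f x = g x) -> is_derive x 1 f df -> is_derive x 1 g df.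
Proof. exact: near_eq_is_derive. Qed.

Lemma der_derive1 f x df : derivable f x 1 -> derive1 f x = df -> is_derive x 1 f df.
Proof. by move=> Df <-; rewrite derive1E; exact/derivableP. Qed.

Lemma der_continuous f x df : is_derive x 1 f df -> {for x, continuous f}.
Proof. by case=> Df _; exact/differentiable_continuous/derivable1_diffP. Qed.

End DerivativeRules.

(** * Continuity and measurability of functions on R^I *)

Section PointwiseTopology.
Variables (R : realType) (I : finType).
Implicit Types (phi : (I -> R) -> R) (l : I -> R).

Definition pcontinuous phi := continuous (phi : {ptws I -> R} -> R).

Lemma cvg_ptws (Z : Type) (F : set_system Z) (u : Z -> I -> R) l : Filter F ->
  (forall i, u z i @[z --> F] --> l i) -> u z @[z --> F] --> (l : {ptws I -> R}).
Proof.
move=> FF ul; apply/cvg_sup => i; rewrite cvg_image; last first.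
  by rewrite eqEsubset; split=> v // _; exists (cst v).
move=> W /ul; rewrite /= /nbhs /= => Wu; exists (@^~ i @^-1` W) => //.
by rewrite eqEsubset; split => [j [? + <-//]|j Wj]; exists (fun _ => j).
Qed.

Lemma pcontinuous_cvg phi (Z : Type) (F : set_system Z) (u : Z -> I -> R) l :
  Filter F -> pcontinuous phi ->
  (forall i, u z i @[z --> F] --> l i) -> phi (u z) @[z --> F] --> phi l.
Proof.
by move=> FF cphi ul; apply: (cvg_comp u phi (cvg_ptws FF ul)); exact: cphi.
Qed.

Lemma cvg_coord l i : (fun l' : {ptws I -> R} => l' i) @ (l : {ptws I -> R}) --> l i.
Proof. exact: (@proj_continuous I (fun=> R) i l). Qed.

Lemma pcontinuous_bounded phi (a b : R) : pcontinuous phi ->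
  (forall l, ~ (forall i, a <= l i <= b) -> phi l = 0) ->
  exists C, 0 <= C /\ forall l, `|phi l| <= C.
Proof.
move=> cphi phi0; set K : set {ptws I -> R} := [set l | forall i, `[a, b]%classic (l i)].
have cK : compact K.
  by apply: (@tychonoff I (fun=> R) (fun=> `[a, b]%classic)) => i; exact: segment_compact.
have : compact (phi @` K).
  apply: (@continuous_compact {ptws I -> R} R phi K) => //.
  exact: (@continuous_subspaceT {ptws I -> R} R K phi).
move=> /compact_bounded[C0 [_ /(_ (C0 + 1))]]; rewrite ltrDl => /(_ ltr01) HC.
set C := C0 + 1 in HC; exists (Num.max C 0).
split=> [|l]; first by rewrite le_max lexx orbT.
have [Kl|nKl] := pselect (K l); first by rewrite le_max HC //; exists l.
rewrite phi0 ?normr0 ?le_max ?lexx ?orbT // => H; apply: nKl => i /=.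
Qed.

(** Rounding the coordinates down to multiples of 1 / (m + 1) gives maps with countably many values,
    for which measurability needs nothing of [phi]. Continuity is used only for the limit. *)
Lemma measurable_pcontinuous d (T : measurableType d) phi (Y : T -> I -> R) :
  pcontinuous phi -> (forall i, measurable_fun setT (fun w => Y w i)) ->
  measurable_fun setT (fun w => phi (Y w)).
Proof.
move=> cphi mY.
pose D m w i : R := (Num.floor (m.+1%:R * Y w i))%:~R / m.+1%:R.
apply: (@measurable_fun_cvg _ _ _ _ (fun m w => phi (D m w))); last first.
  move=> w _; apply: pcontinuous_cvg => // i.
  have nN : n.+1%:R^-1 @[n --> \oo] --> (0 : R) by exact: cvg_harmonic.
  have E m : D m w i = Y w i - (m.+1%:R * Y w i - (Num.floor (m.+1%:R * Y w i))%:~R) / m.+1%:R.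
    by rewrite /D mulrBl [_.+1%:R * _]mulrC mulfK ?pnatr_eq0 // subKr.
  have H : (fun m => (m.+1%:R * Y w i - (Num.floor (m.+1%:R * Y w i))%:~R) / m.+1%:R)
      @ \oo --> (0 : R).
    apply: (squeeze_cvgr _ (cvg_cst 0) nN); near=> m.
    have := floor_itv (m.+1%:R * Y w i); rewrite intrD => /andP[f1 f2].
    rewrite divr_ge0 ?subr_ge0 //= ler_pdivrMr // mulVf ?pnatr_eq0 //.
    by rewrite lerBlDr addrC ltW.
  have {}H : (fun m => Y w i - (m.+1%:R * Y w i - (Num.floor (m.+1%:R * Y w i))%:~R) / m.+1%:R)
    @ \oo --> Y w i - 0 by apply: (@cvgB _ R); [exact: cvg_cst|exact: H].
  by rewrite subr0 in H; rewrite (funext E).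
move=> m _ B mB; rewrite setTI.
pose q (c : {ffun I -> int}) : I -> R := fun i => (c i)%:~R / m.+1%:R.
rewrite (_ : _ @^-1` B = \bigcup_(c in [set c | B (phi (q c))])
  \bigcap_(i in [set: I]) [set w | Num.floor (m.+1%:R * Y w i) = c i]); last first.
  apply/seteqP; split=> [w Bw|w [c Bc cw]] /=.
    exists [ffun i => Num.floor (m.+1%:R * Y w i)] => [|i _] /=; last by rewrite ffunE.
    by congr (B (phi _)): Bw; apply/funext => i; rewrite /q ffunE.
  by congr (B (phi _)): Bc; apply/funext => i; rewrite /q /D -(cw i).
rewrite bigcup_mkcond; apply: countable_bigcupT_measurable => [|c]; first exact: countableP.
case: ifP => // _; apply: fin_bigcap_measurable => // i _.
rewrite (_ : [set w | _] = (fun w => m.+1%:R * Y w i) @^-1` `[(c i)%:~R, (c i + 1)%:~R[).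
  by rewrite -[X in measurable X]setTI; apply: measurable_funM => //; exact: mY.
by apply/seteqP; split=> w /=; rewrite in_itv /= -floor_eq => /eqP.
Unshelve. all: by end_near. Qed.

End PointwiseTopology.

Lemma Rintegral_eq0 d (T : measurableType d) (R : realType) (m : {measure set T -> \bar R})
    (D : set T) (f : T -> R) : (forall x, D x -> f x = 0) -> \int[m]_(x in D) f x = 0.
Proof. by move=> f0; rewrite /Rintegral integral0_eq // => x /f0 ->. Qed.

Section RealIntegrable.
Context d (T : measurableType d) (R : realType) (m : {measure set T -> \bar R}).
Variables (D : set T) (mD : measurable D).
Implicit Types f g : T -> R.
Local Notation rintegrable f := (m.-integrable D (EFin \o f)).

Lemma rintegrableD f g : rintegrable f -> rintegrable g -> rintegrable (fun x => f x + g x).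
Proof. by move=> fi gi; exact: (integrableD mD fi gi). Qed.

Lemma rintegrableB f g : rintegrable f -> rintegrable g -> rintegrable (fun x => f x - g x).
Proof. by move=> fi gi; exact: (integrableB mD fi gi). Qed.

Lemma rintegrableZ (c : R) f : rintegrable f -> rintegrable (fun x => c * f x).
Proof. by move=> fi; exact: (integrableZl mD c fi). Qed.

Lemma rintegrable_abs f : rintegrable f -> rintegrable (fun x => `|f x|).
Proof. by move=> fi; exact: (integrable_abse fi). Qed.

Lemma rintegrable_sum (J : Type) (r : seq J) (f : J -> T -> R) :
  (forall j, rintegrable (f j)) -> rintegrable (fun x => \sum_(j <- r) f j x).
Proof.
move=> fi; elim: r => [|j r IH].
  by under [X in _.-integrable _ (_ \o X)]eq_fun do rewrite big_nil; exact: integrable0.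
by under [X in _.-integrable _ (_ \o X)]eq_fun do rewrite big_cons; exact: rintegrableD.
Qed.

Lemma Rintegral_sum (J : Type) (r : seq J) (f : J -> T -> R) :
  (forall j, rintegrable (f j)) ->
  \int[m]_(x in D) (\sum_(j <- r) f j x) = \sum_(j <- r) \int[m]_(x in D) f j x.
Proof.
move=> fi; elim: r => [|j r IH].
  by rewrite big_nil; under eq_Rintegral do rewrite big_nil; exact: Rintegral_eq0.
rewrite big_cons -IH -RintegralD //; last exact: rintegrable_sum.
by apply: eq_Rintegral => x _; rewrite big_cons.
Qed.

End RealIntegrable.

(** * Fubini's theorem under a bound of product form *)

Section DominatedFubini.
Context d1 d2 (T1 : measurableType d1) (T2 : measurableType d2) (R : realType).
Variables (m1 : {sigma_finite_measure set T1 -> \bar R}).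
Variables (m2 : {sigma_finite_measure set T2 -> \bar R}).

Lemma dominated_integrable d (T : measurableType d) (m : {measure set T -> \bar R})
    (D : set T) (F g : T -> R) : measurable D ->
  measurable_fun D F -> (forall x, D x -> `|F x| <= g x) ->
  m.-integrable D (EFin \o g) -> m.-integrable D (EFin \o F).
Proof.
move=> mD mF Fg; apply: le_integrable => //; first exact/measurable_EFinP.
by move=> x Dx /=; rewrite lee_fin (le_trans (Fg x Dx)) // ler_norm.
Qed.

Lemma integrable_prodM (u : T1 -> R) (v : T2 -> R) :
  m1.-integrable setT (EFin \o u) -> m2.-integrable setT (EFin \o v) ->
  (m1 \x m2)%E.-integrable setT (fun p => (u p.1 * v p.2)%:E).
Proof.
move=> iu iv; apply/integrable12ltyP.
  apply/measurable_EFinP/measurable_funM.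
    by apply: measurableT_comp => //; apply/measurable_EFinP; exact: measurable_int iu.
  by apply: measurableT_comp => //; apply/measurable_EFinP; exact: measurable_int iv.
have [/measurable_EFinP mu uoo] := integrableP _ _ _ iu.
have [/measurable_EFinP mv voo] := integrableP _ _ _ iv.
have mu' : measurable_fun setT (fun x => `|u x|) by exact: measurableT_comp.
have mv' : measurable_fun setT (fun x => `|v x|) by exact: measurableT_comp.
set V := (\int[m2]_y `|v y|%:E)%E.
rewrite (eq_integral (fun x => (`|u x|%:E * V)%E)) => [|x _].
  rewrite ge0_integralZr //; last exact: integral_ge0.
    by rewrite lte_mul_pinfty ?integral_ge0 // fin_numElt (lt_le_trans _ (integral_ge0 _ _)).
  exact/measurable_EFinP.
rewrite -ge0_integralZl_EFin //; last exact/measurable_EFinP.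
by apply: eq_integral => y _; rewrite /= normrM EFinM.
Qed.

(** The bound by a product makes every section integrable, not just almost every one, so the
    iterated real-valued integrals are meaningful pointwise. *)
Lemma dominated_fubini (F : T1 * T2 -> R) (u : T1 -> R) (v : T2 -> R) :
  measurable_fun setT F -> (forall p, `|F p| <= u p.1 * v p.2) ->
  m1.-integrable setT (EFin \o u) -> m2.-integrable setT (EFin \o v) ->
  [/\ (m1 \x m2)%E.-integrable setT (EFin \o F),
      \int[(m1 \x m2)%E]_p F p = \int[m1]_x \int[m2]_y F (x, y) &
      \int[(m1 \x m2)%E]_p F p = \int[m2]_y \int[m1]_x F (x, y)].
Proof.
move=> mF Fuv iu iv.
have iF : (m1 \x m2)%E.-integrable setT (EFin \o F).
  by apply: (@dominated_integrable _ _ _ _ _ (fun p => u p.1 * v p.2)) => //; exact: integrable_prodM.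
have i1 x : m2.-integrable setT (EFin \o (fun y => F (x, y))).
  apply: (@dominated_integrable _ _ _ _ _ (fun y => u x * v y)) => //.
    exact: measurableT_comp mF (pair1_measurable x).
  exact: (@integrableZl _ _ _ m2 setT measurableT (u x) (EFin \o v) iv).
have i2 y : m1.-integrable setT (EFin \o (fun x => F (x, y))).
  apply: (@dominated_integrable _ _ _ _ _ (fun x => u x * v y)) => //.
    exact: measurableT_comp mF (pair2_measurable y).
  exact: (@integrableZr _ _ _ m1 setT measurableT (v y) (EFin \o u) iu).
split=> //.
- rewrite /Rintegral -integral12_prod_meas1 //; congr fine; apply: eq_integral => x _.
  by rewrite /fubini_F fineK //; apply: integrable_fin_num (i1 x).
- rewrite /Rintegral -integral21_prod_meas1 //; congr fine; apply: eq_integral => x _.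
  by rewrite /fubini_G fineK //; apply: integrable_fin_num (i2 x).
Qed.

End DominatedFubini.

(** * Integration over R^n by induction on n *)

Section LebesgueTupleIntegral.
Variable R : realType.
Local Notation mu := (@lebesgue_measure R).
Local Notation leb := (@lebesgue_tuple R).
Local Notation MR := (measurableTypeR R).

Lemma lebesgue_tuple0 (F : 0.-tuple MR -> R) : measurable_fun setT F ->
  (leb 0).-integrable setT (EFin \o F) /\ \int[leb 0]_t F t = F [tuple].
Proof.
move=> mF; split.
  apply/integrableP; split; first exact/measurable_EFinP.
  rewrite integral_dirac //; last by do 2 apply: measurableT_comp => //.
  by rewrite diracT mul1e ltry.
rewrite /Rintegral integral_dirac //; last exact/measurable_EFinP.
by rewrite diracT mul1e.
Qed.

Lemma lebesgue_tupleS n (F : n.+1.-tuple MR -> R) (u : R -> R) (v : n.-tuple MR -> R) :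
  measurable_fun setT F ->
  (forall s t, `|F (tuple_cons (s, t))| <= u s * v t) ->
  mu.-integrable setT (EFin \o u) -> (leb n).-integrable setT (EFin \o v) ->
  [/\ (leb n.+1).-integrable setT (EFin \o F),
      \int[leb n.+1]_t F t = \int[mu]_s \int[leb n]_t F (tuple_cons (s, t)) &
      \int[leb n.+1]_t F t = \int[leb n]_t \int[mu]_s F (tuple_cons (s, t))].
Proof.
move=> mF Fuv iu iv.
have mF' : measurable_fun setT (F \o @tuple_cons R n).
  exact: measurableT_comp mF (@measurable_tuple_cons R n).
have := @dominated_fubini _ _ MR (n.-tuple MR) R mu (leb n) (F \o @tuple_cons R n) u v mF'.
move=> /(_ (fun p => let: (s, t) := p in Fuv s t)).
move=> /(_ iu iv)[iF F1 F2].
have mt := @measurable_tuple_cons R n.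
have mE : measurable_fun setT (EFin \o F) by exact/measurable_EFinP.
have iF' : (mu \x leb n)%E.-integrable (@tuple_cons R n @^-1` setT) (EFin \o F \o @tuple_cons R n).
  exact: iF.
have E : \int[leb n.+1]_t F t = \int[(mu \x leb n)%E]_p F (tuple_cons p).
  by congr fine; exact: (integral_pushforward mt mE iF' measurableT).
split; [exact: (integrable_pushforward mt mE iF' measurableT)|by rewrite E F1|by rewrite E F2].
Qed.

Lemma integrable_prod_tuple n (h : R -> R) : mu.-integrable setT (EFin \o h) ->
  (leb n).-integrable setT (EFin \o (fun t => \prod_(k < n) h (tnth t k))) /\
  \int[leb n]_t (\prod_(k < n) h (tnth t k)) = (\int[mu]_s h s) ^+ n.
Proof.
move=> ih; have [/measurable_EFinP mh _] := integrableP _ _ _ ih.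
have mP m : measurable_fun setT (fun t : m.-tuple MR => \prod_(k < m) h (tnth t k)).
  by apply: measurable_prod => k _; apply: measurableT_comp => //; exact: measurable_tnth.
have ih' : mu.-integrable setT (EFin \o (fun s => `|h s|)) by exact: integrable_abse ih.
elim: n => [|n [IH1 IH2]].
  have [] := lebesgue_tuple0 (mP 0%N).
  by move=> i ->; split => //; rewrite big_ord0.
have iv : (leb n).-integrable setT (EFin \o (fun t => `|\prod_(k < n) h (tnth t k)|)).
  exact: integrable_abse IH1.
have E s (t : n.-tuple MR) : \prod_(k < n.+1) h (tnth (tuple_cons (s, t)) k) =
    h s * \prod_(k < n) h (tnth t k).
  by rewrite big_ord_recl tnth0; congr (_ * _); apply: eq_bigr => k _; rewrite tnthS.
have Eb s (t : n.-tuple MR) : `|\prod_(k < n.+1) h (tnth (tuple_cons (s, t)) k)| <=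
    `|h s| * `|\prod_(k < n) h (tnth t k)| by rewrite E normrM.
have [iF -> _] := lebesgue_tupleS (mP n.+1) Eb ih' iv.
split=> //; under eq_Rintegral => s _ do under eq_Rintegral => t _ do rewrite E.
under eq_Rintegral => s _ do rewrite RintegralZl // IH2.
by rewrite RintegralZr // -exprS.
Qed.

(** A fixed integrable profile of product form. Bounds by a multiple of [weight] play the role of
    compact support when Fubini is applied. *)
Definition weight1 (s : R) : R := (1 + s ^+ 2)^-1.
Definition weight n (t : n.-tuple MR) : R := \prod_(k < n) weight1 (tnth t k).

Lemma weight1_gt0 s : 0 < weight1 s.
Proof. by rewrite invr_gt0 ltr_pwDl // sqr_ge0. Qed.

Lemma weight1_le1 s : weight1 s <= 1.
Proof. by rewrite invf_le1 ?lerDl ?ltr_pwDl ?sqr_ge0. Qed.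

Lemma integrable_weight1 : mu.-integrable setT (EFin \o weight1).
Proof.
have cw : continuous weight1 by exact: (@continuous_oneDsqrV R).
apply/integrableP; split.
  by apply/measurable_EFinP; exact: continuous_measurable_fun.
under eq_integral => s _ do rewrite /= ger0_norm ?(ltW (weight1_gt0 _)) //.
rewrite ge0_symfun_integralT //.
- by rewrite -set_itvcy (integral0y_oneDsqr R) -EFinM ltry.
- by move=> s; exact/ltW/weight1_gt0.
- by move=> s; rewrite /= /weight1 sqrrN.
Qed.

Lemma weight_gt0 n t : 0 < @weight n t.
Proof. by apply: prodr_gt0 => k _; exact: weight1_gt0. Qed.

Lemma integrable_weight n : (leb n).-integrable setT (EFin \o @weight n).
Proof. by case: (integrable_prod_tuple n integrable_weight1). Qed.

Lemma Rintegral_derive (f f' : R -> R) (a b : R) : a <= b -> continuous f' ->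
  (forall s : R, a <= s <= b -> is_derive s 1 f (f' s)) ->
  \int[mu]_(s in `[a, b]) f' s = f b - f a.
Proof.
rewrite le_eqVlt => /predU1P[<-|ab] cf' df; first by rewrite set_itv1 Rintegral_set1 subrr.
have cf s : a <= s <= b -> {for s, continuous f}.
  by move=> /df[? _]; exact/differentiable_continuous/derivable1_diffP.
rewrite /Rintegral (@continuous_FTC2 _ _ f) //.
- exact: continuous_subspaceT.
- split=> [s||].
  + by rewrite in_itv /= => /andP[/ltW as_ /ltW sb]; case: (df s); rewrite ?as_.
  + by apply/cvg_at_right_filter/cf; rewrite lexx ltW.
  + by apply/cvg_at_left_filter/cf; rewrite lexx ltW.
- move=> s; rewrite in_itv /= => /andP[/ltW as_ /ltW sb].
  have ds : is_derive s 1 f (f' s) by apply: df; rewrite as_.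
  by rewrite derive1E; exact: derive_val.
Qed.

Lemma integral_derive_compact (f f' : R -> R) (b : R) : continuous f' ->
  (forall s : R, is_derive s 1 f (f' s)) -> (forall s, b <= `|s| -> f s = 0) ->
  \int[mu]_s f' s = 0.
Proof.
move=> cf' df fb; set B := `|b| + 1; have B0 : 0 < B by rewrite ltr_pwDr.
(* The margin 1 in [B] puts a neighbourhood of [s] in the zero set of [f]. *)
have f'0 s : B < `|s| -> f' s = 0.
  move=> Bs; have d0 : is_derive s 1 f 0.
    apply: (near_eq_is_derive _ (is_derive_cst (0 : R) s 1)).
    near=> r; apply/esym/fb; apply: le_trans (ler_norm b) _; idtac.
    have : `|s - r| < 1 by near: r; apply: cvgr_dist_lt => //; exact: cvg_id.
    have := ler_distD r s 0; rewrite !subr0; rewrite /B in Bs; lra.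
  by rewrite -(@derive_val _ _ _ _ _ _ _ (df s)) (@derive_val _ _ _ _ _ _ _ d0).
have -> : \int[mu]_s f' s = \int[mu]_(s in `[- B, B]) f' s.
  rewrite [RHS]Rintegral_mkcond; apply: eq_Rintegral => s _.
  rewrite patchE; case: ifPn => //; rewrite notin_setE /= in_itv /= => /negP nB.
  by apply: f'0; rewrite ltNge; apply: contra nB; rewrite ler_norml.
have bB : b <= B by rewrite (le_trans (ler_norm b)) // lerDl.
rewrite (@Rintegral_derive f) ?ge0_cp ?(ltW B0) // fb ?fb ?subrr ?normrN ?(ger0_norm (ltW B0)) //.
Unshelve. all: by end_near. Qed.

Definition upd (I : eqType) (x : I -> R) (k : I) (s : R) : I -> R := [eta x with k |-> s].

(** Induction on the dimension: if [k] is not the first coordinate, that one is fixed and the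
    induction hypothesis applies to the tail; otherwise the first coordinate is integrated
    innermost. *)
Lemma integral_derive_tuple n (k : 'I_n) (F F' : ('I_n -> R) -> R) (b C : R) :
  measurable_fun setT (fun t : n.-tuple MR => F' (tnth t)) ->
  (forall t : n.-tuple MR, `|F' (tnth t)| <= C * weight t) ->
  (forall x (s : R), is_derive s 1 (fun s => F (upd x k s)) (F' (upd x k s))) ->
  (forall x, continuous (fun s => F' (upd x k s))) ->
  (forall x s, b <= `|s| -> F (upd x k s) = 0) ->
  \int[leb n]_t F' (tnth t) = 0.
Proof.
elim: n k F F' b C => [[]//|n IH] k F F' b C mF' F'C dF cF' Fb.
pose cons (s : R) (x : 'I_n -> R) : 'I_n.+1 -> R :=
  fun i => if unlift ord0 i is Some j then x j else s.
have consE s (t : n.-tuple MR) : tnth (tuple_cons (s, t)) = cons s (tnth t) :> ('I_n.+1 -> R).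
  apply/funext => i; rewrite /cons; case: unliftP => [j|] ->; first by rewrite tnthS.
  by rewrite tnth0.
have W s (t : n.-tuple MR) : weight (tuple_cons (s, t)) = weight1 s * weight t.
  by rewrite /weight big_ord_recl tnth0; congr (_ * _); apply: eq_bigr => j _; rewrite tnthS.
have iW : mu.-integrable setT (EFin \o (fun s => C * weight1 s)).
  exact: (@integrableZl _ _ _ mu setT measurableT C (EFin \o weight1) integrable_weight1).
have F'b s (t : n.-tuple MR) : `|F' (tnth (tuple_cons (s, t)))| <= C * weight1 s * weight t.
  by rewrite -mulrA -W.
have [_ F1 F2] := @lebesgue_tupleS n _ (fun s => C * weight1 s) (@weight n) mF' F'b iW
  (integrable_weight n).
case: (unliftP ord0 k) => [j kj|k0].
  rewrite F1; apply: Rintegral_eq0 => s _.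
  under eq_Rintegral => t _ do rewrite consE.
  have E x r : cons s (upd x j r) = upd (cons s x) k r.
    apply/funext => i; rewrite /cons /upd /=; case: unliftP => [i'|] ->.
      by rewrite kj (inj_eq lift_inj).
    by rewrite kj.
  apply: (IH j (fun x => F (cons s x)) (fun x => F' (cons s x)) b (C * weight1 s)).
  - under eq_fun => t do rewrite -consE.
    apply: measurableT_comp mF' _.
    exact: measurableT_comp (@measurable_tuple_cons R n) (pair1_measurable s).
  - by move=> t; rewrite -consE -mulrA -W.
  - by move=> x r; under eq_fun do rewrite E; rewrite E; exact: dF.
  - by move=> x; under eq_fun do rewrite E; exact: cF'.
  - by move=> x r rb; rewrite E Fb.
rewrite F2; apply: Rintegral_eq0 => t _.
have E s : tnth (tuple_cons (s, t)) = upd (cons 0 (tnth t)) k s.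
  rewrite consE; apply/funext => i; rewrite /cons /upd /= k0.
  by case: unliftP => [i'|] ->; rewrite ?eqxx // eq_sym (negPf (neq_lift _ _)).
under eq_Rintegral do rewrite E.
by apply: (@integral_derive_compact (fun s => F (upd (cons 0 (tnth t)) k s)) _ b) => // s sb; exact: Fb.
Qed.

End LebesgueTupleIntegral.

(** * Lipschitz test functions and integration along coordinate rays *)

Section LipschitzClass.
Variables (R : realType) (I : finType).
Local Notation mu := (@lebesgue_measure R).
Implicit Types (h : (I -> R) -> R) (z : I -> R) (T M : R).

Definition ldist z z' : R := \sum_i `|z i - z' i|.

(* Continuous functions on R^I that vanish where sum z >= T and are Lipschitz on
   every translate of the positive orthant: a class that is preserved by
   multiplication by coordinates and by integration along coordinate rays. *)
Definition lipc T h := (forall z, T <= \sum_i z i -> h z = 0) /\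
  forall M, 0 <= M -> exists2 C, 0 <= C & forall z z',
    (forall i, - M <= z i) -> (forall i, - M <= z' i) -> `|h z - h z'| <= C * ldist z z'.

Lemma ldist_ge0 z z' : 0 <= ldist z z'. Proof. exact: sumr_ge0. Qed.

Lemma ldistC z z' : ldist z z' = ldist z' z.
Proof. by apply: eq_bigr => i _; rewrite distrC. Qed.

Lemma sum_upd z j s : \sum_i upd z j s i = \sum_i z i + (s - z j).
Proof.
rewrite (bigD1 j) //= [in RHS](bigD1 j) //= /upd /= eqxx.
rewrite [X in _ + X = _](eq_bigr z) => [|i /negPf->] //; ring.
Qed.

Lemma ldist_upd z j s s' : ldist (upd z j s) (upd z j s') = `|s - s'|.
Proof.
rewrite /ldist (bigD1 j) //= big1 => [|i /negPf ij]; rewrite /upd /= ?eqxx ?addr0 //.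
by rewrite ij subrr normr0.
Qed.

Definition shift z j s := upd z j (z j + s).

Lemma ldist_shift z z' j s : ldist (shift z j s) (shift z' j s) = ldist z z'.
Proof.
apply: eq_bigr => i _; rewrite /shift /upd /=; case: eqP => // ->.
by rewrite opprD addrACA subrr addr0.
Qed.

Lemma shift0 z j : shift z j 0 = z.
Proof. by apply/funext => i; rewrite /shift /upd /= addr0; case: eqP => // ->. Qed.

Lemma ldist_shiftr z j s : ldist z (shift z j s) = `|s|.
Proof.
rewrite -{1}(shift0 z j) /shift ldist_upd addr0 opprD addrA subrr sub0r normrN //.
Qed.

Lemma shiftD z j s r : shift (shift z j s) j r = shift z j (s + r).
Proof. by apply/funext => i; rewrite /shift /upd /= eqxx; case: eqP => //; rewrite addrA. Qed.

Lemma sum_shift z j s : \sum_i shift z j s i = \sum_i z i + s.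
Proof. by rewrite sum_upd addrAC subrr add0r. Qed.

Lemma shift_ge M z j s : 0 <= s -> (forall i, M <= z i) -> forall i, M <= shift z j s i.
Proof. by move=> s0 zM i; rewrite /shift /upd /=; case: eqP => // _; rewrite ler_wpDr. Qed.

Lemma cvg_sumr (Z J : Type) (F : set_system Z) (r : seq J) (P : pred J)
    (f : J -> Z -> R) (l : J -> R) : Filter F ->
  (forall j, P j -> f j x @[x --> F] --> l j) ->
  \sum_(j <- r | P j) f j x @[x --> F] --> \sum_(j <- r | P j) l j.
Proof. by move=> FF fl; apply: (@cvg_big R J +%R 0 P _ Z F r f l) => // x; apply: cvgD; [exact: cvg_fst|exact: cvg_snd]. Qed.

Lemma cvg_ldist (Z : Type) (F : set_system Z) (u : Z -> I -> R) z : Filter F ->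
  (forall i, u x i @[x --> F] --> z i) -> ldist z (u x) @[x --> F] --> (0 : R).
Proof.
move=> FF uz; have : (fun x => ldist z (u x)) @ F --> \sum_i `|z i - z i|.
  apply: cvg_sumr => i _; apply: cvg_norm; apply: cvgB; first exact: cvg_cst.
  exact: uz.
by rewrite big1 // => i _; rewrite subrr normr0.
Qed.

Lemma lipc_cvg T h (Z : Type) (F : set_system Z) (u : Z -> I -> R) z : Filter F ->
  lipc T h -> (forall i, u x i @[x --> F] --> z i) -> h (u x) @[x --> F] --> h z.
Proof.
move=> FF [_ hL] uz; pose M := \sum_i `|z i| + 1.
have M0 : 0 <= M by rewrite addr_ge0 // sumr_ge0.
have zM i : - (\sum_i `|z i|) <= z i.
  by rewrite lerNl (le_trans (ler_norm _)) // normrN (bigD1 i) //= lerDl sumr_ge0.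
have [C C0 HC] := hL M M0.
apply/cvgrPdist_le => e e0; near=> x.
apply: (@le_trans _ _ (C * ldist z (u x))).
  apply: HC => i; first by have := zM i; rewrite /M; lra.
  suff : `|z i - u x i| < 1 by have := zM i; rewrite ltr_distlC /M => ? /andP[? ?]; lra.
  move: i; near: x; apply: filter_forall => i.
  by move/cvgrPdist_lt: (uz i) => /(_ 1 ltr01).
apply: (@le_trans _ _ ((C + 1) * ldist z (u x))); first by rewrite ler_wpM2r ?ldist_ge0 // lerDl.
rewrite -ler_pdivlMl ?ltr_pwDr // mulrC.
have : `|0 - ldist z (u x)| <= e / (C + 1).
  near: x; move/cvgrPdist_le: (cvg_ldist FF uz); apply.
  by rewrite divr_gt0 // ltr_pwDr.
by rewrite sub0r normrN ger0_norm ?ldist_ge0.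
Unshelve. all: by end_near. Qed.

Lemma lipc_pcontinuous T h : lipc T h -> pcontinuous h.
Proof.
move=> lh z; apply: (@lipc_cvg T h {ptws I -> R} (nbhs (z : {ptws I -> R})) id z) => // i.
exact: cvg_coord.
Qed.

Lemma sum_ge M z : (forall i, - M <= z i) -> - (#|I|%:R * M) <= \sum_i z i.
Proof.
by move=> zM; rewrite -mulrN mulr_natl -sumr_const; apply: ler_sum => i _.
Qed.

(** A shift along [j] of a length independent of z reaches the region where [h] vanishes; the
    Lipschitz bound compares the two ends. *)
Lemma lipc_bounded (j : I) T h M : lipc T h -> 0 <= M -> exists2 C, 0 <= C &
  forall z, (forall i, - M <= z i) -> `|h z| <= C.
Proof.
move=> [h0 hL] M0; have [C C0 HC] := hL M M0.
have B0 : 0 <= `|T| + #|I|%:R * M by rewrite addr_ge0 // mulr_ge0.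
exists (C * (`|T| + #|I|%:R * M)) => [|z zM]; first by rewrite mulr_ge0.
have := HC z (shift z j (`|T| + #|I|%:R * M)) zM (shift_ge j B0 zM).
rewrite [h (shift _ _ _)]h0; last first.
  by rewrite sum_shift; have := sum_ge zM; have := ler_norm T; lra.
by rewrite subr0 ldist_shiftr (ger0_norm B0).
Qed.

Lemma lipc0 T : lipc T (fun=> 0).
Proof. by split=> // M _; exists 0 => // z z' _ _; rewrite subrr normr0 mul0r. Qed.

Lemma lipcD T h g : lipc T h -> lipc T g -> lipc T (fun z => h z + g z).
Proof.
move=> [h0 hL] [g0 gL]; split=> [z Tz|M M0]; first by rewrite h0 // g0 // addr0.
have [C C0 HC] := hL M M0; have [D D0 HD] := gL M M0.
exists (C + D) => [|z z' zM z'M]; first exact: addr_ge0.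
rewrite opprD addrACA (le_trans (ler_normD _ _)) // mulrDl lerD //; [exact: HC|exact: HD].
Qed.

Lemma lipcZ T h c : lipc T h -> lipc T (fun z => c * h z).
Proof.
move=> [h0 hL]; split=> [z Tz|M M0]; first by rewrite h0 // mulr0.
have [C C0 HC] := hL M M0.
exists (`|c| * C) => [|z z' zM z'M]; first exact: mulr_ge0.
by rewrite -mulrBr normrM -mulrA ler_wpM2l // HC.
Qed.

Lemma lipcB T h g : lipc T h -> lipc T g -> lipc T (fun z => h z - g z).
Proof.
move=> lh /(lipcZ (-1)) lg; rewrite (_ : (fun z => _) = (fun z => h z + -1 * g z)); first exact: lipcD.
by apply/funext => z; rewrite mulN1r.
Qed.

Lemma lipc_sum T (J : Type) (r : seq J) (h : J -> (I -> R) -> R) :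
  (forall j, lipc T (h j)) -> lipc T (fun z => \sum_(j <- r) h j z).
Proof.
move=> lh; elim: r => [|j r IH].
  by rewrite (_ : (fun z => _) = fun=> 0); [exact: lipc0|apply/funext => z; rewrite big_nil].
rewrite (_ : (fun z => _) = fun z => h j z + \sum_(j <- r) h j z); first exact: lipcD.
by apply/funext => z; rewrite big_cons.
Qed.

Lemma lipc_mul_coord (k : I) T h : lipc T h -> lipc T (fun z => z k * h z).
Proof.
move=> lh; have [h0 hL] := lh; split=> [z Tz|M M0]; first by rewrite h0 // mulr0.
have [C C0 HC] := hL M M0; have [B B0 HB] := lipc_bounded k lh M0.
set D := `|T| + #|I|%:R * M.
have D0 : 0 <= D by rewrite addr_ge0 // mulr_ge0.
(* A coordinate is bounded above because the sum is below [T] and the other coordinates are at least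
   - M. *)
have zD (z : I -> R) : (forall i, - M <= z i) -> \sum_i z i < T -> `|z k| <= D + M.
  move=> zM zT; have : \sum_(i | i != k) z i >= - (#|I|%:R * M).
    rewrite -mulrN mulr_natl; apply: (@le_trans _ _ (\sum_(i | i != k) (- M))).
      by rewrite sumr_const -[leLHS]mulr_natl -[leRHS]mulr_natl !mulrN lerN2 ler_wpM2r // ler_nat max_card.
    by apply: ler_sum.
  move: zT; rewrite (bigD1 k) //= => zT sz; have zk := zM k; have TT := ler_norm T.
  by rewrite ler_norml; apply/andP; split; rewrite /D in D0 *; lra.
have key z z' : (forall i, - M <= z i) -> (forall i, - M <= z' i) -> \sum_i z i < T ->
    `|z k * h z - z' k * h z'| <= ((D + M) * C + B) * ldist z z'.
  move=> zM z'M zT; rewrite (_ : _ - _ = z k * (h z - h z') + (z k - z' k) * h z'); last by ring.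
  rewrite (le_trans (ler_normD _ _)) // [leRHS]mulrDl lerD // normrM.
    by rewrite -mulrA ler_pM ?zD ?HC.
  rewrite mulrC ler_pM ?HB //.
  by rewrite /ldist (bigD1 k) //= lerDl sumr_ge0.
exists ((D + M) * C + B) => [|z z' zM z'M]; first by rewrite addr_ge0 // mulr_ge0 // addr_ge0.
have [zT|Tz] := ltP (\sum_i z i) T; first exact: key.
have [z'T|Tz'] := ltP (\sum_i z' i) T; first by rewrite distrC ldistC; exact: key.
rewrite !h0 // !mulr0 subrr normr0 mulr_ge0 ?ldist_ge0 //.
by rewrite addr_ge0 // mulr_ge0 // addr_ge0.
Qed.

Definition ray_integral (j : I) h : (I -> R) -> R :=
  fun z => \int[mu]_(s in `[0, +oo[) h (shift z j s).

Lemma continuous_shift T h z j : lipc T h -> continuous (fun s => h (shift z j s)).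
Proof.
move=> lh s; apply: pcontinuous_cvg; first exact: lipc_pcontinuous lh.
move=> i; rewrite /shift /upd /=; case: eqP => _; last exact: cvg_cst.
by apply: cvgD; [exact: cvg_cst|exact: cvg_id].
Qed.

Lemma ray_integralE T h j z (B : R) : lipc T h -> 0 <= B -> T <= \sum_i z i + B ->
  ray_integral j h z = \int[mu]_(s in `[0, B]) h (shift z j s).
Proof.
move=> [h0 _] B0 TB; rewrite /ray_integral Rintegral_mkcond [RHS]Rintegral_mkcond.
apply: eq_Rintegral => s _; rewrite !patchE !mem_setE !in_itv /= andbT.
case: (leP 0 s) => //= s0; case: (leP s B) => // Bs.
by rewrite h0 // sum_shift; lra.
Qed.

Lemma ray_integral_lipc T h j : lipc T h -> lipc T (ray_integral j h).
Proof.
move=> lh; have [h0 hL] := lh; split=> [z Tz|M M0].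
  rewrite (@ray_integralE T h j z 0) // ?addr0 // set_itv1 Rintegral_set1 //.
have [C C0 HC] := hL M M0; set B := `|T| + #|I|%:R * M.
have B0 : 0 <= B by rewrite addr_ge0 // mulr_ge0.
exists (B * C) => [|z z' zM z'M]; first exact: mulr_ge0.
have zB (y : I -> R) : (forall i, - M <= y i) -> T <= \sum_i y i + B.
  by move=> yM; have := sum_ge yM; have := ler_norm T; rewrite /B; lra.
rewrite !(@ray_integralE T h j _ B) ?zB //.
have ih y : mu.-integrable `[0, B] (EFin \o (fun s => h (shift y j s))).
  apply: continuous_compact_integrable; first exact: segment_compact.
  by apply: continuous_subspaceT; exact: continuous_shift lh.
rewrite -RintegralB // (le_trans (le_normr_Rintegral _ _)) //; first exact: rintegrableB.
apply: (@le_trans _ _ (\int[mu]_(s in `[0, B]) (C * ldist z z'))).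
  apply: le_Rintegral => //.
  - by apply: rintegrable_abs; exact: rintegrableB.
  - apply: continuous_compact_integrable; first exact: segment_compact.
    by apply: continuous_subspaceT => s; exact: cvg_cst.
  - move=> s; rewrite /= in_itv /= => /andP[s0 _].
    by rewrite (le_trans (HC _ _ (shift_ge j s0 zM) (shift_ge j s0 z'M))) // ldist_shift.
rewrite Rintegral_cst //= lebesgue_measure_itv /= lte_fin.
case: ltP => _; last by rewrite mulr0 mulr_ge0 // ?ldist_ge0 // mulr_ge0.
by rewrite oppr0 addr0 mulrC mulrA.
Qed.

(** Along the ray the integral is F (r + B) - F r for a primitive F, and the upper end lies where
    [h] vanishes. *)
Lemma ray_integral_derive T h j z : lipc T h ->
  is_derive (0 : R) 1 (fun r => ray_integral j h (shift z j r)) (- h z).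
Proof.
move=> lh; pose B : R := `|T| + `|\sum_i z i| + 1.
have ch := @continuous_shift T h z j lh.
(* Starting at -1 leaves room on both sides of r = 0. *)
pose F (s : R) : R := \int[mu]_(u in `[-1, s]) h (shift z j u).
have dF (s : R) : -1 < s -> is_derive s 1 F (h (shift z j s)).
  move=> s1; have s1' : s < s + 1 by rewrite ltrDl.
  have [] := @continuous_FTC1_closed R (fun u => h (shift z j u)) (-1) s _ s1' _ s1 (ch s).
    apply: continuous_compact_integrable; first exact: segment_compact.
    exact: continuous_subspaceT.
  exact: der_derive1.
have B1 : 1 <= B by rewrite lerDr addr_ge0.
have E (r : R) : `|r| < 1 -> ray_integral j h (shift z j r) = F (r + B) - F r.
  move=> /ltr_normlP[r1 r2]; rewrite (@ray_integralE T h j _ B lh) ?(le_trans _ B1) //; last first.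
    by rewrite sum_shift /B; have := ler_norm T; have := ler_norm (- \sum_i z i); rewrite normrN; lra.
  transitivity (\int[mu]_(s in `[0, B]) h (shift z j (r + s))).
    by apply: eq_Rintegral => s _; rewrite shiftD.
  rewrite -[in RHS](addr0 r) -addrA add0r.
  apply: (@Rintegral_derive R (fun s : R => F (r + s)) (fun s => h (shift z j (r + s))) 0 B).
  - by rewrite (le_trans _ B1).
  - move=> s; apply: (@continuous_comp _ _ _ (fun s => r + s) (fun s => h (shift z j s))); last exact: ch.
    by apply: cvgD; [exact: cvg_cst|exact: cvg_id].
  - move=> s /andP[s0 _]; apply: der_eq; last exact: mulr1.
    by apply: der_comp (der_addl r s); apply: dF; lra.
have hB0 : h (shift z j (0 + B)) = 0.
  apply: (proj1 lh); rewrite sum_shift /B.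
  by have := ler_norm T; have := ler_norm (- \sum_i z i); rewrite normrN; lra.
apply: (@der_near _ (fun r => F (r + B) - F r)).
  by apply/nbhs_ballP; exists 1 => //= r; rewrite /ball /= sub0r normrN => /E ->.
apply: (@der_eq _ _ _ (h (shift z j (0 + B)) - h (shift z j 0))); last first.
  by rewrite hB0 shift0 sub0r.
apply: derB; last by apply: dF; lra.
apply: der_eq (mulr1 _); apply: der_comp (der_addr B 0).
by apply: dF; lra.
Qed.

(** Integrating the exponential along the ray gains the factor 1 / lambda. This gain is what makes
    the operator of the uniqueness argument a contraction. *)
Lemma ray_integral_exp T h j lambda a z : lipc T h -> 0 < lambda ->
  (forall z, (forall i, 0 <= z i) -> `|h z| <= a * expR (- lambda * \sum_i z i)) ->
  (forall i, 0 <= z i) -> `|ray_integral j h z| <= a / lambda * expR (- lambda * \sum_i z i).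
Proof.
move=> lh l0 hb z0; set S := \sum_i z i; pose B : R := `|T| + `|S| + 1.
have B0 : 0 <= B by rewrite !addr_ge0.
have a0 : 0 <= a.
  by have := le_trans (normr_ge0 _) (hb _ z0); rewrite pmulr_lge0 // expR_gt0.
rewrite (@ray_integralE T h j z B lh) //; last first.
  by rewrite /B -/S; have := ler_norm T; have := ler_norm (- S); rewrite normrN; lra.
have ih (f : R -> R) : continuous f -> mu.-integrable `[0, B] (EFin \o f).
  move=> cf; apply: continuous_compact_integrable; first exact: segment_compact.
  exact: continuous_subspaceT.
have ch := @continuous_shift T h z j lh.
pose e (s : R) : R := expR (- lambda * (S + s)).
have de (s : R) : is_derive s 1 e (- lambda * e s).
  apply: der_expR; rewrite -[X in is_derive _ _ _ X]mulr1; apply: derZ.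
  exact: der_addl.
have ce : continuous e.
  by move=> s; exact: der_continuous (de s).
apply: (le_trans (le_normr_Rintegral _ (ih _ ch))) => //.
apply: (@le_trans _ _ (\int[mu]_(s in `[0, B]) (a * e s))).
  apply: le_Rintegral => //; [exact/rintegrable_abs/ih| |].
    by apply: ih => s; apply: cvgM; [exact: cvg_cst|exact: ce].
  move=> s /=; rewrite in_itv /= => /andP[s0 _].
  by apply: le_trans (hb _ (shift_ge j s0 z0)) _; rewrite sum_shift.
have dE (s : R) : 0 <= s <= B -> is_derive s 1 (fun s => - (a / lambda) * e s) (a * e s).
  by move=> _; apply: der_eq (derZ _ (de s)) _; field; rewrite gt_eqF.
have cE : continuous (fun s => a * e s).
  by move=> s; apply: cvgM; [exact: cvg_cst|exact: ce].
have P : 0 <= a / lambda * e B by rewrite mulr_ge0 ?expR_ge0 // divr_ge0 // ltW.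
rewrite (Rintegral_derive B0 cE dE) (_ : expR _ = e 0); last by rewrite /e addr0.
by rewrite !mulNr; lra.
Qed.

End LipschitzClass.

(** * Dynkin's formula for the reinforced jump process *)

Section RealLimits.
Variable R : realType.
Local Notation mu := (@lebesgue_measure R).

Lemma Rdominated_cvg d (T : measurableType d) (m : {measure set T -> \bar R}) (D : set T)
    (f_ : nat -> T -> R) (f g : T -> R) : measurable D ->
  (forall n, measurable_fun D (f_ n)) -> measurable_fun D f ->
  (forall x, D x -> f_ n x @[n --> \oo] --> f x) ->
  m.-integrable D (EFin \o g) -> (forall n x, D x -> `|f_ n x| <= g x) ->
  \int[m]_(x in D) f_ n x @[n --> \oo] --> \int[m]_(x in D) f x.
Proof.
move=> mD mf_ mf ff ig fg.
have H1 : {ae m, forall x, D x -> (EFin \o f_ n) x @[n --> \oo] --> (EFin \o f) x}.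
  by apply: aeW => x Dx; apply/fine_cvgP; split; [exact: nearW|exact: ff].
have H2 : {ae m, forall x n, D x -> (`|(EFin \o f_ n) x| <= (EFin \o g) x)%E}.
  by apply: aeW => x n Dx; rewrite /= lee_fin fg.
have [fi _ cf] := dominated_convergence mD (fun n => (measurable_EFinP D (f_ n)).2 (mf_ n))
  ((measurable_EFinP D f).2 mf) H1 ig H2.
apply: fine_cvg; rewrite fineK //.
by apply: integrable_fin_num.
Qed.

Lemma cvg_eq_near (Z : Type) (F : set_system Z) (FF : Filter F) (f g : Z -> R) (l : R) :
  (\forall s \near F, g s = f s) -> g @ F --> l -> f @ F --> l.
Proof. by move=> fg; apply: cvg_trans; exact: near_eq_cvg. Qed.

Lemma der_right_seq (f : R -> R) (df : R) (u : nat -> R) : is_derive (0 : R) 1 f df ->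
  (forall n, 0 < u n) -> u @ \oo --> (0 : R) -> (f (u n) - f 0) / u n @[n --> \oo] --> df.
Proof.
move=> Df u0 cu; have [dvf <-] := Df.
have := dvf; rewrite /derivable => /cvg_ex[l /= Hl].
have -> : 'D_1 f 0 = l by apply: cvg_lim.
have : (fun h : R => h^-1 *: (f (h *: 1 + 0) - f 0)) (u n) @[n --> \oo] --> l.
  apply: (@cvg_comp _ _ _ u _ _ _ _ _ Hl).
  move=> Q; rewrite /= nbhs_simpl /= /dnbhs /within /= => HQ.
  near=> n; suff : u n != 0 -> Q (u n) by apply; exact/lt0r_neq0/u0.
  by near: n; exact: (cu _ HQ).
by apply: cvg_eq_near; apply: nearW => n; rewrite addr0 /GRing.scale /= mulr1 mulrC.
Unshelve. all: by end_near. Qed.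

Lemma near_right_seq (Q : R -> Prop) (t : R) (u : nat -> R) :
  (\forall s \near t^'+, Q s) -> (forall n, t < u n) -> u @ \oo --> t ->
  \forall n \near \oo, Q (u n).
Proof.
rewrite near_withinE => HQ tu ut.
near=> n; suff : t < u n -> Q (u n) by apply; exact: tu.
by near: n; exact: (ut _ HQ).
Unshelve. all: by end_near. Qed.

(* The last zero of u before a point where u is positive would contradict the
   right derivative. *)
Lemma right_derivative_le (f : R -> R) (a b e : R) : a <= b -> continuous f -> 0 < e ->
  (forall t, a <= t < b -> \forall s \near t^'+, f s - f t <= e * (s - t)) ->
  f b - f a <= e * (b - a).
Proof.
move=> ab cf e0 df; pose u t := f t - f a - e * (t - a).
suff : u b <= 0 by rewrite /u subr_le0.
rewrite leNgt; apply/negP => ub0.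
have cu : continuous u.
  move=> t; apply: cvgB; first by apply: cvgB; [exact: cf|exact: cvg_cst].
  by apply: cvgM; [exact: cvg_cst|apply: cvgB; [exact: cvg_id|exact: cvg_cst]].
pose A := [set t | a <= t <= b /\ u t <= 0].
have Aa : A a by rewrite /A /= lexx ab /u !subrr mulr0 subrr.
have hA : has_sup A by split; [exists a|exists b => t [/andP[]]].
pose c := sup A.
have ac : a <= c by apply: ub_le_sup => //; case: hA.
have cb : c <= b by apply: ge_sup; [exists a|move=> t [/andP[]]].
have uc : u c <= 0.
  rewrite leNgt; apply/negP => uc0.
  have : \forall t \near c, 0 < u t.
    move/cvgrPdist_lt: (cu c) => /(_ _ uc0); apply: filterS => t.
    by rewrite ltr_distlC => /andP[]; lra.
  move=> /nbhs_ballP[d /= d0 Hd].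
  have [t At ct] := sup_adherent d0 hA.
  have tc : t <= c by apply: ub_le_sup => //; case: hA.
  have : 0 < u t by apply: Hd; rewrite /ball /= ger0_norm ?subr_ge0 //; rewrite -/c in ct; lra.
  by rewrite ltNge; case: At => _ ->.
have {}cb : c < b by rewrite lt_neqAle cb andbT; apply: contraTneq ub0 => <-; rewrite -leNgt.
have : \forall s \near c^'+, f s - f c <= e * (s - c) by apply: df; rewrite ac cb.
have : \forall s \near c^'+, s <= b by exact: nbhs_right_le.
have : \forall s \near c^'+, c < s by exact: nbhs_right_gt.
move=> H1 H2 H3; have [s [cs sb fs]] : exists s, [/\ c < s, s <= b & f s - f c <= e * (s - c)].
  by apply: (@filter_ex _ c^'+); near=> s; split; near: s.
have : s <= c; last by rewrite leNgt cs.
apply: ub_le_sup; first by case: hA.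
split; first by rewrite sb (le_trans ac) // ltW.
by move: uc; rewrite /u; lra.
Unshelve. all: by end_near. Qed.

(** Only a right derivative of [f] is available. The difference of [f] and a primitive of [psi] has
    right derivative 0, so for every e > 0 its increment over [0, b] is at most e in absolute
    value. *)
Lemma right_derivative_integral (f psi : R -> R) (b : R) : 0 <= b ->
  continuous f -> continuous psi ->
  (forall t, 0 <= t -> (f s - f t) / (s - t) @[s --> t^'+] --> psi t) ->
  f b - f 0 = \int[mu]_(t in `[0, b]) psi t.
Proof.
move=> b0 cf cpsi df.
pose Psi (s : R) : R := \int[mu]_(t in `[-1, s]) psi t.
have dPsi (s : R) : -1 < s -> is_derive s 1 Psi (psi s).
  move=> s1; have s1' : s < s + 1 by rewrite ltrDl.
  have [] := @continuous_FTC1_closed R psi (-1) s _ s1' _ s1 (cpsi s).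
    apply: continuous_compact_integrable; first exact: segment_compact.
    exact: continuous_subspaceT.
  exact: der_derive1.
have -> : \int[mu]_(t in `[0, b]) psi t = Psi b - Psi 0.
  by apply: Rintegral_derive => // s /andP[s0 _]; apply: dPsi; lra.
(* Freezing the argument at 0 makes the function continuous on the whole line, as
   [right_derivative_le] requires. *)
pose v (s : R) : R := f s - Psi (Num.max s 0).
have cv : continuous v.
  move=> s; apply: cvgB; first exact: cf.
  apply: (@continuous_comp _ _ _ (fun s : R => Num.max s 0) Psi).
    by apply: continuous_max; [exact: cvg_id|exact: cvg_cst].
  apply: (@der_continuous _ Psi _ (psi (Num.max s 0))); apply: dPsi.
  by rewrite (@lt_le_trans _ _ 0) // ?le_max ?lexx ?orbT // ltrN10.
have key (e : R) (t : R) : 0 < e -> 0 <= t -> \forall s \near t^'+, `|v s - v t| <= e * (s - t).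
  move=> e0 t0; have e2 : 0 < e / 2 by rewrite divr_gt0.
  have H1 : \forall s \near t^'+, `|psi t - (f s - f t) / (s - t)| <= e / 2.
    by move/cvgrPdist_le: (df t t0); apply.
  have /nbhs_ballP[r /= r0 Hr] : \forall s \near t, `|psi t - psi s| <= e / 2.
    by move/cvgrPdist_le: (cpsi t); apply.
  have H2 : \forall s \near t^'+, t < s < t + r.
    near=> s; apply/andP; split; first by near: s; exact: nbhs_right_gt.
    by near: s; apply: nbhs_right_lt; rewrite ltrDl.
  near=> s; have /andP[ts sr] : t < s < t + r by near: s.
  have [c /[!in_itv]/= /andP[tc cs] Ec] : exists2 c, c \in `]t, s[ & Psi s - Psi t = psi c * (s - t).
    apply: MVT => //.
      by move=> x /[!in_itv]/= /andP[tx _]; apply: dPsi; lra.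
    apply: derivable_within_continuous => x /[!in_itv]/= /andP[tx _].
    by case: (dPsi x _) => //; lra.
  have pc : `|psi t - psi c| <= e / 2.
    by apply: Hr; rewrite /ball /= distrC ger0_norm; lra.
  have pf : `|psi t - (f s - f t) / (s - t)| <= e / 2 by near: s.
  have st : 0 < s - t by rewrite subr_gt0.
  rewrite /v !max_l ?(ltW (le_lt_trans t0 ts)) //.
  have -> : f s - Psi s - (f t - Psi t) = ((f s - f t) / (s - t) - psi c) * (s - t).
    by rewrite mulrBl -Ec mulfVK ?gt_eqF //; ring.
  rewrite normrM [`|s - t|]gtr0_norm // ler_pM2r //.
  have -> : (f s - f t) / (s - t) - psi c = (psi t - psi c) - (psi t - (f s - f t) / (s - t)) by ring.
  by rewrite (le_trans (ler_normB _ _)) // [leRHS](splitr e) lerD.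
have v0 : v b - v 0 = 0.
  apply/eqP; rewrite -normr_eq0; apply/eqP; apply: le_anti; rewrite normr_ge0 andbT.
  apply/ler_addgt0Pl => e e0; rewrite addr0.
  have d0 : 0 < e / (b + 1) by rewrite divr_gt0 // ltr_wpDl.
  have eb : e / (b + 1) * (b - 0) <= e.
    by rewrite subr0 mulrAC ler_pdivrMr ?ltr_wpDl // ler_wpM2l ?lerDl // ltW.
  rewrite ler_norml lerNl; apply/andP; split; apply: (le_trans _ eb).
    have -> : - (v b - v 0) = (- v b) - (- v 0) by ring.
    apply: (@right_derivative_le (fun s => - v s)) => //.
      by move=> s; apply: cvgN; exact: cv.
    move=> t /andP[t0 _]; apply: filterS (key _ t d0 t0) => s.
    by rewrite -opprD; apply: le_trans; rewrite -normrN ler_norm.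
  apply: right_derivative_le => // t /andP[t0 _]; apply: filterS (key _ t d0 t0) => s.
  by apply: le_trans; exact: ler_norm.
by move: v0; rewrite /v max_l // maxxx; lra.
Unshelve. all: by end_near. Qed.

End RealLimits.

(** * Joint measurability of right-continuous paths *)

Section RightContinuous.
Variable R : realType.
Local Notation MR := (measurableTypeR R).
Context d (T : measurableType d).
Local Notation mu := (@lebesgue_measure R).
Variables (Y : R -> T -> R) (t : R).
Hypothesis t0 : 0 <= t.
Hypothesis mY : forall s, 0 <= s <= t -> measurable_fun setT (Y s).
Hypothesis rcY : forall w s, 0 <= s < t -> \forall r \near s^'+, Y r w = Y s w.

Let A (m k : nat) (s : R) := (0 <= s <= t) && (k%:R <= m.+1%:R * s < k.+1%:R).
(** The minimum with [t] keeps the sampling time in the interval on which measurability is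
    assumed. *)
Let tau (m k : nat) : R := Num.min t (k.+1%:R / m.+1%:R).

(* The step functions equal to Y at the right end point of each interval. *)
Lemma measurable_right_continuous :
  measurable_fun setT (fun p : MR * T => if 0 <= p.1 <= t then Y p.1 p.2 else 0).
Proof.
apply: (@measurable_fun_cvg _ _ _ _ (fun m (p : MR * T) =>
  \sum_(k < (Num.truncn (m.+1%:R * t)).+1) (A m k p.1)%:R * Y (tau m k) p.2)).
  move=> m; apply: measurable_sum => k; apply: measurable_funM.
    have mA : measurable_fun setT (fun s : MR => (A m k s)%:R : R).
      have -> : (fun s => (A m k s)%:R) = \1_([set s | A m k s]) :> (MR -> R).
        by apply/funext => s; rewrite indicE mem_setE.
      apply: measurable_indic.
      have -> : [set s | A m k s] = `[0, t] `&` [set s : R | k%:R <= m.+1%:R * s < k.+1%:R].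
        by apply/seteqP; split => s; rewrite /A /= in_itv /=; [move=> /andP[-> ->]|case=> -> ->].
      apply: measurableI => //.
      have -> : [set s : R | k%:R <= m.+1%:R * s < k.+1%:R] =
          (fun s : R => m.+1%:R * s) @^-1` `[k%:R, k.+1%:R[ by [].
      by rewrite -[X in measurable X]setTI; apply: measurable_funM.
    exact: (measurableT_comp mA measurable_fst).
  apply: (measurableT_comp _ measurable_snd); apply: mY.
  by rewrite le_min t0 ge_min lexx divr_ge0.
move=> [s w] _ /=; case: ifPn => [/andP[s0 st]|nst]; last first.
  rewrite (_ : (fun m => _) = cst 0); first exact: cvg_cst.
  by apply/funext => m; rewrite big1 // => k _; rewrite /A (negPf nst) mul0r.
have E m : \sum_(k < (Num.truncn (m.+1%:R * t)).+1) (A m k s)%:R * Y (tau m k) w =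
    Y (tau m (Num.truncn (m.+1%:R * s))) w.
  have ms0 : 0 <= m.+1%:R * s by rewrite mulr_ge0.
  have Hk : (Num.truncn (m.+1%:R * s) < (Num.truncn (m.+1%:R * t)).+1)%N.
    by rewrite ltnS; apply: le_truncn; rewrite ler_wpM2l.
  rewrite (bigD1 (Ordinal Hk)) //= big1 ?addr0 => [|k kn].
    by rewrite /A s0 st (truncn_itv ms0) mul1r.
  rewrite /A s0 st /=; have [/truncn_def kE|_] := boolP (_ <= _ < _); last by rewrite mul0r.
  by case/eqP: kn; apply: val_inj; rewrite /= kE.
rewrite (funext E); move: st; rewrite le_eqVlt => /predU1P[st|st].
  rewrite (_ : (fun m => _) = cst (Y s w)); first exact: cvg_cst.
  apply/funext => m; rewrite /= /tau -st; congr (Y _ w); apply/min_idPl.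
  have ms0 : 0 <= m.+1%:R * s by rewrite mulr_ge0.
  by rewrite ler_pdivlMr // mulrC ltW //; case/andP: (truncn_itv ms0).
apply: cvg_near_cst.
have := rcY w (s := s); rewrite s0 st => /(_ isT) H.
pose u m := (Num.truncn (m.+1%:R * s)).+1%:R / m.+1%:R : R.
have us m : s < u m.
  have ms0 : 0 <= m.+1%:R * s by rewrite mulr_ge0.
  by rewrite ltr_pdivlMr // mulrC; case/andP: (truncn_itv ms0).
have uls m : u m <= s + m.+1%:R^-1.
  have ms0 : 0 <= m.+1%:R * s by rewrite mulr_ge0.
  rewrite ler_pdivrMr // mulrDl mulVf // -natr1 lerD2r [s * _]mulrC.
  by case/andP: (truncn_itv ms0).
have cu : u @ \oo --> s.
  apply: (@squeeze_cvgr _ _ _ _ (cst s) (fun m => s + m.+1%:R^-1)).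
  - by apply: nearW => m; rewrite (ltW (us m)) uls.
  - exact: cvg_cst.
  - by rewrite -[X in _ --> X]addr0; apply: cvgD; [exact: cvg_cst|exact: cvg_harmonic].
have H1 := near_right_seq H us cu.
have H2 : \forall m \near \oo, u m < t by apply: (cvgr_lt s).
near=> m; rewrite /tau (_ : Num.min _ _ = u m).
  by near: m.
by apply/min_idPr/ltW; near: m.
Unshelve. all: by end_near. Qed.

Lemma measurable_path w : measurable_fun setT (fun s : MR => if 0 <= s <= t then Y s w else 0).
Proof.
exact: (measurableT_comp measurable_right_continuous (pair2_measurable w)).
Qed.

Lemma measurable_Rintegral_path : (forall s w, 0 <= Y s w <= 1) ->
  measurable_fun setT (fun w => \int[mu]_(s in `[0, t]) Y s w).
Proof.
move=> Y01.
have := @measurable_fun_fubini_tonelli_G _ _ _ _ R mu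
  (EFin \o (fun p : MR * T => if 0 <= p.1 <= t then Y p.1 p.2 else 0)).
have mY' := measurable_right_continuous.
move=> /(_ ((measurable_EFinP _ _).2 mY')) H.
have /H {}H : forall p, (0 <= (EFin \o (fun p : MR * T => if (0 <= p.1 <= t)%R then Y p.1 p.2 else 0%R)) p)%E.
  by move=> p; rewrite /= lee_fin; case: ifP => // _; case/andP: (Y01 p.1 p.2).
rewrite (_ : (fun w => _) = fine \o fubini_G mu
  (EFin \o (fun p : MR * T => if 0 <= p.1 <= t then Y p.1 p.2 else 0))).
  by apply: measurableT_comp => //; exact: measurable_fine.
apply/funext => w; rewrite Rintegral_mkcond /Rintegral /fubini_G /=; congr fine.
by apply: eq_integral => s _; rewrite patchE mem_setE in_itv.
Qed.

End RightContinuous.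

(** * Local times and means along the process *)

Section VrjpProcess.
Context (R : realType) (Lambda : finType) d (T : measurableType d).
Variables (P : probability T R) (beta : Lambda -> Lambda -> R).
Variables (X : R -> T -> Lambda) (L0 : T -> Lambda -> R).
Hypothesis XL : vrjp P beta X L0.
Hypothesis beta_ge0 : forall i j, 0 <= beta i j.
Local Notation mu := (@lebesgue_measure R).
Local Notation L := (local_time X L0).
Implicit Types (F g h : Lambda -> (Lambda -> R) -> R) (t s u : R) (w : T) (i j k : Lambda).

Lemma path_right_continuous i w s : 0 <= s ->
  \forall r \near s^'+, ((X r w == i)%:R : R) = (X s w == i)%:R.
Proof.
move=> s0; have := vrjp_right_continuous XL w s0.
by apply: filterS => r ->.
Qed.

(** Over an arbitrary measurable space, since it is applied both to the given sigma-algebra and to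
    the history at time [t]. *)
Lemma local_time_measurable_gen d' (T' : measurableType d') (X' : R -> T' -> Lambda)
    (L0' : T' -> Lambda -> R) t i : 0 <= t ->
  (forall s, 0 <= s <= t -> measurable_fun setT (fun v => (X' s v == i)%:R : R)) ->
  (forall (v : T') s, 0 <= s -> \forall r \near s^'+, ((X' r v == i)%:R : R) = (X' s v == i)%:R) ->
  measurable_fun setT (fun v => L0' v i) ->
  measurable_fun setT (fun v => local_time X' L0' t v i).
Proof.
move=> t0 mX rcX mL; apply: measurable_funD => //.
apply: (@measurable_Rintegral_path _ _ _ (fun s (v : T') => (X' s v == i)%:R)) => //.
- by move=> v s /andP[s0 _]; exact: rcX.
- by move=> s v; case: (_ == _); rewrite ?lexx ?ler01.
Qed.

Lemma measurable_state t i : 0 <= t -> measurable_fun setT (fun w => (X t w == i)%:R : R).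
Proof.
move=> t0; rewrite (_ : (fun w => _) = \1_([set w | X t w = i])).
  by apply: measurable_indic; exact: vrjp_measurable XL _ _ t0.
by apply/funext => w; rewrite indicE; congr (_%:R); congr nat_of_bool; apply/eqP/idP => [?|];
  rewrite inE.
Qed.

Lemma local_time_measurable t i : 0 <= t -> measurable_fun setT (fun w => L t w i).
Proof.
move=> t0; apply: local_time_measurable_gen => //.
- by move=> s /andP[s0 _]; exact: measurable_state.
- by move=> w s; exact: path_right_continuous.
- exact: vrjp_measurable0 XL i.
Qed.

(** The generators of [history], named so that the history can serve as the sigma-algebra of a
    measurable type. *)
Definition history_gen t : set (set T) :=
  [set A | (exists s i, [/\ 0 <= s, s <= t & A = [set w | X s w = i]]) \/
      (exists i (B : set (measurableTypeR R)),
         measurable B /\ A = [set w | B (L0 w i)])].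

Lemma local_time_history t i : 0 <= t ->
  measurable_fun (setT : set (g_sigma_algebraType (history_gen t))) (fun w => L t w i).
Proof.
move=> t0; apply: (@local_time_measurable_gen _ (g_sigma_algebraType (history_gen t)) X L0) => //.
- move=> s /andP[s0 st].
  rewrite (_ : (fun w => _) = \1_([set w | X s w = i] : set (g_sigma_algebraType (history_gen t)))).
    apply: measurable_indic; apply: sub_sigma_algebra; left; by exists s, i.
  by apply/funext => w; rewrite indicE; congr (_%:R); congr nat_of_bool; apply/eqP/idP => [?|];
    rewrite inE.
- by move=> w s; exact: path_right_continuous.
- move=> _ B mB; rewrite setTI; apply: sub_sigma_algebra; right; by exists i, B.
Qed.

Lemma integrable_state t w i : 0 <= t ->
  mu.-integrable `[0, t] (EFin \o (fun s => (X s w == i)%:R : R)).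
Proof.
move=> t0; have mp := @measurable_path R _ _ (fun s w => (X s w == i)%:R) t t0
  (fun s st => @measurable_state s i (proj1 (andP st)))
  (fun w s st => @path_right_continuous i w s (proj1 (andP st))) w.
apply: (@dominated_integrable _ _ _ _ _ _ (cst 1)) => //.
- apply: (@eq_measurable_fun _ _ _ _ _ (fun s : measurableTypeR R =>
    (if 0 <= s <= t then (X s w == i)%:R else 0) : R)).
    by move=> s; rewrite inE /= in_itv /= => ->.
  exact: measurable_funTS.
- by move=> s _; case: (_ == _); rewrite ?normr1 // normr0.
- apply: continuous_compact_integrable; first exact: segment_compact.
  by apply: continuous_subspaceT => s; exact: cvg_cst.
Qed.

Lemma local_timeB t u w i : 0 <= t -> 0 <= u ->
  L (t + u) w i - L t w i = \int[mu]_(s in `]t, t + u]) (X s w == i)%:R.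
Proof.
move=> t0 u0; rewrite /local_time opprD addrACA subrr add0r.
apply: (@Rintegral_itvB R (fun s => (X s w == i)%:R) (BLeft 0) (BRight (t + u)) t).
- by apply: integrable_state; exact: addr_ge0.
- by rewrite bnd_simp.
- by rewrite bnd_simp lerDl.
Qed.

Lemma integrable_state_oc t u w i : 0 <= t -> 0 <= u ->
  mu.-integrable `]t, t + u] (EFin \o (fun s => (X s w == i)%:R : R)).
Proof.
move=> t0 u0; apply: (@integrableS _ _ _ mu `[0, t + u]) => //.
  by move=> s /=; rewrite !in_itv /= => /andP[ts ->]; rewrite (le_trans t0) // ltW.
by apply: integrable_state; exact: addr_ge0.
Qed.

Lemma fine_lebesgue_oc t u : 0 <= u -> fine (mu `]t, t + u]) = u.
Proof.
move=> u0; rewrite lebesgue_measure_itv /= lte_fin ltrDl.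
case: ltP => [_|u0']; first by rewrite -EFinD /= addrAC subrr add0r.
by apply/le_anti; rewrite u0 u0'.
Qed.

Lemma local_time_le t u w i : 0 <= t -> 0 <= u -> L t w i <= L (t + u) w i.
Proof.
move=> t0 u0; rewrite -subr_ge0 local_timeB //; apply: Rintegral_ge0 => s _.
by case: (_ == _).
Qed.

Lemma local_time_ge0 t w i : 0 <= t -> 0 <= L t w i.
Proof.
move=> t0; apply: addr_ge0; first exact/ltW/(vrjp_gt0 XL).
by apply: Rintegral_ge0 => s _; case: (_ == _).
Qed.

Lemma sum_local_timeB t u w : 0 <= t -> 0 <= u -> \sum_i (L (t + u) w i - L t w i) = u.
Proof.
move=> t0 u0; under eq_bigr => i _ do rewrite local_timeB //.
rewrite -Rintegral_sum //; last by move=> i; exact: integrable_state_oc.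
rewrite (@eq_Rintegral _ _ _ _ _ (cst 1)) => [|s _].
  by rewrite Rintegral_cst // fine_lebesgue_oc // mul1r.
by rewrite (bigD1 (X s w)) //= eqxx big1 ?addr0 // => i /negPf; rewrite eq_sym => ->.
Qed.

Lemma ldist_local_time t u w : 0 <= t -> 0 <= u -> ldist (L t w) (L (t + u) w) = u.
Proof.
move=> t0 u0; rewrite -[RHS](@sum_local_timeB t u w) //; apply: eq_bigr => i _.
by rewrite distrC ger0_norm // subr_ge0 local_time_le.
Qed.

Lemma local_time0 w i : L 0 w i = L0 w i.
Proof. by rewrite /local_time set_itv1 Rintegral_set1 addr0. Qed.

Lemma sum_local_time t w : 0 <= t -> \sum_i L t w i = \sum_i L0 w i + t.
Proof.
move=> t0; have := @sum_local_timeB 0 t w (lexx 0) t0; rewrite add0r sumrB => E.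
rewrite -[LHS](subrK (\sum_i L 0 w i)) E addrC; congr (_ + _).
by apply: eq_bigr => i _; exact: local_time0.
Qed.

Lemma local_time_near t w : 0 <= t ->
  \forall u \near 0^'+, L (t + u) w = shift (L t w) (X t w) u.
Proof.
move=> t0; have := vrjp_right_continuous XL w t0; rewrite near_withinE => /nbhs_ballP[e /= e0 He].
near=> u; have u0 : 0 < u by near: u; exact: nbhs_right_gt.
have ue : u < e by near: u; exact: nbhs_right_lt.
apply/funext => i; rewrite -[LHS](subrK (L t w i)) (_ : _ - _ = (X t w == i)%:R * u).
  rewrite /shift /upd /=; case: (eqVneq i (X t w)) => [->|/negPf iX].
    by rewrite mul1r addrC.
  by rewrite mulr0n mul0r add0r.
rewrite local_timeB ?(ltW u0) // (@eq_Rintegral _ _ _ _ _ (cst (X t w == i)%:R)) => [|s].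
  by rewrite Rintegral_cst // fine_lebesgue_oc ?(ltW u0).
rewrite inE /= in_itv /= => /andP[ts su]; rewrite He //.
by rewrite /ball /= distrC ger0_norm; lra.
Unshelve. all: by end_near. Qed.

(** Bounds are required only on the closed positive orthant, where the local times take their
    values; one constant serves for the size and for the Lipschitz estimate. *)
Definition observable (C : R) F := [/\ 0 <= C, forall j, pcontinuous (F j),
  forall j z, (forall k, 0 <= z k) -> `|F j z| <= C &
  forall j z z', (forall k, 0 <= z k) -> (forall k, 0 <= z' k) ->
    `|F j z - F j z'| <= C * ldist z z'].

Definition mean F t : R := \int[P]_w F (X t w) (L t w).

Lemma measurable_observable F s t : (forall j, pcontinuous (F j)) -> 0 <= s -> 0 <= t ->
  measurable_fun setT (fun w => F (X s w) (L t w)).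
Proof.
move=> cF s0 t0; rewrite (_ : (fun w => _) = (fun w => \sum_j (X s w == j)%:R * F j (L t w))).
  apply: measurable_sum => j; apply: measurable_funM; first exact: measurable_state.
  by apply: measurable_pcontinuous => // i; exact: local_time_measurable.
apply/funext => w; rewrite (bigD1 (X s w)) //= eqxx mul1r big1 ?addr0 // => i /negPf.
by rewrite eq_sym => ->; rewrite mul0r.
Qed.

Lemma rintegrable_bounded (Y : T -> R) (C : R) : measurable_fun setT Y ->
  (forall w, `|Y w| <= C) -> P.-integrable setT (EFin \o Y).
Proof.
move=> mY YC; apply: (@dominated_integrable _ _ _ _ _ _ (cst C)) => //.
by apply: finite_measure_integrable_cst.
Qed.

Lemma Rintegral_prob_cst (c : R) : \int[P]_w cst c w = c.
Proof.
have := @Rintegral_cst _ _ R P setT measurableT c.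
by rewrite [X in fine X](_ : _ = 1%E) ?mulr1 //; exact: probability_setT.
Qed.

Lemma integrable_observable C F s t : observable C F -> 0 <= s -> 0 <= t ->
  P.-integrable setT (EFin \o (fun w => F (X s w) (L t w))).
Proof.
move=> [C0 cF bF _] s0 t0; apply: (@rintegrable_bounded _ C); first exact: measurable_observable.
by move=> w; apply: bF => k; exact: local_time_ge0.
Qed.

Definition moved s t w : R := (X s w != X t w)%:R.

Lemma measurable_moved s t : 0 <= s -> 0 <= t -> measurable_fun setT (moved s t).
Proof.
move=> s0 t0; rewrite (_ : moved s t = (fun w => 1 - \sum_j (X s w == j)%:R * (X t w == j)%:R)).
  apply: measurable_funB => //; apply: measurable_sum => j.
  by apply: measurable_funM; exact: measurable_state.
apply/funext => w; rewrite /moved (bigD1 (X s w)) //= eqxx mul1r big1 ?addr0 => [|j /negPf].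
  by rewrite eq_sym; case: (_ == _); rewrite ?subrr ?subr0.
by rewrite eq_sym => ->; rewrite mul0r.
Qed.

Lemma moved_norm s t w : `|moved s t w| <= 1.
Proof. by rewrite /moved; case: (_ != _); rewrite ?normr1 ?normr0. Qed.

Lemma integrable_moved s t : 0 <= s -> 0 <= t -> P.-integrable setT (EFin \o moved s t).
Proof.
by move=> s0 t0; apply: (@rintegrable_bounded _ 1); [exact: measurable_moved|exact: moved_norm].
Qed.

Definition prob_moved s t : R := \int[P]_w moved s t w.

(** If the state is the same at both times, only the local times differ, by s - t in total;
    otherwise the crude bound 2 C applies. *)
Lemma observable_diff C F s t w : observable C F -> 0 <= t -> t <= s ->
  `|F (X s w) (L s w) - F (X t w) (L t w)| <= 2 * C * moved s t w + C * (s - t).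
Proof.
move=> [C0 cF bF lF] t0 ts; have s0 := le_trans t0 ts.
have Lp r : 0 <= r -> forall k, 0 <= L r w k by move=> r0 k; exact: local_time_ge0.
rewrite /moved; case: eqVneq => [->|_] /=.
  rewrite mulr0 add0r (le_trans (lF _ _ _ (Lp s s0) (Lp t t0))) // ldistC.
  have -> : s = t + (s - t) by rewrite addrC subrK.
  by rewrite ldist_local_time ?subr_ge0 // addrAC subrr add0r.
rewrite mulr1 (le_trans (ler_normB _ _)) //.
apply: (@le_trans _ _ (C + C)); first by rewrite lerD // bF //; exact: Lp.
by rewrite mulr2n mulrDl mul1r lerDl mulr_ge0 // subr_ge0.
Qed.

Lemma mean_diff C F s t : observable C F -> 0 <= t -> t <= s ->
  `|mean F s - mean F t| <= 2 * C * prob_moved s t + C * (s - t).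
Proof.
move=> oF t0 ts; have s0 := le_trans t0 ts.
have is_ := integrable_observable oF s0 s0; have it := integrable_observable oF t0 t0.
have im := integrable_moved s0 t0.
rewrite /mean -RintegralB // (le_trans (le_normr_Rintegral _ (rintegrableB _ is_ it))) //.
have ic : P.-integrable setT (EFin \o cst (C * (s - t))).
  exact: finite_measure_integrable_cst.
apply: (@le_trans _ _ (\int[P]_w (2 * C * moved s t w + cst (C * (s - t)) w))).
  apply: le_Rintegral => //.
  - exact/rintegrable_abs/rintegrableB.
  - by apply: rintegrableD => //; exact: rintegrableZ.
  - by move=> w _; exact: observable_diff.
rewrite RintegralD //; last exact: rintegrableZ.
by rewrite RintegralZl // Rintegral_prob_cst.
Qed.

Lemma prob_moved_right t (u : nat -> R) : 0 <= t -> (forall n, t < u n) -> u @ \oo --> t ->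
  prob_moved (u n) t @[n --> \oo] --> (0 : R).
Proof.
move=> t0 tu ut; have -> : 0 = \int[P]_w (cst 0 w) :> R by rewrite Rintegral_eq0.
apply: (@Rdominated_cvg _ _ _ _ _ _ _ (cst 1)) => //.
- by move=> n; apply: measurable_moved => //; exact: le_trans (ltW (tu n)).
- move=> w _; apply: cvg_near_cst.
  have := near_right_seq (vrjp_right_continuous XL w t0) tu ut.
  by apply: filterS => n E; rewrite /moved E eqxx.
- exact: finite_measure_integrable_cst.
- by move=> n w _; exact: moved_norm.
Qed.

(** The place where the absence of fixed jump times enters: right continuity of the paths controls
    only the approach from the other side. *)
Lemma prob_moved_left t : 0 < t -> prob_moved t (t - h) @[h --> 0^'+] --> (0 : R).
Proof.
move=> t0; have := vrjp_no_fixed_jump XL t0 => /fine_cvgP[_ H].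
apply: cvg_trans H; apply: near_eq_cvg; near=> h.
have h0 : 0 <= h by near: h; exact: nbhs_right_ge.
have ht : 0 <= t - h by rewrite subr_ge0; near: h; exact: nbhs_right_le.
rewrite /prob_moved /Rintegral; congr fine.
have t_ : 0 <= t by exact: ltW.
have AE : [set w | X (t - h) w <> X t w] = moved t (t - h) @^-1` [set 1].
  apply/seteqP; split => w /=; rewrite /moved.
    by move=> /eqP; rewrite eq_sym => ->.
  by case: eqVneq => [_ /eqP|/eqP H _ E]; [rewrite eq_sym oner_eq0|apply: H].
have mA : measurable [set w | X (t - h) w <> X t w].
  by rewrite AE -[X in measurable X]setTI; apply: (measurable_moved t_ ht).
rewrite (_ : (fun w => _) = (fun w => (\1_[set w | X (t - h) w <> X t w] w)%:E)).
  by rewrite integral_indic // setIT.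
apply/funext => w; congr EFin; rewrite indicE /moved; congr (_%:R); congr nat_of_bool.
apply/idP/idP => [/eqP H|]; first by rewrite inE /= => E; apply: H; rewrite E.
by rewrite inE /= => H; apply/eqP => E; apply: H; rewrite E.
Unshelve. all: by end_near. Qed.

Lemma prob_moved_ge0 s t : 0 <= prob_moved s t.
Proof. by apply: Rintegral_ge0 => w _; rewrite /moved; case: (_ != _). Qed.

Lemma cvg_rightP (f : R -> R) (a l : R) :
  (forall u : nat -> R, (forall n, a < u n) -> u @ \oo --> a -> f (u n) @[n --> \oo] --> l) ->
  f x @[x --> a^'+] --> l.
Proof. by move=> H; apply/cvg_at_rightP => u [au ua]; exact: H. Qed.

(** The maximum with 0 extends the mean to negative times as a constant, so that the later lemmas
    can ask for continuity on the whole line. *)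
Lemma continuous_mean C F : observable C F -> continuous (fun t => mean F (Num.max t 0)).
Proof.
move=> oF; have C0 : 0 <= C by case: oF.
have right_cvg t : 0 <= t -> mean F s @[s --> t^'+] --> mean F t.
  move=> t0; apply: cvg_rightP => u tu ut.
  apply/cvgrPdist_le => e e0.
  have H : (fun n => 2 * C * prob_moved (u n) t + C * (u n - t)) @ \oo --> 2 * C * 0 + C * (t - t).
    apply: cvgD; apply: cvgM; try exact: cvg_cst; first exact: prob_moved_right.
    by apply: cvgB => //; exact: cvg_cst.
  rewrite subrr !mulr0 addr0 in H; move/cvgrPdist_le: H => /(_ e e0); apply: filterS => n.
  rewrite sub0r normrN distrC => /(le_trans (ler_norm _)); apply: le_trans.
  by apply: mean_diff => //; exact: ltW.
have left_cvg t : 0 < t -> mean F s @[s --> t^'-] --> mean F t.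
  move=> t0; have H : (fun h : R => 2 * C * prob_moved t (t - h) + C * h) @ 0^'+ --> 2 * C * 0 + C * 0.
    apply: cvgD; apply: cvgM; try exact: cvg_cst; first exact: prob_moved_left.
    by apply: cvg_at_right_filter; exact: cvg_id.
  rewrite !mulr0 addr0 in H.
  apply/cvgrPdist_le => e e0; move/cvgrPdist_le: H => /(_ e e0) H.
  rewrite near_withinE in H; move: H => /nbhs_ballP[r /= r0 Hr].
  near=> s; have st : s < t by near: s; exact: nbhs_left_lt.
  have s0 : 0 <= s by near: s; exact: nbhs_left_ge.
  have sr : t - r < s by near: s; apply: nbhs_left_gt; rewrite ltrBlDr ltrDl.
  rewrite (le_trans (mean_diff oF s0 (ltW st))) //.
  have := Hr (t - s); rewrite /ball /= sub0r normrN ger0_norm ?subr_ge0 ?(ltW st) //.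
  rewrite subr_gt0 sub0r normrN subKr => Hr'; apply: (le_trans (ler_norm _)); apply: Hr' => //; lra.
move=> t; have [t0|t0|->] := ltgtP t 0.
- apply: cvg_near_cst; near=> s; rewrite !max_r //; first exact: ltW.
  near: s; apply/nbhs_ballP; exists (- t) => [|s] /=; first by rewrite oppr_gt0.
  by rewrite /ball /= ltr_distlC => /andP[]; lra.
- apply/left_right_continuousP; split.
    apply: (@cvg_eq_near _ _ _ _ _ (mean F)); last by rewrite max_l ?ltW //; exact: left_cvg.
    by near=> s; rewrite max_l //; near: s; exact: nbhs_left_ge.
  apply: (@cvg_eq_near _ _ _ _ _ (mean F)); last by rewrite max_l ?ltW //; exact/right_cvg/ltW.
  near=> s; rewrite max_l //; near: s.
  by apply: filterS (nbhs_right_gt t) => s ts; rewrite ltW // (lt_trans t0).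
- apply/left_right_continuousP; split; rewrite maxxx.
    apply: (@cvg_eq_near _ _ _ _ _ (cst (mean F 0))); last exact: cvg_cst.
    by near=> s; rewrite max_r //; near: s; exact: nbhs_left_le.
  apply: (@cvg_eq_near _ _ _ _ _ (mean F)); last exact: right_cvg.
  by near=> s; rewrite max_l //; near: s; exact: nbhs_right_ge.
Unshelve. all: by end_near. Qed.

End VrjpProcess.

(** Indexes the integers of [-K, K) by natural numbers, for a finite sum over level sets. *)
Lemma int_offset (v : int) (K : nat) : - K%:Z <= v -> v < K%:Z ->
  exists2 k : nat, v = k%:Z - K%:Z & (k < K.*2)%N.
Proof. by move=> v1 v2; exists (absz (v + K%:Z)); lia. Qed.

(** * The forward equation *)

Section Dynkin.
Context (R : realType) (Lambda : finType) d (T : measurableType d).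
Variables (P : probability T R) (beta : Lambda -> Lambda -> R).
Variables (X : R -> T -> Lambda) (L0 : T -> Lambda -> R).
Hypothesis XL : vrjp P beta X L0.
Hypothesis beta_ge0 : forall i j, 0 <= beta i j.
Local Notation mu := (@lebesgue_measure R).
Local Notation L := (local_time X L0).
Local Notation mean := (mean P X L0).
Implicit Types (t s : R) (w : T) (i j k : Lambda).

Lemma history_measurable t (A : set T) : 0 <= t -> history X L0 t A -> measurable A.
Proof.
move=> t0; apply: smallest_sub; first exact: sigma_algebra_measurable.
move=> B [[s [i [s0 _ ->]]]|[i [D [mD ->]]]]; first exact: vrjp_measurable XL _ _ s0.
by have := vrjp_measurable0 XL i measurableT mD; rewrite setTI.
Qed.

Section rate.
Variables (t T0 : R) (i j : Lambda) (u : nat -> R).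
Hypotheses (t0 : 0 <= t) (ij : i != j).
Hypotheses (u0 : forall n, 0 < u n) (cu : u @ \oo --> (0 : R)).

(** On [B] the jump rate is bounded. Below, [In Y n] is the difference quotient of the jump rate
    axiom, tested against a function [Y] instead of an event, and [J Y] is its expected limit. *)
Let B : set T := [set w | \sum_k L t w k < T0].
Let S n w : R := (X t w == i)%:R * (X (t + u n) w == j)%:R.
Let W w : R := (X t w == i)%:R * (beta i j * L t w j).
Let In (Y : T -> R) n : R := (u n)^-1 * \int[P]_w (S n w * Y w).
Let J (Y : T -> R) : R := \int[P]_w (W w * Y w).

Let tu n : 0 <= t + u n. Proof. by rewrite addr_ge0 // ltW. Qed.

Let mS n : measurable_fun setT (S n).
Proof.
have := measurable_funM (measurable_state XL i t0) (measurable_state XL j (tu n)); exact.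
Qed.

Let S01 n w : `|S n w| <= 1.
Proof. by rewrite /S; do 2 case: (_ == _); rewrite ?mulr0 ?mul0r ?mulr1 ?normr0 ?normr1. Qed.

Let mW : measurable_fun setT W.
Proof.
apply: measurable_funM; first exact: measurable_state XL _ _ t0.
by apply: measurable_funM => //; exact: local_time_measurable XL _ _ t0.
Qed.

Let W_ge0 w : 0 <= W w.
Proof. by rewrite /W mulr_ge0 // mulr_ge0 // (local_time_ge0 XL). Qed.

Let WB w : B w -> W w <= beta i j * T0.
Proof.
move=> Bw; have Lj : L t w j <= T0.
  apply: le_trans (ltW Bw); rewrite (bigD1 j) //= lerDl sumr_ge0 // => k _.
  exact: (local_time_ge0 XL).
apply: (@le_trans _ _ (beta i j * L t w j)); last by rewrite ler_wpM2l.
rewrite /W; case: (_ == _); rewrite ?mul1r ?mul0r ?mulr_ge0 //; exact: (local_time_ge0 XL).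
Qed.

Let iS n (Y : T -> R) (C : R) : measurable_fun setT Y -> (forall w, `|Y w| <= C) ->
  P.-integrable setT (EFin \o (fun w => S n w * Y w)).
Proof.
move=> mY YC; apply: (@rintegrable_bounded _ _ _ _ _ C); first exact: measurable_funM.
by move=> w; rewrite normrM -[leRHS]mul1r ler_pM ?S01 ?YC.
Qed.

Let iW (Y : T -> R) (C : R) : measurable_fun setT Y -> 0 <= C -> (forall w, `|Y w| <= C * \1_B w) ->
  P.-integrable setT (EFin \o (fun w => W w * Y w)).
Proof.
move=> mY C0 YC; have [T00|T00] := leP 0 T0; last first.
  have Y0 w : Y w = 0.
    apply/eqP; rewrite -normr_le0 (le_trans (YC w)) // indicE memNset ?mulr0 //= /B /=.
    apply/negP; rewrite -leNgt ltW // (lt_le_trans T00) // sumr_ge0 // => k _.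
    exact: (local_time_ge0 XL).
  apply: (@rintegrable_bounded _ _ _ _ _ 0); first exact: measurable_funM.
  by move=> w; rewrite Y0 mulr0 normr0.
apply: (@rintegrable_bounded _ _ _ _ _ (beta i j * T0 * C)); first exact: measurable_funM.
move=> w; rewrite normrM (ger0_norm (W_ge0 w)); have := YC w; rewrite indicE.
have [/set_mem Bw|nBw] := boolP (w \in B).
  by rewrite mulr1 => ?; apply: ler_pM => //; exact: WB.
rewrite mulr0 normr_le0 => /eqP ->; rewrite normr0 mulr0.
by rewrite !mulr_ge0.
Qed.

Let rate_set (A : set T) : history X L0 t A -> A `<=` B ->
  In (\1_A) n @[n --> \oo] --> J (\1_A).
Proof.
move=> hA AB; have mA := history_measurable t0 hA.
have Ai w : `|\1_A w : R| <= 1 * \1_B w.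
  rewrite mul1r !indicE; have [/set_mem Aw|] := boolP (w \in A); last by rewrite normr0; case: (_ \in _).
  by rewrite normr1 mem_set //; exact: AB.
have mA1 : measurable_fun setT (\1_A : T -> R) by exact: measurable_indic.
have := vrjp_rate XL t0 ij hA.
have E1 : (\int[P]_(w in A `&` [set w | X t w = i]) (beta i j * L t w j)%:E = (J (\1_A))%:E)%E.
  rewrite /J /Rintegral fineK; last exact: integrable_fin_num (iW mA1 ler01 Ai).
  rewrite [LHS]integral_mkcond; apply: eq_integral => w _; rewrite patchE /W.
  rewrite indicE in_setI; case: (boolP (w \in A)) => /= Aw; last by rewrite mulr0.
  case: (eqVneq (X t w) i) => [E|/eqP nE]; first by rewrite mem_set // mul1r mulr1.
  by rewrite memNset // !mul0r.
rewrite E1 => /fine_cvgP[_ H].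
have {}H : fine ((u n)^-1%:E * P (A `&` [set w | X t w = i /\ X (t + u n) w = j])) @[n --> \oo]
    --> J (\1_A).
  by move/cvg_at_rightP: H; apply; split.
apply: cvg_eq_near H; apply: nearW => n; rewrite /In.
have mSn : measurable [set w | X t w = i /\ X (t + u n) w = j].
  by apply: measurableI; apply: vrjp_measurable XL _ _ _.
rewrite fineM ?fin_num_measure //; last exact: measurableI.
congr (_ * _); rewrite -[A `&` _]setIT -integral_indic //; last exact: measurableI.
congr fine; apply: eq_integral => w _; congr EFin; rewrite indicE in_setI /S.
rewrite indicE [in RHS]mulrC; case: (boolP (w \in A)) => Aw; rewrite ?mul0r //= mul1r.
case: (eqVneq (X t w) i) => [E|/eqP nE]; last by rewrite memNset ?mul0r // => -[].
case: (eqVneq (X (t + u n) w) j) => [E'|/eqP nE]; last by rewrite memNset ?mulr0 // => -[].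
by rewrite mem_set ?mulr1.
Qed.

(** The axiom gives the limit for events of the history. [G] is approximated on [B] by a step
    function whose finitely many level sets are such events; the error in the difference quotients
    is at most eps times the quotient of [B], which converges. *)
Lemma rate_lipc (G : (Lambda -> R) -> R) : lipc T0 G ->
  In (fun w => G (L t w)) n @[n --> \oo] --> J (fun w => G (L t w)).
Proof.
move=> lG; have [C C0 GC] := lipc_bounded i lG (lexx 0).
have Lp w k : - 0 <= L t w k by rewrite oppr0; exact: (local_time_ge0 XL).
have hL : measurable_fun (setT : set (g_sigma_algebraType (history_gen X L0 t)))
    (fun w => \sum_k L t w k).
  by apply: measurable_sum => k; exact: local_time_history XL _ _ t0.
have hG : measurable_fun (setT : set (g_sigma_algebraType (history_gen X L0 t)))
    (fun w => G (L t w)).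
  apply: measurable_pcontinuous; first exact: lipc_pcontinuous lG.
  by move=> k; exact: local_time_history XL _ _ t0.
have hB : history X L0 t B.
  have := hL measurableT _ (measurable_itv `]-oo, T0[); rewrite setTI.
  rewrite (_ : _ @^-1` _ = B) //; apply/seteqP; split=> w /=; rewrite in_itv //=.
have mG : measurable_fun setT (fun w => G (L t w)).
  apply: measurable_pcontinuous; first exact: lipc_pcontinuous lG.
  by move=> k; exact: local_time_measurable XL _ _ t0.
have mB : measurable_fun setT (\1_B : T -> R) by apply: measurable_indic; exact: history_measurable hB.
have B1 w : `|\1_B w : R| <= 1 * \1_B w.
  by rewrite mul1r ger0_norm // indicE.
have B1' w : `|\1_B w : R| <= 1 by rewrite indicE; case: (_ \in _); rewrite ?normr0 ?normr1.
have cB := rate_set hB (@subset_refl _ B).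
have GB w : ~ B w -> G (L t w) = 0.
  by move=> /negP; rewrite -leNgt => Tw; case: lG => G0 _; exact: G0.
have GCB w : `|G (L t w)| <= C * \1_B w.
  rewrite indicE; have [/set_mem Bw|/negP nBw] := boolP (w \in B); first by rewrite mulr1 GC.
  by rewrite GB ?normr0 ?mulr0 // => Bw; apply: nBw; rewrite inE.
have JB0 : 0 <= J (\1_B).
  by apply: Rintegral_ge0 => w _; rewrite mulr_ge0.
apply/cvgrPdist_le => e e0.
(* The three errors at the end add up to eps times this denominator. *)
pose eps : R := e / (J (\1_B) *+ 2 + 2).
have den0 : 0 < J (\1_B) *+ 2 + 2 by rewrite ltr_wpDl // mulrn_wge0.
have eps0 : 0 < eps by rewrite divr_gt0.
(* All values of [G / eps] on [B] lie between 1 - K and K - 1, so the levels k - K with k < 2 K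
   suffice. *)
pose K : nat := (Num.truncn (C / eps)).+2.
have CK : C / eps + 1 < K%:R.
  by rewrite /K -natr1 ltrD2r; have /andP[_] := truncn_itv (divr_ge0 C0 (ltW eps0)).
pose fl w : int := Num.floor (G (L t w) / eps).
pose A (k : nat) : set T := B `&` [set w | fl w = k%:Z - K%:Z].
have hA (k : nat) : history X L0 t (A k).
  have := @measurableI _ (g_sigma_algebraType (history_gen X L0 t)) B [set w | fl w = k%:Z - K%:Z] hB.
  have hGe : measurable_fun (setT : set (g_sigma_algebraType (history_gen X L0 t)))
    (fun w => G (L t w) / eps) by apply: measurable_funM.
  apply; have := hGe measurableT _ (measurable_itv `[(k%:Z - K%:Z)%:~R, (k%:Z - K%:Z + 1)%:~R[).
  rewrite setTI.
  rewrite (_ : _ @^-1` _ = [set w | fl w = k%:Z - K%:Z]) //.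
  by apply/seteqP; split=> w /=; rewrite in_itv /= -floor_eq => /eqP.
pose a (k : nat) : R := eps * (k%:Z - K%:Z)%:~R.
pose Ge w : R := \sum_(k < K.*2) a k * \1_(A k) w.
have mA (k : nat) : measurable_fun setT (\1_(A k) : T -> R).
  by apply: measurable_indic; exact: history_measurable (hA k).
have A1 (k : nat) w : `|\1_(A k) w : R| <= 1 * \1_B w.
  rewrite mul1r !indicE; have [/set_mem[Bw _]|] := boolP (w \in A k); last by rewrite normr0; case: (_ \in _).
  by rewrite normr1 mem_set.
have A1' (k : nat) w : `|\1_(A k) w : R| <= 1 by rewrite indicE; case: (_ \in _); rewrite ?normr0 ?normr1.
have GGe w : `|G (L t w) - Ge w| <= eps * \1_B w.
  rewrite indicE; have [/set_mem Bw|/negP nBw] := boolP (w \in B); last first.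
    rewrite GB; last by move=> Bw; apply: nBw; rewrite inE.
    rewrite /Ge big1 ?subrr ?normr0 ?mulr0 // => k _; rewrite indicE memNset ?mulr0 // => -[Bw _].
    by apply: nBw; rewrite inE.
  have /andP[f1 f2] := floor_itv (G (L t w) / eps); rewrite -/(fl w) in f1 f2.
  have := GC _ (Lp w); rewrite ler_norml => /andP[G1 G2].
  have fK : - K%:Z <= fl w.
    rewrite -(ler_int R) mulrNz -pmulrn; rewrite intrD mulr1z in f2.
    have : - (C / eps) <= G (L t w) / eps by rewrite -mulNr ler_pM2r ?invr_gt0.
    by move=> ?; lra.
  have fK2 : fl w < K%:Z.
    rewrite -(ltr_int R); apply: le_lt_trans f1 _.
    have : G (L t w) / eps <= C / eps by rewrite ler_pM2r ?invr_gt0.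
    by rewrite -pmulrn => ?; lra.
  have [k kE kK] := int_offset fK fK2.
  rewrite /Ge (bigD1 (Ordinal kK)) //= big1 ?addr0 => [|k' kk']; last first.
    rewrite indicE memNset ?mulr0 // => -[_ /=]; rewrite kE => E.
    by case/eqP: kk'; apply: val_inj; case/addIr: E.
  rewrite indicE mem_set ?mulr1; last by split.
  rewrite /a -kE; rewrite intrD mulr1z in f2.
  have -> : G (L t w) - eps * (fl w)%:~R = eps * (G (L t w) / eps - (fl w)%:~R).
    by rewrite mulrBr mulrCA divff ?mulr1 // gt_eqF.
  rewrite normrM (gtr0_norm eps0) -[leRHS]mulr1 ler_pM2l // ger0_norm ?subr_ge0 //.
  by lra.
have mGe : measurable_fun setT Ge.
  by apply: measurable_sum => k; apply: measurable_funM.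
have JGe : J Ge = \sum_(k < K.*2) a k * J (\1_(A k)).
  under [RHS]eq_bigr => k _ do rewrite -RintegralZl ?(iW (mA k) ler01 (A1 k)) //.
  rewrite -Rintegral_sum //; last by move=> k; apply: rintegrableZ => //; exact: iW (mA k) ler01 (A1 k).
  by apply: eq_Rintegral => w _; rewrite mulr_sumr; apply: eq_bigr => k _; rewrite mulrCA.
have InGe n : In Ge n = \sum_(k < K.*2) a k * In (\1_(A k)) n.
  under [RHS]eq_bigr => k _ do rewrite mulrCA -RintegralZl ?(iS n (mA k) (A1' k)) //.
  have iSA (k : nat) : P.-integrable setT (EFin \o (fun w => a k * (S n w * \1_(A k) w))).
    have iSk := iS n (mA k) (A1' k).
    exact: (rintegrableZ measurableT (a k) iSk).
  rewrite -mulr_sumr -Rintegral_sum //.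
  congr (_ * _); apply: eq_Rintegral => w _; rewrite mulr_sumr; apply: eq_bigr => k _.
  by rewrite mulrCA.
have cGe : In Ge n @[n --> \oo] --> J Ge.
  rewrite JGe (funext InGe); apply: cvg_sumr => k _; apply: cvgM; first exact: cvg_cst.
  by apply: rate_set => // w [].
have GeC w : `|Ge w| <= (C + eps) * \1_B w.
  rewrite (_ : Ge w = G (L t w) - (G (L t w) - Ge w)); last by rewrite opprB addrC subrK.
  by rewrite (le_trans (ler_normB _ _)) // mulrDl lerD.
have Ce0 : 0 <= C + eps by rewrite addr_ge0 // ltW.
have JG : `|J (fun w => G (L t w)) - J Ge| <= eps * J (\1_B).
  have i1 := iW mG C0 GCB; have i2 := iW mGe Ce0 GeC.
  rewrite /J -RintegralB // (le_trans (le_normr_Rintegral _ (rintegrableB _ i1 i2))) //.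
  rewrite -RintegralZl ?(iW mB ler01 B1) //.
  apply: le_Rintegral => //; first exact/rintegrable_abs/rintegrableB.
    by apply: rintegrableZ => //; exact: iW mB ler01 B1.
  move=> w _; rewrite -mulrBr normrM (ger0_norm (W_ge0 w)) mulrCA ler_wpM2l //.
have InG n : `|In (fun w => G (L t w)) n - In Ge n| <= eps * In (\1_B) n.
  have GeC' w : `|Ge w| <= C + eps.
    by rewrite (le_trans (GeC w)) // -[leRHS]mulr1 ler_wpM2l // indicE; case: (_ \in _).
  have i1 := iS n mG (fun w => GC _ (Lp w)); have i2 := iS n mGe GeC'.
  rewrite /In -mulrBr normrM ger0_norm ?invr_ge0 ?(ltW (u0 n)) // mulrCA ler_wpM2l ?invr_ge0 ?(ltW (u0 n)) //.
  rewrite -RintegralB // (le_trans (le_normr_Rintegral _ (rintegrableB _ i1 i2))) //.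
  rewrite -RintegralZl ?(iS n mB B1') //.
  apply: le_Rintegral => //; first exact/rintegrable_abs/rintegrableB.
    have iSB := iS n mB B1'; exact: (rintegrableZ measurableT eps iSB).
  move=> w _; rewrite -mulrBr normrM mulrCA.
  have S0 : 0 <= S n w by rewrite /S mulr_ge0.
  by rewrite (ger0_norm S0) ler_wpM2l.
near=> n.
have n1 : `|J (\1_B) - In (\1_B) n| <= 1 by near: n; move/cvgrPdist_le: cB; apply.
have n2 : `|J Ge - In Ge n| <= eps by near: n; move/cvgrPdist_le: cGe; apply.
have -> : J (fun w => G (L t w)) - In (fun w => G (L t w)) n =
  (J (fun w => G (L t w)) - J Ge) + (J Ge - In Ge n) - (In (fun w => G (L t w)) n - In Ge n) by ring.
rewrite (le_trans (ler_normB _ _)) // (le_trans (lerD (ler_normD _ _) (InG n))) //.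
apply: (@le_trans _ _ (eps * J (\1_B) + eps + eps * (J (\1_B) + 1))).
  apply: lerD; first exact: lerD.
  rewrite ler_wpM2l ?(ltW eps0) //; move: n1; rewrite ler_norml => /andP[]; lra.
have -> : eps * J (\1_B) + eps + eps * (J (\1_B) + 1) = eps * (J (\1_B) *+ 2 + 2) by ring.
by rewrite /eps divfK // gt_eqF.
Unshelve. all: by end_near. Qed.

End rate.

Definition generator_part (g : Lambda -> (Lambda -> R) -> R) i (z : Lambda -> R) : R :=
  \sum_j beta i j * (z j * (g j z - g i z)).

Lemma generator_part_lipc T0 g i : (forall j, lipc T0 (g j)) -> lipc T0 (generator_part g i).
Proof.
move=> lg; apply: lipc_sum => j; apply: lipcZ; apply: lipc_mul_coord.
exact: lipcB.
Qed.

Lemma lipc_observable (i0 : Lambda) T0 (g : Lambda -> (Lambda -> R) -> R) :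
  (forall j, lipc T0 (g j)) -> exists C, observable C g.
Proof.
move=> lg; have H j : exists C, 0 <= C /\ (forall z, (forall k, 0 <= z k) -> `|g j z| <= C) /\
    (forall z z', (forall k, 0 <= z k) -> (forall k, 0 <= z' k) -> `|g j z - g j z'| <= C * ldist z z').
  have [C C0 HC] := lipc_bounded i0 (lg j) (lexx 0).
  have [D D0 HD] := (proj2 (lg j)) 0 (lexx 0).
  exists (C + D); split; first exact: addr_ge0.
  split=> [z z0|z z' z0 z'0].
    by rewrite (le_trans (HC z _)) ?lerDl // => k; rewrite oppr0.
  rewrite (le_trans (HD z z' _ _)) // => [k|k|]; rewrite ?oppr0 //.
  by rewrite ler_wpM2r ?ldist_ge0 // lerDr.
have [C HC] := choice H; exists (\sum_j C j).
have CC j : C j <= \sum_j C j.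
  by rewrite (bigD1 j) //= lerDl sumr_ge0 // => k _; case: (HC k).
split=> [|j|j z z0|j z z' z0 z'0].
- by apply: sumr_ge0 => j _; case: (HC j).
- exact: lipc_pcontinuous (lg j).
- by apply: (le_trans _ (CC j)); case: (HC j) => _ [+ _]; exact.
- case: (HC j) => _ [_ /(_ z z' z0 z'0) H']; apply: (le_trans H').
  by rewrite ler_wpM2r ?ldist_ge0.
Qed.

Section forward.
Variables (T0 : R) (g h : Lambda -> (Lambda -> R) -> R).
Hypotheses (lg : forall j, lipc T0 (g j)) (lh : forall j, lipc T0 (h j)).
Hypothesis dg : forall j z, is_derive (0 : R) 1 (fun r => g j (shift z j r)) (- h j z).

Let F i z := generator_part g i z - h i z.

Let lF i : lipc T0 (F i).
Proof. by apply: lipcB => //; exact: generator_part_lipc. Qed.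

Lemma mean_right_derivative t : 0 <= t ->
  (mean g s - mean g t) / (s - t) @[s --> t^'+] --> mean F t.
Proof.
move=> t0; have [i0 _] : exists w : Lambda, True.
  have [w _] : exists w : T, True by exists point.
  by exists (X 0 w).
have [C oC] := lipc_observable i0 lg; have [C0 cg bg lpg] := oC.
have [Ch oh] := lipc_observable i0 lh; have [Ch0 ch bh lph] := oh.
apply: cvg_rightP => v tv cv.
pose u n := v n - t; have u0 n : 0 < u n by rewrite subr_gt0.
have cu : u @ \oo --> (0 : R).
  have : u @ \oo --> t - t by apply: cvgB => //; exact: cvg_cst.
  by rewrite subrr.
have vE n : v n = t + u n by rewrite /u addrC subrK.
have v0 n : 0 <= v n by rewrite (le_trans t0) // ltW.
have Lp s w : 0 <= s -> forall k, 0 <= L s w k by move=> s0 k; exact: (local_time_ge0 XL).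
have ld n w : ldist (L t w) (L (v n) w) = u n by rewrite vE (ldist_local_time XL) // ltW.
(* The increment has three parts: the growth of the local times with the state frozen, the jump with
   the local times frozen, and a mixed remainder. The remainder is of order [u n] and vanishes
   unless the state has moved, so its quotient tends to 0. *)
pose D1 n w := g (X t w) (L (v n) w) - g (X t w) (L t w).
pose D2 n w := g (X (v n) w) (L t w) - g (X t w) (L t w).
pose D3 n w := (g (X (v n) w) (L (v n) w) - g (X (v n) w) (L t w)) - D1 n w.
have iX a b : 0 <= a -> 0 <= b -> P.-integrable setT (EFin \o (fun w => g (X a w) (L b w))).
  by move=> a0 b0; exact: (integrable_observable XL oC).
have i1 n : P.-integrable setT (EFin \o D1 n) by apply: rintegrableB => //; exact: iX.
have i2 n : P.-integrable setT (EFin \o D2 n) by apply: rintegrableB => //; exact: iX.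
have i3 n : P.-integrable setT (EFin \o D3 n).
  by apply: rintegrableB => //; apply: rintegrableB => //; exact: iX.
have E n : (mean g (v n) - mean g t) / (v n - t) =
    (u n)^-1 * \int[P]_w D1 n w + (u n)^-1 * \int[P]_w D2 n w + (u n)^-1 * \int[P]_w D3 n w.
  rewrite -/(u n) mulrC -!mulrDr; congr (_ * _).
  rewrite -(RintegralD measurableT (i1 n) (i2 n)).
  rewrite -(RintegralD measurableT (rintegrableD measurableT (i1 n) (i2 n)) (i3 n)).
  rewrite -(RintegralB measurableT (iX _ _ (v0 n) (v0 n)) (iX _ _ t0 t0)).
  by apply: eq_Rintegral => w _; rewrite /D1 /D2 /D3 /D1; ring.
rewrite (funext E).
pose S i j n w : R := (X t w == i)%:R * (X (t + u n) w == j)%:R.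
have c1 : (u n)^-1 * \int[P]_w D1 n w @[n --> \oo] --> \int[P]_w (- h (X t w) (L t w)).
  under eq_fun => n do rewrite -RintegralZl //.
  apply: (@Rdominated_cvg _ _ _ _ _ _ _ (cst C)) => //.
  - move=> n; apply: measurable_funM => //.
    by have /measurable_EFinP := measurable_int _ (i1 n).
  - apply: measurableT_comp => //.
    by have /measurable_EFinP := measurable_int _ (integrable_observable XL oh t0 t0).
  - move=> w _; have := der_right_seq (dg (X t w) (L t w)) u0 cu.
    apply: cvg_eq_near; have := near_right_seq (local_time_near XL w t0) u0 cu.
    by apply: filterS => n Ln; rewrite /D1 vE Ln shift0 mulrC.
  - exact: finite_measure_integrable_cst.
  - move=> n w _ /=; rewrite normrM gtr0_norm ?invr_gt0 // ler_pdivrMl // mulrC.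
    by rewrite (le_trans (lpg _ _ _ (Lp _ w (v0 n)) (Lp _ w t0))) // ldistC ld.
have c2 : (u n)^-1 * \int[P]_w D2 n w @[n --> \oo] --> \int[P]_w generator_part g (X t w) (L t w).
  pose G i j z := g j z - g i z.
  have lG i j : lipc T0 (G i j) by exact: lipcB.
  pose I i j n : R := (u n)^-1 * \int[P]_w (S i j n w * G i j (L t w)).
  pose J i j : R := \int[P]_w ((X t w == i)%:R * (beta i j * L t w j) * G i j (L t w)).
  have IJ i j : I i j n @[n --> \oo] --> J i j.
    have [<-|ij] := eqVneq i j; last exact: (rate_lipc t0 ij u0 cu (lG i j)).
    have G0 z : G i i z = 0 by rewrite /G subrr.
    rewrite (_ : J i i = 0); last by apply: Rintegral_eq0 => w _; rewrite G0 mulr0.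
    rewrite (_ : I i i = cst 0); first exact: cvg_cst.
    by apply/funext => n; rewrite /I Rintegral_eq0 ?mulr0 // => w _; rewrite G0 mulr0.
  have mS i j n : measurable_fun setT (S i j n).
    have tu : 0 <= t + u n by rewrite -vE.
    have := measurable_funM (measurable_state XL i t0) (measurable_state XL j tu); exact.
  have mG i j : measurable_fun setT (fun w => G i j (L t w)).
    apply: measurable_pcontinuous; first exact: lipc_pcontinuous (lG i j).
    by move=> k; exact: local_time_measurable XL _ _ t0.
  have iSG i j n : P.-integrable setT (EFin \o (fun w => S i j n w * G i j (L t w))).
    apply: (@rintegrable_bounded _ _ _ _ _ (1 * (C + C))); first exact: measurable_funM.
    move=> w; rewrite normrM ler_pM //.
      by rewrite /S; do 2 case: (_ == _); rewrite ?mulr0 ?mul0r ?mulr1 ?normr0 ?normr1.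
    by rewrite (le_trans (ler_normB _ _)) // lerD // bg //; exact: Lp.
  have bJ i j : P.-integrable setT
      (EFin \o (fun w => (X t w == i)%:R * (beta i j * L t w j) * G i j (L t w))).
    have lz : forall k, lipc T0 (fun z => beta i j * (z j * G i j z)) by move=> k; exact/lipcZ/lipc_mul_coord.
    have [D [D0 _ bD _]] := lipc_observable i0 lz.
    apply: (@rintegrable_bounded _ _ _ _ _ D).
      have mb : measurable_fun setT (fun w => beta i j * L t w j).
        by apply: measurable_funM => //; exact: local_time_measurable XL _ _ t0.
      have := measurable_funM (measurable_funM (measurable_state XL i t0) mb) (mG i j); exact.
    move=> w; have bw := bD i _ (Lp t w t0); rewrite -mulrA -mulrA.
    by case: (_ == _); [rewrite mulr1n mul1r|rewrite mulr0n mul0r normr0].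
  have EI n : (u n)^-1 * \int[P]_w D2 n w = \sum_i \sum_j I i j n.
    rewrite /I; under eq_bigr do rewrite -mulr_sumr; rewrite -mulr_sumr; congr (_ * _).
    under eq_bigr => i _ do rewrite -Rintegral_sum //.
    rewrite -Rintegral_sum //; last by move=> i; exact: rintegrable_sum.
    apply: eq_Rintegral => w _; rewrite /S -vE (bigD1 (X t w)) //= [X in _ = _ + X]big1 ?addr0; last first.
      by move=> i /negPf niX; rewrite big1 // => j _; rewrite eq_sym niX !mul0r.
    rewrite (bigD1 (X (v n) w)) //= [X in _ = _ + X]big1 ?addr0; last first.
      by move=> i /negPf niX; rewrite [_ == i]eq_sym niX mulr0 mul0r.
    by rewrite !eqxx !mul1r.
  have EJ : \int[P]_w generator_part g (X t w) (L t w) = \sum_i \sum_j J i j.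
    rewrite /J; under [RHS]eq_bigr => i _ do rewrite -Rintegral_sum //.
    rewrite -Rintegral_sum //; last by move=> i; exact: rintegrable_sum.
    apply: eq_Rintegral => w _; rewrite (bigD1 (X t w)) //= [X in _ = _ + X]big1 ?addr0; last first.
      by move=> i /negPf niX; rewrite big1 // => j _; rewrite eq_sym niX !mul0r.
    by apply: eq_bigr => j _; rewrite eqxx mul1r mulrA.
  rewrite EJ (funext EI); apply: cvg_sumr => i _; apply: cvg_sumr => j _; exact: IJ.
have c3 : (u n)^-1 * \int[P]_w D3 n w @[n --> \oo] --> (0 : R).
  have D3b n w : `|D3 n w| <= 2 * C * u n * moved X (v n) t w.
    rewrite /D3 /D1 /moved; case: eqVneq => [->|_]; first by rewrite subrr normr0 mulr0.
    rewrite mulr1 (le_trans (ler_normB _ _)) // mulrAC mulr2n mulrDl mul1r mulrDl.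
    by apply: lerD; rewrite (le_trans (lpg _ _ _ (Lp _ w (v0 n)) (Lp _ w t0))) // ldistC ld mulrC.
  have H : (fun n => 2 * C * prob_moved P X (v n) t) @ \oo --> 2 * C * 0.
    by apply: cvgM; [exact: cvg_cst|exact: (prob_moved_right XL)].
  rewrite mulr0 in H; apply/cvgrPdist_le => e e0; move/cvgrPdist_le: H => /(_ e e0).
  apply: filterS => n; rewrite !sub0r !normrN; apply: le_trans.
  rewrite [leRHS]ger0_norm; last by rewrite mulr_ge0 ?mulr_ge0 // prob_moved_ge0.
  rewrite normrM gtr0_norm ?invr_gt0 // ler_pdivrMl // mulrC mulrAC.
  rewrite (le_trans (le_normr_Rintegral _ (i3 n))) // /prob_moved -RintegralZl //; last first.
    exact: (integrable_moved XL).
  apply: le_Rintegral => //; first exact: rintegrable_abs.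
    by apply: rintegrableZ => //; exact: (integrable_moved XL).
have -> : mean F t = \int[P]_w (- h (X t w) (L t w)) + \int[P]_w generator_part g (X t w) (L t w) + 0.
  have lgen i : lipc T0 (generator_part g i) by exact: generator_part_lipc.
  have [Cg og] := lipc_observable i0 lgen.
  have ih := integrable_observable XL oh t0 t0; have ig := integrable_observable XL og t0 t0.
  have ih' : P.-integrable setT (EFin \o (fun w => - h (X t w) (L t w))).
    rewrite (_ : (fun w => _) = (fun w => -1 * h (X t w) (L t w))); first exact: rintegrableZ.
    by apply/funext => w; rewrite mulN1r.
  rewrite addr0 -(RintegralD measurableT ih' ig); apply: eq_Rintegral => w _.
  by rewrite /F addrC.
by apply: cvgD => //; apply: cvgD.
Qed.

(** At time [T0] the local times sum to at least [T0], so the final mean is 0 and only the initial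
    one remains. *)
Lemma dynkin : 0 <= T0 -> mean g 0 + \int[mu]_(t in `[0, T0]) mean F t = 0.
Proof.
move=> T00.
have [i0 _] : exists w : Lambda, True.
  have [w _] : exists w : T, True by exists point.
  by exists (X 0 w).
have [C oC] := lipc_observable i0 lg; have [D oD] := lipc_observable i0 lF.
have gT : mean g T0 = 0.
  apply: Rintegral_eq0 => w _; apply: (proj1 (lg _)).
  by rewrite (sum_local_time XL) // lerDr sumr_ge0 // => i _; exact/ltW/(vrjp_gt0 XL).
have := right_derivative_integral T00 (continuous_mean XL oC) (continuous_mean XL oD).
rewrite maxxx (max_l T00) gT => H.
have -> : \int[mu]_(t in `[0, T0]) mean F t = \int[mu]_(t in `[0, T0]) mean F (Num.max t 0).
  by apply: eq_Rintegral => t; rewrite inE /= in_itv /= => /andP[t0 _]; rewrite max_l.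
rewrite -H ?sub0r ?subrr // => t t0; rewrite (max_l t0).
apply: cvg_eq_near (mean_right_derivative t0); near=> s; rewrite max_l //.
by near: s; apply: filterS (nbhs_right_gt t) => s ts; rewrite ltW // (le_lt_trans t0).
Unshelve. all: by end_near. Qed.

End forward.
End Dynkin.

(** * Forms depending on the radii *)

Section MixedPartials.
Variables (R : realType) (I : finType).
Implicit Types (i j k : I) (x : I -> R) (g : (I -> R) -> R) (s : seq I).

Lemma pderivs_cat s1 s2 g : pderivs (s1 ++ s2) g = pderivs s1 (pderivs s2 g).
Proof. by rewrite /pderivs foldr_cat. Qed.

Lemma smooth_pderivs s g : smooth g -> smooth (pderivs s g).
Proof. by move=> sg s'; rewrite -pderivs_cat; exact: sg. Qed.

Lemma smooth_continuous s g : smooth g -> pcontinuous (pderivs s g).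
Proof. by move=> /(_ s)[]. Qed.

Lemma updK x k : upd x k (x k) = x.
Proof. by apply/funext => l; rewrite /upd /=; case: eqP => // ->. Qed.

Lemma updE x k (r : R) : upd x k r k = r.
Proof. by rewrite /upd /= eqxx. Qed.

Lemma upd_neq x k l (r : R) : l != k -> upd x k r l = x l.
Proof. by move=> /negPf lk; rewrite /upd /= lk. Qed.

Lemma upd_upd x k (r s : R) : upd (upd x k r) k s = upd x k s.
Proof. by apply/funext => l; rewrite /upd /=; case: eqP. Qed.

Lemma updC x i j (r s : R) : i != j -> upd (upd x i r) j s = upd (upd x j s) i r.
Proof.
move=> ij; apply/funext => l; rewrite /upd /=; have [->|//] := eqVneq l j.
by rewrite eq_sym (negPf ij).
Qed.

Lemma smooth_derive g s i x (r : R) : smooth g ->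
  is_derive r 1 (fun t => pderivs s g (upd x i t)) (pderivs (i :: s) g (upd x i r)).
Proof.
move=> sg; have [_ /(_ i (upd x i r))] := sg s; rewrite updE => Dg.
have E : (fun t : R => pderivs s g [eta upd x i r with i |-> t]) = (fun t => pderivs s g (upd x i t)).
  by apply/funext => t; rewrite -/(upd _ _ _) upd_upd.
rewrite E in Dg; apply: der_derive1 => //=.
by rewrite /pderiv updE E.
Qed.

Lemma second_difference g i j x (r : R) : smooth g -> i != j -> 0 < r ->
  exists a b : R, [/\ x i <= a <= x i + r, x j <= b <= x j + r &
    (g (upd (upd x i (x i + r)) j (x j + r)) - g (upd x i (x i + r))) -
    (g (upd x j (x j + r)) - g x) =
    pderivs [:: j; i] g (upd (upd x i a) j b) * r * r].
Proof.
move=> sg ij r0.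
pose f t := g (upd (upd x i t) j (x j + r)) - g (upd x i t).
pose df t := pderivs [:: i] g (upd (upd x i t) j (x j + r)) - pderivs [:: i] g (upd x i t).
have Df (t : R) : is_derive t 1 f (df t).
  apply: derB; last exact: (smooth_derive [::]).
  by under eq_fun do rewrite updC //; rewrite updC //; exact: (smooth_derive [::]).
have xr k : x k < x k + r by rewrite ltrDl.
have xrK k : x k + r - x k = r by rewrite addrAC subrr add0r.
have cf : {within `[x i, x i + r], continuous f}.
  by apply: continuous_subspaceT => t; exact: der_continuous (Df t).
have [a] := MVT (xr i) (fun t _ => Df t) cf.
rewrite in_itv /= => /andP[/ltW a1 /ltW a2]; rewrite xrK {1 2}/f updK => fE.
pose h t := pderivs [:: i] g (upd (upd x i a) j t).
have Dh (t : R) : is_derive t 1 h (pderivs [:: j; i] g (upd (upd x i a) j t)).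
  exact: (smooth_derive [:: i]).
have ch : {within `[x j, x j + r], continuous h}.
  by apply: continuous_subspaceT => t; exact: der_continuous (Dh t).
have [b] := MVT (xr j) (fun t _ => Dh t) ch.
rewrite in_itv /= => /andP[/ltW b1 /ltW b2]; rewrite xrK => hE.
exists a, b; split; rewrite ?a1 ?b1 // fE /df; congr (_ * _); rewrite -hE /h.
congr (_ - _); congr (pderivs _ _ _).
have ji : j != i by rewrite eq_sym.
by rewrite -[in RHS](upd_neq x a ji) updK.
Qed.

Let difference_eq (a b r A B C D : R) : r != 0 -> a * r * r = (A - B) - (C - D) ->
  b * r * r = (A - C) - (B - D) -> a = b.
Proof. by move=> r0 E1 E2; apply: (mulIf r0); apply: (mulIf r0); rewrite E1 E2; ring. Qed.

(** Schwarz's theorem: the second difference over a small square is symmetric in the two directions,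
    and each of the mixed derivatives represents it at some point of the square. *)
Lemma pderivC g i j : smooth g -> pderiv i (pderiv j g) = pderiv j (pderiv i g).
Proof.
move=> sg; have [->//|ij] := eqVneq i j; apply/funext => x.
have ji : j != i by rewrite eq_sym.
pose r n : R := n.+1%:R^-1; have r0 n : 0 < r n by rewrite invr_gt0 ltr0n.
have /choice[ab abP] : forall n, exists ab : R * R,
    [/\ x i <= ab.1 <= x i + r n, x j <= ab.2 <= x j + r n &
    pderivs [:: j; i] g (upd (upd x i ab.1) j ab.2) * r n * r n =
    (g (upd (upd x i (x i + r n)) j (x j + r n)) - g (upd x i (x i + r n))) -
    (g (upd x j (x j + r n)) - g x)].
  by move=> n; have [a [b [? ? ->]]] := second_difference x sg ij (r0 n); exists (a, b).
have /choice[cd cdP] : forall n, exists cd : R * R,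
    [/\ x j <= cd.1 <= x j + r n, x i <= cd.2 <= x i + r n &
    pderivs [:: i; j] g (upd (upd x j cd.1) i cd.2) * r n * r n =
    (g (upd (upd x j (x j + r n)) i (x i + r n)) - g (upd x j (x j + r n))) -
    (g (upd x i (x i + r n)) - g x)].
  by move=> n; have [a [b [? ? ->]]] := second_difference x sg ji (r0 n); exists (a, b).
have cr : r @ \oo --> (0 : R) by exact: cvg_harmonic.
have near_x (c : nat -> R) k : (forall n, x k <= c n <= x k + r n) -> c @ \oo --> x k.
  move=> H; apply: (squeeze_cvgr _ (cvg_cst (x k)) (_ : (fun n => x k + r n) @ \oo --> x k)).
    by near=> n; exact: H.
  by rewrite -[X in _ --> X]addr0; apply: cvgD cr; exact: cvg_cst.
have upd_cvg (c d : nat -> R) k l : c @ \oo --> x k -> d @ \oo --> x l ->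
    forall m, upd (upd x k (c n)) l (d n) m @[n --> \oo] --> x m.
  move=> ck dl m; rewrite /upd /=; have [->//|_] := eqVneq m l.
  by have [->//|_] := eqVneq m k; exact: cvg_cst.
have c1 : pderivs [:: j; i] g (upd (upd x i (ab n).1) j (ab n).2) @[n --> \oo] --> pderivs [:: j; i] g x.
  apply: pcontinuous_cvg; first exact: smooth_continuous.
  by apply: upd_cvg; apply: near_x => n; case: (abP n).
have c2 : pderivs [:: i; j] g (upd (upd x j (cd n).1) i (cd n).2) @[n --> \oo] --> pderivs [:: i; j] g x.
  apply: pcontinuous_cvg; first exact: smooth_continuous.
  by apply: upd_cvg; apply: near_x => n; case: (cdP n).
have E n : pderivs [:: j; i] g (upd (upd x i (ab n).1) j (ab n).2) =
    pderivs [:: i; j] g (upd (upd x j (cd n).1) i (cd n).2).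
  case: (abP n) (cdP n) => [_ _ E1] [_ _ E2].
  rewrite (updC x (x i + r n) (x j + r n) ij) in E1; apply: (difference_eq _ E1 E2).
  by rewrite gt_eqF.
by rewrite (funext E) in c1; exact: (cvg_unique _ c2 c1).
Unshelve. all: by end_near. Qed.

(** [gapp] lists the variables in the order of the enumeration, whereas a further derivative is put
    in front; symmetry of mixed derivatives reconciles the two. *)
Lemma pderivs_insert g (S : pred I) k s : smooth g -> uniq s -> k \in s -> ~~ S k ->
  pderivs [seq j <- s | (j == k) || S j] g = pderiv k (pderivs [seq j <- s | S j] g).
Proof.
move=> sg; elim: s => //= j s IH /andP[js us]; rewrite inE => /orP[/eqP kj|ks] nSk.
  rewrite -kj eqxx (negPf nSk) /=; congr (pderiv k (pderivs _ g)).
  by apply: eq_in_filter => l ls; case: eqP ls => // ->; rewrite kj (negPf js).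
have -> : (j == k) = false by apply: contraNF js => /eqP ->.
case: (S j) => /=; last exact: IH.
by rewrite (IH us ks nSk); exact: (pderivC j k (smooth_pderivs _ sg)).
Qed.

End MixedPartials.

(** * Functions of forms with square-zero nilpotent part *)

Section GrassmannFunctions.
Local Close Scope classical_set_scope.
Local Open Scope set_scope.
Variables (R : realType) (I J : finType).
Implicit Types (F : grassmann R I) (g : (J -> R) -> R) (h : R -> R).

(** When the nilpotent parts square to 0, only multi-indices with entries 0 and 1 contribute, and
    these are subsets. *)
Lemma gapp_sq0 g (Fs : J -> grassmann R I) :
  (forall j, (Fs j - (body (Fs j))%:A) ^+ 2 = 0) -> (J -> 0 < #|I|)%N ->
  gapp g Fs = \sum_(S : {set J}) pderivs [seq j <- enum J | j \in S] g (fun j => body (Fs j)) *: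
    \prod_(j in S) (Fs j - (body (Fs j))%:A).
Proof.
move=> N2 JI; rewrite /gapp (bigID (fun al : {ffun J -> 'I_#|I|.+1} => [forall j, al j < 2]%N)) /=.
rewrite [X in _ + X]big1 ?addr0; last first.
  move=> al /forallPn[j]; rewrite -leqNgt => al2.
  suff -> : \prod_j (Fs j - (body (Fs j))%:A) ^+ al j = 0 by rewrite scaler0.
  have : j \in index_enum J by rewrite mem_index_enum.
  move: (index_enum J) => s; elim: s => // j' s IH; rewrite inE big_cons => /orP[/eqP <-|/IH ->].
    by rewrite -(subnKC al2) exprD N2 mul0r mul0r.
  by rewrite mulr0.
(* If [J] has an element there is at least one generator, so 1 is a legal index and [inord] does not
   change it. *)
pose al (S : {set J}) : {ffun J -> 'I_#|I|.+1} := [ffun j => inord (j \in S)].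
have alE S j : al S j = (j \in S) :> nat.
  by rewrite ffunE inordK //; case: (j \in S) => //=; rewrite ltnS; exact: JI.
rewrite (reindex_onto al (fun al => [set j | al j == 1 :> nat])) /=; last first.
  move=> a /forallP a2; apply/ffunP => j; apply: val_inj; rewrite /= alE inE.
  by case: (nat_of_ord (a j)) (a2 j) => [|[]].
apply: eq_big => [S|S _].
  have -> : [forall j, al S j < 2]%N by apply/forallP => j; rewrite alE; case: (_ \in _).
  by apply/eqP/finset.setP => j; rewrite inE alE; case: (_ \in _).
have -> : \prod_j (al S j)`! = 1%N by rewrite big1 // => j _; rewrite alE; case: (_ \in _).
rewrite divr1; congr (pderivs _ _ _ *: _).
  by elim: (enum J) => //= j s ->; rewrite alE; case: (_ \in _).
rewrite [RHS]big_mkcond; apply: eq_bigr => j _; rewrite alE; case: (_ \in _); rewrite ?expr1 ?expr0 //.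
Qed.

End GrassmannFunctions.

Section GrassmannFunctions1.
Local Close Scope classical_set_scope.
Local Open Scope set_scope.
Variables (R : realType) (I : finType).
Implicit Types (F N : grassmann R I) (h : R -> R).

Lemma gapp1_sq0 h (b : R) N : body N = 0 -> N ^+ 2 = 0 -> (0 < #|I|)%N ->
  gapp1 h (b%:A + N) = (h b)%:A + derive1 h b *: N.
Proof.
move=> N0 N2 I0; have bE : body (b%:A + N) = b by rewrite bodyD bodyA N0 addr0.
rewrite /gapp1 gapp_sq0 // => [|_]; last by rewrite bE addrAC subrr add0r.
rewrite (bigD1 finset.set0) //= (bigD1 [set tt]) /=; last by apply/finset.set0Pn; exists tt; rewrite inE.
rewrite [X in _ + (_ + X)]big1 ?addr0; last first.
  move=> S /andP[/finset.set0Pn[[] S1] /eqP[]]; apply/finset.setP => -[]; by rewrite S1 inE.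
have unitE : enum (unit : finType) = [:: tt] by rewrite enumT unlock.
rewrite unitE /= !inE /= /pderiv big_set0 big_set1 bE addrAC subrr add0r.
by have -> : (fun t : R => h ([eta fun=> b with tt |-> t] tt)) = h by [].
Qed.

Lemma gapp1_expR F : gapp1 expR F = expR (body F) *: gexp (F - (body F)%:A).
Proof.
rewrite /gapp1 /gapp /gexp scaler_sumr.
rewrite (reindex (fun m : 'I_#|I|.+1 => [ffun _ : unit => m])) /=; last first.
  by exists (fun al => al tt) => [m|al] _; rewrite ?ffunE //; apply/ffunP => -[]; rewrite ffunE.
apply: eq_bigr => m _.
have unitE : enum (unit : finType) = [:: tt] by rewrite enumT unlock.
have prodT (f : unit -> grassmann R I) : \prod_j f j = f tt.
  have idxE : index_enum (unit : finType) = [:: tt] by rewrite /index_enum locked_withE -enumT.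
  by rewrite idxE big_seq1.
rewrite unitE /= cats0 ffunE scalerA prodT.
have -> : (\prod_(j : unit) ([ffun=> m] j)`! = m`!)%N.
  by rewrite (bigD1 tt) //= big1 ?muln1 ?ffunE // => -[].
rewrite ffunE; congr (_ / _ *: _).
elim: (nat_of_ord m) => // n IH.
have {}IH : forall v : unit -> R, pderivs (nseq n tt) (fun v => expR (v tt)) v = expR (v tt).
  elim: n {IH} => // n IH v /=; rewrite /pderiv (funext (fun t => IH [eta v with tt |-> t])) /=.
  by rewrite derive1E derive_val.
by rewrite /= /pderiv (funext (fun t => IH _)) /= derive1E derive_val.
Qed.

End GrassmannFunctions1.

(** * Derivatives and limits of Grassmann-valued functions *)

Section GrassmannCalculus.
Variables (R : realType) (I : finType).
Implicit Types (F G : R -> grassmann R I) (dF dG : grassmann R I) (t : R).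

Definition gderive t F dF := forall A, is_derive t 1 (fun s => F s A) (dF A).

Lemma gderive_cst t (c : grassmann R I) : gderive t (fun=> c) 0.
Proof. by move=> A; rewrite ffunE; exact: der_cst. Qed.

Lemma gderiveD t F G dF dG : gderive t F dF -> gderive t G dG ->
  gderive t (fun s => F s + G s) (dF + dG).
Proof.
move=> Ff Gg A; rewrite ffunE; under eq_fun do rewrite ffunE; exact: derD.
Qed.

Lemma gderive_sum t (J : Type) (r : seq J) (F : J -> R -> grassmann R I)
    (dF : J -> grassmann R I) :
  (forall j, gderive t (F j) (dF j)) ->
  gderive t (fun s => \sum_(j <- r) F j s) (\sum_(j <- r) dF j).
Proof.
move=> Ff; elim: r => [|j r IH].
  by under [X in gderive _ X]eq_fun do rewrite big_nil; rewrite big_nil; exact: gderive_cst.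
under [X in gderive _ X]eq_fun do rewrite big_cons; rewrite big_cons.
by apply: gderiveD.
Qed.

Lemma gderiveZ t (c : R -> R) (dc : R) F dF : is_derive t 1 c dc -> gderive t F dF ->
  gderive t (fun s => c s *: F s) (dc *: F t + c t *: dF).
Proof.
move=> cc Ff A; rewrite ffunE !grassmannZ; under eq_fun do rewrite grassmannZ.
by apply: derM.
Qed.

Lemma gderiveZA t (c : R -> R) (dc : R) : is_derive t 1 c dc ->
  gderive t (fun s => (c s)%:A) dc%:A.
Proof. by move=> cc; have := gderiveZ cc (gderive_cst t 1); rewrite scaler0 addr0. Qed.

Lemma gderiveB t F G dF dG : gderive t F dF -> gderive t G dG ->
  gderive t (fun s => F s - G s) (dF - dG).
Proof.
move=> Ff Gg A; rewrite !ffunE; under eq_fun do rewrite !ffunE.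
exact: (derB (Ff A) (Gg A)).
Qed.

Lemma gderiveM t F G dF dG : gderive t F dF -> gderive t G dG ->
  gderive t (fun s => F s * G s) (dF * G t + F t * dG).
Proof.
move=> Ff Gg A; rewrite ffunE !grassmannM -big_split /=.
under eq_fun do rewrite grassmannM big_mkcond; rewrite big_mkcond.
apply: der_sum => B; case: ifP => _; last exact: der_cst.
under eq_fun do rewrite -mulrA; rewrite -!mulrA -mulrDr.
by apply: derZ; apply: derM.
Qed.

Lemma gderiveX t F dF m : geven (F t) -> gderive t F dF ->
  gderive t (fun s => F s ^+ m) (m%:R *: (dF * F t ^+ m.-1)).
Proof.
move=> [cF _] Ff; elim: m => [|m IH].
  by rewrite scale0r; under [X in gderive _ X]eq_fun do rewrite expr0; exact: gderive_cst.
under [X in gderive _ X]eq_fun do rewrite exprS.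
have := gderiveM Ff IH; congr gderive; rewrite -scalerAr cF -mulrA -exprSr.
case: m {IH} => [|m] /=; first by rewrite expr0 scale0r addr0 scale1r.
by rewrite -[X in X + _]scale1r -scalerDl -mulrS.
Qed.

Lemma gderive_gexp t F dF : geven (F t) -> body (F t) = 0 -> body dF = 0 ->
  gderive t F dF -> gderive t (fun s => gexp (F s)) (dF * gexp (F t)).
Proof.
move=> eF F0 dF0 Ff; rewrite /gexp.
(* Both [dF] and [F t] have zero body, so the product has order above [#|I|]. This covers the last
   term of [gexp (F t)]. *)
have dFK : dF * F t ^+ #|I| = 0.
  apply: (@gorder_eq0 _ _ (1 + 1 * #|I|)); first by rewrite mul1n add1n.
  by apply: gorderM; [exact: gorder1|apply/gorderX/gorder1].
have D (m : 'I_#|I|.+1) : gderive t (fun s => (m`!%:R)^-1 *: F s ^+ m)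
    ((m`!%:R)^-1 *: (m%:R *: (dF * F t ^+ m.-1))).
  have := gderiveZ (der_cst (m`!%:R)^-1 t) (gderiveX m eF Ff).
  by rewrite scale0r add0r.
have := gderive_sum (index_enum _) D; congr gderive.
rewrite big_ord_recl scale0r scaler0 add0r big_ord_recr /= mulrDr -scalerAr dFK scaler0 addr0.
rewrite mulr_sumr; apply: eq_bigr => i _; rewrite -scalerAr scalerA; congr (_ *: _).
by rewrite /bump /= add1n factS natrM invfM mulrAC mulVf ?mul1r // pnatr_eq0.
Qed.

Definition gcvg (Z : Type) (F : set_system Z) (u : Z -> grassmann R I) (l : grassmann R I) :=
  forall A, u z A @[z --> F] --> l A.

Section gcvg.
Variables (Z : Type) (F : set_system Z).
Hypothesis FF : Filter F.
Implicit Types (u v : Z -> grassmann R I) (l m : grassmann R I).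

Lemma gcvg_cst l : gcvg F (fun=> l) l.
Proof. by move=> A; exact: cvg_cst. Qed.

Lemma gcvgD u v l m : gcvg F u l -> gcvg F v m -> gcvg F (fun z => u z + v z) (l + m).
Proof.
move=> ul vm A; rewrite ffunE; under eq_fun do rewrite ffunE.
by apply: (@cvgD _ R^o); [exact: ul|exact: vm].
Qed.

Lemma gcvgZ (c : Z -> R) (c0 : R) u l : c @ F --> c0 -> gcvg F u l ->
  gcvg F (fun z => c z *: u z) (c0 *: l).
Proof.
move=> cc ul A; rewrite grassmannZ; under eq_fun do rewrite grassmannZ.
by apply: cvgM; [exact: cc|exact: ul].
Qed.

Lemma gcvgM u v l m : gcvg F u l -> gcvg F v m -> gcvg F (fun z => u z * v z) (l * m).
Proof.
move=> ul vm A; rewrite grassmannM; under eq_fun do rewrite grassmannM.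
apply: cvg_sumr => B _; apply: cvgM; last exact: vm.
by apply: cvgM; [exact: cvg_cst|exact: ul].
Qed.

Lemma gcvg_sum (J : Type) (r : seq J) (P : pred J) (u : J -> Z -> grassmann R I)
    (l : J -> grassmann R I) : (forall j, P j -> gcvg F (u j) (l j)) ->
  gcvg F (fun z => \sum_(j <- r | P j) u j z) (\sum_(j <- r | P j) l j).
Proof.
move=> ul A; rewrite sum_ffunE; under eq_fun do rewrite sum_ffunE.
by apply: cvg_sumr => j Pj; exact: ul.
Qed.

Lemma gcvgX u l n : gcvg F u l -> gcvg F (fun z => u z ^+ n) (l ^+ n).
Proof.
move=> ul; elim: n => [|n IH]; first by rewrite expr0; exact: gcvg_cst.
by rewrite exprS; under [X in gcvg _ X]eq_fun do rewrite exprS; exact: gcvgM.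
Qed.

Lemma gcvg_gexp u l : gcvg F u l -> gcvg F (fun z => gexp (u z)) (gexp l).
Proof.
move=> ul; apply: gcvg_sum => m _; apply: gcvgZ; first exact: cvg_cst.
exact: gcvgX.
Qed.

Lemma gcvgZA (c : Z -> R) (c0 : R) : c @ F --> c0 -> gcvg F (fun z => (c z)%:A) c0%:A.
Proof. by move=> cc; apply: gcvgZ => //; exact: gcvg_cst. Qed.

Lemma gcvgB u v l m : gcvg F u l -> gcvg F v m -> gcvg F (fun z => u z - v z) (l - m).
Proof.
move=> ul vm; rewrite -[m]scale1r -scaleNr.
under [X in gcvg _ X]eq_fun do rewrite -[v _]scale1r -scaleNr.
by apply: gcvgD => //; apply: gcvgZ => //; exact: cvg_cst.
Qed.

End gcvg.
End GrassmannCalculus.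

(** * Forms that depend on q_k + 2 xi_k eta_k *)

Section SuperFunctions.
Variables (R : realType) (Lambda : finType).
Local Notation galg := (galg R Lambda).
Local Notation xi := (@gxi R Lambda).
Local Notation eta := (@geta R Lambda).
Local Notation xieta := (@xieta R Lambda).
Implicit Types (q : Lambda -> R) (i j k : Lambda) (G : (Lambda -> R) -> galg)
  (dG : Lambda -> (Lambda -> R) -> galg).

Definition positive q := forall k, 0 < q k.

(* Forms that depend on (z_k, x_k, y_k, xi_k, eta_k) only through
   q_k + 2 xi_k eta_k, where q_k = z_k^2 - x_k^2 - y_k^2: the derivative in
   eta_k is then determined by the derivative dG k in q_k. *)
Record superfunction G dG : Prop := SuperFunction {
  superfunction_even q : positive q -> geven (G q);
  superfunction_derive q k : positive q ->
    gderive (q k) (fun t => G (upd q k t)) (dG k q);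
  superfunction_eta q k : positive q -> gderiv (inr k) (G q) = - 2 *: (xi k * dG k q);
  superfunction_cvg q : positive q -> gcvg (nbhs (q : {ptws Lambda -> R})) G (G q);
  superfunction_dcvg q k : positive q ->
    gcvg (nbhs (q : {ptws Lambda -> R})) (dG k) (dG k q) }.

Lemma superfunctionM G1 dG1 G2 dG2 : superfunction G1 dG1 -> superfunction G2 dG2 ->
  superfunction (fun q => G1 q * G2 q) (fun k q => dG1 k q * G2 q + G1 q * dG2 k q).
Proof.
move=> [e1 d1 n1 c1 dc1] [e2 d2 n2 c2 dc2]; split=> [q q0|q k q0|q k q0|q q0|q k q0].
- by apply: gevenM; [exact: e1|exact: e2].
- by have := gderiveM (d1 q k q0) (d2 q k q0); rewrite updK.
- have [cG1 dG] := e1 q q0; rewrite dG n1 // n2 // mulrDr scalerDr -scalerAl -mulrA.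
  by rewrite -scalerAr !cG1 -mulrA.
- by apply: gcvgM; [exact: c1|exact: c2].
- apply: gcvgD; apply: gcvgM; [exact: dc1|exact: c2|exact: c1|exact: dc2].
Qed.

Lemma superfunctionZ (c : R) G dG : superfunction G dG ->
  superfunction (fun q => c *: G q) (fun k q => c *: dG k q).
Proof.
move=> [e1 d1 n1 c1 dc1]; split=> [q q0|q k q0|q k q0|q q0|q k q0].
- exact/gevenZ/e1.
- by have := gderiveZ (der_cst c (q k)) (d1 q k q0); rewrite scale0r add0r.
- by rewrite gderivZ n1 // -scalerAr !scalerA mulrC.
- by apply: gcvgZ; [exact: cvg_cst|exact: c1].
- by apply: gcvgZ; [exact: cvg_cst|exact: dc1].
Qed.

Lemma superfunction_sum (J : Type) (r : seq J) (G : J -> (Lambda -> R) -> galg)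
    (dG : J -> Lambda -> (Lambda -> R) -> galg) : (forall j : J, superfunction (G j) (dG j)) ->
  superfunction (fun q => \sum_(j <- r) G j q) (fun k q => \sum_(j <- r) dG j k q).
Proof.
move=> sG; split=> [q q0|q k q0|q k q0|q q0|q k q0].
- by apply: geven_sum => j _; exact: superfunction_even (sG j) _ q0.
- by apply: gderive_sum => j; exact: superfunction_derive (sG j) _ _ q0.
- rewrite gderiv_sum mulr_sumr scaler_sumr; apply: eq_bigr => j _.
  exact: superfunction_eta (sG j) _ _ q0.
- by apply: gcvg_sum => j _; exact: superfunction_cvg (sG j) _ q0.
- by apply: gcvg_sum => j _; exact: superfunction_dcvg (sG j) _ _ q0.
Qed.

(** The body is exponentiated separately because [gexp] is the exponential only on nilpotent
    arguments. *)
Lemma superfunction_exp G dG : superfunction G dG ->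
  let E q := expR (body (G q)) *: gexp (G q - (body (G q))%:A) in
  superfunction E (fun k q => dG k q * E q).
Proof.
move=> [e1 d1 n1 c1 dc1] E.
have N0 q : body (G q - (body (G q))%:A) = 0 by rewrite bodyD bodyN bodyA subrr.
have eN q : positive q -> geven (G q - (body (G q))%:A).
  by move=> q0; apply: gevenB; [exact: e1|exact: gevenZA].
have cE q : positive q -> gcvg (nbhs (q : {ptws Lambda -> R})) E (E q).
  move=> q0; apply: gcvgZ.
    by apply: continuous_cvg; [exact: continuous_expR|exact: c1].
  by apply: gcvg_gexp; apply: gcvgB; [exact: c1|apply: gcvgZA; exact: c1].
split=> [q q0|q k q0|q k q0|q q0|q k q0].
- exact/gevenZ/geven_gexp/eN.
- have db : is_derive (q k) 1 (fun t => body (G (upd q k t))) (body (dG k q)) by exact: d1.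
  have dN := gderiveB (d1 q k q0) (gderiveZA db).
  have := gderiveZ (der_expR db) (gderive_gexp _ _ _ dN); rewrite updK => H.
  have := H (eN q q0) (N0 q); rewrite bodyD bodyN bodyA subrr => /(_ erefl); congr gderive.
  rewrite /E -scalerAr mulrBl scalerBr addrC -addrA -scalerAl mul1r scalerA mulrC.
  by rewrite addNr addr0.
- have [cN dN] := eN q q0.
  rewrite gderivZ gderiv_gexp // gderivD gderivN gderivA subr0 n1 // /E.
  by rewrite -scalerAl -!scalerAr !scalerA mulrA; congr (_ *: _); rewrite mulrC.
- exact: cE.
- by apply: gcvgM; [exact: dc1|exact: cE].
Qed.

Lemma cvg_coord_comp (phi : R -> R) q i : {for q i, continuous phi} ->
  phi (q' i) @[q' --> (q : {ptws Lambda -> R})] --> phi (q i).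
Proof. by move=> cphi; apply: (cvg_comp _ _ (@cvg_coord _ _ q i)); exact: cphi. Qed.

(* The form phi (q_i + 2 xi_i eta_i), with psi = 2 phi'. *)
Lemma superfunction1 (phi psi dpsi : R -> R) i :
  (forall t : R, 0 < t -> is_derive t 1 phi (psi t / 2)) ->
  (forall t : R, 0 < t -> is_derive t 1 psi (dpsi t)) ->
  (forall t : R, 0 < t -> {for t, continuous dpsi}) ->
  superfunction (fun q => (phi (q i))%:A + psi (q i) *: xieta i)
    (fun k q => (k == i)%:R *: ((psi (q i) / 2)%:A + dpsi (q i) *: xieta i)).
Proof.
move=> dphi ddpsi cdpsi.
have cpsi (t : R) : 0 < t -> {for t, continuous psi} by move=> t0; exact: der_continuous (ddpsi t t0).
split=> [q q0|q k q0|q k q0|q q0|q k q0].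
- by apply: gevenD; [exact: gevenZA|exact/gevenZ/geven_xieta].
- have [->|ki] := eqVneq k i.
    rewrite scale1r; under [X in gderive _ X]eq_fun do rewrite updE.
    apply: gderiveD; first by apply: gderiveZA; exact: dphi.
    by have := gderiveZ (ddpsi _ (q0 i)) (gderive_cst (q i) (xieta i)); rewrite scaler0 addr0.
  rewrite scale0r; have ik : i != k by rewrite eq_sym.
  by under [X in gderive _ X]eq_fun do rewrite upd_neq //; exact: gderive_cst.
- rewrite gderivD gderivA add0r gderivZ gderiv_eta_xieta.
  have [->|_] := eqVneq k i; last by rewrite oppr0 !scale0r !scaler0 mulr0 scaler0.
  rewrite scale1r mulrDr -!scalerAr mulr1 xi_xieta scaler0 addr0 !scalerA.
  by rewrite /= mulr1n mulrN1 mulNr [2 * _]mulrC divfK ?pnatr_eq0.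
- apply: gcvgD; apply: gcvgZ; try exact: gcvg_cst; apply: cvg_coord_comp.
    exact: der_continuous (dphi _ (q0 i)).
  exact: cpsi.
- apply: gcvgZ; first exact: cvg_cst.
  apply: gcvgD; apply: gcvgZ; try exact: gcvg_cst.
    apply: cvgM; last exact: cvg_cst.
    by apply: cvg_coord_comp; exact: cpsi.
  by apply: cvg_coord_comp; exact: cdpsi.
Qed.

Definition rad q : Lambda -> R := fun k => Num.sqrt (q k).

Lemma der_inv (f : R -> R) (t df : R) : f t != 0 -> is_derive t 1 f df ->
  is_derive t 1 (fun s => (f s)^-1) (- (f t) ^- 2 * df).
Proof. by move=> ft Df; have := is_deriveV ft Df; exact. Qed.

Lemma sqrt_neq0 (t : R) : 0 < t -> Num.sqrt t != 0.
Proof. by move=> t0; rewrite gt_eqF ?sqrtr_gt0. Qed.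

Lemma der_sqrt (t : R) : 0 < t -> is_derive t 1 (@Num.sqrt R) ((Num.sqrt t)^-1 / 2).
Proof. by move=> t0; have := is_derive1_sqrt t0; rewrite invfM mulrC. Qed.

Lemma der_invsqrt (t : R) : 0 < t ->
  is_derive t 1 (fun s : R => (Num.sqrt s)^-1) (- (Num.sqrt t) ^- 3 / 2).
Proof.
move=> t0; have s0 := sqrt_neq0 t0; apply: der_eq (der_inv s0 (der_sqrt t0)) _.
by field; rewrite s0.
Qed.

Let der_invsqrt3 (t : R) : 0 < t ->
  is_derive t 1 (fun s : R => - (Num.sqrt s) ^- 3) (3 * (Num.sqrt t) ^- 5 / 2).
Proof.
move=> t0; have s0 := sqrt_neq0 t0; have D := der_invsqrt t0.
have := derN (derM (derM D D) D).
have -> : (fun s : R => - ((Num.sqrt s)^-1 * (Num.sqrt s)^-1 * (Num.sqrt s)^-1)) =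
  (fun s : R => - (Num.sqrt s) ^- 3).
  by apply/funext => s; rewrite !exprS expr0 mulr1 !invfM mulrA.
by move=> H; apply: der_eq H _; field; rewrite s0.
Qed.

Lemma cont_sqrt (t : R) : {for t, continuous (@Num.sqrt R)}.
Proof. exact: sqrt_continuous. Qed.

Lemma cont_invsqrt n (t : R) : 0 < t -> {for t, continuous (fun s : R => (Num.sqrt s) ^- n)}.
Proof.
move=> t0; apply: cvgV; first by rewrite expf_neq0 // sqrt_neq0.
elim: n => [|n IH]; first by rewrite expr0; under eq_fun do rewrite expr0; exact: cvg_cst.
by rewrite exprS; under eq_fun do rewrite exprS; apply: cvgM => //; exact: cont_sqrt.
Qed.

(* The radius r_i = sqrt (q_i + 2 xi_i eta_i) and its inverse. *)
Definition srad i q : galg := (rad q i)%:A + (rad q i)^-1 *: xieta i.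
Definition dsrad i k q : galg := (k == i)%:R *:
  (((rad q i)^-1 / 2)%:A + (- (rad q i) ^- 3 / 2) *: xieta i).
Definition sinv i q : galg := (rad q i)^-1%:A + (- (rad q i) ^- 3) *: xieta i.
Definition dsinv i k q : galg := (k == i)%:R *:
  ((- (rad q i) ^- 3 / 2)%:A + (3 * (rad q i) ^- 5 / 2) *: xieta i).

Lemma superfunction_srad i : superfunction (srad i) (dsrad i).
Proof.
apply: (@superfunction1 (@Num.sqrt R) (fun t => (Num.sqrt t)^-1)
  (fun t => - (Num.sqrt t) ^- 3 / 2)) => t t0; [exact: der_sqrt|exact: der_invsqrt|].
apply: cvgM; last exact: cvg_cst.
by apply: (@cvgN _ R^o); exact: cont_invsqrt.
Qed.

Lemma superfunction_sinv i : superfunction (sinv i) (dsinv i).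
Proof.
apply: (@superfunction1 (fun t => (Num.sqrt t)^-1) (fun t => - (Num.sqrt t) ^- 3)
  (fun t => 3 * (Num.sqrt t) ^- 5 / 2)) => t t0; [exact: der_invsqrt|exact: der_invsqrt3|].
apply: cvgM; last exact: cvg_cst.
by apply: cvgM; [exact: cvg_cst|exact: cont_invsqrt].
Qed.

End SuperFunctions.

(** * Taylor expansion of a function of the radii *)

Section SuperTaylor.
Local Open Scope set_scope.
Variables (R : realType) (Lambda : finType).
Local Notation galg := (galg R Lambda).
Local Notation xi := (@gxi R Lambda).
Local Notation xieta := (@xieta R Lambda).
Implicit Types (q : Lambda -> R) (i j k : Lambda) (S : {set Lambda}).

(** Products of forms are not commutative, so moving a factor to the front requires it to be
    central. *)
Lemma prod_central (f : Lambda -> galg) k S : k \in S -> (forall F, f k * F = F * f k) ->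
  \prod_(j in S) f j = f k * \prod_(j in S :\ k) f j.
Proof.
move=> kS fk; under [in RHS]eq_bigl do rewrite !inE.
have : k \in index_enum Lambda by rewrite mem_index_enum.
elim: (index_enum Lambda) (index_enum_uniq Lambda) => //= a s IH /andP[as_ us].
rewrite inE !big_cons; have [ka _|ka /= ks] := eqVneq k a.
  rewrite -ka in as_ *.
  rewrite kS; congr (_ * _); rewrite [LHS]big_seq_cond [RHS]big_seq_cond.
  apply: eq_bigl => j /=; have [->|//] := eqVneq j k.
  by rewrite (negPf as_).
by rewrite (IH us ks); case: ifP => // _; rewrite mulrA -fk mulrA.
Qed.

Lemma gderiv_prod0 (f : Lambda -> galg) a S : (forall j, geven (f j)) ->
  (forall j, j \in S -> gderiv a (f j) = 0) -> gderiv a (\prod_(j in S) f j) = 0.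
Proof.
move=> ef df; elim/big_rec: _ => [|j F jS dF]; first exact: gderiv1.
by rewrite (proj2 (ef j)) df // dF mulr0 mul0r addr0.
Qed.

Let M S : galg := \prod_(j in S) xieta j.

Let M_D1 k S : k \in S -> M S = xieta k * M (S :\ k).
Proof. by move=> kS; apply: prod_central => // F; rewrite (proj1 (geven_xieta R k)). Qed.

Let xi_M k S : k \in S -> xi k * M S = 0.
Proof. by move=> kS; rewrite (M_D1 kS) mulrA xi_xieta mul0r. Qed.

Let gderiv_M k S : gderiv (inr k) (M S) = if k \in S then - (xi k * M (S :\ k)) else 0.
Proof.
have D0 (S' : {set Lambda}) : k \notin S' -> gderiv (inr k) (M S') = 0.
  move=> kS; apply: gderiv_prod0 => [j|j jS]; first exact: geven_xieta.
  rewrite gderiv_eta_xieta; case: eqVneq jS kS => [<- ->//|_ _ _].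
  by rewrite oppr0 scale0r.
case: ifP => [kS|/negbT /D0 //].
rewrite (M_D1 kS) (proj2 (geven_xieta R k)) gderiv_eta_xieta eqxx scaleN1r D0 ?mulr0 ?addr0 ?mulNr //.
by rewrite !inE eqxx.
Qed.

Variable nu : (Lambda -> R) -> R.
Hypothesis snu : smooth nu.

Let D S := pderivs [seq j <- enum Lambda | j \in S] nu.
(** With r_j = [rad q j] + xi_j eta_j / [rad q j], the expansion of nu (r) has one summand per
    subset [S], in which [nu] is differentiated once in each variable of [S]. [dc] is the derivative
    of the coefficient in q_k. *)
Let c S q : R := D S (rad q) * \prod_(j in S) (rad q j)^-1.
Let dc k S q : R := (pderiv k (D S) (rad q) * ((rad q k)^-1 / 2) -
  (k \in S)%:R * (D S (rad q) * ((rad q k) ^- 2 / 2))) * \prod_(j in S) (rad q j)^-1.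

Definition staylor q : galg := \sum_S c S q *: M S.
Definition dstaylor k q : galg := \sum_S dc k S q *: M S.

Let D_insert k S : k \notin S -> D (k |: S) = pderiv k (D S).
Proof.
move=> kS; rewrite /D -pderivs_insert // ?enum_uniq ?mem_enum //.
by congr (pderivs _ _); apply: eq_filter => j; rewrite !inE.
Qed.

Let rad_upd q k (t : R) : rad (upd q k t) = upd (rad q) k (Num.sqrt t).
Proof. by apply/funext => j; rewrite /rad /upd /=; case: eqP. Qed.

Let der_c k S q : positive q -> is_derive (q k) 1 (fun t => c S (upd q k t)) (dc k S q).
Proof.
move=> q0; rewrite /c; under eq_fun do rewrite rad_upd.
have d1 : is_derive (q k) 1 (fun t => D S (upd (rad q) k (Num.sqrt t)))
    (pderiv k (D S) (rad q) * ((rad q k)^-1 / 2)).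
  have := smooth_derive [seq j <- enum Lambda | j \in S] k (rad q) (rad q k) snu.
  rewrite updK => H; exact: (@der_comp R _ _ _ _ _ H (der_sqrt (q0 k))).
have d2 : is_derive (q k) 1 (fun t => \prod_(j in S) (upd (rad q) k (Num.sqrt t) j)^-1)
    (- ((k \in S)%:R * ((rad q k) ^- 2 / 2) * \prod_(j in S) (rad q j)^-1)).
  have E (t : R) : \prod_(j in S | j != k) (upd (rad q) k (Num.sqrt t) j)^-1 =
      \prod_(j in S | j != k) (rad q j)^-1.
    by apply: eq_bigr => j /andP[_ jk]; rewrite upd_neq.
  have [kS|kS] := boolP (k \in S).
    under eq_fun do rewrite (bigD1 k) //= updE E.
    have -> : \prod_(j in S) (rad q j)^-1 = (rad q k)^-1 * \prod_(j in S | j != k) (rad q j)^-1.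
      by rewrite (bigD1 k).
    have := derM (der_invsqrt (q0 k)) (der_cst (\prod_(j in S | j != k) (rad q j)^-1) (q k)).
    move=> H; apply: der_eq H _; rewrite mulr0 addr0 -/(rad q k).
    have rk : rad q k != 0 by exact: sqrt_neq0 (q0 k).
    by rewrite mulr1n mul1r; set X := \prod_(_ in _ | _) _; field; rewrite rk.
  rewrite !mul0r oppr0.
  have E' (t : R) : \prod_(j in S) (upd (rad q) k (Num.sqrt t) j)^-1 = \prod_(j in S) (rad q j)^-1.
    by apply: eq_bigr => j jS; rewrite upd_neq //; apply: contraNneq kS => <-.
  by under eq_fun do rewrite E'; exact: der_cst.
apply: der_eq (derM d1 d2) _; rewrite -/(rad q k) updK /dc.
move: (\prod_(_ in _) _) (pderiv k _ _) (D S _) ((k \in S)%:R : R) => A B C E; ring.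
Qed.

(** For [k] outside [S], the eta_k derivative of the summand of [k |: S] matches the q_k derivative
    of the summand of [S]: differentiating the radius gives 1 / (2 r_k), and the factor 2 of the
    rule restores 1 / r_k. On the right-hand side xi_k kills the summands of sets containing [k],
    and with them the derivative of 1 / r_k. *)
Lemma superfunction_staylor : superfunction staylor dstaylor.
Proof.
have FF (q : {ptws Lambda -> R}) : Filter (nbhs q) by exact: nbhs_filter.
have cr q j : rad q' j @[q' --> (q : {ptws Lambda -> R})] --> rad q j.
  by apply: (@cvg_coord_comp R Lambda Num.sqrt); exact: cont_sqrt.
have crV q j : positive q ->
    ((rad q' j)^-1 : R) @[q' --> (q : {ptws Lambda -> R})] --> ((rad q j)^-1 : R).
  move=> q0; exact: (@cvg_coord_comp R Lambda (fun s => (Num.sqrt s)^-1) q j (@cont_invsqrt R 1 _ (q0 j))).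
have cD s q : pderivs s nu (rad q') @[q' --> (q : {ptws Lambda -> R})] --> pderivs s nu (rad q).
  have H := pcontinuous_cvg _ (@smooth_continuous R Lambda s nu snu) (cr q).
  exact: H.
have cP S q : positive q -> (\prod_(j in S) (rad q' j)^-1 : R) @[q' --> (q : {ptws Lambda -> R})] -->
    (\prod_(j in S) (rad q j)^-1 : R).
  move=> q0; elim: (index_enum Lambda) => [|j s IH].
    by rewrite big_nil; under eq_fun do rewrite big_nil; exact: cvg_cst.
  rewrite big_cons; under eq_fun do rewrite big_cons; case: ifP => // _.
  by apply: cvgM => //; exact: crV.
split=> [q q0|q k q0|q k q0|q q0|q k q0].
- by apply: geven_sum => S _; apply/gevenZ/geven_prod => j _; exact: geven_xieta.
- apply: gderive_sum => S.
  by have := gderiveZ (der_c k S q0) (gderive_cst (q k) (M S)); rewrite scaler0 addr0.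
- rewrite gderiv_sum mulr_sumr scaler_sumr.
  rewrite (bigID (fun S => k \in S)) /= [X in _ + X]big1 ?addr0; last first.
    by move=> S /negPf kS; rewrite gderivZ gderiv_M kS scaler0.
  rewrite [RHS](bigID (fun S => k \in S)) /= [X in _ = X + _]big1 ?add0r; last first.
    by move=> S kS; rewrite -scalerAr xi_M // !scaler0.
  rewrite (reindex_onto (fun S => k |: S) (fun S => S :\ k)) /=; last by move=> S kS; rewrite finset.setD1K.
  apply: eq_big => [S|S /andP[_ /eqP SE]].
    rewrite !inE eqxx /=; apply/eqP/idP => [<-|kS]; first by rewrite !inE eqxx.
    by rewrite finset.setU1K.
  have kS : k \notin S by rewrite -SE !inE eqxx.
  rewrite gderivZ gderiv_M !inE eqxx /= SE -scalerAr scalerA scalerN -scaleNr; congr (_ *: _).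
  rewrite /c /dc D_insert // big_setU1 //= (negPf kS) mul0r subr0.
  rewrite -!mulrA -mulrN1; move: (pderiv _ _ _) (\prod_(_ in _) _) ((rad q k)^-1) => A B C.
  by field.
- apply: gcvg_sum => S _; apply: gcvgZ; last exact: gcvg_cst.
  by apply: cvgM; [exact: cD|exact: cP].
- apply: gcvg_sum => S _; apply: gcvgZ; last exact: gcvg_cst.
  apply: cvgM; last exact: cP.
  have crV2 : ((rad q' k) ^- 2 : R) @[q' --> (q : {ptws Lambda -> R})] --> ((rad q k) ^- 2 : R).
    by apply: (@cvg_coord_comp R Lambda (fun s => (Num.sqrt s) ^- 2)); exact: cont_invsqrt.
  apply: (@cvgB _ R^o).
    apply: cvgM; first exact: (cD (k :: [seq j <- enum Lambda | j \in S])).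
    by apply: cvgM; [exact: crV|exact: cvg_cst].
  apply: cvgM; first exact: cvg_cst.
  apply: cvgM; first exact: cD.
  by apply: cvgM; [exact: crV2|exact: cvg_cst].
Qed.

Lemma body_srad i q : body (srad i q) = rad q i.
Proof. by rewrite bodyD bodyA bodyZ body_xieta mulr0 addr0. Qed.

Let card_gt0 i : (0 < #|{: Lambda + Lambda}|)%N.
Proof. by apply/card_gt0P; exists (inl i). Qed.

Lemma gapp_srad q : gapp nu (fun k => srad k q) = staylor q.
Proof.
rewrite gapp_sq0 => [|j|j]; last exact: card_gt0.
  apply: eq_bigr => S _; rewrite /c -scalerA; congr (_ *: _).
    by congr (pderivs _ _ _); apply/funext => j; rewrite body_srad.
  rewrite -scaler_prod; apply: eq_bigr => j _; rewrite body_srad.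
  by rewrite /srad addrAC subrr add0r.
rewrite body_srad /srad addrAC subrr add0r expr2 -scalerAl -scalerAr xieta_sq.
by rewrite !scaler0.
Qed.

End SuperTaylor.

(** * Extension by zero and compact support *)

Section CompactSuperfunctions.
Variables (R : realType) (Lambda : finType).
Local Notation galg := (galg R Lambda).
Local Notation xi := (@gxi R Lambda).
Implicit Types (q r : Lambda -> R) (i j k : Lambda) (G : (Lambda -> R) -> galg)
  (dG : Lambda -> (Lambda -> R) -> galg).

#[local] Instance filter_ptws (q : {ptws Lambda -> R}) : Filter (nbhs q) := nbhs_filter q.

Definition box (a b : R) q := forall k, a <= q k <= b.

(** A [superfunction] extended by 0 to all q and supported in a box: no positivity side conditions
    remain. *)
Record supercompact (a b : R) G dG : Prop := SuperCompact {
  supercompact_even q : geven (G q);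
  supercompact_derive q k : gderive (q k) (fun t => G (upd q k t)) (dG k q);
  supercompact_eta q k : gderiv (inr k) (G q) = - 2 *: (xi k * dG k q);
  supercompact_cvg A : pcontinuous (fun q => G q A);
  supercompact_dcvg k A : pcontinuous (fun q => dG k q A);
  supercompact_eq0 q : ~ box a b q -> G q = 0;
  supercompact_deq0 k q : ~ box a b q -> dG k q = 0 }.

Lemma notP_box a b q : ~ box a b q -> exists k, q k < a \/ b < q k.
Proof.
move=> /existsNP[k /negP]; rewrite negb_and -!ltNge => /orP[|] qk; exists k; [left|right]; exact: qk.
Qed.

Lemma near_not_box a b q : ~ box a b q -> \forall q' \near (q : {ptws Lambda -> R}), ~ box a b q'.
Proof.
move=> /notP_box[k [qk|qk]].
  have H : \forall q' \near (q : {ptws Lambda -> R}), q' k < a.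
    by have := @cvg_coord R Lambda q k _ (lt_nbhsl qk).
  apply: filterS H => q' q'k /(_ k); apply/negP; rewrite negb_and -ltNge q'k //.
have H : \forall q' \near (q : {ptws Lambda -> R}), b < q' k.
  by have := @cvg_coord R Lambda q k _ (lt_nbhsr qk).
by apply: filterS H => q' q'k /(_ k); apply/negP; rewrite negb_and -!ltNge q'k orbT.
Qed.

Lemma near_not_box_line a b q k : ~ box a b q -> \forall t \near q k, ~ box a b (upd q k t).
Proof.
move=> qb; have := near_not_box qb; rewrite -{1}[q](updK q k).
have : (fun t : R => upd q k t) @ q k --> (upd q k (q k) : {ptws Lambda -> R}).
  apply: cvg_ptws => j; rewrite /upd /=; case: eqP => _; first exact: cvg_id.
  exact: cvg_cst.
by move=> /(_ _) H /H.
Qed.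

Lemma near_positive q : positive q -> \forall q' \near (q : {ptws Lambda -> R}), positive q'.
Proof.
move=> q0; have H k : \forall q' \near (q : {ptws Lambda -> R}), 0 < q' k.
  by have := @cvg_coord R Lambda q k _ (lt_nbhsr (q0 k)).
exact: (@filter_forall _ Lambda (fun k (q' : {ptws Lambda -> R}) => 0 < q' k) _ _ H).
Qed.

Lemma near_positive_line q k : positive q -> \forall t \near q k, positive (upd q k t).
Proof.
move=> q0; near=> t => j; rewrite /upd /=; case: eqP => // _.
by near: t; exact: lt_nbhsr (q0 k).
Unshelve. all: by end_near. Qed.

Lemma gcvg_near (u v : {ptws Lambda -> R} -> galg) q l : (\forall q' \near (q : {ptws Lambda -> R}), u q' = v q') ->
  gcvg (nbhs (q : {ptws Lambda -> R})) u l -> gcvg (nbhs (q : {ptws Lambda -> R})) v l.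
Proof.
move=> uv ul A; apply: cvg_eq_near (ul A).
by apply: filterS uv => q' ->.
Qed.

Definition extend G q : galg := `[< positive q >]%:R *: G q.

(** As a > 0, every point that is not positive has a neighbourhood outside the box, where the
    extension is 0. *)
Lemma supercompact_extend (a b : R) G dG : 0 < a -> superfunction G dG ->
  (forall q, positive q -> ~ box a b q -> G q = 0) ->
  (forall k q, positive q -> ~ box a b q -> dG k q = 0) ->
  supercompact a b (extend G) (fun k => extend (dG k)).
Proof.
move=> a0 [eG DG nG cG dcG] G0 dG0.
have E G' q : positive q -> extend G' q = G' q by move=> q0; rewrite /extend asboolT // scale1r.
have E0 G' q : (forall q, positive q -> ~ box a b q -> G' q = 0) -> ~ box a b q -> extend G' q = 0.
  move=> G'0 qb; have [q0|q0] := pselect (positive q); first by rewrite E // G'0.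
  by rewrite /extend asboolF // scale0r.
have nb q : ~ positive q -> ~ box a b q.
  move=> nq qb; apply: nq => k; have /andP[ak _] := qb k; exact: lt_le_trans ak.
have C G' : (forall q, positive q -> gcvg (nbhs (q : {ptws Lambda -> R})) G' (G' q)) ->
    (forall q, positive q -> ~ box a b q -> G' q = 0) ->
    forall A, pcontinuous (fun q => extend G' q A).
  move=> cG' G'0 A q; have [q0|q0] := pselect (positive q).
    have : gcvg (nbhs (q : {ptws Lambda -> R})) (extend G') (G' q).
      apply: (@gcvg_near G') => //; last exact: cG'.
      by apply: filterS (near_positive q0) => q' q'0; rewrite E.
    by rewrite -(E G' q q0); exact.
  have : gcvg (nbhs (q : {ptws Lambda -> R})) (extend G') 0.
    apply: (@gcvg_near (fun=> 0)); last exact: gcvg_cst.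
    by apply: filterS (near_not_box (nb _ q0)) => q' q'b; rewrite E0.
  by rewrite -(E0 G' q G'0 (nb _ q0)); exact.
split.
- move=> q; rewrite /extend; case: asboolP => q0; last by rewrite scale0r; exact: geven0.
  by rewrite scale1r; exact: eG.
- move=> q k; have [q0|q0] := pselect (positive q).
    rewrite E // => A; apply: der_near (DG q k q0 A).
    by apply: filterS (near_positive_line k q0) => t t0; rewrite E.
  rewrite E0; [|exact: dG0|exact: nb] => A; apply: der_near (gderive_cst (q k) 0 A).
  by apply: filterS (near_not_box_line k (nb _ q0)) => t tb; rewrite E0.
- move=> q k; rewrite /extend gderivZ; case: asboolP => q0; last first.
    by rewrite !scale0r mulr0 scaler0.
  by rewrite !scale1r; exact: nG.
- by move=> A; apply: C.
- by move=> k A; apply: C => [q|q]; [exact: dcG|exact: dG0].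
- by move=> q; exact: E0.
- by move=> k q; apply: E0; exact: dG0.
Qed.

Lemma pderivs_eq0 (nu : (Lambda -> R) -> R) (a b : R) (s : seq Lambda) r :
  (forall r, ~ box a b r -> nu r = 0) -> ~ box a b r -> pderivs s nu r = 0.
Proof.
move=> nu0; elim: s r => [|k s IH] r rb; first exact: nu0.
have D : is_derive (r k) 1 (fun t => pderivs s nu (upd r k t)) 0.
  apply: der_near (der_cst 0 (r k)).
  by apply: filterS (near_not_box_line k rb) => t tb; rewrite IH.
by rewrite /= /pderiv derive1E; exact: (@derive_val _ _ _ _ _ _ _ D).
Qed.

Lemma staylor_eq0 (nu : (Lambda -> R) -> R) (a b : R) q : 0 < a ->
  (forall r, ~ box a b r -> nu r = 0) -> positive q -> ~ box (a ^+ 2) (b ^+ 2) q ->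
  staylor nu q = 0 /\ forall k, dstaylor nu k q = 0.
Proof.
move=> a0 nu0 q0 qb; have rb : ~ box a b (rad q).
  move=> rb; apply: qb => k; have /andP[ra rb'] := rb k.
  rewrite -(sqr_sqrtr (ltW (q0 k))) !lerXn2r ?nnegrE ?sqrtr_ge0 ?(ltW a0) //.
  exact: le_trans (ltW a0) (le_trans ra rb').
have P0 s : pderivs s nu (rad q) = 0 by exact: pderivs_eq0 nu0 rb.
split=> [|k]; apply: big1 => S _; rewrite P0 ?mul0r ?scale0r //.
have P1 s : pderiv k (pderivs s nu) (rad q) = 0 by exact: P0 (k :: s).
by rewrite P1 !mul0r mulr0 subr0 mul0r scale0r.
Qed.

End CompactSuperfunctions.

(** * The density of the model *)

Section ModelDensity.
Variables (R : realType) (Lambda : finType).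
Local Notation galg := (galg R Lambda).
Local Notation xi := (@gxi R Lambda).
Local Notation eta := (@geta R Lambda).
Local Notation xieta := (@xieta R Lambda).
Implicit Types (q z x y : Lambda -> R) (i j k : Lambda).

Definition mass2 z x y : Lambda -> R := fun k => z k ^+ 2 - x k ^+ 2 - y k ^+ 2.

Let scalarM (a b : R) : (a%:A : galg) * b%:A = (a * b)%:A.
Proof. by rewrite -scalerAl mul1r scalerA. Qed.

Let card_gt0 i : (0 < #|{: Lambda + Lambda}|)%N.
Proof. by apply/card_gt0P; exists (inl i). Qed.

Lemma superdotE z x y i j :
  superdot (supercoord z x y i) (supercoord z x y j) =
  (x i * x j + y i * y j - z i * z j)%:A - xi i * eta j - xi j * eta i.
Proof.
rewrite /superdot /= !scalarM -scaleNr -!scalerDl.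
rewrite -/(xi i) -/(eta j) -/(eta i) -/(xi j) [eta i * _]generator_anticomm.
by congr (_%:A - _ - _); ring.
Qed.

Lemma superdot_self z x y i :
  - superdot (supercoord z x y i) (supercoord z x y i) =
  (mass2 z x y i)%:A + 2 *: xieta i.
Proof.
rewrite superdotE !opprD !opprK -scaleNr -addrA -mulr2n -scaler_nat; congr (_ %:A + _).
by rewrite /mass2; ring.
Qed.

Lemma timelike_futureE z x y :
  timelike_future z x y = [forall i, (0 < mass2 z x y i) && (0 < z i)].
Proof.
rewrite /timelike_future; apply: eq_forallb => i.
rewrite -oppr_gt0 -bodyN superdot_self bodyD bodyA bodyZ body_xieta mulr0 addr0 //.
Qed.

Lemma superradiusE z x y i : 0 < mass2 z x y i ->
  superradius (supercoord z x y i) = srad i (mass2 z x y).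
Proof.
move=> q0; rewrite /superradius superdot_self gapp1_sq0.
- rewrite derive1E derive_sqrt // scalerA /srad /rad; congr (_ + _ *: _).
  by rewrite invfM mulrAC mulVf ?mul1r // pnatr_eq0.
- by rewrite bodyZ body_xieta mulr0.
- by rewrite expr2 -scalerAl -scalerAr xieta_sq !scaler0.
- exact: card_gt0.
Qed.

Lemma gapp1_inv i q : positive q -> gapp1 GRing.inv (srad i q) = sinv i q.
Proof.
move=> q0; have r0 : rad q i != 0 by exact: sqrt_neq0 (q0 i).
have D := @der_inv R id (rad q i) 1 r0 (der_id _).
rewrite /srad gapp1_sq0.
- rewrite derive1E (@derive_val _ _ _ _ _ _ _ D) mulr1 scalerA /sinv.
  by congr (_ + _ *: _); field.
- by rewrite bodyZ body_xieta mulr0.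
- by rewrite expr2 -scalerAl -scalerAr xieta_sq !scaler0.
- exact: card_gt0.
Qed.

Lemma srad_sq i q : positive q -> srad i q * srad i q = (q i)%:A + 2 *: xieta i.
Proof.
move=> q0; have r0 : rad q i != 0 by exact: sqrt_neq0 (q0 i).
rewrite /srad mulrDl !mulrDr scalarM -!scalerAl -!scalerAr !mul1r !mulr1 xieta_sq !scaler0 addr0.
rewrite !scalerA mulVf // divff // !scale1r -addrA -mulr2n scaler_nat; congr (_%:A + _).
by rewrite -expr2 sqr_sqrtr // ltW.
Qed.

Variable beta : Lambda -> Lambda -> R.
Hypothesis beta_sym : forall i j, beta i j = beta j i.

Definition quad x : R := \sum_i \sum_j beta i j * (x i * x j).

Definition energy z x y : R := (quad x + quad y - quad z) / 2.

Definition radial_energy q : galg :=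
  \sum_i \sum_j (beta i j / 2) *: (srad i q * srad j q).

Definition sigma : galg := \sum_i \sum_j beta i j *: (xi i * eta j).

Lemma geven_sigma : geven sigma.
Proof. by do 2 apply: geven_sum => ? _; apply/gevenZ/geven_generators. Qed.

Lemma body_sigma : body sigma = 0.
Proof.
rewrite body_sum big1 // => i _; rewrite body_sum big1 // => j _.
by rewrite bodyZ body_generatorM mulr0.
Qed.

Lemma supersub_sq (u v : supervector R Lambda) :
  superdot (supersub u v) (supersub u v) =
  superdot u u + superdot v v - superdot u v - superdot v u.
Proof.
have E (a b c d : galg) : (a - b) * (c - d) = a * c - a * d - b * c + b * d.
  by rewrite mulrBl !mulrBr opprB addrA addrAC -!addrA; congr (_ + (_ + _)); rewrite addrC.
rewrite /superdot /= !E.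
(* Products become atoms; what remains is an additive identity, checked coefficient by
   coefficient. *)
repeat match goal with |- context [@GRing.mul ?T ?a ?b] => generalize (@GRing.mul T a b) end.
by intros; apply/ffunP => A; rewrite !ffunE; ring.
Qed.

Let sum2D (F G : Lambda -> Lambda -> galg) :
  \sum_i \sum_j (F i j + G i j) = \sum_i \sum_j F i j + \sum_i \sum_j G i j.
Proof. by rewrite -big_split; apply: eq_bigr => i _; rewrite big_split. Qed.

Let sum2Z (c : R) (F : Lambda -> Lambda -> galg) :
  c *: (\sum_i \sum_j F i j) = \sum_i \sum_j c *: F i j.
Proof. by rewrite scaler_sumr; apply: eq_bigr => i _; rewrite scaler_sumr. Qed.

Let sum2_sym (F : Lambda -> Lambda -> galg) :
  \sum_i \sum_j beta i j *: F j i = \sum_i \sum_j beta i j *: F i j.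
Proof.
by rewrite exchange_big; apply: eq_bigr => i _; apply: eq_bigr => j _; rewrite beta_sym.
Qed.

Let cancel_squares (A B C D E : galg) :
  - A - B - C - D + (A - E - (E - B)) = - (C + D + 2 *: E).
Proof. by apply/ffunP => S; rewrite !ffunE /GRing.scale /=; ring. Qed.

Let sqrB_comm (A B : galg) : A * B = B * A ->
  (A - B) ^+ 2 = A * A - A * B - (A * B - B * B).
Proof. by move=> AB; rewrite expr2 mulrBl !mulrBr AB. Qed.

Let pull_scalars (A B C : galg) (a b c e : R) :
  A * a%:A * b%:A * c%:A * (e *: (B * C)) = (a * b * c * e) *: (A * B * C).
Proof.
have M (F : galg) (k : R) : F * k%:A = k *: F by rewrite -scalerAr mulr1.
by rewrite !M !scalerA -scalerAl -scalerAr scalerA [A * (B * C)]mulrA; congr (_ *: _); ring.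
Qed.

Let quarter (b : R) (A B C : galg) : - (4^-1 *: (b *: - (A + B + 2 *: C))) =
  4^-1 *: (b *: A) + 4^-1 *: (b *: B) + (b / 2) *: C.
Proof. by apply/ffunP => S; rewrite !ffunE /GRing.scale /=; field. Qed.

Let halve (A B : galg) : 2^-1 *: (A - (B + B)) = 2^-1 *: A - B.
Proof. by apply/ffunP => S; rewrite !ffunE /GRing.scale /=; field. Qed.

Let cancel_body (A B C D : galg) : A + B - C - (A + D) = B - D - C.
Proof. by apply/ffunP => S; rewrite !ffunE; ring. Qed.

(** As u_i . u_i = - r_i^2, the squares in the two sums of H cancel and only the products u_i . u_j
    + r_i r_j remain. *)
Lemma oppr_hamiltonian z x y : positive (mass2 z x y) ->
  - hamiltonian beta (supercoord z x y) =
  (energy z x y)%:A + radial_energy (mass2 z x y) - sigma.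
Proof.
move=> q0; set q := mass2 z x y; pose u := supercoord z x y.
have Rr i : superradius (u i) = srad i q by exact: superradiusE.
have srC i j : srad i q * srad j q = srad j q * srad i q.
  exact: (proj1 (superfunction_even (superfunction_srad R i) q0)).
have uu i : superdot (u i) (u i) = - (srad i q * srad i q).
  by rewrite srad_sq // -superdot_self opprK.
have sq2 i j : superdot (supersub (u i) (u j)) (supersub (u i) (u j)) +
    (superradius (u i) - superradius (u j)) ^+ 2 =
    - (superdot (u i) (u j) + superdot (u j) (u i) + 2 *: (srad i q * srad j q)).
  rewrite supersub_sq !uu !Rr (sqrB_comm (srC i j)); exact: cancel_squares.
have -> : - hamiltonian beta u = (4^-1 *: \sum_i \sum_j beta i j *: superdot (u i) (u j) +
    4^-1 *: \sum_i \sum_j beta i j *: superdot (u j) (u i)) + radial_energy q.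
  rewrite /hamiltonian -scalerDr -sum2D /radial_energy !sum2Z -!sum2D.
  rewrite -sumrN; apply: eq_bigr => i _; rewrite -sumrN; apply: eq_bigr => j _.
  by rewrite -[in LHS]scalerDr sq2; exact: quarter.
rewrite (sum2_sym (fun i j => superdot (u i) (u j))) -scalerDl addrAC; congr (_ + _).
have -> : (4^-1 + 4^-1 : R) = 2^-1 by field.
transitivity (2^-1 *: (\sum_i \sum_j beta i j *: ((x i * x j + y i * y j - z i * z j)%:A : galg)
   - (\sum_i \sum_j beta i j *: (xi i * eta j) + \sum_i \sum_j beta i j *: (xi j * eta i)))).
  congr (_ *: _); rewrite -sum2D -sumrB; apply: eq_bigr => i _; rewrite -sumrB.
  by apply: eq_bigr => j _; rewrite superdotE -!scalerDr -scalerBr opprD addrA.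
rewrite (sum2_sym (fun i j => xi i * eta j)) -/sigma halve; congr (_ - _).
rewrite sum2Z /energy /quad -big_split -sumrB /= mulr_suml scaler_suml.
apply: eq_bigr => i _; rewrite -big_split -sumrB /= mulr_suml scaler_suml.
by apply: eq_bigr => j _; rewrite !scalerA; congr (_ *: _); ring.
Qed.

Definition boltzmann_radial q : galg :=
  expR (body (radial_energy q)) *: gexp (radial_energy q - (body (radial_energy q))%:A).

Lemma gapp1_boltzmann z x y : positive (mass2 z x y) ->
  gapp1 expR (- hamiltonian beta (supercoord z x y)) =
  expR (energy z x y) *: (boltzmann_radial (mass2 z x y) * gexp (- sigma)).
Proof.
move=> q0; rewrite gapp1_expR oppr_hamiltonian //; set S := radial_energy _.
have b : body ((energy z x y)%:A + S - sigma) = energy z x y + body S.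
  by rewrite bodyD bodyN body_sigma subr0 bodyD bodyA.
rewrite b expRD -scalerA /boltzmann_radial -/S -scalerAl; congr (_ *: (_ *: _)).
rewrite -gexpD; last first.
- by rewrite /GRing.comm mulrN mulNr (proj1 geven_sigma).
- by rewrite bodyN body_sigma oppr0.
- by rewrite bodyD bodyN bodyA subrr.
by congr gexp; rewrite scalerDl; exact: cancel_body.
Qed.

Definition dradial_energy k q : galg :=
  \sum_i \sum_j (beta i j / 2) *: (dsrad i k q * srad j q + srad i q * dsrad j k q).

Lemma superfunction_boltzmann_radial :
  superfunction boltzmann_radial (fun k q => dradial_energy k q * boltzmann_radial q).
Proof.
apply: superfunction_exp; do 2 apply: superfunction_sum => ?.
by apply: superfunctionZ; apply: superfunctionM; exact: superfunction_srad.
Qed.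

Section density.
Variables (nu : (Lambda -> R) -> R) (a b : R) (i : Lambda).
Hypotheses (snu : smooth nu) (a0 : 0 < a) (nu0 : forall r, ~ box a b r -> nu r = 0).

(** The factor nu (r) / r_i exp (sum beta_kl r_k r_l / 2) of the integrand. Its extension by zero is
    the even form G_i. *)
Definition radial q : galg := staylor nu q * sinv i q * boltzmann_radial q.
Definition dradial k q : galg :=
  (dstaylor nu k q * sinv i q + staylor nu q * dsinv i k q) * boltzmann_radial q +
  staylor nu q * sinv i q * (dradial_energy k q * boltzmann_radial q).

Lemma supercompact_radial : supercompact (a ^+ 2) (b ^+ 2) (extend radial) (fun k => extend (dradial k)).
Proof.
apply: supercompact_extend; first by rewrite exprn_gt0.
- apply: superfunctionM; last exact: superfunction_boltzmann_radial.
  by apply: superfunctionM; [exact: superfunction_staylor|exact: superfunction_sinv].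
- by move=> q q0 qb; rewrite /radial (proj1 (staylor_eq0 a0 nu0 q0 qb)) !mul0r.
- move=> k q q0 qb; have [s0 ds0] := staylor_eq0 a0 nu0 q0 qb.
  by rewrite /dradial s0 ds0 !(mul0r, addr0).
Qed.

Definition radial_density q : R := gtop (extend radial q * gexp (- sigma)).

(** Outside the future cone both sides vanish: on the right, [extend] takes care of q and the
    product of indicators of z. *)
Lemma berezin_densityE (f : (Lambda -> R) -> R) j p :
  berezin_density (boltzmann beta (fun z x y => let u := supercoord z x y in
    gapp nu (fun k => superradius (u k)) * gapp1 GRing.inv (superradius (u i)) *
    sx (u i) * sx (u j) * (f z)%:A)) p =
  (vec p.1.2 i * vec p.1.2 j) * ((\prod_k (0 < vec p.1.1 k)%R%:R) * f (vec p.1.1) *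
    (expR (energy (vec p.1.1) (vec p.1.2) (vec p.2)) *
     radial_density (mass2 (vec p.1.1) (vec p.1.2) (vec p.2)))).
Proof.
rewrite /berezin_density; move: (vec p.1.1) (vec p.1.2) (vec p.2) => z x y.
rewrite /boltzmann -/(gtop _) gtopZ timelike_futureE /radial_density /extend.
have [zx|nzx] := boolP [forall i, (0 < mass2 z x y i) && (0 < z i)]; last first.
  rewrite mul0r; move/forallPn: nzx => [k]; rewrite negb_and => /orP[qk|zk].
    rewrite asboolF ?scale0r ?mul0r ?gtop0 ?mulr0 // => q0; move: qk; by rewrite q0.
  by rewrite (bigD1 k) //= (negPf zk) !mul0r mulr0.
have q0 : positive (mass2 z x y) by move=> k; move/forallP: zx => /(_ k)/andP[].
rewrite asboolT // scale1r mul1r big1 ?mul1r => [|k _]; last first.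
  by move/forallP: zx => /(_ k)/andP[_ ->].
have -> : (fun k => superradius (supercoord z x y k)) = (fun k => srad k (mass2 z x y)).
  by apply/funext => k; rewrite superradiusE.
rewrite superradiusE // gapp_srad gapp1_inv // gapp1_boltzmann // /radial /=.
set U := staylor _ _ * _; set V := boltzmann_radial _; set W := gexp _; set e := expR _.
by rewrite pull_scalars gtopZ !mulrA.
Qed.

End density.
End ModelDensity.

(** * Localization *)

Section LipschitzPartials.
Variables (R : realType) (I : finType).
Implicit Types (x y z : I -> R).

(** Coordinates are changed one at a time, which never leaves the translated orthant; each change is
    a mean value estimate. *)
Lemma lipschitz_partials (m C : R) (f : (I -> R) -> R) (f' : I -> (I -> R) -> R) :
  (forall z k (s : R), is_derive s 1 (fun s => f (upd z k s)) (f' k (upd z k s))) ->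
  (forall z k, (forall i, m <= z i) -> `|f' k z| <= C) ->
  forall x y, (forall i, m <= x i) -> (forall i, m <= y i) -> `|f x - f y| <= C * ldist x y.
Proof.
move=> df f'C x y xm ym.
have step u k (s : R) : (forall i, m <= u i) -> m <= s -> `|f u - f (upd u k s)| <= C * `|u k - s|.
  move=> um ms.
  have up t : m <= t -> forall i, m <= upd u k t i.
    by move=> mt i; rewrite /upd /=; case: eqP.
  have cf (a b : R) : {within `[a, b], continuous (fun t => f (upd u k t))}.
    by apply: continuous_subspaceT => t; exact: der_continuous (df u k t).
  have main (a b : R) : m <= a -> a < b -> `|f (upd u k b) - f (upd u k a)| <= C * `|b - a|.
    move=> ma ab; have [c] := MVT ab (fun t _ => df u k t) (cf a b).
    rewrite in_itv /= => /andP[/ltW ac _] ->; rewrite normrM ler_wpM2r //.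
    by apply: f'C; apply: up; exact: le_trans ac.
  rewrite -{1}[u](updK u k); have [us|su|->] := ltgtP (u k) s.
  - by rewrite distrC [`|u k - s|]distrC; exact: main.
  - exact: main.
  - by rewrite !subrr normr0 mulr0.
suff H s : uniq s -> forall u, (forall i, m <= u i) -> (forall i, i \notin s -> u i = y i) ->
    `|f u - f y| <= C * \sum_(i <- s) `|u i - y i|.
  have := H (index_enum I) (index_enum_uniq I) x xm; apply => i.
  by rewrite mem_index_enum.
elim: s => [_ u um uy|k s IH /= /andP[ks us] u um uy].
  have -> : u = y by apply/funext => i; exact: uy.
  by rewrite subrr normr0 big_nil mulr0.
rewrite big_cons mulrDr.
have -> : f u - f y = (f u - f (upd u k (y k))) + (f (upd u k (y k)) - f y).
  by rewrite addrA subrK.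
apply: (le_trans (ler_normD _ _)); apply: lerD; first exact: step.
have -> : \sum_(i <- s) `|u i - y i| = \sum_(i <- s) `|upd u k (y k) i - y i|.
  apply: eq_big_seq => i si; rewrite upd_neq //.
  by apply: contraNneq ks => <-.
apply: IH => // [i|i si]; first by rewrite /upd /=; case: eqP.
have [->|ik] := eqVneq i k; first exact: updE.
by rewrite upd_neq // uy // inE negb_or ik.
Qed.

End LipschitzPartials.

Section SigmaFiniteProduct.
 Context d1 d2 (T1 : measurableType d1) (T2 : measurableType d2) (R : realType).
Variables (m1 : {sigma_finite_measure set T1 -> \bar R}) (m2 : {sigma_finite_measure set T2 -> \bar R}).
Lemma product_sigma_finiteT : sigma_finite setT (m1 \x m2)%E.
Proof.
have /sigma_finiteP[F [TF ndF Foo]] := sigma_finiteT m1.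
have /sigma_finiteP[G [TG ndG Goo]] := sigma_finiteT m2.
exists (fun n => F n `*` G n).
 rewrite -setXTT TF TG predeqE => -[x y]; split.
    move=> [/= [n _ Fnx] [k _ Gky]]; exists (maxn n k) => //; split.
    - by move: x Fnx; exact/subsetPset/ndF/leq_maxl.
    - by move: y Gky; exact/subsetPset/ndG/leq_maxr.
  by move=> [n _ []/= ? ?]; split; exists n.
move=> k; have [? ?] := Foo k; have [? ?] := Goo k.
split; first exact: measurableX.
by rewrite product_measure1E// lte_mul_pinfty// ge0_fin_numE.
Qed.
(** Registers the product measure as sigma-finite, so that it can be one of the two factors when
    Fubini is applied to z, x and y. *)
Definition sigma_finite_product : set (T1 * T2) -> \bar R := (m1 \x m2)%E.
HB.instance Definition _ := Measure.on sigma_finite_product.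
HB.instance Definition _ := Measure_isSigmaFinite.Build _ _ _ sigma_finite_product product_sigma_finiteT.

End SigmaFiniteProduct.


(** * Integration by parts on R^(3 Lambda) *)

Section Points.
Variables (R : realType) (Lambda : finType).
Local Notation MR := (measurableTypeR R).
Local Notation n := #|Lambda|.
Local Notation leb := (@lebesgue_tuple R n).
Local Notation leb3 := (@lebesgue3 R Lambda).
Local Notation W := ((Lambda + Lambda) + Lambda)%type.
Implicit Types (w : W -> R) (k : Lambda)
  (p : n.-tuple MR * n.-tuple MR * n.-tuple MR).

Definition iz k : W := inl (inl k).
Definition ix k : W := inl (inr k).
Definition iy k : W := inr k.

(** The coordinates form a single family, so that differentiation and continuity treat z, x and y
    alike. *)
Definition pt (z x y : Lambda -> R) : W -> R := fun c =>
  match c with inl (inl k) => z k | inl (inr k) => x k | inr k => y k end.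

Definition point p : W -> R := pt (vec p.1.1) (vec p.1.2) (vec p.2).

Lemma measurable_vec k : measurable_fun setT (fun t : n.-tuple MR => vec t k).
Proof. exact: measurable_tnth. Qed.

Lemma measurable_point c : measurable_fun setT (fun p => point p c).
Proof.
case: c => [[k|k]|k] /=.
- exact: measurableT_comp (measurable_vec k) (measurableT_comp measurable_fst measurable_fst).
- exact: measurableT_comp (measurable_vec k) (measurableT_comp measurable_snd measurable_fst).
- exact: measurableT_comp (measurable_vec k) measurable_snd.
Qed.

Lemma measurable_on_points (F : (W -> R) -> R) : pcontinuous F ->
  measurable_fun setT (fun p => F (point p)).
Proof. by move=> cF; apply: measurable_pcontinuous cF _ => c; exact: measurable_point. Qed.

Let leb2 := sigma_finite_product leb leb.

Section fubini3.
Variables (F : n.-tuple MR * n.-tuple MR * n.-tuple MR -> R) (u v h : n.-tuple MR -> R).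
Hypotheses (mF : measurable_fun setT F) (Fb : forall p, `|F p| <= u p.1.1 * v p.1.2 * h p.2).
Hypotheses (iu : leb.-integrable setT (EFin \o u)) (iv : leb.-integrable setT (EFin \o v))
  (ih : leb.-integrable setT (EFin \o h)).

Let iuv : leb2.-integrable setT (EFin \o (fun q => u q.1 * v q.2)).
Proof. exact: integrable_prodM. Qed.

Lemma fubini3_integrable : leb3.-integrable setT (EFin \o F).
Proof. by have [] := @dominated_fubini _ _ _ _ R leb2 leb F (fun q => u q.1 * v q.2) h mF Fb iuv ih. Qed.

Let mF3 (y : n.-tuple MR) : measurable_fun setT (fun q => F (q, y)).
Proof. exact: measurableT_comp mF (pair2_measurable y). Qed.

Lemma fubini3_y : \int[leb3]_p F p = \int[leb2]_q \int[leb]_y F (q, y).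
Proof. by have [] := @dominated_fubini _ _ _ _ R leb2 leb F (fun q => u q.1 * v q.2) h mF Fb iuv ih. Qed.

Let F2 : \int[leb3]_p F p = \int[leb]_y \int[leb2]_q F (q, y).
Proof. by have [] := @dominated_fubini _ _ _ _ R leb2 leb F (fun q => u q.1 * v q.2) h mF Fb iuv ih. Qed.

Let inner (y : n.-tuple MR) := @dominated_fubini _ _ _ _ R leb leb (fun q => F (q, y)) u (fun x => v x * h y) (mF3 y).

Let inner_b (y : n.-tuple MR) q : `|F (q, y)| <= u q.1 * (v q.2 * h y).
Proof. by rewrite mulrA; exact: Fb. Qed.

Let ivh (y : n.-tuple MR) : leb.-integrable setT (EFin \o (fun x => v x * h y)).
Proof. exact: (@integrableZr _ _ _ leb setT measurableT (h y) (EFin \o v) iv). Qed.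

Lemma fubini3_x : \int[leb3]_p F p = \int[leb]_y \int[leb]_z \int[leb]_x F (z, x, y).
Proof.
rewrite F2; apply: eq_Rintegral => y _.
by have [] := inner (inner_b y) iu (ivh y).
Qed.

Lemma fubini3_z : \int[leb3]_p F p = \int[leb]_y \int[leb]_x \int[leb]_z F (z, x, y).
Proof.
rewrite F2; apply: eq_Rintegral => y _.
by have [] := inner (inner_b y) iu (ivh y).
Qed.

End fubini3.

Definition weight3 p : R := weight p.1.1 * weight p.1.2 * weight p.2.

(** On the box [weight1] is at least its value c at [B], so a factor c^(-n) for each of the blocks
    z, x and y compensates the weight. *)
Lemma weight3_compact (F : (W -> R) -> R) (B : R) : 0 <= B -> pcontinuous F ->
  (forall w, ~ box (- B) B w -> F w = 0) ->
  exists2 C, 0 <= C & forall p, `|F (point p)| <= C * weight3 p.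
Proof.
move=> B0 cF FB; have [C0 [C00 FC]] := pcontinuous_bounded cF FB.
pose c := weight1 B; have c0 : 0 < c := weight1_gt0 B.
exists (C0 * (c ^- n * c ^- n * c ^- n)); first by rewrite mulr_ge0 ?mulr_ge0 ?invr_ge0 ?exprn_ge0 // ltW.
move=> p; have [bp|nb] := pselect (box (- B) B (point p)); last first.
  rewrite FB // normr0 mulr_ge0 ?mulr_ge0 ?invr_ge0 ?exprn_ge0 // ?(ltW c0) //;
  by rewrite ltW // weight_gt0.
apply: (le_trans (FC _)); rewrite -mulrA ler_peMr //.
have W1 (t : n.-tuple MR) : (forall k, - B <= vec t k <= B) -> 1 <= c ^- n * weight t.
  move=> tB; rewrite mulrC ler_pdivlMr ?exprn_gt0 // mul1r /weight.
  rewrite -[n in X in X <= _]card_ord -prodr_const; apply: ler_prod => j _.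
  rewrite (ltW c0) /=; rewrite /c /weight1 lef_pV2 ?posrE ?ltr_pwDl ?sqr_ge0 // lerD2l.
  have := tB (enum_val j); rewrite /vec enum_valK -ler_norml => H.
  by rewrite -[tnth t j ^+ 2]real_normK ?num_real // lerXn2r ?nnegrE.
have w1 := W1 p.1.1 (fun k => bp (iz k)).
have w2 := W1 p.1.2 (fun k => bp (ix k)).
have w3 := W1 p.2 (fun k => bp (iy k)).
rewrite /weight3.
have -> : c ^- n * c ^- n * c ^- n * (weight p.1.1 * weight p.1.2 * weight p.2) =
  (c ^- n * weight p.1.1) * (c ^- n * weight p.1.2) * (c ^- n * weight p.2) by ring.
by rewrite mulr_ege1 // mulr_ege1.
Qed.

Let vec_upd (F : (Lambda -> R) -> R) (k : Lambda) (u : 'I_n -> R) (s : R) :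
  F (fun i => upd u (enum_rank k) s (enum_rank i)) = F (upd (fun i => u (enum_rank i)) k s).
Proof.
by congr F; apply/funext => i; rewrite /upd /= (inj_eq enum_rank_inj).
Qed.

Lemma integral_derive_vec k (F F' : (Lambda -> R) -> R) (b C : R) :
  measurable_fun setT (fun t => F' (vec t)) ->
  (forall t : n.-tuple MR, `|F' (vec t)| <= C * weight t) ->
  (forall x (s : R), is_derive s 1 (fun s => F (upd x k s)) (F' (upd x k s))) ->
  (forall x, continuous (fun s => F' (upd x k s))) ->
  (forall x s, b <= `|s| -> F (upd x k s) = 0) ->
  \int[leb]_t F' (vec t) = 0.
Proof.
move=> mF' F'C dF cF' Fb.
pose e (f : (Lambda -> R) -> R) (u : 'I_n -> R) := f (fun i => u (enum_rank i)).
apply: (@integral_derive_tuple R n (enum_rank k) (e F) (e F') b C) => //.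
- by move=> u s; rewrite /e vec_upd; under eq_fun do rewrite vec_upd; exact: dF.
- by move=> u; rewrite /e; under eq_fun do rewrite vec_upd; exact: cF'.
- by move=> u s bs; rewrite /e vec_upd; exact: Fb.
Qed.

Lemma continuous_upd (F : (W -> R) -> R) w c : pcontinuous F ->
  continuous (fun s => F (upd w c s)).
Proof.
move=> cF s; apply: (pcontinuous_cvg _ cF) => c'; rewrite /upd /=.
by case: eqP => _; [exact: cvg_id|exact: cvg_cst].
Qed.

Let iw := integrable_weight R n.
Let iC (C : R) : leb.-integrable setT (EFin \o (fun t => C * weight t)).
Proof. exact: rintegrableZ iw. Qed.

Let weightE : forall (C : R) p, C * weight3 p = C * weight p.1.1 * weight p.1.2 * weight p.2.
Proof. by move=> C p; rewrite /weight3 !mulrA. Qed.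

Lemma compact_integrable (F : (W -> R) -> R) (B : R) : 0 <= B -> pcontinuous F ->
  (forall w, ~ box (- B) B w -> F w = 0) ->
  leb3.-integrable setT (EFin \o (fun p => F (point p))).
Proof.
move=> B0 cF FB; have [C C0 FC] := weight3_compact B0 cF FB.
apply: (fubini3_integrable (measurable_on_points cF) _ (iC C) iw iw) => p.
by rewrite -weightE.
Qed.

Lemma integral_derive_point c (F F' : (W -> R) -> R) (B : R) : 0 <= B ->
  pcontinuous F' ->
  (forall w, ~ box (- B) B w -> F w = 0) -> (forall w, ~ box (- B) B w -> F' w = 0) ->
  (forall w (s : R), is_derive s 1 (fun s => F (upd w c s)) (F' (upd w c s))) ->
  \int[leb3]_p F' (point p) = 0.
Proof.
move=> B0 cF' FB F'B dF; have [C C0 FC] := weight3_compact B0 cF' F'B.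
have mF' := measurable_on_points cF'.
have Fb p : `|F' (point p)| <= C * weight p.1.1 * weight p.1.2 * weight p.2 by rewrite -weightE.
have Fc w s : B + 1 <= `|s| -> F (upd w c s) = 0.
  move=> Bs; apply: FB => /(_ c); rewrite updE -ler_norml; apply/negP.
  by rewrite -ltNge; apply: lt_le_trans Bs; rewrite ltrDl.
case: c dF Fc => [[k|k]|k] dF Fc.
- rewrite (fubini3_z mF' Fb (iC C) iw iw); apply: Rintegral_eq0 => y _.
  apply: Rintegral_eq0 => x _; pose P (z : Lambda -> R) := pt z (vec x) (vec y).
  have E z (s : R) : P (upd z k s) = upd (P z) (iz k) s.
    by apply/funext => -[[i|i]|i]; rewrite /P /upd /=.
  apply: (@integral_derive_vec k (F \o P) (F' \o P) (B + 1) (C * weight x * weight y)).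
  + by apply: measurableT_comp (measurableT_comp mF' (pair2_measurable y)) (pair2_measurable x).
  + by move=> z; have := Fb (z, x, y); rewrite /= -!mulrA [weight z * _]mulrC !mulrA.
  + by move=> z s /=; rewrite E; under eq_fun do rewrite E; exact: dF.
  + by move=> z; rewrite /=; under eq_fun do rewrite E; exact: continuous_upd.
  + by move=> z s Bs; rewrite /= E; exact: Fc.
- rewrite (fubini3_x mF' Fb (iC C) iw iw); apply: Rintegral_eq0 => y _.
  apply: Rintegral_eq0 => z _; pose P (x : Lambda -> R) := pt (vec z) x (vec y).
  have E x (s : R) : P (upd x k s) = upd (P x) (ix k) s.
    by apply/funext => -[[i|i]|i]; rewrite /P /upd /=.
  apply: (@integral_derive_vec k (F \o P) (F' \o P) (B + 1) (C * weight z * weight y)).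
  + by apply: measurableT_comp (measurableT_comp mF' (pair2_measurable y)) (pair1_measurable z).
  + by move=> x; have := Fb (z, x, y); rewrite /= mulrAC.
  + by move=> x s /=; rewrite E; under eq_fun do rewrite E; exact: dF.
  + by move=> x; rewrite /=; under eq_fun do rewrite E; exact: continuous_upd.
  + by move=> x s Bs; rewrite /= E; exact: Fc.
- rewrite (fubini3_y mF' Fb (iC C) iw iw); apply: Rintegral_eq0 => -[z x] _.
  pose P (y : Lambda -> R) := pt (vec z) (vec x) y.
  have E y (s : R) : P (upd y k s) = upd (P y) (iy k) s.
    by apply/funext => -[[i|i]|i]; rewrite /P /upd /=.
  apply: (@integral_derive_vec k (F \o P) (F' \o P) (B + 1) (C * weight z * weight x)).
  + exact: measurableT_comp mF' (pair1_measurable (z, x)).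
  + by move=> y; have := Fb (z, x, y).
  + by move=> y s /=; rewrite E; under eq_fun do rewrite E; exact: dF.
  + by move=> y; rewrite /=; under eq_fun do rewrite E; exact: continuous_upd.
  + by move=> y s Bs; rewrite /= E; exact: Fc.
Qed.

End Points.

(** * The divergence identity behind localization *)

Section BerezinCalculus.
Variables (R : realType) (Lambda : finType).
Local Notation galg := (galg R Lambda).
Local Notation xi := (@gxi R Lambda).
Local Notation eta := (@geta R Lambda).
Implicit Types (i j k l : Lambda) (x : Lambda -> R).

Lemma gtopE (F : galg) : gtop F = \sum_A F A * gtop (monom R A).
Proof.
rewrite {1}(_ : F = \sum_A F A *: monom R A).
  by rewrite gtop_sum; apply: eq_bigr => A _; rewrite gtopZ.
apply/ffunP => C; rewrite sum_ffunE (bigD1 C) //= big1 ?addr0 => [|A AC].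
  by rewrite grassmannZ ffunE eqxx mulr1.
by rewrite grassmannZ ffunE eq_sym (negPf AC) mulr0.
Qed.

Lemma der_gtop (t : R) (F : R -> galg) dF : gderive t F dF ->
  is_derive t 1 (fun s => gtop (F s)) (gtop dF).
Proof.
move=> Ff; rewrite gtopE; under eq_fun do rewrite gtopE.
by apply: der_sum => A; have := derM (Ff A) (der_cst (gtop (monom R A)) t); rewrite mulr0 addr0.
Qed.

Lemma cvg_gtop (Z : Type) (F : set_system Z) (u : Z -> galg) (m : galg) : Filter F ->
  gcvg F u m -> gtop (u z) @[z --> F] --> gtop m.
Proof.
move=> FF ul; rewrite gtopE; under eq_fun do rewrite gtopE.
by apply: cvg_sumr => A _; apply: cvgM; [exact: ul|exact: cvg_cst].
Qed.

Variables (beta : Lambda -> Lambda -> R).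
Hypothesis beta_sym : forall i j, beta i j = beta j i.
Local Notation sigma := (sigma beta).

Definition bmul x k : R := \sum_j beta k j * x j.

Lemma quadE x : quad beta x = \sum_k x k * bmul x k.
Proof.
rewrite /quad /bmul; apply: eq_bigr => i _; rewrite mulr_sumr.
by apply: eq_bigr => j _; rewrite mulrCA.
Qed.

Lemma gderiv_sigma k : gderiv (inr k) sigma = - \sum_i beta i k *: xi i.
Proof.
rewrite gderiv_sum -sumrN; apply: eq_bigr => i _; rewrite gderiv_sum (bigD1 k) //= big1 ?addr0.
  by rewrite gderivZ gderiv_generatorM gderiv_generator /= eqxx !scale0r !scale1r sub0r mulr1 scalerN.
move=> j jk; rewrite gderivZ gderiv_generatorM gderiv_generator /= scale0r sub0r.
have -> : (inr k == inr j :> Lambda + Lambda) = false by apply/eqP => -[kj]; rewrite kj eqxx in jk.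
by rewrite !scale0r mulr0 oppr0 scaler0.
Qed.

Definition zeta x : galg := \sum_l bmul x l *: eta l.

(* The divergence of the vector field with components
   gtop (xi k * zeta x * (B * E)) exp (t quad x / 2), divided by the exponential. *)
Lemma localization_identity (t : R) x (B : galg) (dB : Lambda -> galg) :
  geven B -> (forall k, gderiv (inr k) B = - 2 *: (xi k * dB k)) ->
  let E := gexp (- (t *: sigma)) in
  \sum_k (gtop (xi k * (\sum_l beta l k *: eta l) * (B * E)) +
    gtop (xi k * zeta x * ((- 2 * x k) *: dB k * E)) +
    t * bmul x k * gtop (xi k * zeta x * (B * E))) =
  gtop (sigma * (B * E)) - quad beta x * gtop (B * E).
Proof.
move=> eB nB E; set H := B * E.
have eN : geven (- (t *: sigma)) by apply/gevenN/gevenZ/geven_sigma.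
have eE : geven E by exact: geven_gexp.
have dE k : gderiv (inr k) E = t *: ((\sum_i beta i k *: xi i) * E).
  rewrite gderiv_gexp ?bodyN ?bodyZ ?body_sigma ?mulr0 ?oppr0 //.
  by rewrite gderivN gderivZ gderiv_sigma scalerN opprK -scalerAl.
have dH k : gderiv (inr k) H = - 2 *: (xi k * (dB k * E)) + t *: ((\sum_i beta i k *: xi i) * H).
  rewrite (proj2 eB) nB dE -scalerAl -!mulrA; congr (_ + _).
  by rewrite -scalerAr mulrA (proj1 eB) /H mulrA.
have xizeta k : xi k * zeta x = - (zeta x * xi k).
  rewrite /zeta mulr_sumr mulr_suml -sumrN; apply: eq_bigr => l _.
  by rewrite -scalerAr -scalerAl generator_anticomm scalerN.
(* Fermionic integration by parts in eta_k, for the form [zeta x * H]. *)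
have zd k : gtop (zeta x * gderiv (inr k) H) = bmul x k * gtop H.
  have : gderiv (inr k) (zeta x * H) = bmul x k *: H - zeta x * gderiv (inr k) H.
    transitivity (\sum_l bmul x l *: ((k == l)%:R *: H) - zeta x * gderiv (inr k) H).
      rewrite /zeta !mulr_suml gderiv_sum -sumrB; apply: eq_bigr => l _.
      by rewrite -!scalerAl gderivZ gderiv_generatorM scalerBr.
    congr (_ - _); rewrite (bigD1 k) //= eqxx scale1r big1 ?addr0 // => l lk.
    by rewrite eq_sym (negPf lk) scale0r scaler0.
  by move/(congr1 (@gtop _ _)); rewrite gtop_gderiv gtopD gtopN gtopZ => /esym/subr0_eq.
rewrite !big_split /=.
have -> : \sum_k gtop (xi k * (\sum_l beta l k *: eta l) * H) = gtop (sigma * H).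
  rewrite -gtop_sum -mulr_suml; congr (gtop (_ * _)).
  apply: eq_bigr => k _; rewrite mulr_sumr; apply: eq_bigr => l _.
  by rewrite -scalerAr beta_sym.
rewrite -addrA; congr (_ + _); rewrite -big_split /= quadE mulr_suml -sumrN.
transitivity (- \sum_k x k * gtop (zeta x * gderiv (inr k) H)); last first.
  by rewrite -sumrN; apply: eq_bigr => k _; rewrite zd mulrA.
have -> : \sum_k x k * gtop (zeta x * gderiv (inr k) H) =
  gtop (zeta x * \sum_k (x k *: gderiv (inr k) H)).
  by rewrite mulr_sumr gtop_sum; apply: eq_bigr => k _; rewrite -scalerAr gtopZ.
have -> : \sum_k (x k *: gderiv (inr k) H) =
    \sum_k ((- 2 * x k) *: (xi k * (dB k * E)) + (t * bmul x k) *: (xi k * H)).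
  rewrite big_split /=; under eq_bigr => k _ do rewrite dH scalerDr !scalerA.
  rewrite big_split /=; congr (_ + _).
    by apply: eq_bigr => k _; rewrite mulrC.
  transitivity (\sum_k \sum_i (t * (beta i k * x k)) *: (xi i * H)).
    apply: eq_bigr => k _; rewrite mulr_suml scaler_sumr; apply: eq_bigr => i _.
    by rewrite -scalerAl scalerA; congr (_ *: _); ring.
  rewrite exchange_big; apply: eq_bigr => i _; rewrite /bmul mulr_sumr scaler_suml.
  by apply: eq_bigr.
rewrite mulr_sumr gtop_sum -sumrN; apply: eq_bigr => k _.
rewrite xizeta !mulNr !gtopN mulrDr -!scalerAl -!scalerAr !gtopD !gtopZ opprD.
rewrite -(mulrA (zeta x) (xi k) (dB k * E)) -(mulrA (zeta x) (xi k) H) /GRing.scale /=.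
by move: (gtop (zeta x * (xi k * (dB k * E)))) (gtop (zeta x * (xi k * H))) => g1 g2; ring.
Qed.

End BerezinCalculus.

(** * Functions of the squared masses on the future cone *)

Section FutureForms.
Variables (R : realType) (Lambda : finType).
Local Notation galg := (galg R Lambda).
Local Notation W := ((Lambda + Lambda) + Lambda)%type.
Implicit Types (w : W -> R) (k : Lambda) (c : W).

#[local] Instance nbhs_ptws_filter (I : finType) (q : {ptws I -> R}) : Filter (nbhs q) := nbhs_filter q.

Definition zc w : Lambda -> R := fun k => w (iz k).
Definition xc w : Lambda -> R := fun k => w (ix k).
Definition yc w : Lambda -> R := fun k => w (iy k).
Definition mass w : Lambda -> R := mass2 (zc w) (xc w) (yc w).
Definition future w : R := \prod_k (0 < w (iz k))%R%:R.

Definition vertex c : Lambda := match c with inl (inl k) => k | inl (inr k) => k | inr k => k end.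
(** The sign with which the square of the coordinate [c] enters q. *)
Definition signature c : R := if c is inl (inl _) then 1 else -1.

Lemma mass_upd w c (s : R) :
  mass (upd w c s) = upd (mass w) (vertex c) (mass w (vertex c) + signature c * (s ^+ 2 - w c ^+ 2)).
Proof.
apply/funext => l; rewrite /mass /mass2 /zc /xc /yc.
case: c => [[k|k]|k]; rewrite /upd /= /iz /ix /iy;
  rewrite ?(inj_eq inl_inj) ?(inj_eq inr_inj) /=; case: eqVneq => [->|//]; ring.
Qed.

Lemma cvg_mass w k : mass w' k @[w' --> (w : {ptws W -> R})] --> mass w k.
Proof.
have sq c : (w' c) ^+ 2 @[w' --> (w : {ptws W -> R})] --> w c ^+ 2.
  by apply: cvgM; exact: (@cvg_coord R W w c).
apply: (@cvgB _ R^o); last exact: sq.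
by apply: (@cvgB _ R^o); exact: sq.
Qed.

Section support.
Variables (a b : R) (H : (Lambda -> R) -> R).
Hypotheses (a0 : 0 < a) (Hab : forall q, ~ box a b q -> H q = 0).

Definition hat w : R := future w * H (mass w).

Lemma hat_neq0 w : hat w != 0 ->
  forall k, [/\ 0 < w (iz k), `|w (ix k)| <= w (iz k) & `|w (iy k)| <= w (iz k)].
Proof.
rewrite mulf_eq0 negb_or => /andP[f0 H0] k.
have zk : 0 < w (iz k).
  move: f0; rewrite /future (bigD1 k) //= mulf_eq0 negb_or => /andP[+ _].
  by case: (0 < w (iz k)) => //; rewrite eqxx.
have qb : box a b (mass w) by apply: contrapT => /Hab Hw; rewrite Hw eqxx in H0.
have /andP[ak _] := qb k; rewrite /mass /mass2 in ak.
have H1 (u v : R) : 0 <= a + u ^+ 2 -> v ^+ 2 + (a + u ^+ 2) <= w (iz k) ^+ 2 -> `|v| <= w (iz k).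
  move=> u0 uv; rewrite -(@ler_pXn2r _ 2) ?nnegrE ?(ltW zk) // real_normK ?num_real //.
  by apply: le_trans uv; rewrite lerDl.
rewrite /zc /xc /yc in ak; split=> //.
  by apply: (H1 (w (iy k))); [rewrite addr_ge0 ?sqr_ge0 // ltW|lra].
by apply: (H1 (w (ix k))); [rewrite addr_ge0 ?sqr_ge0 // ltW|lra].
Qed.

Let cases w : (exists k, mass w k < a) \/ (forall k, a <= mass w k).
Proof.
have [/existsNP[k /negP]|] := pselect (~ forall k, a <= mass w k); last by move/contrapT; right.
by rewrite -ltNge; left; exists k.
Qed.

Let hat0 w k : mass w k < a -> hat w = 0.
Proof.
by move=> qk; rewrite /hat Hab ?mulr0 // => /(_ k); rewrite leNgt qk.
Qed.

Let z_neq0 w k : a <= mass w k -> w (iz k) != 0.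
Proof.
move=> ak; apply/eqP => zk; move: ak; rewrite leNgt => /negP; apply.
rewrite /mass /mass2 /zc zk expr0n /= sub0r; apply: le_lt_trans a0.
by rewrite -opprD oppr_le0 addr_ge0 ?sqr_ge0.
Qed.

Let near_sign (r : R) : r != 0 -> \forall s \near r, (0 < s) = (0 < r).
Proof.
rewrite neq_lt => /orP[r0|r0].
  by near=> s; rewrite [RHS]lt_gtF // lt_gtF //; near: s; exact: lt_nbhsl.
by near=> s; rewrite r0; near: s; exact: lt_nbhsr.
Unshelve. all: by end_near. Qed.

(** Where all q_k are at least a > 0, no z_k vanishes and the cut to z > 0 is locally constant;
    elsewhere the function is 0 nearby. The jump of the indicator is never seen. *)
Lemma pcontinuous_hat : pcontinuous H -> pcontinuous hat.
Proof.
move=> cH w; have [[k qk]|qa] := cases w.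
  have nk : \forall w' \near (w : {ptws W -> R}), mass w' k < a.
    by have := @cvg_mass w k _ (lt_nbhsl qk).
  rewrite /continuous_at (hat0 qk); apply: cvg_eq_near (cvg_cst 0).
  by apply: filterS nk => w' /hat0 ->.
have nf : \forall w' \near (w : {ptws W -> R}), future w' = future w.
  have nk k : \forall w' \near (w : {ptws W -> R}), (0 < w' (iz k)) = (0 < w (iz k)).
    by have := @cvg_coord R W w (iz k) _ (near_sign (z_neq0 (qa k))).
  have na : \forall w' \near (w : {ptws W -> R}), forall k, (0 < w' (iz k)) = (0 < w (iz k)).
    exact: (@filter_forall _ Lambda (fun k (w' : {ptws W -> R}) => (0 < w' (iz k)) = (0 < w (iz k))) _ _ nk).
  by apply: filterS na => w' E; rewrite /future; apply: eq_bigr => k _; rewrite E.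
have cHm : H (mass w') @[w' --> (w : {ptws W -> R})] --> H (mass w).
  have F0 : Filter (nbhs (w : {ptws W -> R})) by exact: nbhs_filter.
  by have Hc := pcontinuous_cvg _ cH (@cvg_mass w); exact: Hc.
have : future w * H (mass w') @[w' --> (w : {ptws W -> R})] --> hat w.
  by apply: cvgM; [exact: cvg_cst|exact: cHm].
apply: cvg_eq_near; apply: filterS nf => w' E; by rewrite /hat E.
Qed.

Lemma derive_hat (dH : Lambda -> (Lambda -> R) -> R) w c :
  (forall (q : Lambda -> R) k, is_derive (q k) 1 (fun t => H (upd q k t)) (dH k q)) ->
  (forall q k, ~ box a b q -> dH k q = 0) ->
  is_derive (w c) 1 (fun s => hat (upd w c s))
    (signature c * 2 * w c * (future w * dH (vertex c) (mass w))).
Proof.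
move=> DH dH0; have updw : upd w c (w c) = w by exact: updK.
have cm : (fun s : R => upd w c s) @ w c --> (w : {ptws W -> R}).
  apply: cvg_ptws => c'; rewrite /upd /=; case: eqVneq => [->|_]; first exact: cvg_id.
  exact: cvg_cst.
have [[k qk]|qa] := cases w.
  rewrite dH0 ?mulr0; last by move=> /(_ k); rewrite leNgt qk.
  have nk : \forall s \near w c, mass (upd w c s) k < a.
    have nk : \forall w' \near (w : {ptws W -> R}), mass w' k < a.
      by have := @cvg_mass w k _ (lt_nbhsl qk).
    exact: cm _ nk.
  apply: der_near (der_cst 0 (w c)).
  by apply: filterS nk => s /hat0 ->.
have nf : \forall s \near w c, future (upd w c s) = future w.
  have nk k : \forall w' \near (w : {ptws W -> R}), (0 < w' (iz k)) = (0 < w (iz k)).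
    by have := @cvg_coord R W w (iz k) _ (near_sign (z_neq0 (qa k))).
  have na : \forall w' \near (w : {ptws W -> R}), forall k, (0 < w' (iz k)) = (0 < w (iz k)).
    exact: (@filter_forall _ Lambda (fun k (w' : {ptws W -> R}) => (0 < w' (iz k)) = (0 < w (iz k))) _ _ nk).
  have ns : \forall s \near w c, forall k, (0 < upd w c s (iz k)) = (0 < w (iz k)) by exact: cm _ na.
  by apply: filterS ns => s E; rewrite /future; apply: eq_bigr => k _; rewrite E.
have Dm : is_derive (w c) 1 (fun s => mass w (vertex c) + signature c * (s ^+ 2 - w c ^+ 2))
    (signature c * (2 * w c)).
  have D := derD (der_cst (mass w (vertex c)) (w c))
    (derZ (signature c) (derB (derM (der_id (w c)) (der_id (w c))) (der_cst (w c ^+ 2) (w c)))).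
  by apply: der_eq D _; ring.
have := DH (mass w) (vertex c).
have E : mass w (vertex c) = mass w (vertex c) + signature c * (w c ^+ 2 - w c ^+ 2).
  by rewrite subrr mulr0 addr0.
rewrite {1}E => DH'; have := derZ (future w) (@der_comp R (fun t => H (upd (mass w) (vertex c) t))
  (fun s => mass w (vertex c) + signature c * (s ^+ 2 - w c ^+ 2)) _ _ _ DH' Dm) => D.
apply: der_near (der_eq D _).
  by apply: filterS nf => s Es; rewrite /hat Es mass_upd.
by ring.
Qed.

End support.
End FutureForms.

(** * Closure properties of continuity *)

Section PointwiseContinuity.
Variables (R : realType) (I : finType).
Implicit Types (f g : (I -> R) -> R).

Let FF (q : {ptws I -> R}) : Filter (nbhs q). Proof. exact: nbhs_filter. Qed.

Lemma pcontinuous_cst (c : R) : pcontinuous (fun _ : I -> R => c).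
Proof. by move=> q; exact: (@cvg_cst _ _ _ (nbhs (q : {ptws I -> R})) (FF q)). Qed.

Lemma pcontinuousD f g : pcontinuous f -> pcontinuous g -> pcontinuous (fun q => f q + g q).
Proof. by move=> cf cg q; apply: (@cvgD _ R^o _ _ (FF q)); [exact: cf|exact: cg]. Qed.

Lemma pcontinuousB f g : pcontinuous f -> pcontinuous g -> pcontinuous (fun q => f q - g q).
Proof. by move=> cf cg q; apply: (@cvgB _ R^o _ _ (FF q)); [exact: cf|exact: cg]. Qed.

Lemma pcontinuousM f g : pcontinuous f -> pcontinuous g -> pcontinuous (fun q => f q * g q).
Proof. by move=> cf cg q; apply: (@cvgM R _ _ (FF q)); [exact: cf|exact: cg]. Qed.

Lemma pcontinuous_sum (J : Type) (r : seq J) (P : pred J) (f : J -> (I -> R) -> R) :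
  (forall j, P j -> pcontinuous (f j)) -> pcontinuous (fun q => \sum_(j <- r | P j) f j q).
Proof. by move=> cf q; apply: (@cvg_sumr _ _ _ _ _ _ _ _ (FF q)) => j Pj; exact: cf. Qed.

Lemma pcontinuous_coord i : pcontinuous (fun q : I -> R => q i).
Proof. by move=> q; exact: cvg_coord. Qed.

Lemma pcontinuous_comp (phi : R -> R) f : continuous phi -> pcontinuous f ->
  pcontinuous (fun q => phi (f q)).
Proof. by move=> cphi cf q; apply: (cvg_comp _ _ (cf q)); exact: cphi. Qed.

Lemma pcontinuous_sub (J : finType) (h : (J -> R) -> R) (s : J -> I) : pcontinuous h ->
  pcontinuous (fun q : I -> R => h (fun j => q (s j))).
Proof.
move=> ch q; have cs (j : J) : q' (s j) @[q' --> (q : {ptws I -> R})] --> q (s j) by exact: cvg_coord.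
have F0 := FF q; by have Hc := pcontinuous_cvg _ ch cs; exact: Hc.
Qed.

Lemma pcontinuous_norm f : pcontinuous f -> pcontinuous (fun q => `|f q|).
Proof. by move=> cf; apply: pcontinuous_comp cf => r; exact: norm_continuous. Qed.

Lemma pcontinuous_expR f : pcontinuous f -> pcontinuous (fun q => expR (f q)).
Proof. by move=> cf; apply: pcontinuous_comp cf; exact: continuous_expR. Qed.

Variable Lambda : finType.
Local Notation galg := (galg R Lambda).

Definition gcontinuous (F : (I -> R) -> galg) := forall A, pcontinuous (fun q => F q A).

Lemma gcontinuous_cst (c : galg) : gcontinuous (fun=> c).
Proof. by move=> A; exact: pcontinuous_cst. Qed.

Lemma gcontinuousM F G : gcontinuous F -> gcontinuous G -> gcontinuous (fun q => F q * G q).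
Proof.
move=> cF cG A q; apply: (@gcvgM _ _ _ _ (FF q)) => C; [exact: cF|exact: cG].
Qed.

Lemma gcontinuousZ f F : pcontinuous f -> gcontinuous F -> gcontinuous (fun q => f q *: F q).
Proof.
move=> cf cF A q; apply: (@gcvgZ _ _ _ _ (FF q)) => [|C]; [exact: cf|exact: cF].
Qed.

Lemma gcontinuous_sum (J : Type) (r : seq J) (F : J -> (I -> R) -> galg) :
  (forall j : J, gcontinuous (F j)) -> gcontinuous (fun q => \sum_(j <- r) F j q).
Proof.
by move=> cF A q; apply: (@gcvg_sum _ _ _ _ (FF q)) => j _ C; exact: cF.
Qed.

Lemma pcontinuous_gtop F : gcontinuous F -> pcontinuous (fun q => gtop (F q)).
Proof. by move=> cF q; apply: (@cvg_gtop _ _ _ _ _ _ (FF q)) => A; exact: cF. Qed.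

End PointwiseContinuity.

(** * Independence of the interaction *)

Section Localization.
Variables (R : realType) (Lambda : finType).
Local Notation galg := (galg R Lambda).
Local Notation xi := (@gxi R Lambda).
Local Notation eta := (@geta R Lambda).
Local Notation W := ((Lambda + Lambda) + Lambda)%type.
Local Notation leb3 := (@lebesgue3 R Lambda).
Implicit Types (w : W -> R) (k : Lambda) (c : W) (s t : R).

Variables (a b T : R) (G : (Lambda -> R) -> galg) (dG : Lambda -> (Lambda -> R) -> galg).
Hypotheses (a0 : 0 < a) (sG : supercompact a b G dG) (T0 : 0 <= T).
Variable phi : (Lambda -> R) -> R.
Hypotheses (cphi : pcontinuous phi)
  (phi0 : forall z, (forall k, 0 <= z k) -> T <= \sum_k z k -> phi z = 0).

(** A form in q alone does not have compact support in the coordinates; the test function [phi] of z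
    supplies it. *)
Definition cutoff (H : (Lambda -> R) -> galg) w : galg :=
  phi (zc w) *: (future w *: H (mass w)).

Let B := cutoff G.
Let dB k := cutoff (dG k).

Lemma cutoffE (H : (Lambda -> R) -> galg) w A : cutoff H w A = phi (zc w) * hat (fun q => H q A) w.
Proof. by rewrite /cutoff !grassmannZ. Qed.

(** On the support z is positive with sum below [T], and it dominates |x| and |y|; this confines all
    coordinates. *)
Lemma cutoff_eq0 (H : (Lambda -> R) -> galg) w : (forall q, ~ box a b q -> H q = 0) -> ~ box (- T) T w -> cutoff H w = 0.
Proof.
move=> H0 nb; apply/ffunP => A; rewrite cutoffE [RHS]ffunE; apply/eqP; rewrite mulf_eq0; apply/orP.
case: (boolP (hat _ w == 0)) => [_|hw]; [by right|left].
have HA q : ~ box a b q -> H q A = 0 by move=> qb; rewrite H0 // ffunE.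
have supp := hat_neq0 a0 HA hw; apply/eqP; apply: phi0.
  by move=> k; have [/ltW] := supp k.
rewrite leNgt; apply/negP => zT; apply: nb => c.
have zkT k : w (iz k) <= T.
  apply: le_trans (ltW zT); rewrite (bigD1 k) //= lerDl sumr_ge0 // => j _.
  by have [/ltW] := supp j.
rewrite -ler_norml; case: c => [[k|k]|k].
- by have [zk _ _] := supp k; rewrite ger0_norm ?(ltW zk) //; exact: zkT.
- by have [_ xk _] := supp k; apply: le_trans xk (zkT k).
- by have [_ _ yk] := supp k; apply: le_trans yk (zkT k).
Qed.

Lemma gcontinuous_cutoff (H : (Lambda -> R) -> galg) : (forall q, ~ box a b q -> H q = 0) ->
  (forall A, pcontinuous (fun q => H q A)) -> gcontinuous (cutoff H).
Proof.
move=> H0 cH A; have -> : (fun w => cutoff H w A) = (fun w => phi (zc w) * hat (fun q => H q A) w).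
  by apply/funext => w; rewrite cutoffE.
apply: pcontinuousM; first exact: (@pcontinuous_sub R W Lambda phi (@iz Lambda) cphi).
by apply: (@pcontinuous_hat _ _ a b) => // q qb; rewrite H0 // ffunE.
Qed.

Let cB : gcontinuous B.
Proof. by apply: gcontinuous_cutoff; [exact: supercompact_eq0 sG|exact: supercompact_cvg sG]. Qed.

Let cdB k : gcontinuous (dB k).
Proof. by apply: gcontinuous_cutoff; [exact: supercompact_deq0 sG k|exact: supercompact_dcvg sG k]. Qed.

Let B0 w : ~ box (- T) T w -> B w = 0.
Proof. by apply: cutoff_eq0; exact: supercompact_eq0 sG. Qed.

Let dB0 k w : ~ box (- T) T w -> dB k w = 0.
Proof. by apply: cutoff_eq0; exact: supercompact_deq0 sG k. Qed.

Lemma geven_cutoff w : geven (B w).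
Proof. by do 2 apply: gevenZ; exact: supercompact_even sG _. Qed.

Lemma gderiv_cutoff w k : gderiv (inr k) (B w) = - 2 *: (xi k * dB k w).
Proof.
rewrite /B /dB /cutoff !gderivZ (supercompact_eta sG) -!scalerAr !scalerA.
by congr (_ *: _); ring.
Qed.

Lemma gderive_cutoff w c s : signature R c = -1 ->
  gderive s (fun r => B (upd w c r)) ((- 2 * s) *: dB (vertex c) (upd w c s)).
Proof.
move=> c1 A; rewrite grassmannZ cutoffE.
have zcE r : zc (upd w c r) = zc w.
  apply/funext => j; rewrite /zc upd_neq //; apply/eqP => jc; move: c1; rewrite -jc /= => /eqP.
  by rewrite -subr_eq0 opprK -mulr2n pnatr_eq0.
have := @derive_hat R Lambda a b (fun q => G q A) a0 _ (fun k q => dG k q A) (upd w c s) c.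
move=> /(_ _ (fun q k => supercompact_derive sG q k A)); rewrite updE => D.
have D' : is_derive s 1 (fun r => hat (fun q => G q A) (upd w c r))
    (signature R c * 2 * s * (future (upd w c s) * dG (vertex c) (mass (upd w c s)) A)).
  have <- : (fun r => hat (fun q => G q A) (upd (upd w c s) c r)) =
      (fun r => hat (fun q => G q A) (upd w c r)) by apply/funext => r; rewrite upd_upd.
  apply: D => [q qb|q k qb]; first by rewrite (supercompact_eq0 sG qb) ffunE.
  by rewrite (supercompact_deq0 sG k qb) ffunE.
have -> : (fun r => B (upd w c r) A) = (fun r => phi (zc w) * hat (fun q => G q A) (upd w c r)).
  by apply/funext => r; rewrite cutoffE zcE.
by apply: der_eq (derZ (phi (zc w)) D') _; rewrite zcE c1 /hat; ring.
Qed.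

Variable beta : Lambda -> Lambda -> R.
Hypothesis beta_sym : forall i j, beta i j = beta j i.
Local Notation sigma := (sigma beta).
Local Notation quad := (quad beta).

Let E t : galg := gexp (- (t *: sigma)).
Let Q w : R := (quad (xc w) + quad (yc w)) / 2.
Let e t w : R := expR (t * Q w).

Let cQ : pcontinuous Q.
Proof.
apply: pcontinuousM; last exact: pcontinuous_cst.
by apply: pcontinuousD; do 2 (apply: pcontinuous_sum => ? _);
  apply: pcontinuousM; try exact: pcontinuous_cst; apply: pcontinuousM; exact: pcontinuous_coord.
Qed.

Let ce t : pcontinuous (e t).
Proof. by apply: pcontinuous_expR; apply: pcontinuousM => //; exact: pcontinuous_cst. Qed.

Lemma der_upd (x : Lambda -> R) k j s : is_derive s 1 (fun r => upd x k r j) (j == k)%:R.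
Proof.
have [->|jk] := eqVneq j k; first by under eq_fun do rewrite updE; exact: der_id.
by under eq_fun do rewrite upd_neq //; exact: der_cst.
Qed.

Lemma der_quad (x : Lambda -> R) k s :
  is_derive s 1 (fun r => quad (upd x k r)) (2 * bmul beta (upd x k s) k).
Proof.
have := @der_sum R _ (index_enum Lambda) _ s _ (fun i => @der_sum R _ (index_enum Lambda) _ s _
  (fun j => derZ (beta i j) (derM (der_upd x k i s) (der_upd x k j s)))).
move=> D; apply: der_eq D _.
under eq_bigr do under eq_bigr do rewrite mulrDr.
under eq_bigr do rewrite big_split /=; rewrite big_split /= mulr2n mulrDl mul1r; congr (_ + _).
  rewrite (bigD1 k) //= [X in _ + X]big1 ?addr0 => [|i /negPf ik]; last first.
    by rewrite big1 // => j _; rewrite ik mul0r mulr0.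
  by rewrite /bmul; apply: eq_bigr => j _; rewrite eqxx mul1r.
rewrite exchange_big (bigD1 k) //= [X in _ + X]big1 ?addr0 => [|i /negPf ik]; last first.
  by rewrite big1 // => j _; rewrite ik !mulr0.
by rewrite /bmul; apply: eq_bigr => j _; rewrite eqxx mulr1 beta_sym.
Qed.

Lemma gderive_zeta (x : Lambda -> R) k s :
  gderive s (fun r => zeta beta (upd x k r)) (\sum_l beta l k *: eta l).
Proof.
apply: gderive_sum => l.
have D : is_derive s 1 (fun r => bmul beta (upd x k r) l) (beta l k).
  have := @der_sum R _ (index_enum Lambda) _ s _ (fun j => derZ (beta l j) (der_upd x k j s)).
  move=> D; apply: der_eq D _; rewrite (bigD1 k) //= big1 ?addr0 ?eqxx ?mulr1 // => j /negPf ->.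
  by rewrite mulr0.
by have := gderiveZ D (gderive_cst s (eta l)); rewrite scaler0 addr0.
Qed.

Section direction.
Variable co : Lambda -> W.
Hypotheses (co_inj : injective co) (co1 : forall k, signature R (co k) = -1)
  (co_vertex : forall k, vertex (co k) = k).
Let cv w : Lambda -> R := fun k => w (co k).
Hypothesis dQ : forall w k s,
  is_derive s 1 (fun r => Q (upd w (co k) r)) (bmul beta (cv (upd w (co k) s)) k).

Let cv_upd w k s : cv (upd w (co k) s) = upd (cv w) k s.
Proof. by apply/funext => j; rewrite /cv /upd /= (inj_eq co_inj). Qed.

Let cbmul l : pcontinuous (fun w => bmul beta (cv w) l).
Proof.
apply: pcontinuous_sum => j _; apply: pcontinuousM; first exact: pcontinuous_cst.
exact: pcontinuous_coord.
Qed.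

Let czeta : gcontinuous (fun w => zeta beta (cv w)).
Proof. by apply: gcontinuous_sum => l; apply: gcontinuousZ; [exact: cbmul|exact: gcontinuous_cst]. Qed.

(** [V k] is the component along [co k] of a vector field, where [co] stands for the x or the y
    coordinates, and [V' k] is its derivative. Each [V' k] has integral 0, and
    [localization_identity] computes their sum. *)
Lemma localization_divergence t :
  \int[leb3]_p ((gtop (sigma * (B (point p) * E t)) -
     quad (cv (point p)) * gtop (B (point p) * E t)) * e t (point p)) = 0.
Proof.
pose V k w := gtop (xi k * zeta beta (cv w) * (B w * E t)) * e t w.
pose V' k w := (gtop (xi k * (\sum_l beta l k *: eta l) * (B w * E t)) +
    gtop (xi k * zeta beta (cv w) * ((- 2 * cv w k) *: dB k w * E t)) +
    t * bmul beta (cv w) k * gtop (xi k * zeta beta (cv w) * (B w * E t))) * e t w.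
have cBE : gcontinuous (fun w => B w * E t).
  by apply: gcontinuousM => //; exact: gcontinuous_cst.
have cxz k : gcontinuous (fun w => xi k * zeta beta (cv w)).
  by apply: gcontinuousM => //; exact: gcontinuous_cst.
have cV' k : pcontinuous (V' k).
  apply: pcontinuousM => //; apply: pcontinuousD; first apply: pcontinuousD.
  - by apply: pcontinuous_gtop; apply: gcontinuousM => //; exact: gcontinuous_cst.
  - apply: pcontinuous_gtop; apply: gcontinuousM => //; apply: gcontinuousM; last exact: gcontinuous_cst.
    apply: gcontinuousZ; last exact: cdB.
    by apply: pcontinuousM; [exact: pcontinuous_cst|exact: pcontinuous_coord].
  - apply: pcontinuousM; last by apply: pcontinuous_gtop; exact: gcontinuousM.
    by apply: pcontinuousM; [exact: pcontinuous_cst|exact: cbmul].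
have V0 k w : ~ box (- T) T w -> V k w = 0.
  by move=> wb; rewrite /V B0 // mul0r mulr0 gtop0 mul0r.
have V'0 k w : ~ box (- T) T w -> V' k w = 0.
  move=> wb; rewrite /V' B0 // dB0 // scaler0 !mul0r !mulr0 gtop0.
  by rewrite mulr0 !addr0 mul0r.
have DV k w s : is_derive s 1 (fun r => V k (upd w (co k) r)) (V' k (upd w (co k) s)).
  have DB : gderive s (fun r => B (upd w (co k) r)) ((- 2 * s) *: dB k (upd w (co k) s)).
    by have := gderive_cutoff w s (co1 k); rewrite co_vertex.
  have Dz : gderive s (fun r => zeta beta (cv (upd w (co k) r))) (\sum_l beta l k *: eta l).
    under [X in gderive _ X]eq_fun do rewrite cv_upd; exact: gderive_zeta.
  have D1 := gderiveM (gderive_cst s (xi k)) Dz; rewrite mul0r add0r in D1.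
  have D2 := gderiveM DB (gderive_cst s (E t)); rewrite mulr0 addr0 in D2.
  have D3 := der_gtop (gderiveM D1 D2); rewrite gtopD in D3.
  have D4 := der_expR (derZ t (dQ w k s)).
  apply: der_eq (derM D3 D4) _; rewrite /V' /e.
  have -> : cv (upd w (co k) s) k = s by rewrite /cv updE.
  by ring.
have I0 k := integral_derive_point T0 (cV' k) (V0 k) (V'0 k) (DV k).
transitivity (\sum_k \int[leb3]_p V' k (point p)); last by apply: big1 => k _; exact: I0.
rewrite -Rintegral_sum //; last by move=> k; exact: compact_integrable T0 (cV' k) (V'0 k).
apply: eq_Rintegral => p _; rewrite -mulr_suml; congr (_ * _).
rewrite (localization_identity beta_sym t (cv (point p)) (geven_cutoff (point p)) _) //.
by move=> k; exact: gderiv_cutoff.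
Qed.

End direction.
Let quad_const (x : Lambda -> R) s : is_derive s 1 (fun _ : R => quad x) 0.
Proof. exact: der_cst. Qed.

Let inj_ix : injective (@ix Lambda). Proof. by move=> i j []. Qed.
Let inj_iy : injective (@iy Lambda). Proof. by move=> i j []. Qed.

Let dQx w k s :
  is_derive s 1 (fun r => Q (upd w (ix k) r)) (bmul beta (xc (upd w (ix k) s)) k).
Proof.
have xE r : xc (upd w (ix k) r) = upd (xc w) k r.
  by apply/funext => j; rewrite /xc /upd /=.
have yE r : yc (upd w (ix k) r) = yc w by [].
have := derM (derD (der_quad (xc w) k s) (quad_const (yc w) s)) (der_cst (2^-1) s).
rewrite -xE => D; rewrite /Q; under eq_fun do rewrite xE yE.
by apply: der_eq D _; rewrite mulr0 !addr0 mulrAC divff ?mul1r // pnatr_eq0.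
Qed.

Let dQy w k s :
  is_derive s 1 (fun r => Q (upd w (iy k) r)) (bmul beta (yc (upd w (iy k) s)) k).
Proof.
have yE r : yc (upd w (iy k) r) = upd (yc w) k r.
  by apply/funext => j; rewrite /yc /upd /=.
have xE r : xc (upd w (iy k) r) = xc w by [].
have := derM (derD (quad_const (xc w) s) (der_quad (yc w) k s)) (der_cst (2^-1) s).
rewrite -yE => D; rewrite /Q; under eq_fun do rewrite xE yE.
by apply: der_eq D _; rewrite mulr0 add0r addr0 mulrAC divff ?mul1r // pnatr_eq0.
Qed.

Let J t w : R := gtop (B w * E t) * e t w.
Let dJ t w : R := (Q w * gtop (B w * E t) - gtop (sigma * (B w * E t))) * e t w.

Let cE t : gcontinuous (fun w => B w * E t).
Proof. by apply: gcontinuousM => //; exact: gcontinuous_cst. Qed.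

Let csE t : gcontinuous (fun w => sigma * (B w * E t)).
Proof. by apply: gcontinuousM => //; exact: gcontinuous_cst. Qed.

Let cJ t : pcontinuous (J t).
Proof. by apply: pcontinuousM => //; exact: pcontinuous_gtop. Qed.

Let J0 t w : ~ box (- T) T w -> J t w = 0.
Proof. by move=> wb; rewrite /J B0 // mul0r gtop0 mul0r. Qed.

(** The derivative in t is minus half the sum of the divergences in x and in y; half of the two
    quadratic forms together is [Q]. *)
Let integral_dJ t : \int[leb3]_p dJ t (point p) = 0.
Proof.
have Hx := localization_divergence inj_ix (fun=> erefl) (fun=> erefl) dQx t.
have Hy := localization_divergence inj_iy (fun=> erefl) (fun=> erefl) dQy t.
pose D (v : (W -> R) -> Lambda -> R) w := (gtop (sigma * (B w * E t)) - quad (v w) * gtop (B w * E t)) * e t w.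
have iD (v : (W -> R) -> Lambda -> R) : pcontinuous (fun w => quad (v w)) ->
    leb3.-integrable setT (EFin \o (fun p => D v (point p))).
  move=> cv; apply: (@compact_integrable _ _ (D v) T) => // [|w wb]; last first.
    by rewrite /D B0 // mul0r mulr0 gtop0 mulr0 subr0 mul0r.
  apply: pcontinuousM; last exact: ce.
  apply: pcontinuousB; first exact: pcontinuous_gtop (@csE t).
  by apply: pcontinuousM; [exact: cv|exact: pcontinuous_gtop (@cE t)].
have cquad (v : Lambda -> W) : pcontinuous (fun w => quad (fun k => w (v k))).
  do 2 (apply: pcontinuous_sum => ? _); apply: pcontinuousM; first exact: pcontinuous_cst.
  by apply: pcontinuousM; exact: pcontinuous_coord.
have ixD := @iD (@xc R Lambda) (@cquad (@ix Lambda)).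
have iyD := @iD (@yc R Lambda) (@cquad (@iy Lambda)).
have : \int[leb3]_p (D (@xc R Lambda) (point p) + D (@yc R Lambda) (point p)) = 0.
  by rewrite (RintegralD measurableT ixD iyD); rewrite [X in X + _]Hx [X in _ + X]Hy addr0.
move=> H; transitivity (- 2^-1 * \int[leb3]_p (D (@xc R Lambda) (point p) + D (@yc R Lambda) (point p))).
  rewrite -RintegralZl //; last exact: rintegrableD.
  by apply: eq_Rintegral => p _; rewrite /dJ /D /Q; field.
by rewrite H mulr0.
Qed.

Let der_J t w : is_derive t 1 (fun s => J s w) (dJ t w).
Proof.
have eN : geven (- (t *: sigma)) by apply/gevenN/gevenZ/geven_sigma.
have DN : gderive t (fun s => - (s *: sigma)) (- sigma).
  have := gderiveB (gderive_cst t 0) (gderiveZ (der_id t) (gderive_cst t sigma)).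
  rewrite scaler0 addr0 scale1r sub0r; congr gderive.
  by apply/funext => s; rewrite sub0r.
have DE := gderive_gexp eN _ _ DN; rewrite !bodyN bodyZ body_sigma mulr0 oppr0 in DE.
have D1 := der_gtop (gderiveM (gderive_cst t (B w)) (DE erefl erefl)).
have D2 := der_expR (derM (der_id t) (der_cst (Q w) t)).
apply: der_eq (derM D1 D2) _; rewrite /dJ /e mul0r add0r mul1r mulr0 addr0.
have -> : B w * (- sigma * gexp (- (t *: sigma))) = - (sigma * (B w * E t)).
  by rewrite mulNr mulrN mulrA [B w * sigma](proj1 (geven_cutoff w)) -mulrA.
by rewrite gtopN -/(E t); ring.
Qed.

Let gexpE s : E s = \sum_(m < #|{: Lambda + Lambda}|.+1) ((- s) ^+ m / m`!%:R) *: sigma ^+ m.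
Proof.
rewrite /E /gexp; apply: eq_bigr => m _.
by rewrite -scaleNr exprZn scalerA mulrC.
Qed.

(** Bounds the derivative in t uniformly for |t| <= M by a continuous function of compact support,
    as differentiation under the integral requires. *)
Let bound M w : R := \sum_(m < #|{: Lambda + Lambda}|.+1) M ^+ m *
  (`|Q w| * `|gtop (B w * sigma ^+ m)| + `|gtop (sigma * (B w * sigma ^+ m))|) * expR (M * `|Q w|).

Let dJ_bound M s w : `|s| <= M -> `|dJ s w| <= bound M w.
Proof.
move=> sM; have M0 : 0 <= M by rewrite (le_trans _ sM).
rewrite /dJ normrM (ger0_norm (expR_ge0 _)) /bound -mulr_suml.
apply: ler_pM => //; last first.
  by rewrite ler_expR (le_trans (ler_norm _)) // normrM ler_wpM2r.
have -> : Q w * gtop (B w * E s) - gtop (sigma * (B w * E s)) =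
    \sum_(m < #|{: Lambda + Lambda}|.+1) ((- s) ^+ m / m`!%:R) *
      (Q w * gtop (B w * sigma ^+ m) - gtop (sigma * (B w * sigma ^+ m))).
  rewrite gexpE !mulr_sumr !gtop_sum !mulr_sumr -sumrB; apply: eq_bigr => m _.
  by rewrite -!scalerAr !gtopZ; ring.
apply: (le_trans (ler_norm_sum _ _ _)); apply: ler_sum => m _; rewrite normrM.
apply: ler_pM => //; last by rewrite (le_trans (ler_normB _ _)) // normrM.
rewrite normrM normrX normrN -[leRHS]mulr1; apply: ler_pM => //.
  by rewrite lerXn2r ?nnegrE.
by rewrite normrV ?unitfE ?pnatr_eq0 -?lt0n ?fact_gt0 // invf_le1 ?normr_nat ?ler1n ?ltr0n ?fact_gt0.
Qed.

(** The integral of [J t] has derivative 0 in t, and t = 0 switches the interaction off. *)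
Lemma localization : \int[leb3]_p J 1 (point p) = \int[leb3]_p gtop (B (point p)).
Proof.
pose K t := \int[leb3]_p J t (point p).
have cbound M : pcontinuous (bound M).
  apply: pcontinuous_sum => m _; apply: pcontinuousM; last first.
    apply: pcontinuous_expR; apply: pcontinuousM; first exact: pcontinuous_cst.
    exact: pcontinuous_norm.
  apply: pcontinuousM; first exact: pcontinuous_cst.
  have cs : gcontinuous (fun w => B w * sigma ^+ m) by apply: gcontinuousM => //; exact: gcontinuous_cst.
  apply: pcontinuousD; last first.
    by apply: pcontinuous_norm; apply: pcontinuous_gtop; apply: gcontinuousM => //; exact: gcontinuous_cst.
  by apply: pcontinuousM; apply: pcontinuous_norm => //; exact: pcontinuous_gtop.
have bound0 M w : ~ box (- T) T w -> bound M w = 0.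
  move=> wb; apply: big1 => m _; rewrite B0 // mul0r mulr0 gtop0 normr0 mulr0 addr0.
  by rewrite mulr0 mul0r.
have DK t : is_derive t 1 K 0.
  pose M := `|t| + 1.
  have It : `]t - 1, t + 1[%classic t by rewrite /= in_itv /= ltrBlDr !ltrDl ltr01.
  have IM s : `]t - 1, t + 1[%classic s -> `|s| <= M.
    rewrite /= in_itv /= => /andP[s1 s2]; rewrite -[s](subrK t) addrC.
    rewrite (le_trans (ler_normD _ _)) // lerD2l ler_norml; apply/andP; split; lra.
  have d1 s p : partial1of2 (fun s p => J s (point p)) s p = dJ s (point p).
    by rewrite partial1of2E; exact: (@derive_val _ _ _ _ _ _ _ (der_J s (point p))).
  have intf s : `]t - 1, t + 1[%classic s -> leb3.-integrable setT (EFin \o (fun p => J s (point p))).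
    by move=> _; have := @compact_integrable R Lambda (J s) T T0 (@cJ s) (@J0 s); exact.
  have derf s p : `]t - 1, t + 1[%classic s -> setT p -> derivable (fun s => J s (point p)) s 1.
    by move=> _ _; case: (der_J s (point p)).
  have bM0 p : 0 <= bound M (point p) by exact: le_trans (dJ_bound (point p) (IM t It)).
  have ib := compact_integrable T0 (cbound M) (bound0 M).
  have ub s p : `]t - 1, t + 1[%classic s -> setT p ->
      `|partial1of2 (fun s p => J s (point p)) s p| <= bound M (point p).
    by move=> Is _; rewrite d1; apply: dJ_bound; exact: IM.
  have DD := derivable_under_integral measurableT It intf derf bM0 ib ub.
  apply: der_derive1 DD _.
  have := differentiation_under_integral measurableT It intf derf bM0 ib ub.
  by move=> ->; under eq_Rintegral do rewrite d1; exact: integral_dJ.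
have -> : \int[leb3]_p J 1 (point p) = K 0 by apply: is_derive_0_is_cst.
apply: eq_Rintegral => p _.
by rewrite /J /e /E scale0r oppr0 gexp0 mulr1 mul0r expR0 mulr1.
Qed.

End Localization.

(** Together with 1 + u <= exp u it bounds |x| by 2 / r times exp (r^2 x^2 / 4), at the price of
    half of a Gaussian decay exp (- r^2 x^2 / 2). *)
Lemma norm_le_square (R : realType) (x r : R) : 0 < r ->
  `|x| <= 2 / r * (1 + r ^+ 2 / 4 * x ^+ 2).
Proof.
move=> r0; have -> : 2 / r * (1 + r ^+ 2 / 4 * x ^+ 2) =
    `|x| + ((r * `|x| / 2 - 1) ^+ 2 + 1 + (r * `|x| / 2) ^+ 2) / r.
  by rewrite -[x ^+ 2]real_normK ?num_real //; field; rewrite gt_eqF.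
by rewrite lerDl divr_ge0 ?addr_ge0 ?sqr_ge0 // ltW.
Qed.

(** * Gaussian integrals in x and y *)

Section Gaussian.
Variables (R : realType) (Lambda : finType).
Local Notation MR := (measurableTypeR R).
Local Notation mu := (@lebesgue_measure R).
Local Notation n := #|Lambda|.
Local Notation leb := (@lebesgue_tuple R n).
Local Notation leb3 := (@lebesgue3 R Lambda).
Implicit Types (s : R).

(** Stated for the square because x and y contribute equal factors; the value comes from the normal
    density of standard deviation s^(-1/2). *)
Lemma gauss1 s : 0 < s ->
  mu.-integrable setT (EFin \o (fun x : R => expR (- (s / 2 * x ^+ 2)))) /\
  (\int[mu]_x expR (- (s / 2 * x ^+ 2))) ^+ 2 = 2 * pi / s.
Proof.
move=> s0; pose sg : R := (Num.sqrt s)^-1.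
have sg0 : sg != 0 by rewrite invr_eq0 gt_eqF // sqrtr_gt0.
have sgE : sg ^+ 2 = s^-1 by rewrite /sg exprVn sqr_sqrtr // ltW.
have peak0 : 0 < normal_peak sg by exact: normal_peak_gt0.
have E : (fun x : R => expR (- (s / 2 * x ^+ 2))) = (fun x => (normal_peak sg)^-1 * normal_pdf 0 sg x).
  apply/funext => x; have -> : normal_pdf 0 sg x = normal_peak sg * normal_fun 0 sg x by rewrite normal_pdfE.
  rewrite mulrA mulVf ?gt_eqF // mul1r /normal_fun.
  by congr expR; rewrite subr0 sgE; field; rewrite gt_eqF.
have i0 : mu.-integrable setT (EFin \o normal_pdf 0 sg) by exact: integrable_normal_pdf.
split; first by rewrite E; exact: rintegrableZ i0.
rewrite E RintegralZl // exprMn.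
have -> : \int[mu]_x normal_pdf 0 sg x = 1 by rewrite /Rintegral integral_normal_pdf.
rewrite expr1n mulr1 exprVn /normal_peak exprVn invrK sqr_sqrtr; last first.
  by rewrite mulrn_wge0 // mulr_ge0 ?sqr_ge0 // pi_ge0.
by rewrite sgE; field; rewrite gt_eqF.
Qed.

Definition gauss s (t : n.-tuple MR) : R := \prod_(k < n) expR (- (s / 2 * (tnth t k) ^+ 2)).

Lemma gaussE s t : gauss s t = expR (- (s / 2 * \sum_k vec t k ^+ 2)).
Proof.
rewrite /gauss -expR_sum; congr expR; rewrite mulr_sumr -sumrN.
by rewrite [RHS](reindex (@enum_val Lambda predT)) /=; [apply: eq_bigr => k _; rewrite /vec enum_valK|
  apply: onW_bij; exact: enum_val_bij].
Qed.

Lemma integral_prod3 (u v h : n.-tuple MR -> R) : leb.-integrable setT (EFin \o u) ->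
  leb.-integrable setT (EFin \o v) -> leb.-integrable setT (EFin \o h) ->
  leb3.-integrable setT (EFin \o (fun p => u p.1.1 * v p.1.2 * h p.2)) /\
  \int[leb3]_p (u p.1.1 * v p.1.2 * h p.2) =
    (\int[leb]_t u t) * (\int[leb]_t v t) * (\int[leb]_t h t).
Proof.
move=> iu iv ih.
have m (f : n.-tuple MR -> R) : leb.-integrable setT (EFin \o f) -> measurable_fun setT f.
  by move=> /measurable_int /measurable_EFinP.
have mF : measurable_fun setT (fun p : n.-tuple MR * n.-tuple MR * n.-tuple MR => u p.1.1 * v p.1.2 * h p.2).
  apply: measurable_funM; first apply: measurable_funM.
  - exact: measurableT_comp (m _ iu) (measurableT_comp measurable_fst measurable_fst).
  - exact: measurableT_comp (m _ iv) (measurableT_comp measurable_snd measurable_fst).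
  - exact: measurableT_comp (m _ ih) measurable_snd.
have Fb p : `|u p.1.1 * v p.1.2 * h p.2| <= `|u p.1.1| * `|v p.1.2| * `|h p.2| by rewrite !normrM.
have iN f : leb.-integrable setT (EFin \o f) -> leb.-integrable setT (EFin \o (fun t => `|f t|)).
  by move=> i; exact: rintegrable_abs i.
split; first exact: (fubini3_integrable mF Fb (iN _ iu) (iN _ iv) (iN _ ih)).
rewrite (fubini3_z mF Fb (iN _ iu) (iN _ iv) (iN _ ih)) /=.
under eq_Rintegral => y _.
  under eq_Rintegral => x _.
    under eq_Rintegral => z _ do rewrite -mulrA.
    rewrite RintegralZr //; over.
  rewrite /=; under eq_Rintegral => x _ do rewrite mulrA [_ * v x]mulrC -mulrA.
  rewrite RintegralZr //; over.
rewrite /=; under eq_Rintegral => y _ do rewrite mulrA [_ * h y]mulrC.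
by rewrite RintegralZr // mulrC [\int[leb]_t v t * _]mulrC.
Qed.

Lemma gauss3 s (u : n.-tuple MR -> R) : 0 < s -> leb.-integrable setT (EFin \o u) ->
  leb3.-integrable setT (EFin \o (fun p => u p.1.1 * gauss s p.1.2 * gauss s p.2)) /\
  \int[leb3]_p (u p.1.1 * gauss s p.1.2 * gauss s p.2) = (2 * pi / s) ^+ n * \int[leb]_t u t.
Proof.
move=> s0 iu; have [ig Eg] := gauss1 s0.
have [iG EG] := integrable_prod_tuple n ig.
have [iP EP] := integral_prod3 iu iG iG; split => //.
rewrite EP EG -mulrA -exprD addnn -mul2n exprM Eg mulrC //.
Qed.

End Gaussian.

Section GrassmannProduct.
Variables (R : realType) (Lambda : finType).
Local Notation galg := (galg R Lambda).
Local Notation xieta := (@xieta R Lambda).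

Lemma gexp_sum_xieta (s : R) (l : seq Lambda) :
  gexp (s *: \sum_(i <- l) xieta i) = \prod_(i <- l) (1 + s *: xieta i).
Proof.
have bs (l' : seq Lambda) : body (s *: \sum_(i <- l') xieta i) = 0.
  by rewrite bodyZ body_sum big1 ?mulr0 // => i _; exact: body_xieta.
elim: l => [|i l IH]; first by rewrite !big_nil scaler0 gexp0.
rewrite !big_cons scalerDr gexpD ?bs ?bodyZ ?body_xieta ?mulr0 //; last first.
  exact: (proj1 (gevenZ s (geven_xieta R i))).
rewrite IH; congr (_ * _).
have I0 : (0 < #|{: Lambda + Lambda}|)%N by apply/card_gt0P; exists (inl i).
have sq0 : (s *: xieta i) ^+ 2 = 0 by rewrite expr2 -scalerAl -scalerAr xieta_sq !scaler0.
rewrite /gexp (bigD1 ord0) //= (bigD1 (Ordinal (I0 : (1 < #|{: Lambda + Lambda}|.+1)%N))) //=.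
rewrite big1 ?addr0 => [|m /andP[m0 m1]].
  by rewrite expr0 expr1 fact0 invr1 !scale1r.
have m2 : (2 <= m)%N by case: m m0 m1 => -[|[|m]].
by rewrite -(subnK m2) addnC exprD sq0 mul0r scaler0.
Qed.

(** Only the shape as a polynomial in s matters: the coefficients below the leading one just have to
    be independent of s. *)
Lemma prod_xieta_expand (l : seq Lambda) : exists C : nat -> galg, forall s : R,
  \prod_(i <- l) (1 + s *: xieta i) =
  \sum_(m < size l) s ^+ m *: C m + s ^+ (size l) *: \prod_(i <- l) xieta i.
Proof.
elim: l => [|i l [C IH]].
  by exists (fun=> 0) => s; rewrite !big_nil big_ord0 add0r expr0 scale1r.
pose P := \prod_(j <- l) xieta j.
exists (fun m => (if (m < size l)%N then C m else P) + (if m is m'.+1 then xieta i * C m' else 0)) => s.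
rewrite !big_cons IH mulrDl mul1r mulrDr /=.
under [X in _ = X + _]eq_bigr do rewrite scalerDr; rewrite big_split /=.
rewrite big_ord_recr /= ltnn -/P [X in _ = _ + X + _]big_ord_recl /= scaler0 add0r.
under [X in _ = X + _ + _ + _]eq_bigr => m _ do rewrite ltn_ord.
have E (k : R) (F : galg) : s *: xieta i * (k *: F) = (s * k) *: (xieta i * F).
  by rewrite -scalerAl -scalerAr scalerA.
rewrite -!addrA; congr (_ + (_ + _)); rewrite E -exprS; congr (_ + _).
by rewrite mulr_sumr; apply: eq_bigr => m _; rewrite E -exprS /bump /= add1n.
Qed.

End GrassmannProduct.

(** * The localized value in the limit of strong interaction *)

Section LocalizationValue.
Variables (R : realType) (Lambda : finType).
Local Notation galg := (galg R Lambda).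
Local Notation W := ((Lambda + Lambda) + Lambda)%type.
Local Notation MR := (measurableTypeR R).
Local Notation n := #|Lambda|.
Local Notation leb := (@lebesgue_tuple R n).
Local Notation leb3 := (@lebesgue3 R Lambda).
Implicit Types (w : W -> R) (k : Lambda) (c : W).

Variables (a b T : R) (G : (Lambda -> R) -> galg) (dG : Lambda -> (Lambda -> R) -> galg).
Hypotheses (a0 : 0 < a) (sG : supercompact a b G dG) (T0 : 0 <= T).
Variable phi : (Lambda -> R) -> R.
Hypotheses (cphi : pcontinuous phi)
  (phi0 : forall z, (forall k, 0 <= z k) -> T <= \sum_k z k -> phi z = 0).
Local Notation B := (cutoff phi G).

Let B0 w : ~ box (- T) T w -> B w = 0.
Proof. by move=> wb; apply: (cutoff_eq0 a0 phi0 (supercompact_eq0 sG) wb). Qed.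

Let cB : gcontinuous B.
Proof. by apply: (gcontinuous_cutoff a0 cphi); [exact: supercompact_eq0 sG|exact: supercompact_cvg sG]. Qed.

Let e (s : R) w : R := expR (- (s / 2 * (\sum_k xc w k ^+ 2 + \sum_k yc w k ^+ 2))).

Let eE s p : e s (point p) = gauss s p.1.2 * gauss s p.2.
Proof. by rewrite !gaussE -expRD; congr expR; rewrite mulrDr opprD. Qed.

Let ce s : pcontinuous (e s).
Proof.
apply: pcontinuous_expR; rewrite (_ : (fun w => _) =
  (fun w => (- (s / 2)) * (\sum_k xc w k * xc w k + \sum_k yc w k * yc w k))).
  apply: pcontinuousM; first exact: pcontinuous_cst.
  by apply: pcontinuousD; apply: pcontinuous_sum => k _; apply: pcontinuousM; exact: pcontinuous_coord.
by apply/funext => w; rewrite mulNr.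
Qed.

(* Localization for the interaction - s times the identity *)
Let value_gauss s : \int[leb3]_p gtop (B (point p)) =
  \int[leb3]_p (gtop (B (point p) * \prod_(i <- enum Lambda) (1 + s *: xieta R i)) * e s (point p)).
Proof.
pose beta (i j : Lambda) : R := - s * (i == j)%:R.
have beta_sym i j : beta i j = beta j i by rewrite /beta eq_sym.
rewrite -(localization a0 sG T0 cphi phi0 beta_sym); apply: eq_Rintegral => p _.
have sE : - (1 *: sigma beta) = s *: \sum_(i <- enum Lambda) xieta R i.
  rewrite scale1r /sigma -sumrN big_enum /= scaler_sumr; apply: eq_bigr => i _.
  rewrite (bigD1 i) //= big1 ?addr0 => [|j ji]; first by rewrite /beta eqxx mulr1 scaleNr opprK.
  by rewrite /beta eq_sym (negPf ji) mulr0 scale0r.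
rewrite sE gexp_sum_xieta; congr (_ * expR _).
have qE (x : Lambda -> R) : quad beta x = - s * \sum_k x k ^+ 2.
  rewrite mulr_sumr /quad; apply: eq_bigr => i _.
  rewrite (bigD1 i) //= big1 ?addr0 => [|j ji]; first by rewrite /beta eqxx mulr1.
  by rewrite /beta eq_sym (negPf ji) mulr0 mul0r.
by rewrite !qE mul1r; field.
Qed.

Let weight_z (F : (W -> R) -> R) : pcontinuous F -> (forall w, ~ box (- T) T w -> F w = 0) ->
  exists2 C, 0 <= C & forall p, `|F (point p)| <= C * weight p.1.1.
Proof.
move=> cF F0; have [C C0 FC] := weight3_compact T0 cF F0; exists C => // p.
apply: (le_trans (FC p)); rewrite ler_wpM2l // /weight3 -mulrA -[leRHS]mulr1.
have w1 (t : n.-tuple MR) : 0 <= weight t <= 1.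
  by rewrite ltW ?weight_gt0 //=; apply: prodr_ile1 => k; rewrite ltW ?weight1_gt0 ?weight1_le1.
have /andP[w10 _] := w1 p.1.1; have /andP[w20 w21] := w1 p.1.2; have /andP[w30 w31] := w1 p.2.
by rewrite ler_wpM2l // mulr_ile1.
Qed.

Let Wt : R := \int[leb]_t weight t.

Let iw (C : R) : leb.-integrable setT (EFin \o (fun t => C * weight t)).
Proof. exact: rintegrableZ (integrable_weight R n). Qed.

Let gauss_bound s (C : R) (F : (W -> R) -> R) : 0 < s -> pcontinuous F ->
  (forall p, `|F (point p)| <= C * weight p.1.1 * e s (point p)) ->
  `|\int[leb3]_p F (point p)| <= (2 * pi / s) ^+ n * (C * Wt).
Proof.
move=> s0 cF Fb; have [ig Eg] := gauss3 s0 (iw C).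
have Fb' p : `|F (point p)| <= C * weight p.1.1 * gauss s p.1.2 * gauss s p.2.
  by rewrite -mulrA -eE.
have iF : leb3.-integrable setT (EFin \o (fun p => F (point p))).
  by apply: dominated_integrable ig => //; exact: measurable_on_points.
apply: (le_trans (le_normr_Rintegral measurableT iF)).
have <- : \int[leb]_t (C * weight t) = C * Wt by rewrite RintegralZl //; exact: integrable_weight.
rewrite -Eg; apply: le_Rintegral => //; first exact: rintegrable_abs iF.
Qed.

Let A w : R := body (B w).
Let A0 w : R := body (B (pt (zc w) (fun=> 0) (fun=> 0))).

Let cA0 : pcontinuous A0.
Proof.
move=> w; have FF : Filter (nbhs (w : {ptws W -> R})) by exact: nbhs_filter.
have cs c : pt (zc w') (fun=> 0) (fun=> 0) c @[w' --> (w : {ptws W -> R})] -->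
    pt (zc w) (fun=> 0) (fun=> 0) c.
  by case: c => [[k|k]|k] /=; [exact: cvg_coord|exact: cvg_cst|exact: cvg_cst].
by have Hc := pcontinuous_cvg _ (@cB finset.set0) cs; exact: Hc.
Qed.

(** The derivatives in the x and y coordinates are bounded, being continuous of compact support, so
    setting x and y to 0 costs a multiple of their absolute values. *)
Let AA0 : exists2 C, 0 <= C & forall p,
  `|A (point p) - A0 (point p)| <= C * weight p.1.1 * (\sum_k `|vec p.1.2 k| + \sum_k `|vec p.2 k|).
Proof.
pose dA c w : R := - 2 * w c * body (cutoff phi (dG (vertex c)) w).
have cdA c : pcontinuous (dA c).
  apply: pcontinuousM; last first.
    have cD : gcontinuous (cutoff phi (dG (vertex c))).
      apply: (gcontinuous_cutoff a0 cphi); first exact: supercompact_deq0 sG (vertex c).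
      exact: supercompact_dcvg sG (vertex c).
    exact: (@cD finset.set0).
  by apply: pcontinuousM; [exact: pcontinuous_cst|exact: pcontinuous_coord].
have dA0 c w : ~ box (- T) T w -> dA c w = 0.
  by move=> wb; rewrite /dA (cutoff_eq0 a0 phi0 (supercompact_deq0 sG (vertex c)) wb) /body ffunE mulr0.
have /choice[C HC] : forall c, exists C, 0 <= C /\ forall w, `|dA c w| <= C.
  by move=> c; have [C [C0 HC]] := pcontinuous_bounded (cdA c) (dA0 c); exists C.
pose C1 := \sum_c C c; have C10 : 0 <= C1 by apply: sumr_ge0 => c _; case: (HC c).
(* Outside the box in z both values are 0; inside it, [ub] times the weight of z is at least 1. *)
pose ub : R := weight1 T ^- n; have ub0 : 0 < ub by rewrite invr_gt0 exprn_gt0 ?weight1_gt0.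
exists (C1 * ub) => [|p]; first by rewrite mulr_ge0 // ltW.
have S0 : 0 <= \sum_k `|vec p.1.2 k| + \sum_k `|vec p.2 k| by rewrite addr_ge0 ?sumr_ge0.
have [zT|nzT] := pselect (forall k, - T <= vec p.1.1 k <= T); last first.
  have z1 : A (point p) = 0 by rewrite /A B0 /body ?ffunE // => H; apply: nzT => k; exact: H (iz k).
  have z2 : A0 (point p) = 0.
    by rewrite /A0 B0 /body ?ffunE // => H; apply: nzT => k; exact: H (iz k).
  by rewrite z1 z2 subr0 normr0 mulr_ge0 ?mulr_ge0 // ltW // weight_gt0.
pose f (v : Lambda + Lambda -> R) := A (pt (vec p.1.1) (fun k => v (inl k)) (fun k => v (inr k))).
pose ic (c : Lambda + Lambda) : W := match c with inl k => ix k | inr k => iy k end.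
pose f' (c : Lambda + Lambda) (v : Lambda + Lambda -> R) := dA (ic c) (pt (vec p.1.1) (fun k => v (inl k)) (fun k => v (inr k))).
have ptE (v : Lambda + Lambda -> R) (c : Lambda + Lambda) (s : R) : pt (vec p.1.1) (fun k => upd v c s (inl k)) (fun k => upd v c s (inr k)) =
    upd (pt (vec p.1.1) (fun k => v (inl k)) (fun k => v (inr k))) (ic c) s.
  by apply/funext => -[[k|k]|k]; case: c => c; rewrite /upd /=.
have df (v : Lambda + Lambda -> R) (c : Lambda + Lambda) (s : R) : is_derive s 1 (fun s => f (upd v c s)) (f' c (upd v c s)).
  rewrite /f /f' ptE; under eq_fun do rewrite ptE.
  have c1 : signature R (ic c) = -1 by case: c.
  have := gderive_cutoff a0 sG phi (pt (vec p.1.1) (fun k => v (inl k)) (fun k => v (inr k))) s c1.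
  by move=> /(_ finset.set0) D; apply: der_eq D _; rewrite /dA updE /body grassmannZ.
have f'C z (c : Lambda + Lambda) : `|f' c z| <= C1.
  rewrite /f'; set c' := ic c; have [_ H] := HC c'; apply: (le_trans (H _)).
  by rewrite /C1 (bigD1 c') //= lerDl sumr_ge0 // => j _; case: (HC j).
pose v1 (c : Lambda + Lambda) : R := match c with inl k => vec p.1.2 k | inr k => vec p.2 k end.
pose m : R := - \sum_c `|v1 c|.
have m0 : m <= 0 by rewrite oppr_le0 sumr_ge0.
have mv (c : Lambda + Lambda) : m <= v1 c.
  rewrite lerNl (le_trans (ler_norm _)) // normrN (bigD1 c) //= lerDl sumr_ge0 //.
have := @lipschitz_partials R _ m C1 f f' df (fun z d _ => f'C z d) v1 (fun=> 0) mv (fun=> m0).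
have -> : f v1 = A (point p) by [].
have -> : f (fun=> 0) = A0 (point p) by [].
move=> /le_trans; apply; rewrite -!mulrA ler_wpM2l // /ldist big_sumType /=.
under eq_bigr do rewrite subr0; under [X in _ + X <= _]eq_bigr do rewrite subr0.
rewrite mulrA ler_peMl // /ub mulrC ler_pdivlMr ?exprn_gt0 ?weight1_gt0 // mul1r /weight.
rewrite -[n in X in X <= _]card_ord -prodr_const; apply: ler_prod => j _.
rewrite (ltW (weight1_gt0 _)) /=; rewrite /weight1 lef_pV2 ?posrE ?ltr_pwDl ?sqr_ge0 // lerD2l.
have := zT (enum_val j); rewrite /vec enum_valK -ler_norml => H.
by rewrite -[tnth _ j ^+ 2]real_normK ?num_real // lerXn2r ?nnegrE.
Qed.

(** The Gaussian form of the integral does not depend on s = r^2. Its leading power s^n against the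
    Gaussian mass (2 pi / s)^n gives the value; lower powers lose at least a factor 1 / s, and
    evaluating the body at x = y = 0 costs a factor 1 / r. *)
Lemma localization_value : \int[leb3]_p gtop (B (point p)) =
  (2 * pi) ^+ n * \int[leb]_t body (B (pt (vec t) (fun=> 0) (fun=> 0))).
Proof.
set I0 := LHS; set V := \int[leb]_t _.
have [C HC] := prod_xieta_expand R (enum Lambda); rewrite -cardE in HC.
pose P := \prod_(i <- enum Lambda) xieta R i.
have cBC (F : galg) : pcontinuous (fun w => gtop (B w * F)).
  by apply: pcontinuous_gtop; apply: gcontinuousM => //; exact: gcontinuous_cst.
have BC0 (F : galg) w : ~ box (- T) T w -> gtop (B w * F) = 0.
  by move=> /B0 ->; rewrite mul0r gtop0.
have /choice[D HD] : forall m : nat, exists D, 0 <= D /\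
    forall p, `|gtop (B (point p) * C m)| <= D * weight p.1.1.
  by move=> m; have [D D0 HD] := weight_z (cBC (C m)) (@BC0 (C m)); exists D.
have [D0 D00 HD0] := AA0.
have two_pi : 0 < 2 * pi :> R by rewrite mulr_gt0 ?pi_gt0.
(* The sum bounds the lower powers of s, the last term the evaluation at x = y = 0. The latter
   spends half of the Gaussian, whence 4 pi. *)
pose K : R := \sum_(m < n) (2 * pi) ^+ n * (D m * Wt) + (4 * pi) ^+ n * (D0 * (4 * n%:R) * Wt).
have Wt0 : 0 <= Wt by apply: Rintegral_ge0 => t _; rewrite ltW // weight_gt0.
have K0 : 0 <= K.
  apply: addr_ge0; first apply: sumr_ge0 => m _.
    by rewrite mulr_ge0 ?exprn_ge0 ?(ltW two_pi) // mulr_ge0 //; case: (HD m).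
  by rewrite mulr_ge0 ?exprn_ge0 ?mulr_ge0 ?pi_ge0.
have cA : pcontinuous A by exact: (@cB finset.set0).
have cAA0 : pcontinuous (fun w => A w - A0 w) by exact: pcontinuousB.
have [DA _ HDA] : exists2 D, 0 <= D & forall p, `|A (point p)| <= D * weight p.1.1.
  by apply: weight_z cA _ => w wb; rewrite /A B0 // /body ffunE.
pose u (t : n.-tuple MR) : R := body (B (pt (vec t) (fun=> 0) (fun=> 0))).
have uE p : A0 (point p) = u p.1.1 by [].
have iu : leb.-integrable setT (EFin \o u).
  apply: dominated_integrable (iw DA) => // [|t _].
    have mc c : measurable_fun setT (fun t : n.-tuple MR => pt (vec t) (fun=> 0) (fun=> 0) c).
      by case: c => [[k|k]|k] /=; [exact: measurable_vec|exact: measurable_cst|exact: measurable_cst].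
    by have := measurable_pcontinuous cA0 mc; exact.
  pose z0 := unvec (fun _ : Lambda => 0 : R); have := HDA (t, z0, z0).
  have z0E : vec z0 = (fun=> 0).
    by apply/funext => k; rewrite /vec /z0 /unvec tnth_mktuple.
  by rewrite /A /point /= z0E.
have bound (r : R) : 1 <= r -> `|I0 - (2 * pi) ^+ n * V| <= K / r.
  move=> r1; have r0 : 0 < r by exact: lt_le_trans ltr01 r1.
  pose s := r ^+ 2; have s0 : 0 < s by rewrite exprn_gt0.
  have rs : r <= s by rewrite /s expr2 ler_peMr // ltW.
  have s1 : 1 <= s by exact: le_trans rs.
  pose X m p : R := gtop (B (point p) * C m) * e s (point p).
  have cX (F : galg) : pcontinuous (fun w => gtop (B w * F) * e s w) by exact: pcontinuousM.
  have iX (F : galg) : leb3.-integrable setT (EFin \o (fun p => gtop (B (point p) * F) * e s (point p))).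
    apply: (@compact_integrable _ _ (fun w => gtop (B w * F) * e s w) T) => // w wb.
    by rewrite BC0 // mul0r.
  have iA : leb3.-integrable setT (EFin \o (fun p => A (point p) * e s (point p))).
    apply: (@compact_integrable _ _ (fun w => A w * e s w) T) => // [|w wb]; first exact: pcontinuousM.
    by rewrite /A B0 // /body ffunE mul0r.
  have [iG EG] := gauss3 s0 iu.
  have iA0 : leb3.-integrable setT (EFin \o (fun p => A0 (point p) * e s (point p))).
    by apply: eq_integrable iG => // p _; rewrite /= eE mulrA.
  have I0E : I0 = \sum_(m < n) s ^+ m * \int[leb3]_p X m p + s ^+ n * \int[leb3]_p (A (point p) * e s (point p)).
    rewrite /I0 (value_gauss s).
    have iXm (m : nat) := rintegrableZ measurableT (s ^+ m) (iX (C m)).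
    have iAs := rintegrableZ measurableT (s ^+ n) iA.
    have XE (m : nat) : s ^+ m * \int[leb3]_p X m p = \int[leb3]_p (s ^+ m * X m p).
      by rewrite RintegralZl //; exact: iX (C m).
    under [X in _ = X + _]eq_bigr => m _ do rewrite XE.
    have -> : s ^+ n * \int[leb3]_p (A (point p) * e s (point p)) =
        \int[leb3]_p (s ^+ n * (A (point p) * e s (point p))).
      by rewrite RintegralZl.
    rewrite -(Rintegral_sum measurableT _ (fun m : 'I_n => iXm m)).
    have iS := rintegrable_sum measurableT (index_enum 'I_n) (fun m : 'I_n => iXm m).
    rewrite -(RintegralD measurableT iS iAs).
    apply: eq_Rintegral => p _; rewrite HC mulrDr gtopD mulr_sumr gtop_sum mulrDl mulr_suml.
    congr (_ + _); last by rewrite -scalerAr gtopZ gtop_xieta_body mulrA.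
    by apply: eq_bigr => m _; rewrite -scalerAr gtopZ mulrA.
  have VE : (2 * pi) ^+ n * V = s ^+ n * \int[leb3]_p (A0 (point p) * e s (point p)).
    have -> : \int[leb3]_p (A0 (point p) * e s (point p)) = (2 * pi / s) ^+ n * V.
      by rewrite -EG; apply: eq_Rintegral => p _; rewrite eE mulrA.
    by rewrite mulrA -exprMn [s * _]mulrC divfK // gt_eqF.
  have diffE : s ^+ n * \int[leb3]_p (A (point p) * e s (point p)) - (2 * pi) ^+ n * V =
      s ^+ n * \int[leb3]_p ((A (point p) - A0 (point p)) * e s (point p)).
    rewrite VE -mulrBr; congr (_ * _); rewrite -RintegralB //.
    by apply: eq_Rintegral => p _; rewrite mulrBl.
  rewrite I0E -addrA diffE; apply: (le_trans (ler_normD _ _)).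
  rewrite /K mulrDl; apply: lerD.
    apply: (le_trans (ler_norm_sum _ _ _)); rewrite mulr_suml; apply: ler_sum => m _.
    rewrite normrM normrX (gtr0_norm s0).
    have Xb : `|\int[leb3]_p X m p| <= (2 * pi / s) ^+ n * (D m * Wt).
      apply: (@gauss_bound s (D m) (fun w => gtop (B w * C m) * e s w)) => // p.
      by rewrite normrM (ger0_norm (expR_ge0 _)) ler_wpM2r ?expR_ge0 //; case: (HD m).
    apply: (le_trans (ler_wpM2l _ Xb)); first by rewrite exprn_ge0 // ltW.
    rewrite expr_div_n; set q := (2 * pi) ^+ n; set c := D m * Wt.
    have q0 : 0 <= q by rewrite exprn_ge0 // ltW.
    have c0 : 0 <= c by rewrite mulr_ge0 //; case: (HD m).
    have -> : s ^+ m * (q / s ^+ n * c) = q * c * (s ^+ m / s ^+ n) by ring.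
    apply: ler_wpM2l; first exact: mulr_ge0.
    rewrite ler_pdivrMr ?exprn_gt0 // mulrC ler_pdivlMr //.
    apply: (@le_trans _ _ (s ^+ m * s)); first by apply: ler_wpM2l => //; exact/exprn_ge0/ltW.
    by rewrite -exprSr; apply: ler_weXn2l.
  have s20 : 0 < s / 2 by rewrite divr_gt0.
  have lin (p : n.-tuple MR * n.-tuple MR * n.-tuple MR) : \sum_k `|vec p.1.2 k| + \sum_k `|vec p.2 k| <=
      4 * n%:R / r * expR (s / 4 * (\sum_k vec p.1.2 k ^+ 2 + \sum_k vec p.2 k ^+ 2)).
    set Ex := expR _.
    have one (x : R) : s / 4 * x ^+ 2 <= s / 4 * (\sum_k vec p.1.2 k ^+ 2 + \sum_k vec p.2 k ^+ 2) ->
        `|x| <= 2 / r * Ex.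
      move=> xS; have : 1 + s / 4 * x ^+ 2 <= Ex.
        by apply: le_trans (expR_ge1Dx _) _; rewrite ler_expR.
      move=> xE; apply: (le_trans (norm_le_square x r0)).
      by rewrite ler_wpM2l ?divr_ge0 // ltW.
    have s4 : 0 <= s / 4 by rewrite divr_ge0 // ltW.
    have sxk k : `|vec p.1.2 k| <= 2 / r * Ex.
      apply: one; rewrite ler_wpM2l // (bigD1 k) //= -addrA lerDl addr_ge0 ?sumr_ge0 // => *; exact: sqr_ge0.
    have syk k : `|vec p.2 k| <= 2 / r * Ex.
      apply: one; rewrite ler_wpM2l // addrC (bigD1 k) //= -addrA lerDl addr_ge0 ?sumr_ge0 // => *; exact: sqr_ge0.
    apply: (@le_trans _ _ (\sum_(k : Lambda) (2 / r * Ex) + \sum_(k : Lambda) (2 / r * Ex))).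
      by apply: lerD; apply: ler_sum.
    rewrite !sumr_const -mulr_natl; have -> : #|Lambda| = #|xpredT : pred Lambda| by [].
    by rewrite le_eqVlt; apply/orP; left; apply/eqP; field; rewrite gt_eqF.
  have Yb : `|\int[leb3]_p ((A (point p) - A0 (point p)) * e s (point p))| <=
      (2 * pi / (s / 2)) ^+ n * (D0 * (4 * n%:R / r) * Wt).
    apply: (@gauss_bound (s / 2) _ (fun w => (A w - A0 w) * e s w)) => // [|p]; first exact: pcontinuousM.
    rewrite normrM (ger0_norm (expR_ge0 _)).
    apply: (le_trans (ler_wpM2r (expR_ge0 _) (HD0 p))).
    have w0 : 0 <= D0 * weight p.1.1 by rewrite mulr_ge0 // ltW // weight_gt0.
    apply: (le_trans (ler_wpM2r (expR_ge0 _) (ler_wpM2l w0 (lin p)))).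
    have eh : e (s / 2) (point p) = expR (s / 4 * (\sum_k vec p.1.2 k ^+ 2 + \sum_k vec p.2 k ^+ 2)) *
        expR (- (s / 2 * (\sum_k xc (point p) k ^+ 2 + \sum_k yc (point p) k ^+ 2))).
      rewrite -expRD; congr expR; rewrite [\sum_k vec p.1.2 k ^+ 2 + _](_ : _ =
        \sum_k xc (point p) k ^+ 2 + \sum_k yc (point p) k ^+ 2) //.
      by move: (_ + _) => S; field.
    rewrite eh le_eqVlt; apply/orP; left; apply/eqP.
    by move: (expR _) (expR _) (weight _) (4 * n%:R / r) => E1 E2 E3 E4; ring.
  rewrite normrM normrX (gtr0_norm s0); apply: (le_trans (ler_wpM2l _ Yb)).
    by rewrite exprn_ge0 // ltW.
  have -> : (4 * pi) ^+ n = s ^+ n * (2 * pi / (s / 2)) ^+ n.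
    by rewrite -exprMn; congr (_ ^+ _); field; rewrite gt_eqF.
  rewrite le_eqVlt; apply/orP; left; apply/eqP.
  by move: (s ^+ n) ((2 * pi / (s / 2)) ^+ n) => E1 E2; ring.
apply/eqP; rewrite -subr_eq0 -normr_eq0; apply/negPn/negP => d0.
have d1 : 0 < `|I0 - (2 * pi) ^+ n * V| by rewrite lt_def d0 /=.
(* For this r the bound K / r is smaller than the supposed positive difference. *)
have r1 : 1 <= K / `|I0 - (2 * pi) ^+ n * V| + 1 by rewrite lerDr divr_ge0.
have := bound _ r1; rewrite leNgt => /negP; apply.
rewrite ltr_pdivrMr ?(lt_le_trans ltr01 r1) // mulrDr mulr1 mulrC divfK // ltrDl //.
Qed.

End LocalizationValue.

(** * Integration by parts *)

Section IntegrationByParts.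
Variables (R : realType) (Lambda : finType).
Local Notation galg := (galg R Lambda).
Local Notation W := ((Lambda + Lambda) + Lambda)%type.
Local Notation n := #|Lambda|.
Local Notation leb := (@lebesgue_tuple R n).
Local Notation leb3 := (@lebesgue3 R Lambda).
Implicit Types (w : W -> R) (k j : Lambda) (c : W) (s : R).
Variables (beta : Lambda -> Lambda -> R).
Hypothesis beta_sym : forall i j, beta i j = beta j i.
Variables (nu : (Lambda -> R) -> R) (a b : R) (i : Lambda).
Hypotheses (snu : smooth nu) (a0 : 0 < a) (nu0 : forall r, ~ box a b r -> nu r = 0).
Local Notation G := (extend (radial beta nu i)).
Local Notation dG := (fun k => extend (dradial beta nu i k)).
Let N : galg := gexp (- sigma beta).
Let Th := radial_density beta nu i.
Let dTh k q : R := gtop (dG k q * N).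
Let sG := supercompact_radial beta i snu a0 nu0.
Let a20 : 0 < a ^+ 2. Proof. exact: exprn_gt0. Qed.

Let Th0 q : ~ box (a ^+ 2) (b ^+ 2) q -> Th q = 0.
Proof. by move=> qb; rewrite /Th /radial_density (supercompact_eq0 sG qb) mul0r gtop0. Qed.

Let dTh0 q k : ~ box (a ^+ 2) (b ^+ 2) q -> dTh k q = 0.
Proof. by move=> qb; rewrite /dTh (supercompact_deq0 sG k qb) mul0r gtop0. Qed.

Lemma pcontinuous_radial_density : pcontinuous (radial_density beta nu i).
Proof.
apply: (@pcontinuous_gtop R Lambda Lambda); apply: gcontinuousM; last exact: gcontinuous_cst.
by move=> A; case: sG => _ _ _ H _ _ _; exact: (H A).
Qed.

Let cdTh k : pcontinuous (dTh k).
Proof.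
apply: (@pcontinuous_gtop R Lambda Lambda); apply: gcontinuousM; last exact: gcontinuous_cst.
by move=> A; case: sG => _ _ _ _ H _ _; exact: (H k A).
Qed.

Let der_Th (q : Lambda -> R) k : is_derive (q k) 1 (fun t : R => Th (upd q k t)) (dTh k q).
Proof.
have D := der_gtop (gderiveM (supercompact_derive sG q k) (gderive_cst (q k) N)).
by apply: der_eq D _; rewrite mulr0 addr0.
Qed.

Let chat : pcontinuous (hat Th).
Proof. exact: (pcontinuous_hat a20 Th0 pcontinuous_radial_density). Qed.

Let cdhat k : pcontinuous (hat (dTh k)).
Proof. exact: (pcontinuous_hat a20 (fun q => @dTh0 q k) (@cdTh k)). Qed.

Let der_hat w c s : is_derive s 1 (fun r : R => hat Th (upd w c r))
  (signature R c * 2 * s * hat (dTh (vertex c)) (upd w c s)).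
Proof.
have D := @derive_hat R Lambda _ _ Th a20 Th0 dTh (upd w c s) c der_Th dTh0.
rewrite updE in D; under eq_fun do rewrite -(upd_upd w c s).
exact: D.
Qed.

Let E w : R := expR (energy beta (zc w) (xc w) (yc w)).

Let cquad (co : Lambda -> W) : pcontinuous (fun w => quad beta (fun k => w (co k))).
Proof.
do 2 (apply: pcontinuous_sum => ? _).
apply: pcontinuousM; first exact: pcontinuous_cst.
by apply: pcontinuousM; exact: pcontinuous_coord.
Qed.

Let cE : pcontinuous E.
Proof.
apply: pcontinuous_expR; apply: pcontinuousM; last exact: pcontinuous_cst.
by apply: pcontinuousB; [apply: pcontinuousD|]; exact: cquad.
Qed.

Let cbmul (co : Lambda -> W) k : pcontinuous (fun w => bmul beta (fun k => w (co k)) k).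
Proof.
apply: pcontinuous_sum => ? _; apply: pcontinuousM; first exact: pcontinuous_cst.
exact: pcontinuous_coord.
Qed.

Let zc_z w k s : zc (upd w (iz k) s) = upd (zc w) k s.
Proof. by apply/funext => j; rewrite /zc /upd /=. Qed.
Let xc_x w k s : xc (upd w (ix k) s) = upd (xc w) k s.
Proof. by apply/funext => j; rewrite /xc /upd /=. Qed.

Let der_E_x w k s : is_derive s 1 (fun r : R => E (upd w (ix k) r))
  (bmul beta (xc (upd w (ix k) s)) k * E (upd w (ix k) s)).
Proof.
apply: der_expR; rewrite /energy xc_x.
under eq_fun do rewrite xc_x.
have D := derM (derB (derD (der_quad beta_sym (xc w) k s) (der_cst (quad beta (yc w)) s))
  (der_cst (quad beta (zc w)) s)) (der_cst (2^-1) s).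
by apply: der_eq D _; rewrite mulr0 subr0 !addr0 mulrAC divff ?mul1r // pnatr_eq0.
Qed.

Let der_E_z w k s : is_derive s 1 (fun r : R => E (upd w (iz k) r))
  (- bmul beta (zc (upd w (iz k) s)) k * E (upd w (iz k) s)).
Proof.
apply: der_expR; rewrite /energy zc_z.
under eq_fun do rewrite zc_z.
have D := derM (derB (derD (der_cst (quad beta (xc w)) s) (der_cst (quad beta (yc w)) s))
  (der_quad beta_sym (zc w) k s)) (der_cst (2^-1) s).
by apply: der_eq D _; rewrite mulr0 !addr0 add0r mulNr mulrAC divff ?mul1r // pnatr_eq0.
Qed.

Variables (T : R) (g h : Lambda -> (Lambda -> R) -> R).
Hypotheses (T0 : 0 <= T) (lg : forall j, lipc T (g j)) (lh : forall j, lipc T (h j))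
  (dg : forall j z, is_derive (0 : R) 1 (fun r : R => g j (shift z j r)) (- h j z)).

Let der_g j w s : is_derive s 1 (fun r : R => g j (zc (upd w (iz j) r))) (- h j (zc (upd w (iz j) s))).
Proof.
rewrite zc_z.
have H r : g j (zc (upd w (iz j) r)) = g j (shift (upd (zc w) j s) j (r - s)).
  by rewrite zc_z /shift upd_upd updE subrKC.
under eq_fun do rewrite H.
have D0 : is_derive (s - s) 1 (fun r : R => g j (shift (upd (zc w) j s) j r)) (- h j (upd (zc w) j s)).
  by rewrite subrr; exact: dg.
have D := @der_comp R (fun r : R => g j (shift (upd (zc w) j s) j r)) (fun r : R => r - s) s _ _ D0
  (derB (der_id s) (der_cst s s)).
by apply: der_eq D _; rewrite subr0 mulr1.
Qed.

Let cz (f : (Lambda -> R) -> R) : lipc T f -> pcontinuous (fun w => f (zc w)).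
Proof. by move=> /lipc_pcontinuous cf; exact: (@pcontinuous_sub R W Lambda f (@iz Lambda) cf). Qed.

Let outside w : ~ box (- T) T w -> T <= \sum_k zc w k \/ forall H : (Lambda -> R) -> R,
  (forall q, ~ box (a ^+ 2) (b ^+ 2) q -> H q = 0) -> hat H w = 0.
Proof.
move=> nb; case: (leP T (\sum_k zc w k)) => [?|zT]; [by left|right => H H0].
apply/eqP; apply: contrapT => /negP hw; apply: nb.
have supp := hat_neq0 a20 H0 hw.
have zkT k : w (iz k) <= T.
  apply: le_trans (ltW zT); rewrite (bigD1 k) //= lerDl sumr_ge0 // => j _.
  by have [/ltW] := supp j.
move=> c; rewrite -ler_norml; case: c => [[k|k]|k].
- by have [zk _ _] := supp k; rewrite ger0_norm ?(ltW zk) //; exact: zkT.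
- by have [_ xk _] := supp k; apply: le_trans xk (zkT k).
- by have [_ _ yk] := supp k; apply: le_trans yk (zkT k).
Qed.

(** [D1 j] is the x_j derivative of z_j g_j x_i times the density, [D2 j] the z_j derivative of x_j
    x_i g_j times the density. [A] is what differentiating x_i leaves, and [K j] is the integrand
    for the generator. *)
Let D1 j w : R := zc w j * g j (zc w) * ((i == j)%:R * (hat Th w * E w) +
  xc w i * ((-1 * 2 * xc w j * hat (dTh j) w) * E w + hat Th w * (bmul beta (xc w) j * E w))).
Let D2 j w : R := xc w j * xc w i * (- h j (zc w) * (hat Th w * E w) +
  g j (zc w) * ((1 * 2 * zc w j * hat (dTh j) w) * E w + hat Th w * (- bmul beta (zc w) j * E w))).
Let A w : R := zc w i * g i (zc w) * (hat Th w * E w).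
Let K j w : R := xc w i * xc w j *
  ((generator_part beta g j (zc w) - h j (zc w)) * (hat Th w * E w)).

Let cD1 j : pcontinuous (D1 j).
Proof.
have cg := cz (lg j); have cb := @cbmul (@ix Lambda) j.
have chE : pcontinuous (fun w => hat Th w * E w) by exact: pcontinuousM.
apply: pcontinuousM; first by apply: pcontinuousM; [exact: pcontinuous_coord|exact: cg].
apply: pcontinuousD; first by apply: pcontinuousM; [exact: pcontinuous_cst|exact: chE].
apply: pcontinuousM; first exact: pcontinuous_coord.
apply: pcontinuousD; apply: pcontinuousM; [|exact: cE|exact: chat|by apply: pcontinuousM; [exact: cb|exact: cE]].
apply: pcontinuousM; last exact: cdhat.
by apply: pcontinuousM; [exact: pcontinuous_cst|exact: pcontinuous_coord].
Qed.

Let cD2 j : pcontinuous (D2 j).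
Proof.
have cg := cz (lg j); have ch := cz (lh j); have cb := @cbmul (@iz Lambda) j.
have opp (f : (W -> R) -> R) : pcontinuous f -> pcontinuous (fun w => - f w).
  move=> cf; rewrite (_ : (fun w => - f w) = (fun w => -1 * f w)).
    by apply: pcontinuousM; [exact: pcontinuous_cst|exact: cf].
  by apply/funext => w; rewrite mulN1r.
have chE : pcontinuous (fun w => hat Th w * E w) by exact: pcontinuousM.
apply: pcontinuousM; first by apply: pcontinuousM; exact: pcontinuous_coord.
apply: pcontinuousD; first by apply: pcontinuousM; [apply: opp; exact: ch|exact: chE].
apply: pcontinuousM; first exact: cg.
apply: pcontinuousD; apply: pcontinuousM;
  [|exact: cE|exact: chat|by apply: pcontinuousM; [apply: opp; exact: cb|exact: cE]].
apply: pcontinuousM; last exact: cdhat.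
by apply: pcontinuousM; [exact: pcontinuous_cst|exact: pcontinuous_coord].
Qed.

Let lgen j : lipc T (fun z => generator_part beta g j z - h j z).
Proof. by apply: lipcB => //; exact: generator_part_lipc. Qed.

Let cK j : pcontinuous (K j).
Proof.
have ? := cz (lgen j).
by do ![apply: pcontinuousM => //|exact: pcontinuous_coord].
Qed.

Let out0 w : ~ box (- T) T w -> [/\ forall j, D1 j w = 0, forall j, D2 j w = 0 & forall j, K j w = 0].
Proof.
move=> /outside[zT|hw].
  have e1 j := (lg j).1 _ zT; have e2 j := (lh j).1 _ zT.
  have e3 j : generator_part beta g j (zc w) - h j (zc w) = 0 := (lgen j).1 _ zT.
  by split=> j; rewrite /D1 /D2 /K ?e3 ?e1 ?e2 ?oppr0 !(mul0r, mulr0, addr0).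
have h0 := hw _ Th0; have dh0 j := hw _ (fun q => @dTh0 q j).
by split=> j; rewrite /D1 /D2 /K ?h0 ?dh0; rewrite !(mul0r, mulr0, addr0).
Qed.

Let intD1 j : \int[leb3]_p D1 j (point p) = 0.
Proof.
apply: (@integral_derive_point R Lambda (ix j)
  (fun w => zc w j * g j (zc w) * (xc w i * (hat Th w * E w))) (D1 j) T) => //.
- move=> w /outside[zT|hw]; first by rewrite ((lg j).1 _ zT) mulr0 mul0r.
  by rewrite (hw _ Th0) mul0r !mulr0.
- by move=> w /out0[].
move=> w s; under eq_fun do rewrite xc_x.
have D := derZ (zc w j * g j (zc w)) (derM (der_upd (xc w) j i s)
  (derM (der_hat w (ix j) s) (der_E_x w j s))).
by apply: der_eq D _; rewrite /D1 !xc_x updE.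
Qed.

Let intD2 j : \int[leb3]_p D2 j (point p) = 0.
Proof.
apply: (@integral_derive_point R Lambda (iz j)
  (fun w => xc w j * xc w i * (g j (zc w) * (hat Th w * E w))) (D2 j) T) => //.
- move=> w /outside[zT|hw]; first by rewrite ((lg j).1 _ zT) mul0r mulr0.
  by rewrite (hw _ Th0) mul0r !mulr0.
- by move=> w /out0[].
move=> w s.
have D := derZ (xc w j * xc w i) (derM (der_g j w s)
  (derM (der_hat w (iz j) s) (der_E_z w j s))).
by apply: der_eq D _; rewrite /D2 zc_z updE.
Qed.

Let integ (F : (W -> R) -> R) : pcontinuous F -> (forall w, ~ box (- T) T w -> F w = 0) ->
  leb3.-integrable setT (EFin \o (fun p => F (point p))).
Proof. by move=> cF F0; exact: compact_integrable cF F0. Qed.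

(** The last terms of [rearrange1] and [rearrange2] are opposite, which is how the derivatives in q
    disappear. *)
Let rearrange1 (z t x c H dH e xj bx : R) :
  z * t * (c * (H * e) + x * ((-1 * 2 * xj * dH) * e + H * (bx * e))) =
  z * t * c * (H * e) + x * (z * t * bx * (H * e)) - x * (2 * xj * z * t * dH * e).
Proof. ring. Qed.

Let rearrange2 (z t x H dH e xj bz hj : R) :
  xj * x * (- hj * (H * e) + t * ((1 * 2 * z * dH) * e + H * (- bz * e))) =
  x * xj * (- hj * (H * e)) - x * (xj * t * bz * (H * e)) + x * (2 * xj * z * t * dH * e).
Proof. ring. Qed.

(** The derivatives of the energy recombine, by symmetry of [beta], into the jump part of the
    generator. *)
Let gen_sum (x z u : Lambda -> R) :
  \sum_j x j * (\sum_k beta j k * (z k * (u k - u j))) =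
  \sum_j (z j * u j * bmul beta x j - x j * u j * bmul beta z j).
Proof.
rewrite sumrB; under eq_bigr do rewrite mulr_sumr.
under [X in X - _]eq_bigr do rewrite mulr_sumr.
under [X in _ - X]eq_bigr do rewrite mulr_sumr.
rewrite [X in X - _]exchange_big -sumrB; apply: eq_bigr => j _.
rewrite -sumrB; apply: eq_bigr => k _; rewrite (beta_sym k j).
by move: (beta j k) => t; ring.
Qed.

Let sumD w : \sum_j (D1 j w + D2 j w) = A w + \sum_j K j w.
Proof.
transitivity (\sum_j (zc w j * g j (zc w) * (i == j)%:R * (hat Th w * E w)) +
  xc w i * (hat Th w * E w) * (\sum_j (zc w j * g j (zc w) * bmul beta (xc w) j -
     xc w j * g j (zc w) * bmul beta (zc w) j)) +
  \sum_j xc w i * xc w j * (- h j (zc w) * (hat Th w * E w))).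
  rewrite mulr_sumr -!big_split /=; apply: eq_bigr => j _; rewrite /D1 /D2 rearrange1 rearrange2.
  by move: (hat _ _) (hat _ _) (E w) (bmul _ _ _) (bmul _ _ _) (_ == _)%:R => *; ring.
rewrite -gen_sum -addrA; congr (_ + _).
  rewrite (bigD1 i) //= big1 ?addr0 => [|j /negPf ij]; last by rewrite eq_sym ij mulr0 mul0r.
  by rewrite eqxx mulr1.
rewrite mulr_sumr -big_split /=; apply: eq_bigr => j _; rewrite /K /generator_part.
by move: (\sum_(_ <- _) _) => t; move: (hat _ _) (E w) => *; ring.
Qed.

Let integral_A : \int[leb3]_p A (point p) = - \sum_j \int[leb3]_p K j (point p).
Proof.
have iD1 j : leb3.-integrable setT (EFin \o (fun p => D1 j (point p))).
  by apply: integ => // w /out0[].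
have iD2 j : leb3.-integrable setT (EFin \o (fun p => D2 j (point p))).
  by apply: integ => // w /out0[].
have iK j : leb3.-integrable setT (EFin \o (fun p => K j (point p))).
  by apply: integ => // w /out0[].
transitivity (\int[leb3]_p (\sum_j (D1 j (point p) + D2 j (point p)) - \sum_j K j (point p))).
  by apply: eq_Rintegral => p _; rewrite sumD addrK.
have iD j := rintegrableD measurableT (iD1 j) (iD2 j).
rewrite RintegralB //; [|by apply: (rintegrable_sum measurableT) => j; exact: iD|by apply: (rintegrable_sum measurableT) => j; exact: iK].
rewrite !Rintegral_sum // big1 ?sub0r // => j _.
by rewrite RintegralD // intD1 intD2 addr0.
Qed.

(** The factor exp (- quad z / 2) of the energy is moved into the test function; what is left is the
    exponential in x and y that localization deforms. *)
Let phi (z : Lambda -> R) : R := z i * g i z * expR (- (quad beta z / 2)).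

Let cphi : pcontinuous phi.
Proof.
apply: pcontinuousM; first by apply: pcontinuousM; [exact: pcontinuous_coord|exact: lipc_pcontinuous (lg i)].
apply: pcontinuous_expR.
rewrite (_ : (fun _ => _) = (fun q => - 1 / 2 * quad beta q)); last first.
  by apply/funext => q; rewrite !mulNr mul1r mulrC.
apply: pcontinuousM; first exact: pcontinuous_cst.
do 2 (apply: pcontinuous_sum => ? _).
apply: pcontinuousM; first exact: pcontinuous_cst.
by apply: pcontinuousM; exact: pcontinuous_coord.
Qed.

Let phi0 z : (forall k, 0 <= z k) -> T <= \sum_k z k -> phi z = 0.
Proof. by move=> _ zT; rewrite /phi ((lg i).1 _ zT) mulr0 mul0r. Qed.

Let A_cutoff w : A w = gtop (cutoff phi G w * gexp (- (1 *: sigma beta))) *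
  expR (1 * ((quad beta (xc w) + quad beta (yc w)) / 2)).
Proof.
rewrite scale1r mul1r -/N.
have -> : gtop (cutoff phi G w * N) = phi (zc w) * (future w * gtop (G (mass w) * N)).
  rewrite /cutoff; move: (G (mass w)) (phi _) (future w) => Gw u v.
  have -> : u *: (v *: Gw) * N = u *: (v *: (Gw * N)) by rewrite -!scalerAl.
  by rewrite gtopZ gtopZ.
rewrite /A /hat /Th /radial_density /E /phi -/N.
have -> : energy beta (zc w) (xc w) (yc w) =
  - (quad beta (zc w) / 2) + (quad beta (xc w) + quad beta (yc w)) / 2.
  by rewrite /energy mulrBl addrC.
rewrite expRD; move: (future w) (gtop _) (expR _) (expR _) => *; ring.
Qed.

Lemma body_staylor q : body (staylor nu q) = nu (rad q).
Proof.
rewrite /staylor body_sum (bigD1 finset.set0) //= [X in _ + X]big1 ?addr0 => [|S S0].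
  rewrite bodyZ !big_set0 body1 !mulr1 (_ : [seq j <- enum Lambda | j \in finset.set0] = [::]) //.
  by rewrite (eq_filter (a2 := pred0)) ?filter_pred0 // => j; rewrite inE.
have [k kS] := set0Pn _ S0.
rewrite bodyZ (@prod_central R Lambda _ k) //; last by case: (geven_xieta R k).
by rewrite bodyM body_xieta mul0r mulr0.
Qed.

(** Unless all z_k are positive, both sides are 0 by the support of [nu]. Otherwise the radii of the
    squares are z itself, and the factors other than [g] and [nu] cancel exactly. *)
Let body_cutoff z : body (cutoff phi G (pt z (fun=> 0) (fun=> 0))) = g i z * nu z.
Proof.
rewrite /cutoff 2!bodyZ (_ : zc _ = z) //.
have [zp|/existsNP[k /negP zk]] := pselect (forall k, 0 < z k); last first.
  rewrite nu0 ?mulr0; last first.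
    by move=> /(_ k)/andP[azk _]; move: zk; rewrite -leNgt => /(le_trans azk); rewrite leNgt a0.
  by rewrite /future (bigD1 k) //= (negPf zk) !mul0r mulr0.
have mE : mass (pt z (fun=> 0) (fun=> 0)) = (fun k => z k ^+ 2).
  by apply/funext => k; rewrite /mass /mass2 /zc /xc /yc /= expr0n /= !subr0.
have rE : rad (fun k => z k ^+ 2) = z.
  by apply/funext => k; rewrite /rad sqrtr_sqr ger0_norm // ltW.
have f1 : future (pt z (fun=> 0) (fun=> 0)) = 1.
  by rewrite /future big1 // => k _; rewrite /iz /= zp.
rewrite f1 mul1r mE /extend bodyZ (_ : `[< _ >] = true); last first.
  by apply/asboolP => k; rewrite exprn_gt0.
rewrite mul1r /radial !bodyM body_staylor rE /sinv bodyD bodyA bodyZ body_xieta mulr0 addr0 rE.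
rewrite /boltzmann_radial bodyZ -/(body _).
have bg : body (gexp (radial_energy beta (fun k => z k ^+ 2) - (body (radial_energy beta (fun k => z k ^+ 2)))%:A)) = 1.
  rewrite /gexp body_sum big_ord_recl /= bodyZ expr0 body1 fact0 invr1 mul1r big1 ?addr0 // => m _.
  rewrite bodyZ exprS bodyM bodyD bodyN bodyA subrr mul0r mulr0 //.
have be : body (radial_energy beta (fun k => z k ^+ 2)) = quad beta z / 2.
  rewrite /radial_energy body_sum /quad mulr_suml; apply: eq_bigr => k _.
  rewrite body_sum mulr_suml; apply: eq_bigr => l _.
  by rewrite bodyZ bodyM !body_srad rE mulrAC.
rewrite bg be mulr1 /phi.
have ee : expR (- (quad beta z / 2)) * expR (quad beta z / 2) = 1.
  by rewrite -expRD addNr expR0.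
have zz : z i * (z i)^-1 = 1 by rewrite divff // gt_eqF.
transitivity (g i z * nu z * (z i * (z i)^-1) * (expR (- (quad beta z / 2)) * expR (quad beta z / 2))).
  by move: (expR _) (expR _) ((z i)^-1) => *; ring.
by rewrite ee zz !mulr1.
Qed.

Lemma radial_generator :
  \sum_j \int[leb3]_p (vec p.1.2 i * vec p.1.2 j *
    ((generator_part beta g j (vec p.1.1) - h j (vec p.1.1)) *
     (hat (radial_density beta nu i) (point p) *
      expR (energy beta (vec p.1.1) (vec p.1.2) (vec p.2))))) =
  - ((2 * pi) ^+ n * \int[leb]_t (g i (vec t) * nu (vec t))).
Proof.
apply/eqP; rewrite -eqr_oppLR -integral_A; apply/eqP.
under eq_Rintegral do rewrite A_cutoff.
rewrite (localization a20 sG T0 cphi phi0 beta_sym).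
rewrite (localization_value a20 sG T0 cphi phi0); congr (_ * _).
by apply: eq_Rintegral => t _; rewrite body_cutoff.
Qed.
End IntegrationByParts.

(** * Integrability *)

Section Integrability.
Variables (R : realType) (Lambda : finType).
Local Notation W := ((Lambda + Lambda) + Lambda)%type.
Local Notation MR := (measurableTypeR R).
Local Notation n := #|Lambda|.
Local Notation leb := (@lebesgue_tuple R n).
Local Notation leb3 := (@lebesgue3 R Lambda).
Implicit Types (w : W -> R) (k q j : Lambda) (x y z : Lambda -> R).

Lemma expR_beats_power (N : nat) (c : R) : 0 < c ->
  exists2 C, 0 <= C & forall u : R, 0 <= u -> u ^+ N * expR (- (c * u)) <= C.
Proof.
(* With this rate u <= exp (e u) / e, and the N-th power of exp (e u) is at most exp (c u). *)
move=> c0; pose e := c / N.+1%:R; have e0 : 0 < e by rewrite divr_gt0.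
exists (e^-1 ^+ N); first by rewrite exprn_ge0 // invr_ge0 ltW.
move=> u u0; rewrite expRN ler_pdivrMr ?expR_gt0 //.
have ue : u <= e^-1 * expR (e * u).
  rewrite -ler_pdivrMl ?invr_gt0 // invrK.
  by apply: le_trans (expR_ge1Dx _); rewrite lerDr.
apply: (@le_trans _ _ ((e^-1 * expR (e * u)) ^+ N)); first by apply: lerXn2r ue; rewrite nnegrE ?mulr_ge0 ?invr_ge0 ?expR_ge0 ?(ltW e0).
rewrite exprMn ler_pM2l ?exprn_gt0 ?invr_gt0 // -expRM_natl ler_expR mulrA ler_wpM2r //.
by rewrite /e mulrCA ler_piMr ?(ltW c0) // ler_pdivrMr // mul1r ler_nat.
Qed.

(* Reversed Cauchy-Schwarz inequality for vectors of squared mass at least [m]. *)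
Lemma timelike_dot (m zp zq xp xq yp yq : R) : 0 < m -> 0 < zp -> 0 < zq ->
  m <= zp ^+ 2 - xp ^+ 2 - yp ^+ 2 -> m <= zq ^+ 2 - xq ^+ 2 - yq ^+ 2 ->
  xp * xq + yp * yq - zp * zq <= - (m / 2 * (zq / zp)).
Proof.
move=> m0 zp0 zq0 mp mq; pose t := m / 2 * (zq / zp).
have tE : t * zp = m / 2 * zq by rewrite /t -mulrA divfK ?gt_eqF.
have t0 : 0 <= t by rewrite mulr_ge0 ?divr_ge0 ?ltW.
have zp2 : m <= zp ^+ 2.
  by apply: le_trans mp _; rewrite -addrA gerDl -opprD oppr_le0 addr_ge0 ?sqr_ge0.
have ztp : t * zp <= zp * zq * zp.
  rewrite tE (_ : zp * zq * zp = zp ^+ 2 * zq); last ring.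
  by rewrite ler_wpM2r ?(ltW zq0) //; lra.
have zt : 0 <= zp * zq - t by rewrite subr_ge0 -(ler_pM2r zp0).
rewrite -/t lerBlDr [- t + _]addrC.
have [X0|X0] := leP (xp * xq + yp * yq) 0; first exact: le_trans X0 zt.
rewrite -(@ler_pXn2r _ 2) ?nnegrE ?(ltW X0) //.
have cs : (xp * xq + yp * yq) ^+ 2 <= (xp ^+ 2 + yp ^+ 2) * (xq ^+ 2 + yq ^+ 2).
  rewrite -subr_ge0 (_ : _ - _ = (xp * yq - yp * xq) ^+ 2) ?sqr_ge0 //; ring.
apply: le_trans cs _.
have b1 : xp ^+ 2 + yp ^+ 2 <= zp ^+ 2 - m by rewrite lerBrDr addrC -lerBrDr opprD addrA.
have b2 : xq ^+ 2 + yq ^+ 2 <= zq ^+ 2.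
  by rewrite -subr_ge0 opprD addrA (le_trans (ltW m0)).
apply: (@le_trans _ _ ((zp ^+ 2 - m) * zq ^+ 2)).
  by apply: ler_pM => //; rewrite addr_ge0 ?sqr_ge0.
rewrite (_ : (zp * zq - t) ^+ 2 = zp ^+ 2 * zq ^+ 2 - 2 * zq * (t * zp) + t ^+ 2); last ring.
rewrite tE (_ : 2 * zq * (m / 2 * zq) = m * zq ^+ 2); last by field.
by rewrite mulrBl lerDl sqr_ge0.
Qed.

Variables (beta : Lambda -> Lambda -> R).
Hypotheses (beta_ge0 : forall i j, 0 <= beta i j)
  (beta_connected : forall i j, connect (fun k l => 0 < beta k l) i j).
Variables (m : R).
Hypothesis m0 : 0 < m.
Let supp z x y := forall k, 0 < z k /\ m <= mass2 z x y k.

Lemma energy_le z x y p q : supp z x y -> energy beta z x y <= - (beta p q * m / 4 * (z q / z p)).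
Proof.
move=> S.
have -> : energy beta z x y = \sum_k \sum_l beta k l * (x k * x l + y k * y l - z k * z l) / 2.
  rewrite /energy /quad -big_split -sumrB mulr_suml; apply: eq_bigr => k _.
  by rewrite -big_split -sumrB mulr_suml; apply: eq_bigr => l _; congr (_ / _); rewrite mulrBr mulrDr.
have le k l : beta k l * (x k * x l + y k * y l - z k * z l) / 2 <= - (beta k l * m / 4 * (z l / z k)).
  have [zk mk] := S k; have [zl ml] := S l.
  have H := ler_wpM2l (beta_ge0 k l) (timelike_dot m0 zk zl mk ml).
  rewrite ler_pdivrMr //; apply: le_trans H _.
  by rewrite le_eqVlt; apply/orP; left; apply/eqP; field; rewrite gt_eqF.
have le0 k l : beta k l * (x k * x l + y k * y l - z k * z l) / 2 <= 0.
  apply: le_trans (le k l) _; have [zk _] := S k; have [zl _] := S l.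
  by rewrite oppr_le0 mulr_ge0 ?divr_ge0 ?mulr_ge0 ?(ltW zk) ?(ltW zl) ?(ltW m0).
rewrite (bigD1 p) //= (bigD1 q) //=; apply: le_trans (le p q).
rewrite -addrA gerDl -[leRHS](addr0 0) lerD ?sumr_le0 // => k _; exact: sumr_le0.
Qed.

Lemma energy_le0 z x y : supp z x y -> energy beta z x y <= 0.
Proof.
move=> S; case: (pickP (@predT Lambda)) => [p _|e0]; last first.
  by rewrite /energy /quad !big_pred0 ?addr0 ?subr0 ?mul0r.
apply: le_trans (energy_le p p S) _; have [zp _] := S p.
by rewrite oppr_le0 mulr_ge0 ?divr_ge0 ?mulr_ge0 ?(ltW zp) ?(ltW m0).
Qed.

Let z_ge z x y k : supp z x y -> Num.sqrt m <= z k.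
Proof.
move=> /(_ k)[zk mk]; rewrite -(ger0_norm (ltW zk)) -sqrtr_sqr ler_sqrt ?sqr_ge0 //.
by apply: le_trans mk _; rewrite /mass2 -addrA gerDl -opprD oppr_le0 addr_ge0 ?sqr_ge0.
Qed.

(* Through the connectedness of the graph, the interaction energy controls every
   z_q by a single z_k. *)
Lemma energy_controls k q (N : nat) (e : R) : 0 < e -> exists2 C, 0 <= C &
  forall z x y, supp z x y ->
    (1 + z q) ^+ N * expR (e * energy beta z x y) <= C * (1 + z k) ^+ N.
Proof.
move: (beta_connected k q) => /connectP[s ps ->]; elim/last_ind: s e ps => [|s r IH] e.
  move=> _ e0 /=; exists 1 => // z x y S; rewrite mul1r ler_piMr //.
    by rewrite exprn_ge0 // addr_ge0 // ltW //; have [] := S k.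
  by rewrite -expR0 ler_expR pmulr_rle0 // energy_le0.
rewrite rcons_path last_rcons => /andP[ps]; set p := last k s => bpr e0.
(* Half of the energy pays for the last edge of the path, the other half is left to the induction
   hypothesis. *)
have e20 : 0 < e / 2 by rewrite divr_gt0.
have [C1 C10 H1] := IH (e / 2) ps e20; rewrite -/p in H1.
pose c := e / 2 * (beta p r * m / 4).
have c0 : 0 < c by rewrite mulr_gt0 // divr_gt0 // mulr_gt0.
have [C2 C20 H2] := expR_beats_power N c0.
pose a := Num.sqrt m; have a0 : 0 < a by rewrite sqrtr_gt0.
pose D := (1 + a^-1) ^+ N.
have D0 : 0 <= D by rewrite exprn_ge0 // addr_ge0 // invr_ge0 ltW.
exists (D * C2 * C1); first by rewrite !mulr_ge0.
move=> z x y S; have [zr _] := S r; have [zp _] := S p.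
have zra : a <= z r by exact: z_ge S.
have ratio : 1 + z r <= (1 + a^-1) * (z r / z p) * (1 + z p).
  have h1 : 1 + z r <= (1 + a^-1) * z r.
    by rewrite mulrDl mul1r addrC lerD2l -ler_pdivrMl ?invr_gt0 // invrK mulr1.
  apply: le_trans h1 _; rewrite -mulrA ler_wpM2l ?addr_ge0 ?invr_ge0 ?(ltW a0) //.
  by rewrite mulrDr mulr1 divfK ?gt_eqF // lerDr divr_ge0 ?ltW.
have u0 : 0 <= z r / z p by rewrite divr_ge0 ?ltW.
have r1 : (1 + z r) ^+ N <= D * (z r / z p) ^+ N * (1 + z p) ^+ N.
  by rewrite /D -!exprMn; apply: lerXn2r ratio; rewrite nnegrE ?mulr_ge0 ?addr_ge0 ?invr_ge0 ?(ltW zr) ?(ltW zp) ?(ltW a0).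
have e1 : expR (e / 2 * energy beta z x y) <= expR (- (c * (z r / z p))).
  rewrite ler_expR /c; have := ler_wpM2l (ltW e20) (energy_le p r S).
  by rewrite mulrN !mulrA.
have -> : e * energy beta z x y = e / 2 * energy beta z x y + e / 2 * energy beta z x y.
  by rewrite -mulrDl -splitr.
rewrite expRD; have h2 := H2 _ u0; have h1 := H1 _ _ _ S.
move: h1 h2 e1 r1; set F := expR (e / 2 * _); set u := _ ^+ N; set v := (1 + z p) ^+ N.
set X := (z r / z p) ^+ N; set Y := expR (- _) => h1 h2 e1 r1.
have F0 : 0 <= F by exact: expR_ge0.
have v0 : 0 <= v by rewrite exprn_ge0 // addr_ge0 // ltW.
have X0 : 0 <= X by rewrite exprn_ge0.
apply: (@le_trans _ _ (D * X * v * (Y * F))).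
  by apply: ler_pM => //; [rewrite exprn_ge0 ?addr_ge0 ?(ltW zr)|rewrite mulr_ge0|rewrite ler_wpM2r].
rewrite (_ : _ * (Y * F) = D * ((X * Y) * (v * F))); last by ring.
have Y0 : 0 <= Y by exact: expR_ge0.
have -> : D * C2 * C1 * (1 + z k) ^+ N = D * (C2 * (C1 * (1 + z k) ^+ N)) by rewrite !mulrA.
apply: ler_wpM2l => //; apply: ler_pM => //; exact: mulr_ge0.
Qed.

Lemma weight_vec (t : n.-tuple MR) : weight t = \prod_k weight1 (vec t k).
Proof.
rewrite /weight (reindex (@enum_rank Lambda)) /=; first by apply: eq_bigr.
by exists enum_val => ? _; rewrite ?enum_rankK ?enum_valK.
Qed.

Section density.
Variables (b : R) (H : (Lambda -> R) -> R).
Hypotheses (H0 : forall q : Lambda -> R, ~ box m b q -> H q = 0) (cH : pcontinuous H).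
Variables (i j : Lambda).
Let density (f : (Lambda -> R) -> R) (p : n.-tuple MR * n.-tuple MR * n.-tuple MR) : R :=
  vec p.1.2 i * vec p.1.2 j * (f (vec p.1.1) *
    (hat H (point p) * expR (energy beta (vec p.1.1) (vec p.1.2) (vec p.2)))).

Let regroup (Z F C e w : R) : Z * Z * (F * (C * e)) * (Z ^+ 6 * w) = C * w * (F * (Z ^+ 8 * e)).
Proof. ring. Qed.

Let cancel (C D B w s : R) : 0 < s -> C * D * B * w = C * w * (D * s^-1 * (B * s)).
Proof. by move=> s0; field; rewrite gt_eqF. Qed.

Let prod_ge1 (S : pred Lambda) (F : Lambda -> R) : (forall l, 1 <= F l) -> 1 <= \prod_(l | S l) F l.
Proof. by move=> F1; apply: (big_rec (fun t => 1 <= t)) => // l t _ t1; rewrite mulr_ege1. Qed.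

Let prod_le (S1 S2 : Lambda -> R) : (forall k, 0 <= S1 k <= S2 k) -> \prod_k S1 k <= \prod_k S2 k.
Proof. by move=> S12; apply: ler_prod. Qed.

Let hat_supp p : hat H (point p) != 0 -> supp (vec p.1.1) (vec p.1.2) (vec p.2) /\
  forall k, `|vec p.1.2 k| <= vec p.1.1 k /\ `|vec p.2 k| <= vec p.1.1 k.
Proof.
move=> hp; have hn := hat_neq0 m0 H0 hp; split=> k; have [zk xk yk] := hn k; split=> //.
have: H (mass (point p)) != 0 by move: hp; rewrite /hat mulf_eq0 negb_or => /andP[].
have [bx _|nb] := pselect (box m b (mass (point p))); last by rewrite H0 ?eqxx.
by have /andP[] := bx k.
Qed.

Lemma density_bound f k : (forall N : nat, exists C, forall z, (forall k, 0 <= z k) ->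
    `|f z| <= C * (1 + z k) ^- N) ->
  exists2 C, 0 <= C & forall p, `|density f p| <= C * weight3 p.
Proof.
move=> fdecay.
have n0 : (0 < n)%N by apply/card_gt0P; exists i.
have [CH [CH0 HCH]] := pcontinuous_bounded cH H0.
(* With Z the product of all 1 + z_q, Z^2 pays for x_i x_j and Z^6 for the weights in z, x and y.
   Each of the n factors of Z^8 takes a share 1 / n of the energy and is traded for (1 + z_k)^8. *)
have [Cf HCf] := fdecay (8 * n)%N.
have einv : 0 < n%:R^-1 :> R by rewrite invr_gt0 ltr0n.
have /choice[Cq HCq] : forall q, exists C, 0 <= C /\ forall z x y, supp z x y ->
    (1 + z q) ^+ 8 * expR (n%:R^-1 * energy beta z x y) <= C * (1 + z k) ^+ 8.
  by move=> q; have [C C0 HC] := energy_controls k q 8 einv; exists C.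
pose CC := \prod_q Cq q.
have CC0 : 0 <= CC by apply: prodr_ge0 => q _; have [] := HCq q.
exists (CH * `|Cf| * CC); first by rewrite !mulr_ge0.
move=> p; have w0 : 0 <= weight3 p by rewrite !mulr_ge0 // ltW ?weight_gt0.
have [h0|hn] := eqVneq (hat H (point p)) 0.
  by rewrite /density h0 mul0r !mulr0 normr0 mulr_ge0 // !mulr_ge0.
have [S xy] := hat_supp hn.
set z := vec p.1.1 in S xy *; set x := vec p.1.2 in S xy *; set y := vec p.2 in S xy *.
have z0 l : 0 <= z l by have [/ltW] := S l.
pose Z := \prod_q (1 + z q).
have s1 q : 1 <= 1 + z q by rewrite lerDl.
have sZ q : 1 + z q <= Z.
  rewrite /Z (bigD1 q) //= ler_peMr ?addr_ge0 //.
  by apply: prod_ge1 => l.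
have Z1 : 1 <= Z by apply: le_trans (s1 k) (sZ k).
have Z0 : 0 <= Z by apply: le_trans Z1.
have xZ q : `|x q| <= Z.
  by have [xq _] := xy q; apply: le_trans xq (le_trans _ (sZ q)); rewrite lerDr.
have hatb : `|hat H (point p)| <= CH.
  rewrite /hat normrM -[leRHS]mul1r; apply: ler_pM => //.
  rewrite /future normr_prod; apply: (@le_trans _ _ (\prod_(l : Lambda) (1 : R))); last by rewrite big1.
  by apply: prod_le => l; rewrite normr_ge0 /= ger0_norm ?ler0n // lern1 leq_b1.
have fb : `|f z| <= `|Cf| * (1 + z k) ^- (8 * n).
  apply: le_trans (HCf z z0) _; rewrite ler_wpM2r ?ler_norm // invr_ge0 exprn_ge0 //.
  by apply: le_trans (s1 k).
have Eb : Z ^+ 8 * expR (energy beta z x y) <= CC * (1 + z k) ^+ (8 * n).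
  have -> : expR (energy beta z x y) = \prod_(q : Lambda) expR (n%:R^-1 * energy beta z x y).
    by rewrite prodr_const -expRM_natl mulrA divff ?mul1r // pnatr_eq0 -lt0n.
  rewrite /Z -prodrXl -big_split /=.
  have -> : CC * (1 + z k) ^+ (8 * n) = \prod_q (Cq q * (1 + z k) ^+ 8).
    by rewrite big_split /= prodr_const exprM.
  apply: prod_le => q; rewrite mulr_ge0 ?exprn_ge0 ?addr_ge0 ?expR_ge0 //=.
  by have [_] := HCq q; apply.
have wb : 1 <= Z ^+ 6 * weight3 p.
  rewrite /weight3 !weight_vec -/z -/x -/y -!big_split /= /Z -prodrXl -big_split /=.
  apply: prod_ge1 => q.
  have one (u : R) : `|u| <= z q -> 1 <= (1 + z q) ^+ 2 * weight1 u.
    move=> uz; rewrite /weight1 ler_pdivlMr ?ltr_pwDl ?sqr_ge0 // mul1r.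
    have u2 : u ^+ 2 <= z q ^+ 2 by rewrite -(real_normK (num_real u)) lerXn2r ?nnegrE.
    have := z0 q; nra.
  have [xq yq] := xy q; have zq : `|z q| <= z q by rewrite ger0_norm.
  rewrite (_ : (1 + z q) ^+ 6 * _ = ((1 + z q) ^+ 2 * weight1 (z q)) * ((1 + z q) ^+ 2 * weight1 (x q)) *
    ((1 + z q) ^+ 2 * weight1 (y q))); last by move: (weight1 _) (weight1 _) (weight1 _) => *; ring.
  by rewrite -[1]mulr1 -[X in X * _]mulr1; apply: ler_pM; rewrite ?ler01 ?mulr1 //; [apply: mulr_ege1; exact: one|exact: one].
rewrite /density -/z -/x -/y 4!normrM (ger0_norm (expR_ge0 _)).
move: (expR_ge0 (energy beta z x y)) Eb; set e := expR _ => e0 Eb.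
have sk0 : 0 < (1 + z k) ^+ (8 * n) by rewrite exprn_gt0 // (lt_le_trans ltr01).
move: fb sk0 Eb wb hatb; set s := (1 + z k) ^+ _; set h := `|hat _ _|; set F := `|f z|.
set w := weight3 p in w0 * => fb sk0 Eb wb hatb.
apply: (@le_trans _ _ (Z * Z * (F * (CH * e)))).
  apply: ler_pM; rewrite ?mulr_ge0 ?normr_ge0 //; first by apply: ler_pM.
  by rewrite ler_wpM2l ?normr_ge0 // ler_wpM2r.
apply: (@le_trans _ _ (Z * Z * (F * (CH * e)) * (Z ^+ 6 * w))).
  by rewrite ler_peMr // !mulr_ge0 ?normr_ge0.
rewrite regroup (cancel _ _ _ _ sk0).
apply: ler_wpM2l; first exact: mulr_ge0.
by apply: ler_pM => //; [exact: normr_ge0|rewrite mulr_ge0 ?exprn_ge0].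
Qed.

Lemma density_integrable f k : pcontinuous f ->
  (forall N : nat, exists C, forall z, (forall k, 0 <= z k) -> `|f z| <= C * (1 + z k) ^- N) ->
  leb3.-integrable setT (EFin \o density f).
Proof.
move=> cf /density_bound[C C0 HC].
have md : measurable_fun setT (density f).
  have chat := pcontinuous_hat m0 H0 cH.
  have cq (co : Lambda -> W) : pcontinuous (fun w => quad beta (fun k => w (co k))).
    do 2 (apply: pcontinuous_sum => ? _); apply: pcontinuousM; first exact: pcontinuous_cst.
    by apply: pcontinuousM; exact: pcontinuous_coord.
  have cz := @pcontinuous_sub R W Lambda f (@iz Lambda) cf.
  apply: (@measurable_on_points R Lambda (fun w => w (ix i) * w (ix j) * (f (zc w) *
    (hat H w * expR (energy beta (zc w) (xc w) (yc w)))))).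
  apply: pcontinuousM; first by apply: pcontinuousM; exact: pcontinuous_coord.
  apply: pcontinuousM => //; apply: pcontinuousM => //; apply: pcontinuous_expR.
  apply: pcontinuousM; last exact: pcontinuous_cst.
  by apply: pcontinuousB; [apply: pcontinuousD|]; exact: cq.
have iw := integrable_weight R n.
apply: (fubini3_integrable (u := fun t => C * weight t) (v := @weight R n) (h := @weight R n)) => //.
- by move=> p; apply: le_trans (HC p) _; rewrite /weight3 !mulrA.
- exact: (rintegrableZ measurableT C iw).
Qed.
End density.
End Integrability.

(** * Uniqueness *)

Section LayerCake.
Context d (T : measurableType d) (R : realType) (m : {sigma_finite_measure set T -> \bar R}).
Local Notation mu := (@lebesgue_measure R).
Local Notation MR := (measurableTypeR R).
Variables (U Y : T -> R) (C : R).
Hypotheses (iU : m.-integrable setT (EFin \o U)) (U0 : forall x, 0 <= U x)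
  (mY : measurable_fun setT Y) (YC : forall x, U x != 0 -> `|Y x| <= C).

Let mU : measurable_fun setT U.
Proof. by apply/measurable_EFinP; case/integrableP: iU. Qed.

(** Y + C is the length of [-C, Y), so Fubini expresses the integral through the superlevel sets of
    [Y]. *)
Lemma layer_cake : \int[m]_x (U x * (Y x + C)) =
  \int[mu]_s ((- C <= s)%R%:R * \int[m]_x (U x * (s < Y x)%R%:R)).
Proof.
pose A : set (T * MR) := [set p | - C <= p.2 < Y p.1].
have m2 : measurable_fun setT (fun p : T * MR => p.2 : R) by exact: measurable_snd.
have m1 : measurable_fun setT (fun p : T * MR => Y p.1 - p.2).
  by apply: measurable_funB => //; exact: measurableT_comp mY measurable_fst.
have mA : measurable A.
  have := measurableI _ _ (m2 measurableT _ (measurable_itv `[- C, +oo[)) (m1 measurableT _ (measurable_itv `]0, +oo[)).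
  rewrite !setTI (_ : _ `&` _ = A) //; apply/seteqP; split=> p /=; rewrite !in_itv /= !andbT subr_gt0.
    by move=> [c1 c2]; rewrite /A /= c1.
  by rewrite /A /= => /andP[].
pose F (p : T * MR) : R := U p.1 * \1_A p.
have mF : measurable_fun setT F.
  by apply: measurable_funM; [exact: measurableT_comp mU measurable_fst|exact: measurable_indic].
pose v : MR -> R := \1_(`[- C, C]).
have iv : mu.-integrable setT (EFin \o v) by exact: integrable_indic_itv.
have FE x s : F (x, s) = U x * \1_(`[- C, Y x[) s.
  by rewrite /F !indicE; congr (_ * _%:R); apply/idP/idP; rewrite !inE /= in_itv.
have FB p : `|F p| <= U p.1 * v p.2.
  case: p => x s; rewrite FE normrM (ger0_norm (U0 x)) /=.
  have [->|Ux] := eqVneq (U x) 0; first by rewrite !mul0r.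
  rewrite ler_wpM2l // /v !indicE; have [/set_mem|_] := boolP (s \in `[- C, Y x[%classic); last by rewrite normr0 ler0n.
  rewrite /= in_itv /= => /andP[s1 s2]; rewrite mem_set ?normr1 //= in_itv /= s1 /=.
  by apply: le_trans (ltW s2) _; apply: le_trans (ler_norm _) (YC Ux).
have [_ F1 F2] := dominated_fubini mF FB iU iv.
transitivity (\int[m]_x \int[mu]_s F (x, s)).
  apply: eq_Rintegral => x _; under eq_Rintegral do rewrite FE.
  have [->|Ux] := eqVneq (U x) 0.
    by rewrite mul0r Rintegral_eq0 // => s _; rewrite mul0r.
  rewrite RintegralZl //; last exact: integrable_indic_itv.
  transitivity (U x * fine (mu `[- C, Y x[)); last by rewrite /Rintegral integral_indic // setIT.
  congr (_ * _); rewrite lebesgue_measure_itv /= lte_fin.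
  have := YC Ux; rewrite ler_norml => /andP[CY _].
  case: ltP => [_|YC']; first by rewrite -EFinD /= opprK.
  by rewrite (_ : Y x = - C) ?addNr //; apply/le_anti; rewrite YC' CY.
rewrite -F1 F2; apply: eq_Rintegral => s _.
have [sC|sC] := leP (- C) s; last first.
  by rewrite mul0r Rintegral_eq0 // => x _; rewrite FE indicE memNset ?mulr0 //= in_itv /= leNgt sC.
rewrite mul1r; apply: eq_Rintegral => x _; rewrite FE indicE; congr (_ * _%:R).
by rewrite mem_setE in_itv /= sC.
Qed.

Lemma integrable_weighted : m.-integrable setT (EFin \o (fun x => U x * Y x)).
Proof.
apply: (dominated_integrable (g := fun x => C * U x)) => //; first exact: measurable_funM.
- move=> x _; rewrite normrM (ger0_norm (U0 x)) mulrC.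
  have [->|Ux] := eqVneq (U x) 0; first by rewrite !mulr0.
  by rewrite ler_wpM2r // YC.
exact: (rintegrableZ measurableT C iU).
Qed.

Lemma layer_cake_split : \int[m]_x (U x * (Y x + C)) = \int[m]_x (U x * Y x) + C * \int[m]_x U x.
Proof.
under eq_Rintegral do rewrite mulrDr.
rewrite RintegralD //; [|exact: integrable_weighted|]; last first.
  by under eq_fun do rewrite mulrC; exact: (rintegrableZ measurableT C iU).
by congr (_ + _); under eq_Rintegral do rewrite mulrC; rewrite RintegralZl.
Qed.
End LayerCake.

(** The initial law is given on sets, and equality on superlevel sets suffices for integrals. Bounds
    are asked only where the weight is nonzero, because the test functions are controlled on the
    positive orthant alone. *)
Lemma integral_transfer d1 d2 (T1 : measurableType d1) (T2 : measurableType d2) (R : realType)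
    (m1 : {sigma_finite_measure set T1 -> \bar R}) (m2 : {sigma_finite_measure set T2 -> \bar R})
    (U Y : T1 -> R) (V Z : T2 -> R) (C : R) :
  m1.-integrable setT (EFin \o U) -> (forall x, 0 <= U x) ->
  measurable_fun setT Y -> (forall x, U x != 0 -> `|Y x| <= C) ->
  m2.-integrable setT (EFin \o V) -> (forall x, 0 <= V x) ->
  measurable_fun setT Z -> (forall x, V x != 0 -> `|Z x| <= C) ->
  (forall s, \int[m1]_x (U x * (s < Y x)%R%:R) = \int[m2]_x (V x * (s < Z x)%R%:R)) ->
  \int[m1]_x U x = \int[m2]_x V x ->
  \int[m1]_x (U x * Y x) = \int[m2]_x (V x * Z x).
Proof.
move=> iU U0 mY YC iV V0 mZ ZC E EU.
have := layer_cake iU U0 mY YC; rewrite (layer_cake_split iU U0 mY YC) => H1.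
have := layer_cake iV V0 mZ ZC; rewrite (layer_cake_split iV V0 mZ ZC) => H2.
apply: (addIr (C * \int[m1]_x U x)); rewrite H1 EU H2.
by apply: eq_Rintegral => s _; rewrite E.
Qed.

(** * The identity for Lipschitz functions with cutoff *)

Section Resolvent.
Context (R : realType) (Lambda : finType) d (T : measurableType d).
Variables (P : probability T R) (beta : Lambda -> Lambda -> R).
Variables (X : R -> T -> Lambda) (L0 : T -> Lambda -> R).
Hypotheses (XL : vrjp P beta X L0) (beta_sym : forall i j, beta i j = beta j i)
  (beta_ge0 : forall i j, 0 <= beta i j)
  (beta_connected : forall i j, connect (fun k l => 0 < beta k l) i j).
Variables (nu : Lambda -> (Lambda -> R) -> R) (a b : R).
Hypotheses (nu_ge0 : forall i r, 0 <= nu i r) (snu : forall i, smooth (nu i)) (a0 : 0 < a)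
  (nu0 : forall i r, ~ box a b r -> nu i r = 0) (X0 : initial_law P X L0 nu).
Local Notation mu := (@lebesgue_measure R).
Local Notation L := (local_time X L0).
Local Notation mean := (mean P X L0).
Local Notation MR := (measurableTypeR R).
Local Notation n := #|Lambda|.
Local Notation leb := (@lebesgue_tuple R n).
Local Notation leb3 := (@lebesgue3 R Lambda).
Implicit Types (s : R) (w : T) (i j k : Lambda).

Let unvecK (x : Lambda -> R) : vec (unvec x) = x.
Proof. by apply/funext => i; rewrite /vec /unvec tnth_mktuple enum_rankK. Qed.

Let mnu i : measurable_fun setT (fun t : n.-tuple MR => nu i (vec t)).
Proof.
apply: measurable_pcontinuous; first exact: (@smooth_continuous R Lambda [::] (nu i) (snu i)).
by move=> k; exact: measurable_vec.
Qed.

Lemma integrable_initial i : leb.-integrable setT (EFin \o (fun t : n.-tuple MR => nu i (vec t))).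
Proof.
apply/integrableP; split; first by apply/measurable_EFinP.
under eq_integral do rewrite /= ger0_norm //.
rewrite -(X0 i measurableT); apply: le_lt_trans (probability_le1 P _) (ltry 1).
have -> : [set w | X 0 w = i /\ setT (unvec (L0 w))] = [set w | X 0 w = i].
  by apply/seteqP; split=> w //= -[].
exact: (vrjp_measurable XL).
Qed.

Lemma mean_initial (g : Lambda -> (Lambda -> R) -> R) (T0 : R) : (forall j, lipc T0 (g j)) ->
  mean g 0 = \sum_i \int[leb]_(t in setT) (g i (vec (t : n.-tuple MR)) * nu i (vec t)).
Proof.
move=> lg.
have [i0 _] : exists w : Lambda, True.
  have [w _] : exists w : T, True by exists classical_sets.point.
  by exists (X 0 w).
have [C [C0 cg gC _]] := lipc_observable i0 lg.
have meanE : mean g 0 = \int[P]_w \sum_i ((X 0 w == i)%:R * g i (L0 w)).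
  apply: eq_Rintegral => w _; rewrite (bigD1 (X 0 w)) //= eqxx mul1r big1 ?addr0 => [|i /negPf].
    by congr (g _); apply/funext => k; exact: local_time0.
  by rewrite eq_sym => ->; rewrite mul0r.
have mL i : measurable_fun setT (fun w => g i (L0 w)).
  by apply: measurable_pcontinuous; [exact: cg|move=> k; exact: (vrjp_measurable0 XL)].
have gL i w : `|g i (L0 w)| <= C by apply: gC => k; exact/ltW/(vrjp_gt0 XL).
have mX i : measurable_fun setT (fun w => (X 0 w == i)%:R : R) by exact: (measurable_state XL).
have iX i : P.-integrable setT (EFin \o (fun w => (X 0 w == i)%:R : R)).
  have b1 w : `|(X 0 w == i)%:R : R| <= 1 by case: (_ == _); rewrite ?normr1 ?normr0.
  exact: (rintegrable_bounded P (mX i) b1).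
rewrite meanE (Rintegral_sum measurableT); last first.
  move=> i; have b1 w : `|(X 0 w == i)%:R * g i (L0 w)| <= C.
    by case: (_ == _); rewrite ?mul1r ?mul0r ?normr0.
  exact: (rintegrable_bounded P (measurable_funM (mX i) (mL i)) b1).
have law i (B : set (n.-tuple MR)) : measurable B ->
    \int[P]_w ((X 0 w == i)%:R * (\1_B (unvec (L0 w)))) = \int[leb]_t (nu i (vec t) * \1_B t).
  move=> mB; rewrite /Rintegral; congr fine.
  transitivity (P [set w | X 0 w = i /\ B (unvec (L0 w))]).
    have mS : measurable [set w | X 0 w = i /\ B (unvec (L0 w))].
      have -> : [set w | X 0 w = i /\ B (unvec (L0 w))] =
        [set w | X 0 w = i] `&` [set w | B (unvec (L0 w))] by [].
      apply: measurableI; first exact: (vrjp_measurable XL).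
      have mu0 : measurable_fun setT (fun w => unvec (L0 w)).
        apply/measurable_fun_tnthP => k; rewrite (_ : _ \o _ = (fun w => L0 w (enum_val k))).
          exact: (vrjp_measurable0 XL).
        by apply/funext => w /=; rewrite /unvec tnth_mktuple.
      by have := mu0 measurableT B mB; rewrite setTI.
    rewrite -[X in P X]setIT -integral_indic //; apply: eq_integral => w _; congr EFin.
    rewrite !indicE -natrM mulnb; congr (_%:R); congr nat_of_bool.
    by apply/andP/idP; rewrite !inE /=; [move=> [/eqP]|move=> [/eqP]].
  transitivity (\int[leb]_t ((fun t : n.-tuple MR => (nu i (vec t))%:E) \_ B) t)%E.
    by rewrite X0 // -integral_mkcond.
  congr integral; apply/funext => t; rewrite patchE indicE.
  by case: (t \in B); rewrite ?mulr1 ?mulr0.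
apply: eq_bigr => i _; under [RHS]eq_Rintegral do rewrite mulrC.
have mg : measurable_fun setT (fun t : n.-tuple MR => g i (vec t)).
  by apply: measurable_pcontinuous; [exact: cg|move=> k; exact: measurable_vec].
apply: (@integral_transfer _ _ _ _ R P leb _ _ _ _ C (iX i) _ (mL i) _ (integrable_initial i)) => //.
- move=> t nt; apply: gC => k; have [bt|nb] := pselect (box a b (vec t)).
    by have /andP[/(le_trans (ltW a0))] := bt k.
  by rewrite (nu0 i nb) eqxx in nt.
- move=> s; pose B : set (n.-tuple MR) := [set t | s < g i (vec t)].
  have mB : measurable B.
    have := mg measurableT _ (measurable_itv `]s, +oo[); rewrite setTI.
    by rewrite (_ : _ @^-1` _ = B) //; apply/seteqP; split=> t /=; rewrite in_itv /= andbT.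
  have := law i B mB; under eq_Rintegral do rewrite indicE.
  under [in RHS]eq_Rintegral do rewrite indicE.
  move=> H; transitivity (\int[P]_w ((X 0 w == i)%:R * (unvec (L0 w) \in B)%:R)).
    apply: eq_Rintegral => w _; have -> // : (unvec (L0 w) \in B) = (s < g i (L0 w)).
    by apply/idP/idP; rewrite inE /B /= unvecK.
  rewrite H; apply: eq_Rintegral => t _; have -> // : (t \in B) = (s < g i (vec t)).
  by apply/idP/idP; rewrite inE.
have := law i setT measurableT.
under eq_Rintegral do rewrite indicT mulr1.
by under [in RHS]eq_Rintegral do rewrite indicT mulr1.
Qed.

Definition model_density i j (f : (Lambda -> R) -> R)
    (p : n.-tuple MR * n.-tuple MR * n.-tuple MR) : R :=
  vec p.1.2 i * vec p.1.2 j * (f (vec p.1.1) *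
    (hat (radial_density beta (nu i) i) (point p) *
     expR (energy beta (vec p.1.1) (vec p.1.2) (vec p.2)))).

Definition fast_decay (f : (Lambda -> R) -> R) := exists k, forall N : nat, exists C,
  forall z, (forall k, 0 <= z k) -> `|f z| <= C * (1 + z k) ^- N.

Let a20 : 0 < a ^+ 2. Proof. exact: exprn_gt0. Qed.
Let H0 i (q : Lambda -> R) : ~ box (a ^+ 2) (b ^+ 2) q -> radial_density beta (nu i) i q = 0.
Proof.
have sG := supercompact_radial beta i (snu i) a0 (nu0 i).
by move=> qb; rewrite /radial_density (supercompact_eq0 sG qb) mul0r gtop0.
Qed.

Lemma integrable_model_density i j f : pcontinuous f -> fast_decay f ->
  leb3.-integrable setT (EFin \o model_density i j f).
Proof.
move=> cf [k fk].
have cH : pcontinuous (radial_density beta (nu i) i).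
  exact: (@pcontinuous_radial_density R Lambda beta (nu i) a b i (snu i) a0 (nu0 i)).
by apply: (density_integrable beta_ge0 beta_connected a20 (@H0 i) cH i j cf) => N; exact: fk.
Qed.

Let norm_scale (A x F G h e : R) : `|F| <= A * `|G| -> `|x * (F * (h * e))| <= A * `|x * (G * (h * e))|.
Proof.
move=> FG; rewrite !normrM; move: (`|x|) (`|h|) (`|e|) (normr_ge0 x) (normr_ge0 h) (normr_ge0 e).
move=> x' h' e' x0 h0 e0; rewrite (_ : A * _ = x' * (A * `|G| * (h' * e'))); last by ring.
by rewrite ler_wpM2l // ler_wpM2r // mulr_ge0.
Qed.

(** [hat] vanishes unless z is positive, so comparing the test functions on the orthant suffices. *)
Lemma model_density_le i j f g (A : R) p : (forall z, (forall k, 0 <= z k) -> `|f z| <= A * `|g z|) ->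
  `|model_density i j f p| <= A * `|model_density i j g p|.
Proof.
move=> fg; rewrite /model_density.
have [->|hp] := eqVneq (hat (radial_density beta (nu i) i) (point p)) 0.
  by rewrite !mul0r !mulr0 normr0 mulr0.
have z0 k : 0 <= vec p.1.1 k by have [/ltW] := hat_neq0 a20 (H0 i) hp k.
exact: norm_scale (fg _ z0).
Qed.

Lemma lipc_fast_decay k T0 f : lipc T0 f -> fast_decay f.
Proof.
move=> lf; exists k => N; have [C C0 HC] := lipc_bounded k lf (lexx 0).
exists (C * (1 + `|T0|) ^+ N) => z z0.
have [zT|zT] := leP T0 (\sum_l z l).
  by rewrite (lf.1 _ zT) normr0 !mulr_ge0 ?invr_ge0 ?exprn_ge0 ?addr_ge0.
apply: (@le_trans _ _ C); first by apply: HC => l; rewrite oppr0.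
rewrite -mulrA ler_peMr // ler_pdivlMr ?exprn_gt0 ?ltr_wpDr // mul1r.
apply: lerXn2r; rewrite ?nnegrE ?addr_ge0 // lerD2l (le_trans _ (ler_norm _)) // ltW //.
by apply: le_lt_trans zT; rewrite (bigD1 k) //= lerDl sumr_ge0.
Qed.

Lemma exp_fast_decay k lambda : 0 < lambda ->
  fast_decay (fun z => expR (- lambda * \sum_l z l)).
Proof.
move=> l0; exists k => N; have [C C0 HC] := expR_beats_power N l0.
exists (C * expR lambda) => z z0; rewrite ger0_norm ?expR_ge0 //.
have u0 : 0 < 1 + z k by rewrite ltr_wpDr.
rewrite ler_pdivlMr ?exprn_gt0 //.
apply: (@le_trans _ _ (expR lambda * ((1 + z k) ^+ N * expR (- (lambda * (1 + z k)))))).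
  rewrite mulrCA mulrC ler_wpM2l ?exprn_ge0 ?(ltW u0) // -expRD ler_expR.
  have zk : z k <= \sum_l z l by rewrite (bigD1 k) //= lerDl sumr_ge0.
  have := ler_wpM2l (ltW l0) zk; move: (\sum_l z l) (z k) => S t St.
  by rewrite mulrDr mulr1 opprD addrA subrr add0r mulNr lerN2.
by rewrite mulrC ler_wpM2r ?expR_ge0 // HC // ltW.
Qed.

Lemma pcontinuous_exp lambda : pcontinuous (fun z : Lambda -> R => expR (- lambda * \sum_l z l)).
Proof.
apply: pcontinuous_expR; apply: pcontinuousM; first exact: pcontinuous_cst.
by apply: pcontinuous_sum => l _; exact: pcontinuous_coord.
Qed.

Let vertex0 : Lambda := X 0 classical_sets.point.

Lemma integrable_mean C F T0 : observable C F ->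
  mu.-integrable `[0, T0] (EFin \o (fun s => mean F s)).
Proof.
move=> oC; have : mu.-integrable `[0, T0] (EFin \o (fun s => mean F (Num.max s 0))).
  apply: continuous_compact_integrable; first exact: segment_compact.
  by apply: continuous_subspaceT; exact: (continuous_mean XL oC).
have mI : measurable (`[0, T0]%classic : set MR) by exact: measurable_itv.
move=> H; apply: (eq_integrable mI (EFin \o (fun s => mean F (Num.max s 0)))
  (EFin \o (fun s => mean F s)) _ H) => s; rewrite inE /= in_itv /= => /andP[s0 _].
by rewrite /comp (max_l s0).
Qed.

Section contraction.
Variable T0 : R.
Hypothesis T00 : 0 <= T0.
Implicit Types (g h : Lambda -> (Lambda -> R) -> R).

Let U h : R := \int[mu]_(s in `[0, T0]) mean h s.
Let K h : R := \sum_i \sum_j \int[leb3]_p model_density i j (h j) p.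
Let c : R := (2 * pi) ^+ n.
Let c0 : 0 <= c. Proof. by rewrite exprn_ge0 // mulr_ge0 // pi_ge0. Qed.
(* [D] is invariant under [B], which halves the norm sup |h z| exp (rate * sum z)
   on functions that vanish where sum z >= T0: hence D = 0. *)
Let D h : R := c * U h - K h.
Let B h j : (Lambda -> R) -> R := generator_part beta (fun j => ray_integral j (h j)) j.

Let UB g h : (forall j, lipc T0 (g j)) -> (forall j, lipc T0 (h j)) ->
  U (fun j z => g j z - h j z) = U g - U h.
Proof.
move=> lg lh; have [C1 o1] := lipc_observable vertex0 lg; have [C2 o2] := lipc_observable vertex0 lh.
rewrite -RintegralB //; [|exact: integrable_mean o1|exact: integrable_mean o2].
apply: eq_Rintegral => s; rewrite inE /= in_itv /= => /andP[s0 _].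
by rewrite /mean RintegralB //; [exact: (integrable_observable XL o1)|exact: (integrable_observable XL o2)].
Qed.

Let lipc_integrable i j f : lipc T0 f -> leb3.-integrable setT (EFin \o model_density i j f).
Proof.
move=> lf; apply: integrable_model_density; last exact: lipc_fast_decay vertex0 _ _ lf.
exact: (lipc_pcontinuous lf).
Qed.

Let KB g h : (forall j, lipc T0 (g j)) -> (forall j, lipc T0 (h j)) ->
  K (fun j z => g j z - h j z) = K g - K h.
Proof.
move=> lg lh; rewrite /K -sumrB; apply: eq_bigr => i _; rewrite -sumrB; apply: eq_bigr => j _.
rewrite -RintegralB //; [|exact: lipc_integrable|exact: lipc_integrable].
by apply: eq_Rintegral => p _; rewrite /model_density mulrBl mulrBr.
Qed.

Let lB h j : (forall j, lipc T0 (h j)) -> lipc T0 (B h j).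
Proof. by move=> lh; apply: generator_part_lipc => k; exact: ray_integral_lipc. Qed.

(** Dynkin's formula and integration by parts are applied to the same ray integrals. By the initial
    law their boundary terms agree up to the factor [c], and they cancel in [D]. *)
Let D_step h : (forall j, lipc T0 (h j)) -> D (B h) = D h.
Proof.
move=> lh; pose g j := ray_integral j (h j).
have lg j : lipc T0 (g j) by exact: ray_integral_lipc.
have dg j z : is_derive (0 : R) 1 (fun r => g j (shift z j r)) (- h j z).
  exact: ray_integral_derive (lh j).
have H1 := dynkin XL beta_ge0 lg lh dg T00.
have H2 i := @radial_generator R Lambda beta beta_sym (nu i) a b i (snu i) a0 (nu0 i) T0 g h T00 lg lh dg.
have E1 : U (B h) - U h = - mean g 0.
  rewrite -UB //; last by move=> j; exact: lB.
  by apply/eqP; rewrite -addr_eq0 addrC; apply/eqP.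
have E2 : K (B h) - K h = - (c * mean g 0).
  rewrite -KB //; last by move=> j; exact: lB.
  rewrite (mean_initial lg) mulr_sumr -sumrN; apply: eq_bigr => i _; exact: (H2 i).
have : D (B h) - D h = c * (U (B h) - U h) - (K (B h) - K h) by rewrite /D; ring.
by rewrite E1 E2 mulrN subrr => /eqP; rewrite subr_eq0 => /eqP.
Qed.

(** Both parts of [D] are bounded in the weighted norm: the time interval has length [T0], and the
    density of the exponential weight is integrable. *)
Let D_bound lambda : 0 < lambda -> exists2 C, 0 <= C & forall h A, 0 <= A ->
  (forall j, lipc T0 (h j)) ->
  (forall j z, (forall k, 0 <= z k) -> `|h j z| <= A * expR (- lambda * \sum_k z k)) ->
  `|D h| <= C * A.
Proof.
move=> l0; pose e := fun z : Lambda -> R => expR (- lambda * \sum_k z k).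
have ie i j := integrable_model_density i j (@pcontinuous_exp lambda) (exp_fast_decay vertex0 l0).
exists (c * T0 + \sum_i \sum_j \int[leb3]_p `|model_density i j e p|).
  apply: addr_ge0; first exact: mulr_ge0.
  apply: sumr_ge0 => i _; apply: sumr_ge0 => j _.
  by apply: Rintegral_ge0 => p _.
move=> h A A0 lh hA; have [C1 o1] := lipc_observable vertex0 lh.
have hU : `|U h| <= T0 * A.
  apply: le_trans (le_normr_Rintegral _ _) _ => //; first exact: integrable_mean o1.
  apply: (@le_trans _ _ (\int[mu]_(s in `[0, T0]) A)); last first.
    have muE : fine (mu `[0, T0]) = T0.
      rewrite lebesgue_measure_itv /= lte_fin; case: ltP => [_|T0']; first by rewrite -EFinD /= subr0.
      by apply/le_anti; rewrite T00 T0'.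
    by rewrite Rintegral_cst // muE mulrC.
  apply: le_Rintegral => //.
  - by apply: rintegrable_abs => //; exact: integrable_mean o1.
  - apply: continuous_compact_integrable; first exact: segment_compact.
    by apply: continuous_subspaceT => ?; exact: cvg_cst.
  move=> s /=; rewrite in_itv /= => /andP[s0 _].
  have io := integrable_observable XL o1 s0 s0.
  apply: le_trans (le_normr_Rintegral _ _) _ => //.
  rewrite -[leRHS](Rintegral_prob_cst P A); apply: le_Rintegral => //.
  - by apply: rintegrable_abs.
  - exact: (rintegrable_bounded P (measurable_cst A) (fun=> lexx `|A|)).
  move=> w _ /=; have Lk k : 0 <= L s w k by exact: (local_time_ge0 XL).
  apply: le_trans (hA _ _ Lk) _; rewrite ler_piMr // -expR0 ler_expR mulNr oppr_le0.
  by rewrite mulr_ge0 ?sumr_ge0 // ltW.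
have hK : `|K h| <= (\sum_i \sum_j \int[leb3]_p `|model_density i j e p|) * A.
  rewrite mulr_suml; apply: le_trans (ler_norm_sum _ _ _) _; apply: ler_sum => i _.
  rewrite mulr_suml; apply: le_trans (ler_norm_sum _ _ _) _; apply: ler_sum => j _.
  apply: le_trans (le_normr_Rintegral _ _) _ => //; first exact: lipc_integrable.
  rewrite mulrC -RintegralZl //; last exact: rintegrable_abs.
  apply: le_Rintegral => //.
  - by apply: rintegrable_abs => //; exact: lipc_integrable.
  - by apply: (rintegrableZ measurableT A); exact: rintegrable_abs.
  move=> p _; apply: model_density_le => z z0.
  by rewrite (ger0_norm (expR_ge0 _)); exact: hA.
rewrite /D mulrDl; apply: le_trans (ler_normB _ _) _; apply: lerD => //.
by rewrite normrM (ger0_norm c0) -mulrA ler_wpM2l.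
Qed.

Let total : R := \sum_i \sum_j beta i j.
Let total_ge0 : 0 <= total. Proof. by apply: sumr_ge0 => i _; exact: sumr_ge0. Qed.
(** Makes 2 [T0] [total] / [rate] at most 1 / 2: the jump part brings the factors 2, [T0] and
    [total], the ray integral brings 1 / [rate]. The summand 1 keeps the rate positive. *)
Let rate : R := 4 * (T0 * total) + 1.

Let rate_gt0 : 0 < rate.
Proof. by rewrite ltr_wpDl // !mulr_ge0. Qed.

Let quarter_le (u : R) : u <= 4^-1 * (4 * u + 1).
Proof. lra. Qed.

Let B_bound h A : 0 <= A -> (forall j, lipc T0 (h j)) ->
  (forall j z, (forall k, 0 <= z k) -> `|h j z| <= A * expR (- rate * \sum_k z k)) ->
  forall j z, (forall k, 0 <= z k) -> `|B h j z| <= A / 2 * expR (- rate * \sum_k z k).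
Proof.
move=> A0 lh hA j z z0.
have E0 : 0 <= expR (- rate * \sum_k z k) by exact: expR_ge0.
have [zT|zT] := leP T0 (\sum_k z k).
  by rewrite (lB j lh).1 // normr0 !mulr_ge0.
have gb k : `|ray_integral k (h k) z| <= A / rate * expR (- rate * \sum_l z l).
  exact: (ray_integral_exp k (lh k) rate_gt0 (hA k) z0).
move: E0 gb; set E := expR _ => E0 gb; set G := A / rate * E in gb.
have G0 : 0 <= G by rewrite !mulr_ge0 ?invr_ge0 ?(ltW rate_gt0).
have zk k : z k <= T0.
  by apply: le_trans (ltW zT); rewrite (bigD1 k) //= lerDl sumr_ge0.
apply: (@le_trans _ _ (\sum_k beta j k * (T0 * (2 * G)))).
  apply: le_trans (ler_norm_sum _ _ _) _; apply: ler_sum => k _.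
  rewrite normrM ger0_norm // ler_wpM2l // normrM (ger0_norm (z0 k)).
  apply: ler_pM => //; apply: le_trans (ler_normB _ _) _.
  by rewrite mulr2n mulrDl !mul1r lerD.
rewrite -mulr_suml.
apply: (@le_trans _ _ (total * (T0 * (2 * G)))).
  apply: ler_wpM2r; first exact: (mulr_ge0 T00 (mulr_ge0 (ler0n _ 2) G0)).
  rewrite /total [leRHS](bigD1 j) //= lerDl; apply: sumr_ge0 => i _; exact: sumr_ge0.
rewrite /G (_ : total * _ = (T0 * total) / rate * (2 * A * E)); last by ring.
rewrite (_ : A / 2 * E = 4^-1 * (2 * A * E)); last by field.
rewrite ler_wpM2r ?mulr_ge0 // ler_pdivrMr //; exact: quarter_le.
Qed.

(** Each use of the invariance under [B] halves the weighted norm, so |D h| <= C A / 2^m for all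
    m. *)
Lemma resolvent_lipc h : (forall j, lipc T0 (h j)) ->
  \sum_i \sum_j \int[leb3]_p model_density i j (h j) p =
  (2 * pi) ^+ n * \int[mu]_(s in `[0, T0]) mean h s.
Proof.
move=> lh; suff D0 : D h = 0 by apply/esym/eqP; rewrite -subr_eq0; apply/eqP.
have [C C0 HC] := D_bound rate_gt0.
have iter (m : nat) : forall h A, 0 <= A -> (forall j, lipc T0 (h j)) ->
    (forall j z, (forall k, 0 <= z k) -> `|h j z| <= A * expR (- rate * \sum_k z k)) ->
    `|D h| <= C * (A / 2 ^+ m).
  elim: m => [|m IH] h' A A0 lh' hA; first by rewrite expr0 divr1; exact: HC.
  rewrite -D_step //; apply: le_trans (IH (B h') (A / 2) _ _ _) _.
  - by rewrite divr_ge0.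
  - by move=> j; exact: lB.
  - exact: B_bound.
  by rewrite -[A / 2 / _]mulrA -invfM -exprS.
have [C1 [C10 _ hC _]] := lipc_observable vertex0 lh.
(* As h vanishes where sum z >= [T0], the weight exp (rate sum z) is at most exp (rate T0) where it
   matters. *)
pose A := C1 * expR (rate * T0).
have A0 : 0 <= A by rewrite mulr_ge0 ?expR_ge0.
have hA j z : (forall k, 0 <= z k) -> `|h j z| <= A * expR (- rate * \sum_k z k).
  move=> z0; have [zT|zT] := leP T0 (\sum_k z k).
    by rewrite (lh j).1 // normr0 mulr_ge0 ?expR_ge0.
  apply: le_trans (hC j z z0) _; rewrite /A -mulrA ler_peMr // -expRD -expR0 ler_expR.
  by rewrite mulNr -mulrBr mulr_ge0 ?subr_ge0 ?ltW.
apply/eqP; rewrite -normr_le0; apply/ler_addgt0Pl => e e0; rewrite addr0.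
have [m Hm] : exists m : nat, C * A / e < m%:R.
  by exists (Num.truncn (C * A / e)).+1; have /andP[_] := truncn_itv (divr_ge0 (mulr_ge0 C0 A0) (ltW e0)).
apply: le_trans (iter m h A A0 lh hA) _; rewrite mulrA ler_pdivrMr ?exprn_gt0 //.
rewrite -ler_pdivrMl // mulrC; apply: le_trans (ltW Hm) _.
by rewrite -natrX ler_nat ltnW // ltn_expl.
Qed.
End contraction.
End Resolvent.

(** * Rapidly decaying functions *)

Section SmoothCutoff.
Variables (R : realType) (Lambda : finType).
Implicit Types (F : (Lambda -> R) -> R) (M : nat) (s : R).

(** What the passage to the limit needs of the test function. Unlike smoothness, it is inherited by
    the absolute value. *)
Definition tame F := [/\ pcontinuous F,
  exists2 C, 0 <= C & forall x y, `|F x - F y| <= C * ldist x y,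
  exists2 C, 0 <= C & forall z, `|F z| <= C & fast_decay F].

Definition ramp M s : R := Num.min 1 (Num.max 0 (M%:R + 1 - s)).

Lemma ramp_ge0 M s : 0 <= ramp M s.
Proof. by rewrite le_min ler01 le_max lexx. Qed.

Lemma ramp_le1 M s : ramp M s <= 1.
Proof. by rewrite ge_min lexx. Qed.

Lemma ramp1 M s : s <= M%:R -> ramp M s = 1.
Proof. by move=> sM; rewrite /ramp min_l // le_max; apply/orP; right; lra. Qed.

Lemma ramp0 M s : M%:R + 1 <= s -> ramp M s = 0.
Proof. by move=> sM; rewrite /ramp max_l ?min_r //; lra. Qed.

Let rampP M s : [\/ M%:R + 1 - s <= 0 /\ ramp M s = 0, 0 <= M%:R + 1 - s <= 1 /\ ramp M s = M%:R + 1 - s |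
  1 <= M%:R + 1 - s /\ ramp M s = 1].
Proof.
rewrite /ramp; move: (M%:R + 1 - s) => u.
case: (leP u 0) => u0; first by constructor 1; rewrite min_r // ler01.
case: (leP 1 u) => u1; first by constructor 3.
by constructor 2; rewrite ?(ltW u0) ?(ltW u1).
Qed.

Lemma ramp_homo s : {homo ramp^~ s : M M' / (M <= M')%N >-> M <= M'}.
Proof.
move=> M M' MM'; have : M%:R <= M'%:R :> R by rewrite ler_nat.
case: (rampP M s) => -[+ ->]; case: (rampP M' s) => -[+ ->]; move: (M%:R) (M'%:R) => u v; lra.
Qed.

Lemma ramp_lipschitz M s s' : `|ramp M s - ramp M s'| <= `|s - s'|.
Proof.
have := ler_norm (s - s'); have := ler_norm (s' - s); rewrite distrC.
move: (`|s - s'|) => e; rewrite ler_norml.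
by case: (rampP M s) => -[+ ->]; case: (rampP M s') => -[+ ->]; move: (M%:R) => u ? ? ? ?;
  apply/andP; split; lra.
Qed.

Definition cut M F (z : Lambda -> R) : R := F z * ramp M (\sum_k z k).

Lemma cut_le M F z : `|cut M F z| <= 1 * `|F z|.
Proof. by rewrite normrM (ger0_norm (ramp_ge0 _ _)) mul1r ler_piMr ?ramp_le1. Qed.

Lemma cut_lipc M F : tame F -> lipc (M%:R + 1) (cut M F).
Proof.
move=> [_ [C C0 FC] [B B0 FB] _]; split=> [z zM|m _]; first by rewrite /cut ramp0 ?mulr0.
exists (C + B); first exact: addr_ge0.
move=> x y _ _; rewrite /cut.
have -> : F x * ramp M (\sum_k x k) - F y * ramp M (\sum_k y k) =
  (F x - F y) * ramp M (\sum_k x k) + F y * (ramp M (\sum_k x k) - ramp M (\sum_k y k)) by ring.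
apply: le_trans (ler_normD _ _) _; rewrite [leRHS]mulrDl; apply: lerD.
  rewrite normrM (ger0_norm (ramp_ge0 _ _)); apply: le_trans (FC x y).
  by rewrite ler_piMr ?ramp_le1.
rewrite normrM; apply: ler_pM => //; apply: le_trans (ramp_lipschitz _ _ _) _.
by rewrite -sumrB; exact: ler_norm_sum.
Qed.

Lemma cvg_cut F z : cut M F z @[M --> \oo] --> F z.
Proof.
apply: cvg_near_cst; exists (Num.truncn `|\sum_k z k|).+1 => // M /= MM.
rewrite /cut ramp1 ?mulr1 //; apply: le_trans (ler_norm _) _.
have /andP[_ h] := truncn_itv (normr_ge0 (\sum_k z k)).
by apply: le_trans (ltW h) _; rewrite ler_nat.
Qed.

Lemma tame_norm F : tame F -> tame (fun z => `|F z|).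
Proof.
move=> [cF [C C0 FC] [B B0 FB] [k Fk]]; split.
- exact: pcontinuous_norm.
- by exists C => // x y; apply: le_trans (ler_dist_dist _ _) (FC x y).
- by exists B => // z; rewrite normr_id.
by exists k => N; have [D HD] := Fk N; exists D => z z0; rewrite normr_id HD.
Qed.

Lemma tame_observable (F : Lambda -> (Lambda -> R) -> R) : (forall j, tame (F j)) ->
  exists C, observable C F.
Proof.
move=> tF; have /choice[C HC] j : exists C, 0 <= C /\ forall x y, `|F j x - F j y| <= C * ldist x y.
  by have [_ [C C0 FC] _ _] := tF j; exists C.
have /choice[B HB] j : exists B, 0 <= B /\ forall z, `|F j z| <= B.
  by have [_ _ [B B0 FB] _] := tF j; exists B.
have S0 j : 0 <= C j + B j by rewrite addr_ge0 ?(HC j).1 ?(HB j).1.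
have Sj j : C j + B j <= \sum_k (C k + B k) by rewrite [leRHS](bigD1 j) //= lerDl sumr_ge0.
exists (\sum_k (C k + B k)); split.
- by rewrite sumr_ge0.
- by move=> j; have [] := tF j.
- move=> j z _; apply: le_trans ((HB j).2 z) _; apply: le_trans (Sj j); rewrite lerDr; exact: (HC j).1.
move=> j x y _ _; apply: le_trans ((HC j).2 x y) _; rewrite ler_wpM2r ?ldist_ge0 //.
by apply: le_trans (Sj j); rewrite lerDl (HB j).1.
Qed.

Lemma smooth_decay_tame (f : Lambda -> (Lambda -> R) -> R) j : (forall i, smooth (f i)) ->
  rapid_decay f -> tame (f j).
Proof.
move=> sf df; have [k fk] := df j.
(* The exponent 0 in the decay hypothesis bounds the function and all its derivatives. *)
have bnd (s : seq Lambda) : exists2 C, 0 <= C & forall z, `|pderivs s (f j) z| <= C.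
  have [C HC] := fk s 0%N; exists C => [|z]; last by have := HC z; rewrite expr0 invr1 mulr1.
  by have := HC (fun=> 0); rewrite expr0 invr1 mulr1; exact: le_trans.
split.
- exact: (@smooth_continuous R Lambda [::] (f j) (sf j)).
- have /choice[D HD] i : exists C, 0 <= C /\ forall z, `|pderivs [:: i] (f j) z| <= C.
    by have [C C0 HC] := bnd [:: i]; exists C.
  have D0 : 0 <= \sum_i D i by apply: sumr_ge0 => i _; exact: (HD i).1.
  exists (\sum_i D i) => // x y.
  pose m : R := - (\sum_i (`|x i| + `|y i|)).
  have le i : `|x i| + `|y i| <= \sum_i (`|x i| + `|y i|).
    by rewrite [leRHS](bigD1 i) //= lerDl sumr_ge0 // => l _; rewrite addr_ge0.
  apply: (@lipschitz_partials R Lambda m _ (f j) (fun i z => pderivs [:: i] (f j) z)).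
  + by move=> z i s; exact: (@smooth_derive R Lambda (f j) [::] i z s (sf j)).
  + move=> z i _; apply: le_trans ((HD i).2 z) _.
    by rewrite (bigD1 i) //= lerDl sumr_ge0 // => l _; exact: (HD l).1.
  + move=> i; have := le i; have := lerNnormlW (lexx `|x i|); have := normr_ge0 (y i).
    by rewrite /m; move: (\sum_(_ <- _) _) => S; move: (`|x i|) (`|y i|) => *; lra.
  + move=> i; have := le i; have := lerNnormlW (lexx `|y i|); have := normr_ge0 (x i).
    by rewrite /m; move: (\sum_(_ <- _) _) => S; move: (`|x i|) (`|y i|) => *; lra.
- exact: (bnd [::]).
exists k => N; have [C HC] := fk [::] N; exists C => z z0.
by have := HC z; rewrite (ger0_norm (z0 k)).
Qed.

Lemma compact_positive_box (nu : Lambda -> (Lambda -> R) -> R) : smooth_compact_probability nu ->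
  exists a b : R, 0 < a /\ forall i r, ~ box a b r -> nu i r = 0.
Proof.
move=> [_ _ cK _].
have bounds i (k : Lambda) : exists ab : R * R, [/\ 0 < ab.1, 0 <= ab.2 & forall r, nu i r != 0 ->
    ab.1 <= r k <= ab.2].
  have [K [Kc Kp K0]] := cK i.
  have [Kn0|nK] := pselect (K !=set0); last first.
    (* With an empty [K] the density is 0 and any bounds serve. *)
    exists (1, 1); split=> //= r nr; case: nK; exists r; apply: contrapT => /K0 H.
    by rewrite H eqxx in nr.
  have ck : {within K, continuous (fun r : {ptws Lambda -> R} => r k)}.
    by apply: continuous_subspaceT => r; exact: cvg_coord.
  have [u uK Hu] := compact_EVT_min Kn0 Kc ck; have [v vK Hv] := compact_EVT_max Kn0 Kc ck.
  have uk : 0 < u k by apply: Kp; rewrite inE in uK.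
  have vk : 0 < v k by apply: Kp; rewrite inE in vK.
  exists (u k, v k); split; rewrite //= ?ltW // => r nr.
  have rK : r \in (K : set {ptws Lambda -> R}).
    by rewrite inE; apply: contrapT => /K0 H; rewrite H eqxx in nr.
  by rewrite (Hu _ rK) (Hv _ rK).
have /choice[ab Hab] (p : Lambda * Lambda) : exists ab : R * R, [/\ 0 < ab.1, 0 <= ab.2 &
    forall r, nu p.1 r != 0 -> ab.1 <= r p.2 <= ab.2] by exact: bounds.
(* The inverse of [S] lies below all lower bounds at once, without a minimum over a possibly empty
   family. *)
pose S : R := 1 + \sum_p (ab p).1^-1.
have inv0 p : 0 < (ab p).1^-1 by have [a0 _ _] := Hab p; rewrite invr_gt0.
have S0 : 0 < S by rewrite ltr_pwDl // sumr_ge0 // => p _; exact: ltW.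
exists S^-1, (\sum_p (ab p).2); split=> [|i r nb]; first by rewrite invr_gt0.
apply/eqP; apply: contrapT => /negP nr; apply: nb => k.
have [a0 b0 H] := Hab (i, k); have /andP[h1 h2] := H r nr.
apply/andP; split.
  apply: le_trans h1; rewrite -[leRHS]invrK lef_pV2 ?posrE // /S (bigD1 (i, k)) //= addrCA lerDl.
  by rewrite addr_ge0 // sumr_ge0 // => p _; exact: ltW.
apply: le_trans h2 _; rewrite (bigD1 (i, k)) //= lerDl sumr_ge0 // => p _.
by have [] := Hab p.
Qed.
End SmoothCutoff.

(** * Removal of the cutoff *)

Section Limit.
Context (R : realType) (Lambda : finType) d (T : measurableType d).
Variables (P : probability T R) (beta : Lambda -> Lambda -> R).
Variables (X : R -> T -> Lambda) (L0 : T -> Lambda -> R).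
Hypotheses (XL : vrjp P beta X L0) (beta_sym : forall i j, beta i j = beta j i)
  (beta_ge0 : forall i j, 0 <= beta i j)
  (beta_connected : forall i j, connect (fun k l => 0 < beta k l) i j).
Variables (nu : Lambda -> (Lambda -> R) -> R) (a b : R).
Hypotheses (nu_ge0 : forall i r, 0 <= nu i r) (snu : forall i, smooth (nu i)) (a0 : 0 < a)
  (nu0 : forall i r, ~ box a b r -> nu i r = 0) (X0 : initial_law P X L0 nu).
Local Notation mu := (@lebesgue_measure R).
Local Notation L := (local_time X L0).
Local Notation mean := (mean P X L0).
Local Notation MR := (measurableTypeR R).
Local Notation n := #|Lambda|.
Local Notation leb3 := (@lebesgue3 R Lambda).
Local Notation density := (model_density beta nu).
Implicit Types (t s : R) (w : T) (i j k : Lambda) (M : nat).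

Let mI : measurable (`[0, +oo[%classic : set MR). Proof. exact: measurable_itv. Qed.

Let L_ge0 t w k : 0 <= t -> 0 <= L t w k.
Proof. exact: (local_time_ge0 XL). Qed.

Let c : R := (2 * pi) ^+ n.
Let c0 : 0 < c. Proof. by rewrite exprn_gt0 // mulr_gt0 // pi_gt0. Qed.

Lemma measurable_mean C F : observable C F -> measurable_fun (`[0, +oo[%classic : set MR) (mean F).
Proof.
move=> oC; apply: (eq_measurable_fun (fun s : MR => mean F (Num.max s 0))).
  by move=> s; rewrite inE /= in_itv /= andbT => s0; rewrite (max_l s0).
apply: measurable_funTS; apply: continuous_measurable_fun; exact: (continuous_mean XL oC).
Qed.

(** At time s the local times sum to at least s, so the mean vanishes beyond [T0]. *)
Let patch_mean h (T0 : R) : (forall j, lipc T0 (h j)) ->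
  (EFin \o mean h) \_ `[0, T0] = (EFin \o mean h) \_ `[0, +oo[.
Proof.
move=> lh; apply/funext => s; rewrite !patchE !mem_setE !in_itv /= andbT.
case: (leP 0 s) => //= s0; case: (leP s T0) => // /ltW sT; congr EFin.
apply/esym/Rintegral_eq0 => w _; apply: (lh _).1; rewrite (sum_local_time XL) //.
by apply: le_trans sT _; rewrite lerDr sumr_ge0 // => k _; exact/ltW/(vrjp_gt0 XL).
Qed.

Let mean_lipc h (T0 : R) : (forall j, lipc T0 (h j)) ->
  mu.-integrable (`[0, +oo[%classic : set MR) (EFin \o mean h) /\
  \int[mu]_(s in `[0, +oo[) mean h s = \int[mu]_(s in `[0, T0]) mean h s.
Proof.
move=> lh; have [C oC] := lipc_observable (X 0 classical_sets.point) lh.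
have mJ : measurable (`[0, T0]%classic : set MR) by exact: measurable_itv.
split; last by rewrite /Rintegral integral_mkcond -(patch_mean lh) -integral_mkcond.
apply/(integrable_mkcond _ mI); rewrite -(patch_mean lh).
by apply/(integrable_mkcond _ mJ); exact: (integrable_mean XL T0 oC).
Qed.

Section family.
Variable F : Lambda -> (Lambda -> R) -> R.
Hypothesis tF : forall j, tame (F j).
Let cutF M j := cut M (F j).
Let lcut M j : lipc (M%:R + 1) (cutF M j). Proof. exact: cut_lipc. Qed.

Let iden i j : leb3.-integrable setT (EFin \o density i j (F j)).
Proof.
have [cF _ _ dF] := tF j.
exact: (integrable_model_density beta_ge0 beta_connected snu a0 nu0 i j cF dF).
Qed.

Let icut M i j : leb3.-integrable setT (EFin \o density i j (cutF M j)).
Proof.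
have cc : pcontinuous (cutF M j) := @lipc_pcontinuous R Lambda _ _ (lcut M j).
have dc := lipc_fast_decay j (lcut M j).
exact: (integrable_model_density beta_ge0 beta_connected snu a0 nu0 i j cc dc).
Qed.

Let dominated M i j p : `|density i j (cutF M j) p| <= `|density i j (F j) p|.
Proof.
rewrite -[leRHS]mul1r; apply: (model_density_le beta snu a0 nu0 i j p) => z _; exact: cut_le.
Qed.

Let cut_value M : \sum_i \sum_j \int[leb3]_p density i j (cutF M j) p =
  c * \int[mu]_(s in `[0, +oo[) mean (cutF M) s.
Proof.
have [_ ->] := mean_lipc (lcut M).
have M0 : 0 <= M%:R + 1 :> R by rewrite addr_ge0.
exact: (resolvent_lipc XL beta_sym beta_ge0 beta_connected nu_ge0 snu a0 nu0 X0 M0 (lcut M)).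
Qed.

Let cvg_mean t : 0 <= t -> mean (cutF M) t @[M --> \oo] --> mean F t.
Proof.
move=> t0; have [C oC] := tame_observable tF; have [C0 cF FC _] := oC.
apply: (@Rdominated_cvg R _ T P setT _ _ (cst C)) => //.
- move=> M; apply: (measurable_observable XL) => // j.
  exact: (@lipc_pcontinuous R Lambda _ _ (lcut M j)).
- exact: (measurable_observable XL).
- by move=> w _; exact: cvg_cut.
- exact: (rintegrable_bounded P (measurable_cst C) (fun=> lexx `|C|)).
move=> M w _; apply: le_trans (cut_le _ _ _) _; rewrite mul1r; apply: FC => k; exact: L_ge0.
Qed.

Let bound : R := \sum_i \sum_j \int[leb3]_p `|density i j (F j) p|.

(** Through the identity for the cutoffs, integrability of the density bounds the time integral
    uniformly in [M]. *)
Let mean_cut_bound M : \int[mu]_(s in `[0, +oo[) mean (cutF M) s <= c^-1 * bound.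
Proof.
rewrite -[leLHS](mulKf (lt0r_neq0 c0)) -cut_value ler_wpM2l ?invr_ge0 ?(ltW c0) //.
apply: ler_sum => i _; apply: ler_sum => j _; apply: le_trans (ler_norm _) _.
apply: le_trans (le_normr_Rintegral _ _) _ => //.
by apply: le_Rintegral => //; exact: rintegrable_abs.
Qed.

(** Monotone convergence along the cutoffs, whose time integrals are bounded from the side of the
    density. *)
Lemma mean_nonneg_integrable : (forall j z, 0 <= F j z) ->
  mu.-integrable (`[0, +oo[%classic : set MR) (EFin \o mean F).
Proof.
move=> F0; have [C oC] := tame_observable tF.
have mF0 s : 0 <= mean F s by apply: Rintegral_ge0 => w _; exact: F0.
apply/integrableP; split; first by apply/measurable_EFinP; exact: measurable_mean oC.
under eq_integral do rewrite /= ger0_norm //.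
pose g (M : nat) (s : MR) : \bar R := (mean (cutF M) s)%:E.
have ig M : mu.-integrable (`[0, +oo[%classic : set MR) (g M) := (mean_lipc (lcut M)).1.
have mg M : measurable_fun (`[0, +oo[%classic : set MR) (g M) := measurable_int mu (ig M).
have cut0 M j z : 0 <= cutF M j z by rewrite mulr_ge0 ?ramp_ge0.
have g0 M (s : MR) : (`[0, +oo[%classic : set MR) s -> (0 <= g M s)%E.
  by move=> _; rewrite lee_fin; apply: Rintegral_ge0 => w _; exact: cut0.
have hg (s : MR) : (`[0, +oo[%classic : set MR) s -> {homo g^~ s : M M' / (M <= M')%N >-> (M <= M')%E}.
  rewrite /= in_itv /= andbT => s0 M M' MM'; rewrite lee_fin.
  have [C1 o1] := tame_observable tF.
  have io N : P.-integrable setT (EFin \o (fun w => cutF N (X s w) (L s w))).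
    have [D oD] := lipc_observable (X 0 classical_sets.point) (lcut N).
    exact: (integrable_observable XL oD).
  apply: le_Rintegral => // w _; rewrite /cutF /cut ler_wpM2l //; exact: ramp_homo.
have H := cvg_monotone_convergence mI mg g0 hg.
have lim_g (s : MR) : 0 <= s -> limn (fun M => g M s) = (mean F s)%:E.
  move=> s0; apply/cvg_lim => //; apply: cvg_EFin; first exact: nearW.
  exact: cvg_mean.
have E : integral mu `[0, +oo[ (fun s : MR => (mean F s)%:E) =
    integral mu `[0, +oo[ (fun s : MR => limn (fun M => g M s)).
  by apply: eq_integral => s; rewrite inE /= in_itv /= andbT => s0; rewrite lim_g.
have HL : limn (fun M => integral mu `[0, +oo[ (g M)) = integral mu `[0, +oo[ (fun s : MR => (mean F s)%:E).
  by apply: cvg_lim => //; rewrite E; exact: H.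
rewrite -HL.
apply: (@le_lt_trans _ _ (c^-1 * bound)%:E); last exact: ltry.
apply: lime_le; first by apply/cvg_ex; eexists; exact: H.
apply: nearW => M; rewrite -(fineK (integrable_fin_num mI (ig M))) lee_fin.
exact: mean_cut_bound.
Qed.

Let cvg_density : \sum_i \sum_j \int[leb3]_p density i j (cutF M j) p @[M --> \oo] -->
  \sum_i \sum_j \int[leb3]_p density i j (F j) p.
Proof.
apply: cvg_sumr => i _; apply: cvg_sumr => j _.
have mE (h : n.-tuple MR * n.-tuple MR * n.-tuple MR -> R) : leb3.-integrable setT (EFin \o h) -> measurable_fun setT h.
  by move=> ih; apply/measurable_EFinP; exact: (measurable_int leb3 ih).
apply: (@Rdominated_cvg R _ _ leb3 setT _ _ (fun p => `|density i j (F j) p|)) => //.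
- by move=> M; apply: mE; exact: icut.
- by apply: mE; exact: iden.
- move=> p _; rewrite /model_density; apply: cvgM; first exact: cvg_cst.
  by apply: cvgM; [exact: cvg_cut|exact: cvg_cst].
- by apply: rintegrable_abs.
Qed.

Section value.
Hypothesis imF : mu.-integrable (`[0, +oo[%classic : set MR) (EFin \o mean (fun j z => `|F j z|)).

Let mean_le M t : 0 <= t -> `|mean (cutF M) t| <= mean (fun j z => `|F j z|) t.
Proof.
move=> t0; have [D oD] := lipc_observable (X 0 classical_sets.point) (lcut M).
have io := integrable_observable XL oD t0 t0.
have [C oC] := tame_observable tF; have ioF := integrable_observable XL oC t0 t0.
apply: le_trans (le_normr_Rintegral _ _) _ => //.
apply: le_Rintegral => //; [exact: rintegrable_abs|exact: rintegrable_abs|].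
by move=> w _; apply: le_trans (cut_le _ _ _) _; rewrite mul1r.
Qed.

(** Dominated convergence on both sides of the identity for the cutoffs: the density of F dominates
    on one side, the mean of |F| on the other. *)
Lemma mean_value : mu.-integrable (`[0, +oo[%classic : set MR) (EFin \o mean F) /\
  \sum_i \sum_j \int[leb3]_p density i j (F j) p = c * \int[mu]_(s in `[0, +oo[) mean F s.
Proof.
have [C oC] := tame_observable tF; have mF := measurable_mean oC; split.
  apply: (@dominated_integrable R _ MR mu _ (mean F) (mean (fun j z => `|F j z|))) => //.
  move=> t /=; rewrite in_itv /= andbT => t0.
  have ioF := integrable_observable XL oC t0 t0.
  exact: (le_normr_Rintegral measurableT ioF).
have H1 : c * \int[mu]_(s in `[0, +oo[) mean (cutF M) s @[M --> \oo] -->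
    \sum_i \sum_j \int[leb3]_p density i j (F j) p.
  by have := cvg_density; under eq_fun do rewrite cut_value.
have H2 : c * \int[mu]_(s in `[0, +oo[) mean (cutF M) s @[M --> \oo] -->
    c * \int[mu]_(s in `[0, +oo[) mean F s.
  apply: cvgM; first exact: cvg_cst.
  apply: (@Rdominated_cvg R _ _ mu _ _ _ (mean (fun j z => `|F j z|))) => //.
  - move=> M; have [D oD] := lipc_observable (X 0 classical_sets.point) (lcut M).
    exact: measurable_mean oD.
  - by move=> t /=; rewrite in_itv /= andbT => t0; exact: cvg_mean.
  by move=> M t /=; rewrite in_itv /= andbT => t0; exact: mean_le.
exact: (cvg_unique _ H1 H2).
Qed.
End value.
End family.
End Limit.

Theorem theorem7p3 (R : realType) (Lambda : finType)
  (beta : Lambda -> Lambda -> R)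
  (beta_sym : forall i j, beta i j = beta j i)
  (beta_ge0 : forall i j, 0 <= beta i j)
  (beta_connected : forall i j, connect (fun k l => 0 < beta k l) i j)
  (nu : Lambda -> (Lambda -> R) -> R)
  (nuP : smooth_compact_probability nu)
  (d : measure_display) (T : measurableType d) (P : probability T R)
  (X : R -> T -> Lambda) (L0 : T -> Lambda -> R)
  (XL0_vrjp : vrjp P beta X L0)
  (XL0_initial : initial_law P X L0 nu)
  (f : Lambda -> (Lambda -> R) -> R)
  (f_smooth : forall i, smooth (f i))
  (f_decay : rapid_decay f) :
  let Ef (t : R) := 'E_P[fun w => f (X t w) (local_time X L0 t w)]%E in
  let F (i j : Lambda) : superform R Lambda := fun z x y =>
    let u := supercoord z x y in
    gapp (nu i) (fun k => superradius (u k)) * gapp1 GRing.inv (superradius (u i)) *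
    sx (u i) * sx (u j) * (f j z)%:A in
  [/\ forall t : R, 0 <= t ->
        P.-integrable setT (fun w => (f (X t w) (local_time X L0 t w))%:E),
      (@lebesgue_measure R).-integrable `[0, +oo[ Ef,
      forall i j, superexpectation_cvg beta (F i j) &
      (\int[lebesgue_measure]_(t in `[0%R, +oo[) Ef t =
       \sum_(i : Lambda) \sum_(j : Lambda) superexpectation beta (F i j))%E].
Proof.
move=> Ef F; have [nu_ge0 snu _ _] := nuP.
have [a [b [a0 nu0]]] := compact_positive_box nuP.
have tf j : tame (f j) by exact: smooth_decay_tame.
have [C oC] := tame_observable tf.
have iP t (t0 : 0 <= t) := integrable_observable XL0_vrjp oC t0 t0.
have EfE t : 0 <= t -> Ef t = (mean P X L0 f t)%:E.
  move=> t0; rewrite /Ef unlock /mean /Rintegral fineK //.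
  by apply: integrable_fin_num => //; exact: iP.
have tn j := tame_norm (tf j).
(* Integrability in time comes first for |f|, which then dominates the means of f and of its
   cutoffs. *)
have inorm := mean_nonneg_integrable XL0_vrjp beta_sym beta_ge0 beta_connected nu_ge0 snu a0 nu0
  XL0_initial tn (fun j z => normr_ge0 (f j z)).
have [im value] := mean_value XL0_vrjp beta_sym beta_ge0 beta_connected nu_ge0 snu a0 nu0
  XL0_initial tf inorm.
have dE i j p : berezin_density (boltzmann beta (F i j)) p = model_density beta nu i j (f j) p.
  rewrite (berezin_densityE beta_sym); congr (_ * _); rewrite /hat /future /point.
  by move: (\prod_(_ <- _ | _) _) (f j _) (expR _) (radial_density _ _ _ _) => u v x y; ring.
have iD i j : (@lebesgue3 R Lambda).-integrable setT (EFin \o model_density beta nu i j (f j)).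
  have [cf _ _ df] := tf j.
  exact: (integrable_model_density beta_ge0 beta_connected snu a0 nu0 i j cf df).
have mI : measurable (`[0, +oo[%classic : set (measurableTypeR R)) by exact: measurable_itv.
split.
- by move=> t t0; exact: iP.
- apply: (eq_integrable mI (EFin \o mean P X L0 f) Ef _ im) => t.
  by rewrite inE /= in_itv /= andbT => t0; rewrite EfE.
- move=> i j; rewrite /superexpectation_cvg.
  by apply: (eq_integrable measurableT (EFin \o model_density beta nu i j (f j)) _ _ (iD i j)) => p _; rewrite /= dE.
transitivity (\int[lebesgue_measure]_(t in `[0%R, +oo[) (mean P X L0 f t)%:E)%E.
  by apply: eq_integral => t; rewrite inE /= in_itv /= andbT => t0; rewrite EfE.
have sE i j : superexpectation beta (F i j) =
    ((2 * pi) ^- #|Lambda| * \int[@lebesgue3 R Lambda]_p model_density beta nu i j (f j) p)%:E.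
  rewrite /superexpectation /berezin EFinM; congr (_ * _)%E.
  under eq_integral do rewrite dE.
  by rewrite /Rintegral fineK //; apply: integrable_fin_num => //; exact: iD.
under [RHS]eq_bigr do under eq_bigr do rewrite sE.
under [RHS]eq_bigr do rewrite sumEFin -mulr_sumr.
rewrite sumEFin -mulr_sumr value mulKf.
  by rewrite /Rintegral fineK //; exact: (integrable_fin_num mI im).
by rewrite expf_neq0 // mulf_neq0 // gt_eqF ?pi_gt0.
Qed.
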